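(* Let $\Phi$ be an irreducible crystallographic root system, and let $Z_\Phi(\mathbf s)$, $\Lambda_{S,\ell}$, $H_{S,\ell}$ be as defined in the context. Then $Z_\Phi(\mathbf s)$ continues meromorphically to $\mathbb C^{|\Psi^+|}$, and its polar divisor is supported on the locally finite arrangement $\bigcup_{\varnothing\ne S\subseteq I}\bigcup_{\ell\ge 0}H_{S,\ell}$. Moreover, locally (in a bounded neighborhood of any point of parameter space) one has $$Z_\Phi(\mathbf s)=H(\mathbf s)+\sum_{\mathfrak F}C_{\mathfrak F}(\mathbf s)\prod_{(S,\ell)\in\mathfrak F}\Lambda_{S,\ell}(\mathbf s)^{-1},$$ where $H$ and the coefficients $C_{\mathfrak F}$ are holomorphic, $\mathfrak F$ ranges over strict decorated support flags, and the sum is finite. If $\mathbf s_0$ lies on $\bigcap_{(S,\ell)\in\mathfrak F}H_{S,\ell}$ and on no additional carrier hyperplane (a generic flag intersection), then the corresponding coefficient (of $\prod_{(S,\ell)\in\mathfrak F}\Lambda_{S,\ell}^{-1}$) is the intrinsic multivariable residue of $Z_\Phi$ there, independent of all choices in the expansion. At points where further carrier hyperplanes meet, the Laurent coefficients of the pullback of $Z_\Phi$ to any transverse affine one-dimensional slice, obtained by summing the contributions of all terms of the expansion, are independent of the choice of expansion (only these complete aggregate coefficients are asserted to be intrinsic).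
   Context: Write $\mathbb N=\{1,2,\dots\}$, $\mathbb N_0=\{0,1,2,\dots\}$. Let $\Phi$ be a crystallographic root system of rank $r$, $\Psi=\Phi^\vee$ its coroot system, $\Psi^+$ the positive coroots, $\beta_1,\dots,\beta_r$ the simple coroots, $I=\{1,\dots,r\}$. For $\alpha\in\Psi^+$ write $\alpha=\sum_i b_i(\alpha)\beta_i$ with $b_i(\alpha)\in\mathbb N_0$, $\operatorname{supp}(\alpha)=\{i:b_i(\alpha)\ne0\}$, and $L_\alpha(\mathbf m)=\sum_i b_i(\alpha)m_i$. For $\mathbf s=(s_\alpha)_{\alpha\in\Psi^+}$ with all $\Re s_\alpha$ sufficiently large, $Z_\Phi(\mathbf s)=\sum_{\mathbf m\in\mathbb N^r}\prod_{\alpha\in\Psi^+}L_\alpha(\mathbf m)^{-s_\alpha}$. For nonempty $S\subseteq I$ put $R(S)=\{\alpha\in\Psi^+:\operatorname{supp}(\alpha)\cap S\neq\varnothing\}$; for $\ell\in\mathbb N_0$ put $\Lambda_{S,\ell}(\mathbf s)=\sum_{\alpha\in R(S)}s_\alpha-|S|+\ell$ and $H_{S,\ell}=\{\Lambda_{S,\ell}=0\}$ (carrier hyperplane). A strict decorated support flag is a finite sequence $\mathfrak F=((S_1,\ell_1),\dots,(S_k,\ell_k))$, $k\ge1$, with $\varnothing\ne S_1\subsetneq\cdots\subsetneq S_k\subseteq I$ and $\ell_j\in\mathbb N_0$. The forms $\Lambda_{S_1,\ell_1},\dots,\Lambda_{S_k,\ell_k}$ of a flag have linearly independent differentials, so they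 can be completed to affine coordinates; the multivariable residue at a generic flag intersection is the coefficient of $\prod_j\Lambda_{S_j,\ell_j}^{-1}$ in such coordinates, a function on $\bigcap_jH_{S_j,\ell_j}$. An affine slice $\gamma(t)=\mathbf s_0+t\mathbf v$ is transverse if $(\Lambda\circ\gamma)'(0)\neq0$ for every carrier form $\Lambda$ vanishing at $\mathbf s_0$. *)

(* Defs.v *)
Set Warnings "-notation-incompatible-prefix,-notation-overridden".
From HB Require Import structures.
From mathcomp Require Import all_boot all_order all_algebra.
From mathcomp Require Import complex.
From mathcomp Require Import all_classical all_reals all_analysis.

Set Implicit Arguments.
Unset Strict Implicit.
Unset Printing Implicit Defensive.
Import Order.TTheory GRing.Theory Num.Theory.
Import numFieldNormedType.Exports.
Local Open Scope classical_set_scope.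
Local Open Scope ring_scope.

(* R[i], packaged so that the topology and norm of a numClosedFieldType are
   inferred on its elements.  Its norm takes values in R[i] itself. *)
Definition Cplx (R : realType) : numClosedFieldType := R[i].

Section ComplexPower.
Context {R : realType}.

Definition cexp (z : Cplx R) : Cplx R :=
  Complex (expR (complex.Re z) * cos (complex.Im z))
          (expR (complex.Re z) * sin (complex.Im z)).

(* x ^ z for a real base x > 0 *)
Definition cpow (x : R) (z : Cplx R) : Cplx R := cexp (z * Complex (ln x) 0).

End ComplexPower.

Section RootSystems.
Context {R : realType} {r : nat}.
Implicit Types (u v a b : 'rV[R]_r) (Phi Psi : seq 'rV[R]_r).
Implicit Types beta : r.-tuple 'rV[R]_r.

Definition dot u v : R := \sum_i u 0 i * v 0 i.

Definition coroot a : 'rV[R]_r := (2 / dot a a) *: a.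

Definition reflection a v : 'rV[R]_r := v - dot v (coroot a) *: a.

(* A reduced crystallographic root system spanning the Euclidean space R^r. *)
Definition crystallographic_root_system Phi : Prop :=
  [/\ uniq Phi /\ 0 \notin Phi,
      (<<Phi>> = fullv)%VS,
      (forall a (c : R), a \in Phi -> c *: a \in Phi -> c = 1 \/ c = -1),
      (forall a b, a \in Phi -> b \in Phi -> reflection a b \in Phi) &
      (forall a b, a \in Phi -> b \in Phi -> dot b (coroot a) \is a Num.int)].

Definition irreducible_root_system Phi : Prop :=
  Phi != [::] /\
  forall P : pred 'rV[R]_r,
    (forall a b, a \in Phi -> b \in Phi -> P a -> ~~ P b -> dot a b = 0) ->
    (forall a, a \in Phi -> P a) \/ (forall a, a \in Phi -> ~~ P a).

Definition simple_system Psi beta : Prop :=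
  [/\ (forall i, tnth beta i \in Psi),
      basis_of fullv beta,
      (forall a i, a \in Psi -> coord beta i a \is a Num.int) &
      (forall a, a \in Psi -> (forall i, 0 <= coord beta i a) \/
                              (forall i, coord beta i a <= 0))].

(* The positive coroots, in a fixed enumeration, for simple coroots beta. *)
Definition pos_coroots Phi beta : seq 'rV[R]_r :=
  [seq a <- map coroot Phi | [forall i, 0 <= coord beta i a]].

End RootSystems.

(* C^{Psi^+}: the coordinate j of s is s_alpha for the j-th positive coroot. *)
Notation params Phi beta := ('rV[Cplx _]_(size (pos_coroots Phi beta))).

Section AbsoluteSums.
Context {R : realType}.
Local Notation C := (Cplx R).

(* Absolutely convergent summation of f along an exhausting sequence of finite
   boxes; absolute convergence makes the sum independent of the exhaustion. *)
Definition has_abs_sum (I : Type) (box : nat -> seq I) (f : I -> C) (l : C) :=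
  (exists B : C, forall M, \sum_(i <- box M) `|f i| <= B) /\
  (\sum_(i <- box M) f i @[M --> \oo] --> l).

(* {1, ..., M}^k *)
Definition pos_box (k M : nat) : seq {ffun 'I_k -> nat} :=
  [seq [ffun j => (e j).+1] | e : {ffun 'I_k -> 'I_M}].

(* {-M, ..., M}^k *)
Definition int_box (k M : nat) : seq {ffun 'I_k -> int} :=
  [seq [ffun j => (e j)%:Z - M%:Z] | e : {ffun 'I_k -> 'I_(M.*2.+1)}].

(* {-M, ..., M} *)
Definition int_interval (M : nat) : seq int :=
  [seq (i%:Z - M%:Z) | i <- iota 0 M.*2.+1].

(* g has the Laurent expansion sum_n c_n t^n in a punctured neighbourhood of 0. *)
Definition laurent_at0 (g : C -> C) (c : int -> C) : Prop :=
  \forall t \near (0 : C)^',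
    has_abs_sum int_interval (fun n => c n * t ^ n) (g t).

End AbsoluteSums.

Section SeveralComplexVariables.
Context {R : realType} {n : nat}.
Local Notation C := (Cplx R).
Local Notation Cn := 'rV[C]_n.

(* Differentiability is C-linear here, since Cn is a normed space over C.
   Only used for open U. *)
Definition holomorphic_on (U : set Cn) (f : Cn -> C) : Prop :=
  forall s, U s -> differentiable f s.

(* A meromorphic function is represented by a total function; its values on
   the zero set of the local denominators are irrelevant. *)
Definition meromorphic (f : Cn -> C) : Prop :=
  forall p, exists (U : set Cn) (g h : Cn -> C),
    [/\ open U /\ U p,
        holomorphic_on U g /\ holomorphic_on U h,
        (forall V : set Cn, open V -> V !=set0 -> V `<=` U ->
           exists2 s, V s & h s != 0) &
        (forall s, U s -> h s != 0 -> f s = g s / h s)].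

(* Contains every pole of the function represented by f, and moreover the
   points where the representative f itself is not holomorphic. *)
Definition polar_set (f : Cn -> C) : set Cn :=
  [set p | ~ (\forall s \near p, differentiable f s)].

Definition slice (s0 v : Cn) (t : C) : Cn := s0 + t *: v.

Definition affine_coords (A : 'M[C]_n) (b : Cn) (s : Cn) : Cn := s *m A + b.

(* Sets the first k affine coordinates to 0 and keeps the other ones. *)
Definition kill_coords (k : nat) (A : 'M[C]_n) (b : Cn) (s : Cn) : Cn :=
  (\row_j (if (j < k)%N then 0 else affine_coords A b s 0 j) - b) *m invmx A.

End SeveralComplexVariables.

Section SupportFlags.
Context {R : realType} {r : nat}.
Variables (Phi : seq 'rV[R]_r) (beta : r.-tuple 'rV[R]_r).
Local Notation C := (Cplx R).
Local Notation N := (size (pos_coroots Phi beta)).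
Local Notation Cn := 'rV[C]_N.

Definition pos_coroot (j : 'I_N) : 'rV[R]_r :=
  tnth (in_tuple (pos_coroots Phi beta)) j.

Definition L (j : 'I_N) (m : {ffun 'I_r -> nat}) : R :=
  \sum_i coord beta i (pos_coroot j) * (m i)%:R.

Definition zeta_term (s : Cn) (m : {ffun 'I_r -> nat}) : C :=
  \prod_j cpow (L j m) (- s 0 j).

(* Z_Phi(s), meaningful when the series converges absolutely *)
Definition zeta (s : Cn) : C :=
  lim (\sum_(m <- pos_box r M) zeta_term s m @[M --> \oo]).

Definition supp (j : 'I_N) : {set 'I_r} :=
  [set i | coord beta i (pos_coroot j) != 0]%SET.

Definition Rset (S : {set 'I_r}) : {set 'I_N} :=
  [set j | supp j :&: S != finset.set0]%SET.

(* The pair (S, l), which indexes a carrier hyperplane when S is nonempty. *)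
Definition carrier : Type := ({set 'I_r} * nat)%type.

Definition carriers : set carrier := [set c | c.1 != finset.set0].

Definition Lambda (c : carrier) (s : Cn) : C :=
  \sum_(j in Rset c.1) s 0 j - #|c.1|%:R + c.2%:R.

Definition hyperplane (c : carrier) : set Cn := [set s | Lambda c s = 0].

Definition arrangement : set Cn := \bigcup_(c in carriers) hyperplane c.

Definition locally_finite_arrangement : Prop :=
  forall p : Cn, exists2 U : set Cn, nbhs p U &
    finite_set (carriers `&` [set c | hyperplane c `&` U !=set0]).

Definition flag : Type := seq carrier.

Definition is_flag (F : flag) : bool :=
  [&& F != [::], all (fun c : carrier => c.1 != finset.set0) F
    & sorted (fun c d : carrier => c.1 \proper d.1) F].

Definition flag_locus (F : flag) : set Cn :=
  [set s | forall c, c \in F -> hyperplane c s].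

Definition generic_flag_point (F : flag) (s0 : Cn) : Prop :=
  flag_locus F s0 /\
  forall c, carriers c -> hyperplane c s0 -> c \in F.

(* The flags occurring are listed in Fs; H and the coefficients K are only
   constrained on U. *)
Definition flag_expansion (f : Cn -> C) (U : set Cn) (Fs : seq flag)
    (H : Cn -> C) (K : flag -> Cn -> C) : Prop :=
  [/\ uniq Fs /\ (forall F, F \in Fs -> is_flag F),
      holomorphic_on U H,
      (forall F, F \in Fs -> holomorphic_on U (K F)) &
      (forall s, U s -> ~ arrangement s ->
         f s = H s + \sum_(F <- Fs) K F s * \prod_(c <- F) (Lambda c s)^-1)].

(* The coefficient of \prod_(c <- F) (Lambda c)^-1 in an expansion, near a
   generic point of the flag F.  A listed flag G containing F contributes its
   coefficient times the inverses of its remaining forms, which do not vanish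
   there.  If every listed flag only has carriers through that point, this is
   just K F. *)
Definition flag_coeff (Fs : seq flag) (K : flag -> Cn -> C) (F : flag)
    (s : Cn) : C :=
  \sum_(G <- Fs | all (fun c => c \in G) F)
    K G s * \prod_(c <- G | c \notin F) (Lambda c s)^-1.

(* The forms of F are the first affine coordinates s |-> s *m A + b. *)
Definition completes (F : flag) (A : 'M[C]_N) (b : Cn) : Prop :=
  [/\ A \in unitmx, (size F <= N)%N &
      forall (s : Cn) (j : 'I_N), (j < size F)%N ->
        affine_coords A b s 0 j = Lambda (nth (finset.set0, 0%N) F j) s].

(* Laurent expansion of f near s0 in the variables x_j = Lambda_{S_j, l_j}; the
   coefficients are functions on the locus x = 0, on which the remaining
   affine coordinates serve as coordinates. *)
Definition flag_laurent (f : Cn -> C) (F : flag) (s0 : Cn) (A : 'M[C]_N) (b : Cn)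
    (a : {ffun 'I_(size F) -> int} -> Cn -> C) : Prop :=
  \forall s \near s0,
    (forall e, differentiable (fun z => a e (kill_coords (size F) A b z)) s) /\
    ((forall c, c \in F -> Lambda c s != 0) ->
      has_abs_sum (int_box (size F))
        (fun e => a e (kill_coords (size F) A b s) *
           \prod_j (Lambda (tnth (in_tuple F) j) s) ^ (e j))
        (f s)).

(* rho is, near s0 on the flag locus, the coefficient of
   \prod_(c <- F) (Lambda c)^-1 in the Laurent expansion of f, whichever affine
   coordinates complete the forms of F. *)
Definition is_flag_residue (f : Cn -> C) (F : flag) (s0 : Cn)
    (rho : Cn -> C) : Prop :=
  (exists A b, completes F A b) /\
  forall A b, completes F A b ->
    (exists a, flag_laurent f s0 A b (F := F) a) /\
    (forall a, flag_laurent f s0 A b (F := F) a ->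
       \forall s \near s0, flag_locus F s -> a [ffun=> -1] s = rho s).

Definition transverse (s0 v : Cn) : Prop :=
  forall c, carriers c -> hyperplane c s0 ->
    derive1 (fun t : C => Lambda c (slice s0 v t)) 0 != 0.

(* kappa is obtained by adding, for each n, the n-th Laurent coefficients along
   the slice of all the terms of the expansion. *)
Definition aggregate_laurent (s0 v : Cn) (Fs : seq flag) (H : Cn -> C)
    (K : flag -> Cn -> C) (kappa : int -> C) : Prop :=
  exists (h : int -> C) (k : flag -> int -> C),
    [/\ laurent_at0 (H \o slice s0 v) h,
        (forall F, F \in Fs -> laurent_at0
           ((fun s => K F s * \prod_(c <- F) (Lambda c s)^-1) \o slice s0 v)
           (k F)) &
        (forall n, kappa n = h n + \sum_(F <- Fs) k F n)].

End SupportFlags.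

(* Main.v *)
Require Import Defs.
Set Warnings "-notation-incompatible-prefix,-notation-overridden".
From HB Require Import structures.
From mathcomp Require Import all_boot all_order all_algebra.
From mathcomp Require Import complex.
From mathcomp Require Import all_classical all_reals all_analysis.
From mathcomp Require Import ring lra zify.
Set Implicit Arguments.
Unset Strict Implicit.
Unset Printing Implicit Defensive.
Import Order.TTheory GRing.Theory Num.Theory.
Import numFieldNormedType.Exports.
Local Open Scope classical_set_scope.
Local Open Scope ring_scope.

(* Write D_k(s) for the sum over m of the product of the L_a(m)^(-(ell_a(s) +
   k_a)), where k is an integer weight and a ranges over the positive coroots
   and over the auxiliary forms m_i + m_j, whose exponent ell_a is 0. It
   converges absolutely once, for every support S, the exponents of the forms
   meeting S have real part at least 2|S| in total (a layer-cake estimate). Let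
   S be a nonempty set of indices. Summing m_i times the summand after a shift
   of the index i, for i in S, and expanding the shifted summand by Taylor's
   formula, expresses Lambda_{S, w} D_k, with w the weight of S, through series
   D_k' in which S has larger weight and no other set has smaller weight. If two
   incomparable supports S, S' have too small a weight, multiplying and dividing
   the summand by m_i + m_j, with i in S \ S' and j in S' \ S, raises their
   weights in turn; so one may assume that the supports of small weight form a
   chain and take S to be the smallest one. A partial fraction decomposition of
   two forms with the same support then keeps one carrier per support, which
   yields the flags, and the recursion stops at absolutely convergent series.
   The expansions obtained on larger and larger balls agree by the identity
   theorem.

   Multiplying an expansion by the forms of a flag F gives a function
   holomorphic near a generic point of F; it does not depend on the expansion,
   since the complement of the arrangement is dense, and it restricts to the
   coefficient of F on the flag locus. A Laurent expansion, in one or several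
   variables, determines its coefficients: averaging over an irrational rotation
   of each variable isolates any given exponent. *)

(** * One complex variable *)

(** Absolute convergence depends on all nonempty supports at once, so a step must not repair one
    support at the cost of another. In the identity for S the linear terms keep only indices i
    outside S: lowering the exponent of m_i leaves the weight of S alone, while the raised form
    meets S. The terms of higher degree and the remainder have i in S but raise forms containing m_i
    by at least 2. In all cases a support T loses the exponent of m_i only if i is in T, and then T
    meets the raised form, so no weight drops. The Taylor remainder, however, is sure to gain only
    on supports containing i. It converges absolutely because every support of small weight contains
    S, and this is why S must be the smallest member of a chain. The same inclusion allows a carrier
    of S to be put in front of a chain of carriers. The forms m_i + m_j serve to separate
    incomparable supports; having exponent 0 at the start, they change neither the initial series
    nor any Lambda. The facts on holomorphic functions of several variables are reduced to the
    Taylor formula with remainder on complex lines, which comes from Goursat's lemma. *)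

Section ComplexNorm.
Context {R : realType}.
Local Notation C := (Cplx R).

(* The norm of Cplx R takes values in Cplx R; nm is the same norm with values in R. *)
Definition nm (z : C) : R := complex.Re `|z|.

Definition rc (x : R) : C := Complex x 0.

Definition ii : C := Complex 0 1.

Lemma nmE (z : C) : nm z = Num.sqrt (complex.Re z ^+ 2 + complex.Im z ^+ 2).
Proof. by rewrite /nm normc_def. Qed.

Lemma normC_nm (z : C) : `|z| = rc (nm z).
Proof. by rewrite /nm normc_def. Qed.

Lemma nm_ge0 z : 0 <= nm z. Proof. by rewrite nmE sqrtr_ge0. Qed.

Lemma rcD x y : rc (x + y) = rc x + rc y.
Proof. exact: (rmorphD (real_complex R)). Qed.
Lemma rcB x y : rc (x - y) = rc x - rc y.
Proof. exact: (rmorphB (real_complex R)). Qed.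
Lemma rcM x y : rc (x * y) = rc x * rc y.
Proof. exact: (rmorphM (real_complex R)). Qed.
Lemma rcV x : rc x^-1 = (rc x)^-1.
Proof. exact: (fmorphV (real_complex R)). Qed.
Lemma rcX x n : rc (x ^+ n) = rc x ^+ n.
Proof. exact: (rmorphXn (real_complex R)). Qed.
Lemma rc0 : rc 0 = 0. Proof. by []. Qed.
Lemma rc1 : rc 1 = 1. Proof. by []. Qed.
Lemma rc_nat n : rc n%:R = n%:R.
Proof. exact: (rmorph_nat (real_complex R)). Qed.
Lemma rc_int (n : int) : rc n%:~R = n%:~R.
Proof. exact: (rmorph_int (real_complex R)). Qed.
Lemma rc_sum I (r : seq I) P (F : I -> R) :
  rc (\sum_(i <- r | P i) F i) = \sum_(i <- r | P i) rc (F i).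
Proof. exact: (rmorph_sum (real_complex R)). Qed.

Lemma rc_le x y : (rc x <= rc y) = (x <= y). Proof. exact: lecR. Qed.
Lemma rc_lt x y : (rc x < rc y) = (x < y). Proof. exact: ltcR. Qed.
Lemma rc_inj : injective rc. Proof. by move=> x y []. Qed.

Lemma cgt0P (e : C) : 0 < e -> exists2 d : R, 0 < d & e = rc d.
Proof.
case: e => a b; rewrite ltcE /= => /andP[/eqP-> a0]; by exists a.
Qed.

Lemma cle_real (e : C) (x : R) : rc x <= e -> exists2 d : R, x <= d & e = rc d.
Proof.
by case: e => a b; rewrite lecE /= => /andP[/eqP-> a0]; exists a.
Qed.

Lemma nm0 : nm 0 = 0. Proof. by rewrite /nm normr0. Qed.
Lemma nm1 : nm 1 = 1. Proof. by rewrite /nm normr1. Qed.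
Lemma nmN z : nm (- z) = nm z. Proof. by rewrite /nm normrN. Qed.
Lemma nmB x y : nm (x - y) = nm (y - x). Proof. by rewrite /nm distrC. Qed.
Lemma nmM x y : nm (x * y) = nm x * nm y.
Proof. by apply: rc_inj; rewrite rcM -!normC_nm normrM. Qed.
Lemma nmV x : nm x^-1 = (nm x)^-1.
Proof. by apply: rc_inj; rewrite rcV -!normC_nm normfV. Qed.
Lemma nmX x n : nm (x ^+ n) = nm x ^+ n.
Proof. by apply: rc_inj; rewrite rcX -!normC_nm normrX. Qed.
Lemma nm_rc x : nm (rc x) = `|x|.
Proof. by rewrite nmE /= expr0n addr0 sqrtr_sqr. Qed.
Lemma nm_nat n : nm n%:R = n%:R.
Proof. by rewrite -rc_nat nm_rc normr_nat. Qed.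
Lemma nm_ii : nm ii = 1.
Proof. by rewrite nmE /= expr0n expr1n add0r sqrtr1. Qed.
Lemma nm_prod I (r : seq I) P (F : I -> C) :
  nm (\prod_(i <- r | P i) F i) = \prod_(i <- r | P i) nm (F i).
Proof. by apply: (big_morph nm nmM nm1). Qed.

Lemma nmD x y : nm (x + y) <= nm x + nm y.
Proof. by rewrite -rc_le rcD -!normC_nm ler_normD. Qed.
Lemma nm_sub x y : nm (x - y) <= nm x + nm y.
Proof. by rewrite -(nmN y) nmD. Qed.
Lemma nm_dist y x z : nm (x - z) <= nm (x - y) + nm (y - z).
Proof. by apply: le_trans (nmD _ _); rewrite addrA subrK. Qed.
Lemma nm_rev x y : nm x - nm y <= nm (x - y).
Proof. by rewrite lerBlDr; apply: le_trans (nmD _ _); rewrite subrK. Qed.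
Lemma nm_sum I (r : seq I) P (F : I -> C) :
  nm (\sum_(i <- r | P i) F i) <= \sum_(i <- r | P i) nm (F i).
Proof.
rewrite -rc_le -normC_nm rc_sum; apply: le_trans (ler_norm_sum _ _ _) _.
by apply: ler_sum => i _; rewrite normC_nm.
Qed.

Lemma nm_eq0 z : (nm z == 0) = (z == 0).
Proof. by rewrite -[RHS]normr_eq0 normC_nm -[0 in RHS]rc0 (inj_eq rc_inj). Qed.
Lemma nm_gt0 z : (0 < nm z) = (z != 0).
Proof. by rewrite lt_def nm_ge0 andbT nm_eq0. Qed.

Lemma Re_le_nm (z : C) : `|complex.Re z| <= nm z.
Proof. by rewrite -rc_le -normC_nm; exact: normc_ge_Re. Qed.

Lemma Im_le_nm (z : C) : `|complex.Im z| <= nm z.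
Proof.
by rewrite nmE -sqrtr_sqr ler_wsqrtr // lerDr sqr_ge0.
Qed.

Lemma nm_le_ReIm (z : C) : nm z <= `|complex.Re z| + `|complex.Im z|.
Proof.
case: z => a b; have -> : (Complex a b : C) = rc a + ii * rc b.
  by rewrite /rc /ii; apply/eqP; rewrite eq_complex /=; apply/andP; split; apply/eqP; ring.
by apply: le_trans (nmD _ _) _; rewrite nmM nm_ii mul1r !nm_rc /= !(mul0r, mul1r, mulr0, addr0, add0r, subr0).
Qed.

Lemma ReD (x y : C) : complex.Re (x + y) = complex.Re x + complex.Re y.
Proof. by case: x y => ? ? []. Qed.
Lemma ImD (x y : C) : complex.Im (x + y) = complex.Im x + complex.Im y.
Proof. by case: x y => ? ? []. Qed.
Lemma ReN (x : C) : complex.Re (- x) = - complex.Re x.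
Proof. by case: x. Qed.
Lemma ImN (x : C) : complex.Im (- x) = - complex.Im x.
Proof. by case: x. Qed.
Lemma ReB (x y : C) : complex.Re (x - y) = complex.Re x - complex.Re y.
Proof. by rewrite ReD ReN. Qed.
Lemma ImB (x y : C) : complex.Im (x - y) = complex.Im x - complex.Im y.
Proof. by rewrite ImD ImN. Qed.
Lemma ReM (x y : C) : complex.Re (x * y) =
  complex.Re x * complex.Re y - complex.Im x * complex.Im y.
Proof. by case: x y => ? ? []. Qed.
Lemma ImM (x y : C) : complex.Im (x * y) =
  complex.Re x * complex.Im y + complex.Im x * complex.Re y.
Proof. by case: x y => ? ? []. Qed.

Lemma complexP (x y : C) : complex.Re x = complex.Re y ->
  complex.Im x = complex.Im y -> x = y.
Proof. by case: x y => ? ? [? ?] /= -> ->. Qed.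

Lemma Re_sum I (r : seq I) P (F : I -> C) :
  complex.Re (\sum_(i <- r | P i) F i) = \sum_(i <- r | P i) complex.Re (F i).
Proof. by apply: (big_morph _ ReD). Qed.

Lemma ge0_le_eps (x : R) : (forall e, 0 < e -> x <= e) -> x <= 0.
Proof.
move=> h; case: (lerP x 0) => // x0; have := h _ (divr_gt0 x0 (ltr0n R 2)).
by move=> h2; exfalso; lra.
Qed.

Lemma nm_le0_eq0 (z : C) : nm z <= 0 -> z = 0.
Proof. by move=> h; apply/eqP; rewrite -nm_eq0 eq_le h nm_ge0. Qed.

Lemma nm_eps_eq (x y : C) : (forall e, 0 < e -> nm (x - y) <= e) -> x = y.
Proof.
by move=> h; apply/eqP; rewrite -subr_eq0; apply/eqP/nm_le0_eq0/ge0_le_eps.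
Qed.

(** Errors are measured in [R]; [climP] identifies this with filter convergence. *)
Definition clim (u : nat -> C) (l : C) : Prop :=
  forall e : R, 0 < e -> exists N, forall n, (N <= n)%N -> nm (u n - l) <= e.

Lemma clim_uniq u l l' : clim u l -> clim u l' -> l = l'.
Proof.
move=> h h'; apply: nm_eps_eq => e e0.
have [N hN] := h _ (divr_gt0 e0 (ltr0n R 2)).
have [N' hN'] := h' _ (divr_gt0 e0 (ltr0n R 2)).
have := hN _ (leq_maxl N N'); have := hN' _ (leq_maxr N N').
set n := maxn _ _ => h1 h2.
by have := nm_dist (u n) l l'; rewrite (nmB l (u n)); lra.
Qed.

Lemma clim_ext u v l : (forall n, u n = v n) -> clim u l -> clim v l.
Proof. by move=> uv; have -> : v = u by apply/funext => n. Qed.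

Lemma clim_cst (c : C) : clim (fun=> c) c.
Proof. by move=> e e0; exists 0%N => n _; rewrite subrr nm0 ltW. Qed.

Lemma climD u v l l' : clim u l -> clim v l' -> clim (fun n => u n + v n) (l + l').
Proof.
move=> h h' e e0.
have [N hN] := h _ (divr_gt0 e0 (ltr0n R 2)).
have [N' hN'] := h' _ (divr_gt0 e0 (ltr0n R 2)).
exists (maxn N N') => n; rewrite geq_max => /andP[/hN h1 /hN' h2].
have -> : u n + v n - (l + l') = (u n - l) + (v n - l') by ring.
by have := nmD (u n - l) (v n - l'); lra.
Qed.

Lemma climZ c u l : clim u l -> clim (fun n => c * u n) (c * l).
Proof.
move=> h e e0; have c1 : 0 < nm c + 1 by rewrite ltr_wpDl ?nm_ge0.
have [N hN] := h _ (divr_gt0 e0 c1).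
exists N => n /hN h1; rewrite -mulrBr nmM.
apply: (@le_trans _ _ ((nm c + 1) * (e / (nm c + 1)))).
  by apply: ler_pM h1; rewrite ?nm_ge0 // lerDl.
by rewrite mulrC divfK ?gt_eqF.
Qed.

Lemma climB u v l l' : clim u l -> clim v l' -> clim (fun n => u n - v n) (l - l').
Proof.
move=> h /(climZ (-1)) h'; rewrite -mulN1r.
by apply: (clim_ext _ (climD h h')) => n; rewrite mulN1r.
Qed.

Lemma clim_sum (I : Type) (r : seq I) (P : pred I) (u : I -> nat -> C) (l : I -> C) :
  (forall i, P i -> clim (u i) (l i)) ->
  clim (fun n => \sum_(i <- r | P i) u i n) (\sum_(i <- r | P i) l i).
Proof.
move=> h; elim: r => [|i r IH].
  by rewrite big_nil; apply: (@clim_ext (fun=> 0)) => [n|]; [rewrite big_nil|exact: clim_cst].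
rewrite big_cons; case: ifP => Pi; last first.
  by apply: (clim_ext _ IH) => n; rewrite big_cons Pi.
by apply: (clim_ext _ (climD (h i Pi) IH)) => n; rewrite big_cons Pi.
Qed.

Lemma clim_nm_le u l (B : R) : clim u l -> (forall n, nm (u n) <= B) -> nm l <= B.
Proof.
move=> h hB; rewrite -subr_le0; apply: ge0_le_eps => e e0.
have [N /(_ N (leqnn _)) h1] := h _ e0.
have := hB N; have := nm_rev l (u N); rewrite nmB in h1; lra.
Qed.

Lemma climP (u : nat -> C) (l : C) : clim u l <-> (u n @[n --> \oo] --> l).
Proof.
split.
  move=> h; apply/cvgrPdist_le => e /cgt0P[d d0 ->].
  have [N hN] := h _ d0; exists N => // n /= /hN.
  by rewrite normC_nm rc_le nmB.
move=> /cvgrPdist_le h e e0.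
have [|N _ hN] := h (rc e); first by rewrite -rc0 rc_lt.
by exists N => n /hN; rewrite normC_nm rc_le nmB.
Qed.

Lemma ccauchy (u : nat -> C) :
  (forall e : R, 0 < e -> exists N, forall m n, (N <= m)%N -> (N <= n)%N ->
     nm (u m - u n) <= e) -> exists l, clim u l.
Proof.
move=> h.
(* [p] stands for the real or the imaginary part; all that matters is that it is 1-Lipschitz. *)
have key (p : C -> R) : (forall x y, `|p x - p y| <= nm (x - y)) ->
    exists l : R, forall e : R, 0 < e -> exists N, forall n, (N <= n)%N -> `|p (u n) - l| <= e.
  move=> hp; have : cvgn (p \o u).
    apply/cauchy_cvgP/cauchy_exP => e e0.
    have [N hN] := h _ (divr_gt0 e0 (ltr0n R 2)).
    exists (p (u N)); exists N => // n /= nN; rewrite /ball /=.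
    have := le_trans (hp _ _) (hN N n (leqnn _) nN); lra.
  move=> /cvgrPdist_le hl; exists (lim ((p \o u) n @[n --> \oo])) => e /hl[N _ hN].
  by exists N => n /hN; rewrite distrC.
have [a ha] := key (@complex.Re R) (fun x y => ltac:(rewrite -ReB; exact: Re_le_nm)).
have [b hb] := key (@complex.Im R) (fun x y => ltac:(rewrite -ImB; exact: Im_le_nm)).
exists (Complex a b) => e e0.
have [N hN] := ha _ (divr_gt0 e0 (ltr0n R 2)).
have [N' hN'] := hb _ (divr_gt0 e0 (ltr0n R 2)).
exists (maxn N N') => n; rewrite geq_max => /andP[/hN h1 /hN' h2].
apply: le_trans (nm_le_ReIm _) _; rewrite ReB ImB /=; lra.
Qed.
End ComplexNorm.

(** * Integrals of continuous complex functions on a segment *)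

Section ComplexIntegral.
Context {R : realType}.
Local Notation C := (Cplx R).
Local Notation mu := (@lebesgue_measure R).

Definition con (a b : R) (u : R -> C) : Prop :=
  forall x, a <= x <= b -> forall e : R, 0 < e -> exists2 d : R, 0 < d &
    forall y, a <= y <= b -> `|y - x| < d -> nm (u y - u x) <= e.

Definition ci (u : R -> C) (a b : R) : C :=
  Complex (\int[mu]_(x in `[a, b]) complex.Re (u x))%R
          (\int[mu]_(x in `[a, b]) complex.Im (u x))%R.

Lemma con_integrable (p : C -> R) a b u :
  (forall x y, `|p x - p y| <= nm (x - y)) -> con a b u ->
  mu.-integrable `[a, b] (EFin \o (p \o u)).
Proof.
move=> hp cu; apply: continuous_compact_integrable; first exact: segment_compact.
apply/subspace_continuousP => x; rewrite /= in_itv /= => xab.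
apply/cvgrPdist_le => e e0; have [d d0 hd] := cu x xab e e0.
rewrite /prop_near1 /within /=; exists d => //= y; rewrite /ball_ /= distrC => yx.
rewrite in_itv /= => yab; have h1 := hd y yab yx; have h2 := hp (u x) (u y).
by rewrite nmB in h1; apply: le_trans h2 h1.
Qed.

Lemma con_Re a b u : con a b u ->
  mu.-integrable `[a, b] (EFin \o (fun x => complex.Re (u x))).
Proof. by apply: (@con_integrable (@complex.Re R)) => x y; rewrite -ReB Re_le_nm. Qed.

Lemma con_Im a b u : con a b u ->
  mu.-integrable `[a, b] (EFin \o (fun x => complex.Im (u x))).
Proof. by apply: (@con_integrable (@complex.Im R)) => x y; rewrite -ImB Im_le_nm. Qed.

Lemma con_cst a b c : con a b (fun=> c).
Proof. by move=> x _ e e0; exists 1 => // y _ _; rewrite subrr nm0 ltW. Qed.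

Lemma conD a b u v : con a b u -> con a b v -> con a b (fun x => u x + v x).
Proof.
move=> hu hv x xab e e0.
have [d d0 hd] := hu x xab _ (divr_gt0 e0 (ltr0n R 2)).
have [d' d'0 hd'] := hv x xab _ (divr_gt0 e0 (ltr0n R 2)).
exists (Num.min d d'); first by rewrite lt_min d0.
move=> y yab; rewrite lt_min => /andP[/(hd y yab) h1 /(hd' y yab) h2].
have -> : u y + v y - (u x + v x) = (u y - u x) + (v y - v x) by ring.
by have := nmD (u y - u x) (v y - v x); lra.
Qed.

Lemma conZ a b c u : con a b u -> con a b (fun x => c * u x).
Proof.
move=> hu x xab e e0; have c1 : 0 < nm c + 1 by rewrite ltr_wpDl ?nm_ge0.
have [d d0 hd] := hu x xab _ (divr_gt0 e0 c1); exists d => // y yab /(hd y yab) h1.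
rewrite -mulrBr nmM.
apply: (@le_trans _ _ ((nm c + 1) * (e / (nm c + 1)))).
  by apply: ler_pM h1; rewrite ?nm_ge0 // lerDl.
by rewrite mulrC divfK ?gt_eqF.
Qed.

Lemma ci_ext a b u v : (forall x, a <= x <= b -> u x = v x) -> ci u a b = ci v a b.
Proof.
by move=> uv; congr Complex; apply: eq_Rintegral => x; rewrite inE /= in_itv /= => /uv ->.
Qed.

Lemma ciD a b u v : con a b u -> con a b v ->
  ci (fun x => u x + v x) a b = ci u a b + ci v a b.
Proof.
move=> hu hv; apply: complexP; rewrite ?ReD ?ImD /=.
  rewrite -RintegralD //; [|exact: con_Re|exact: con_Re].
  by apply: eq_Rintegral => x _; rewrite ReD.
rewrite -RintegralD //; [|exact: con_Im|exact: con_Im].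
by apply: eq_Rintegral => x _; rewrite ImD.
Qed.

Lemma ciZ a b c u : con a b u -> ci (fun x => c * u x) a b = c * ci u a b.
Proof.
move=> hu; have h1 := con_Re hu; have h2 := con_Im hu.
have hZ (k : R) (p : R -> R) : mu.-integrable `[a, b] (EFin \o p) ->
    mu.-integrable `[a, b] (EFin \o (fun x => k * p x)).
  move=> hp.
  have : mu.-integrable `[a, b] (fun x => k%:E * (EFin \o p) x)%E.
    by apply: integrableZl.
  by apply: eq_integrable => // x _ /=; rewrite EFinM.
apply: complexP; rewrite ?ReM ?ImM /= -!RintegralZl //.
  rewrite -RintegralB //; [|exact: hZ|exact: hZ].
  by apply: eq_Rintegral => x _; rewrite ReM.
rewrite -RintegralD //; [|exact: hZ|exact: hZ].
by apply: eq_Rintegral => x _; rewrite ImM.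
Qed.

Lemma ci_split a m b u : a <= m <= b -> con a b u ->
  ci u a b = ci u a m + ci u m b.
Proof.
move=> /andP[am mb] hu; have h1 := con_Re hu; have h2 := con_Im hu.
have key (p : R -> R) : mu.-integrable `[a, b] (EFin \o p) ->
    (\int[mu]_(x in `[a, b]) p x =
     \int[mu]_(x in `[a, m]) p x + \int[mu]_(x in `[m, b]) p x)%R.
  move=> hp; rewrite -(@Rintegral_itv_obnd_cbnd _ m (BRight b)).
    by rewrite -(Rintegral_itvB hp) ?bnd_simp //; ring.
  by apply: integrableS hp => //; apply: subset_itvr; rewrite bnd_simp.
by apply: complexP; rewrite ?ReD ?ImD /= -key.
Qed.

Lemma ci_cst a b c : a <= b -> ci (fun=> c) a b = c * rc (b - a).
Proof.
move=> ab; have hm : fine (mu `[a, b]%classic) = b - a.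
  rewrite lebesgue_measure_itv /= lte_fin; case: ltP => // h.
  by rewrite /=; lra.
by apply: complexP; rewrite ?ReM ?ImM /= Rintegral_cst // hm; ring.
Qed.

(** The factor 2 comes from estimating real and imaginary parts separately; it propagates to the
    constants 2 and 4 of [cauchy_taylor]. *)
Lemma ci_bound a b u M : a <= b -> con a b u ->
  (forall x, a <= x <= b -> nm (u x) <= M) -> nm (ci u a b) <= 2 * M * (b - a).
Proof.
move=> ab hu hM; apply: le_trans (nm_le_ReIm _) _ => /=.
have hm : fine (mu `[a, b]%classic) = b - a.
  rewrite lebesgue_measure_itv /= lte_fin; case: ltP => // h.
  by rewrite /=; lra.
have key (p : R -> R) : mu.-integrable `[a, b] (EFin \o p) ->
   (forall x, `|p x| <= nm (u x)) ->
   `|(\int[mu]_(x in `[a, b]) p x)%R| <= M * (b - a).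
  move=> hp pu; apply: le_trans (le_normr_Rintegral _ hp) _ => //.
  rewrite -hm -Rintegral_cst //; apply: le_Rintegral => //.
  - exact: integrable_norm hp.
  - apply: (@con_integrable (@complex.Re R) a b (fun=> rc M)); last exact: con_cst.
    by move=> x y; rewrite -ReB Re_le_nm.
  - by move=> x; rewrite /= in_itv /= => xab; apply: le_trans (pu x) (hM x xab).
apply: le_trans (lerD (key _ (con_Re hu) _) (key _ (con_Im hu) _)) _.
- by move=> x; apply: Re_le_nm.
- by move=> x; apply: Im_le_nm.
- by rewrite -mulrA [2 * _]mulr_natl mulr2n.
Qed.

End ComplexIntegral.

(** * Cousin's bisection principle *)

Section Cousin.
Context {R : realType}.

Lemma geom_small (q e : R) : 0 <= q < 1 -> 0 < e ->
  exists N, forall n, (N <= n)%N -> q ^+ n <= e.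
Proof.
move=> /andP[q0 q1] e0.
have /cvgrPdist_le/(_ e e0)[N _ hN] : q ^+ n @[n --> \oo] --> (0 : R).
  by apply: cvg_expr; rewrite ger0_norm.
by exists N => n /hN /=; rewrite sub0r normrN; apply: le_trans; exact: ler_norm.
Qed.

Lemma nested_point (a b : nat -> R) : (forall n, a n <= a n.+1) ->
  (forall n, b n.+1 <= b n) -> (forall n, a n <= b n) ->
  exists x, forall n, a n <= x <= b n.
Proof.
move=> ha hb hab.
have a_mono m n : (m <= n)%N -> a m <= a n.
  elim: n => [|n IH]; first by rewrite leqn0 => /eqP->.
  by rewrite leq_eqVlt => /predU1P[->//|/IH h]; apply: le_trans h _.
have b_mono m n : (m <= n)%N -> b n <= b m.
  elim: n => [|n IH]; first by rewrite leqn0 => /eqP->.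
  by rewrite leq_eqVlt => /predU1P[->//|/IH h]; apply: le_trans h.
have ub n : ubound (range a) (b n).
  move=> _ [m _ <-]; apply: le_trans (a_mono m (maxn m n) (leq_maxl _ _)) _.
  exact: le_trans (hab _) (b_mono _ _ (leq_maxr _ _)).
exists (sup (range a)) => n; apply/andP; split.
  by apply: ub_le_sup; [by exists (b 0%N); exact: ub|by exists n].
by apply: ge_sup; [by exists (a 0%N); exists 0%N|exact: ub].
Qed.

(** [P a c t] speaks of the rectangle with corner (a, c) and sides [w * t], [h * t]. If [P] failed
    for the whole, repeated quartering would give nested failing rectangles, against the local
    hypothesis at their common point. This serves as the compactness argument below; [w] or [h] may
    be 0, which gives the principle on a segment. *)
Lemma cousin (P : R -> R -> R -> Prop) (X Y w h : R) : 0 <= w -> 0 <= h ->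
  let inside a c t := [/\ X <= a, a + w * t <= X + w, Y <= c & c + h * t <= Y + h] in
  (forall a c t, 0 < t -> inside a c (t *+ 2) ->
     P a c t -> P (a + w * t) c t -> P a (c + h * t) t ->
     P (a + w * t) (c + h * t) t -> P a c (t *+ 2)) ->
  (forall x y, X <= x <= X + w -> Y <= y <= Y + h -> exists2 d, 0 < d &
     forall a c t, 0 < t < d -> inside a c t ->
       a <= x <= a + w * t -> c <= y <= c + h * t -> P a c t) ->
  P X Y 1.
Proof.
move=> w0 h0 inside hs hl; apply: contrapT => nP.
(* A failing quarter: when the first three satisfy [P], the last one fails, as otherwise the whole
   would satisfy [P]. *)
pose next (q : R * R) t :=
  if ~~ `[< P q.1 q.2 t >] then q else
  if ~~ `[< P (q.1 + w * t) q.2 t >] then (q.1 + w * t, q.2) else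
  if ~~ `[< P q.1 (q.2 + h * t) t >] then (q.1, q.2 + h * t) else
  (q.1 + w * t, q.2 + h * t).
pose t n : R := 2^-1 ^+ n.
have t0 n : 0 < t n by rewrite exprn_gt0 ?invr_gt0.
have t2 n : t n = t n.+1 *+ 2 by rewrite /t exprS -[RHS]mulr_natr mulrAC mulVf ?mul1r.
pose fix s n : R * R := if n is m.+1 then next (s m) (t m.+1) else (X, Y).
have inv n : inside (s n).1 (s n).2 (t n) /\ ~ P (s n).1 (s n).2 (t n).
  elim: n => [|n [IHi IHP]]; first by rewrite /= /inside /t expr0 !mulr1; split.
  have wt : 0 <= w * t n.+1 by rewrite mulr_ge0 // ltW.
  have ht : 0 <= h * t n.+1 by rewrite mulr_ge0 // ltW.
  rewrite /= /next; case: (s n) IHi IHP => a c /= IHi IHP.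
  rewrite t2 in IHi; move: (IHi); rewrite /inside !mulrnAr !mulr2n => -[i1 i2 i3 i4].
  case: asboolP => h1 /=; last by split=> //; split => //; lra.
  case: asboolP => h2 /=; last by split=> //; split => //; lra.
  case: asboolP => h3 /=; last by split=> //; split => //; lra.
  split; first by split; lra.
  by move=> h4; apply: IHP; rewrite t2; exact: hs.
have mono n : [/\ (s n).1 <= (s n.+1).1, (s n.+1).1 + w * t n.+1 <= (s n).1 + w * t n,
    (s n).2 <= (s n.+1).2 & (s n.+1).2 + h * t n.+1 <= (s n).2 + h * t n].
  have wt : 0 <= w * t n.+1 by rewrite mulr_ge0 // ltW.
  have ht : 0 <= h * t n.+1 by rewrite mulr_ge0 // ltW.
  rewrite (t2 n) !mulrnAr !mulr2n /= /next; case: (s n) => a c /=.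
  by do 3?case: ifP => _ /=; split; lra.
have [x hx] : exists x, forall n, (s n).1 <= x <= (s n).1 + w * t n.
  apply: nested_point => n; rewrite ?lerDl ?mulr_ge0 ?(ltW (t0 _)) //; by case: (mono n).
have [y hy] : exists y, forall n, (s n).2 <= y <= (s n).2 + h * t n.
  apply: nested_point => n; rewrite ?lerDl ?mulr_ge0 ?(ltW (t0 _)) //; by case: (mono n).
have := hx 0%N; have := hy 0%N; rewrite /= /t expr0 !mulr1 => hy0 hx0.
have [d d0 hd] := hl x y hx0 hy0.
have [|N /(_ N (leqnn _)) hN] := @geom_small 2^-1 (d / 2) _ (divr_gt0 d0 (ltr0n R 2)).
  by lra.
have [i1 i2] := inv N; apply: i2; apply: hd => //.
by rewrite t0 /=; move: hN; rewrite -/(t N); lra.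
Qed.

End Cousin.

(** * Contour integrals over rectangles *)

Section Goursat.
Context {R : realType}.
Local Notation C := (Cplx R).
Implicit Types (G : R -> R -> C) (l : C).

Definition rect (x1 x2 y1 y2 : R) (x y : R) := (x1 <= x <= x2) && (y1 <= y <= y2).

Definition rcont G x1 x2 y1 y2 x y := forall e : R, 0 < e -> exists2 d : R, 0 < d &
  forall x' y', rect x1 x2 y1 y2 x' y' -> `|x' - x| < d -> `|y' - y| < d ->
    nm (G x' y' - G x y) <= e.

(** Complex differentiability of [G] in x + iy, relative to the rectangle, with the increment
    measured by the sum of its two components. *)
Definition rdiff G x1 x2 y1 y2 x y := exists l : C, forall e : R, 0 < e -> exists2 d : R, 0 < d &
  forall x' y', rect x1 x2 y1 y2 x' y' -> `|x' - x| < d -> `|y' - y| < d ->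
    nm (G x' y' - G x y - l * Complex (x' - x) (y' - y)) <= e * (`|x' - x| + `|y' - y|).

(** The integral of G dz along the counterclockwise boundary. *)
Definition boundary G x1 x2 y1 y2 : C :=
  ci (fun x => G x y1) x1 x2 - ci (fun x => G x y2) x1 x2 +
  ii * (ci (G x2) y1 y2 - ci (G x1) y1 y2).

Definition rcontinuous G x1 x2 y1 y2 :=
  forall x y, rect x1 x2 y1 y2 x y -> rcont G x1 x2 y1 y2 x y.

Lemma rcont_con_h G x1 x2 y1 y2 y : rcontinuous G x1 x2 y1 y2 -> y1 <= y <= y2 ->
  con x1 x2 (fun x => G x y).
Proof.
move=> hG hy x hx e e0; have [|d d0 hd] := hG x y _ e e0; first by apply/andP.
by exists d => // x' hx' xx; apply: hd => //; rewrite ?subrr ?normr0 //; apply/andP.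
Qed.

Lemma rcont_con_v G x1 x2 y1 y2 x : rcontinuous G x1 x2 y1 y2 -> x1 <= x <= x2 ->
  con y1 y2 (G x).
Proof.
move=> hG hx y hy e e0; have [|d d0 hd] := hG x y _ e e0; first by apply/andP.
by exists d => // x' hx' xx; apply: hd => //; rewrite ?subrr ?normr0 //; apply/andP.
Qed.

Lemma rcontinuous_sub G x1 x2 y1 y2 x1' x2' y1' y2' :
  x1 <= x1' -> x2' <= x2 -> y1 <= y1' -> y2' <= y2 ->
  rcontinuous G x1 x2 y1 y2 -> rcontinuous G x1' x2' y1' y2'.
Proof.
move=> a b c d hG x y /andP[hx hy] e e0.
have [|d' d0 hd] := hG x y _ e e0; first by apply/andP; split; lra.
exists d' => // x' y' /andP[hx' hy']; apply: hd; apply/andP; split; lra.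
Qed.

Lemma rdiff_rcont G x1 x2 y1 y2 x y : rdiff G x1 x2 y1 y2 x y -> rcont G x1 x2 y1 y2 x y.
Proof.
move=> [l hl] e e0; have [d d0 hd] := hl 1 ltr01.
have k0 : 0 < 2 * (nm l + 1) by have := nm_ge0 l; lra.
exists (Num.min d (e / (2 * (nm l + 1)))); first by rewrite lt_min d0 divr_gt0.
move=> x' y' r'; rewrite !lt_min => /andP[hx hx'] /andP[hy hy'].
have := hd x' y' r' hx hy; rewrite mul1r => h1.
have h2 := nm_le_ReIm (Complex (x' - x) (y' - y) : C); rewrite /= in h2.
have h3 : nm (l * Complex (x' - x) (y' - y)) <= nm l * (`|x' - x| + `|y' - y|).
  by rewrite nmM ler_wpM2l ?nm_ge0.
have h4 : (nm l + 1) * (`|x' - x| + `|y' - y|) <= e.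
  have : `|x' - x| + `|y' - y| <= e / (nm l + 1).
    have -> : e / (nm l + 1) = e / (2 * (nm l + 1)) + e / (2 * (nm l + 1)).
      by field; have := nm_ge0 l; lra.
    lra.
  by rewrite ler_pdivlMr 1?mulrC //; have := nm_ge0 l; lra.
have := nmD (G x' y' - G x y - l * Complex (x' - x) (y' - y)) (l * Complex (x' - x) (y' - y)).
rewrite subrK; lra.
Qed.

Lemma boundary_split_h G x1 m x2 y1 y2 : x1 <= m <= x2 -> y1 <= y2 ->
  rcontinuous G x1 x2 y1 y2 ->
  boundary G x1 x2 y1 y2 = boundary G x1 m y1 y2 + boundary G m x2 y1 y2.
Proof.
move=> hm hy hG; rewrite /boundary.
rewrite (ci_split hm (rcont_con_h hG _)) ?lexx ?hy //.
rewrite (ci_split hm (rcont_con_h hG _)) ?lexx ?hy //.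
by ring.
Qed.

Lemma boundary_split_v G x1 x2 y1 m y2 : y1 <= m <= y2 -> x1 <= x2 ->
  rcontinuous G x1 x2 y1 y2 ->
  boundary G x1 x2 y1 y2 = boundary G x1 x2 y1 m + boundary G x1 x2 m y2.
Proof.
move=> hm hy hG; rewrite /boundary.
rewrite (ci_split hm (rcont_con_v hG _)) ?lexx ?hy //.
rewrite (ci_split hm (rcont_con_v hG _)) ?lexx ?hy //.
by ring.
Qed.

Lemma boundary_bound G x1 x2 y1 y2 M : x1 <= x2 -> y1 <= y2 ->
  rcontinuous G x1 x2 y1 y2 ->
  (forall x y, rect x1 x2 y1 y2 x y -> nm (G x y) <= M) ->
  nm (boundary G x1 x2 y1 y2) <= 4 * M * ((x2 - x1) + (y2 - y1)).
Proof.
move=> hx hy hG hM; rewrite /boundary.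
apply: le_trans (nmD _ _) _; rewrite nmM nm_ii mul1r.
have h1 : nm (ci (fun x => G x y1) x1 x2) <= 2 * M * (x2 - x1).
  apply: ci_bound => //; first by apply: rcont_con_h hG _; rewrite lexx.
  by move=> x hx'; apply: hM; rewrite /rect hx' lexx.
have h2 : nm (ci (fun x => G x y2) x1 x2) <= 2 * M * (x2 - x1).
  apply: ci_bound => //; first by apply: rcont_con_h hG _; rewrite hy lexx.
  by move=> x hx'; apply: hM; rewrite /rect hx' lexx hy.
have h3 : nm (ci (G x1) y1 y2) <= 2 * M * (y2 - y1).
  apply: ci_bound => //; first by apply: rcont_con_v hG _; rewrite lexx.
  by move=> x hx'; apply: hM; rewrite /rect hx' lexx hx.
have h4 : nm (ci (G x2) y1 y2) <= 2 * M * (y2 - y1).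
  apply: ci_bound => //; first by apply: rcont_con_v hG _; rewrite lexx hx.
  by move=> x hx'; apply: hM; rewrite /rect hx' lexx hx.
have := nm_sub (ci (fun x => G x y1) x1 x2) (ci (fun x => G x y2) x1 x2).
have := nm_sub (ci (G x2) y1 y2) (ci (G x1) y1 y2); lra.
Qed.

End Goursat.

(** * Goursat's lemma, also with an exceptional vertical line *)

Section GoursatLine.
Context {R : realType}.
Local Notation C := (Cplx R).
Implicit Types (G : R -> R -> C) (l : C).

Lemma ComplexE (x y : R) : (Complex x y : C) = rc x + ii * rc y.
Proof. by apply: complexP; rewrite ?ReD ?ImD ?ReM ?ImM /=; ring. Qed.

Lemma rcontinuousD G H x1 x2 y1 y2 : rcontinuous G x1 x2 y1 y2 ->
  rcontinuous H x1 x2 y1 y2 -> rcontinuous (fun x y => G x y + H x y) x1 x2 y1 y2.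
Proof.
move=> hG hH x y r e e0.
have [d d0 hd] := hG x y r _ (divr_gt0 e0 (ltr0n R 2)).
have [d' d'0 hd'] := hH x y r _ (divr_gt0 e0 (ltr0n R 2)).
exists (Num.min d d'); first by rewrite lt_min d0.
move=> x' y' r'; rewrite !lt_min => /andP[a b] /andP[a' b'].
have -> : G x' y' + H x' y' - (G x y + H x y) = (G x' y' - G x y) + (H x' y' - H x y) by ring.
have := nmD (G x' y' - G x y) (H x' y' - H x y).
by have := hd x' y' r' a a'; have := hd' x' y' r' b b'; lra.
Qed.

Lemma boundaryD G H x1 x2 y1 y2 : x1 <= x2 -> y1 <= y2 ->
  rcontinuous G x1 x2 y1 y2 -> rcontinuous H x1 x2 y1 y2 ->
  boundary (fun x y => G x y + H x y) x1 x2 y1 y2 =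
  boundary G x1 x2 y1 y2 + boundary H x1 x2 y1 y2.
Proof.
move=> hx hy hG hH; rewrite /boundary !ciD; first by ring.
all: try (by apply: (rcont_con_v hG); rewrite ?lexx ?hx ?hy).
all: try (by apply: (rcont_con_v hH); rewrite ?lexx ?hx ?hy).
all: try (by apply: (rcont_con_h hG); rewrite ?lexx ?hx ?hy).
all: try (by apply: (rcont_con_h hH); rewrite ?lexx ?hx ?hy).
Qed.

Lemma affine_rdiff (a l : C) x1 x2 y1 y2 x y :
  rdiff (fun x y => a + l * Complex x y) x1 x2 y1 y2 x y.
Proof.
exists l => e e0; exists 1 => // x' y' _ _ _.
have -> : a + l * Complex x' y' - (a + l * Complex x y) - l * Complex (x' - x) (y' - y) = 0.
  by rewrite !ComplexE !rcB; ring.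
by rewrite nm0; apply: mulr_ge0; [exact: ltW|exact: addr_ge0].
Qed.

Lemma affine_rcontinuous (a l : C) x1 x2 y1 y2 :
  rcontinuous (fun x y => a + l * Complex x y) x1 x2 y1 y2.
Proof. by move=> x y _; apply: rdiff_rcont; apply: affine_rdiff. Qed.

(** Opposite sides involve the same integral of [rc], which cancels and is never evaluated. *)
Lemma boundary_affine (a l : C) x1 x2 y1 y2 : x1 <= x2 -> y1 <= y2 ->
  boundary (fun x y => a + l * Complex x y) x1 x2 y1 y2 = 0.
Proof.
move=> hx hy.
have conrc u v : con u v rc.
  by move=> x _ e e0; exists e => // y _ /ltW; rewrite -rcB nm_rc.
have h y : ci (fun x => a + l * Complex x y) x1 x2 =
    (a + l * ii * rc y) * rc (x2 - x1) + l * ci rc x1 x2.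
  rewrite -ci_cst // -ciZ // -ciD; [|exact: con_cst|exact: conZ].
  by apply: ci_ext => x _; rewrite ComplexE; ring.
have v x : ci (fun y => a + l * Complex x y) y1 y2 =
    (a + l * rc x) * rc (y2 - y1) + l * ii * ci rc y1 y2.
  rewrite -ci_cst // -ciZ // -ciD; [|exact: con_cst|exact: conZ].
  by apply: ci_ext => y _; rewrite ComplexE; ring.
rewrite /boundary !h !v !rcB; ring.
Qed.

(** Near each point [G] differs from an affine function, whose contour integral is 0, by an error
    small compared with the size of the rectangle. The contour integral of that error is then at
    most e times the square of the scale. *)
Lemma goursat G x1 x2 y1 y2 : x1 <= x2 -> y1 <= y2 ->
  (forall x y, rect x1 x2 y1 y2 x y -> rdiff G x1 x2 y1 y2 x y) ->
  boundary G x1 x2 y1 y2 = 0.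
Proof.
move=> hx hy; have [w w0 ->] : exists2 w, 0 <= w & x2 = x1 + w by exists (x2 - x1); lra.
have [h h0 ->] : exists2 h, 0 <= h & y2 = y1 + h by exists (y2 - y1); lra.
move: x2 y2 hx hy => _ _ _ _ hG.
have cG : rcontinuous G x1 (x1 + w) y1 (y1 + h) by move=> x y r; apply: rdiff_rcont; exact: hG.
apply: nm_eps_eq => e e0; rewrite subr0.
(* The bound is quadratic in the scale, so that the bounds of four quarters add up to the bound for
   the doubled scale. *)
pose P a c t := nm (boundary G a (a + w * t) c (c + h * t)) <= e * t ^+ 2.
suff : P x1 y1 1.
  by rewrite /P !mulr1 expr1n mulr1.
apply: (@cousin R P x1 y1 w h w0 h0).
- move=> a c t t0 [i1 i2 i3 i4] p1 p2 p3 p4.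
  have wt : 0 <= w * t by rewrite mulr_ge0 // ltW.
  have ht : 0 <= h * t by rewrite mulr_ge0 // ltW.
  move: i2 i4; rewrite /P !mulrnAr !mulr2n !addrA => i2 i4.
  have c1 : rcontinuous G a (a + w * t + w * t) c (c + h * t + h * t).
    by apply: rcontinuous_sub cG; lra.
  rewrite (@boundary_split_h _ G a (a + w * t)) //; [|lra|lra].
  have c2 : rcontinuous G a (a + w * t) c (c + h * t + h * t).
    by apply: rcontinuous_sub cG; lra.
  have c3 : rcontinuous G (a + w * t) (a + w * t + w * t) c (c + h * t + h * t).
    by apply: rcontinuous_sub cG; lra.
  rewrite (@boundary_split_v _ G a (a + w * t) c (c + h * t)) //; [|lra|lra].
  rewrite (@boundary_split_v _ G (a + w * t) (a + w * t + w * t) c (c + h * t)) //; [|lra|lra].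
  apply: le_trans (nmD _ _) _; apply: le_trans (lerD (nmD _ _) (nmD _ _)) _.
  move: p1 p2 p3 p4; rewrite /P; set b1 := nm _; set b2 := nm _; set b3 := nm _; set b4 := nm _.
  have -> : (t + t) ^+ 2 = 4 * t ^+ 2 by ring.
  lra.
- move=> x y rx ry.
  have [l hl] := hG x y (introT andP (conj rx ry)).
  (* [K] absorbs the factor 4 of [boundary_bound] and two factors [w + h]; the summand 1 keeps it
     positive. *)
  pose K := 4 * (w + h) ^+ 2 + 1.
  have K0 : 0 < K by have := sqr_ge0 (w + h); rewrite /K; lra.
  have [d d0 hd] := hl _ (divr_gt0 e0 K0).
  exists (d / (w + h + 1)); first by rewrite divr_gt0 //; lra.
  move=> a c t /andP[t0]; rewrite ltr_pdivlMr; last by lra.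
  move=> td [i1 i2 i3 i4] ax cy.
  have wt : 0 <= w * t by rewrite mulr_ge0 // ltW.
  have ht : 0 <= h * t by rewrite mulr_ge0 // ltW.
  have td' : w * t + h * t + t < d by lra.
  rewrite /P.
  pose al := G x y - l * Complex x y.
  pose E x' y' := G x' y' + (- al + - l * Complex x' y').
  have cE u1 u2 v1 v2 : x1 <= u1 -> u2 <= x1 + w -> y1 <= v1 -> v2 <= y1 + h -> rcontinuous E u1 u2 v1 v2.
    move=> k1 k2 k3 k4; apply: rcontinuousD; last exact: affine_rcontinuous.
    exact: rcontinuous_sub cG.
  have cEa : rcontinuous E a (a + w * t) c (c + h * t) by apply: cE; lra.
  have -> : boundary G a (a + w * t) c (c + h * t) = boundary E a (a + w * t) c (c + h * t).
    rewrite /E boundaryD; [|lra|lra| |exact: affine_rcontinuous].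
      by rewrite boundary_affine ?addr0 //; lra.
    by apply: rcontinuous_sub cG; lra.
  have bE x' y' : rect a (a + w * t) c (c + h * t) x' y' -> nm (E x' y') <= e / K * (w * t + h * t).
    move=> /andP[rx' ry'].
    have hxx : `|x' - x| <= w * t by rewrite ler_norml; lra.
    have hyy : `|y' - y| <= h * t by rewrite ler_norml; lra.
    have -> : E x' y' = G x' y' - G x y - l * Complex (x' - x) (y' - y).
      by rewrite /E /al !ComplexE !rcB; ring.
    apply: le_trans (hd x' y' _ _ _) _; try lra.
      by apply/andP; split; lra.
    by rewrite ler_wpM2l ?lerD // ltW // divr_gt0.
  apply: le_trans (boundary_bound _ _ cEa bE) _; try lra.
  rewrite !(addrAC _ _ (- _)) !subrr !add0r -mulrDl.
  have -> : 4 * (e / K * ((w + h) * t)) * ((w + h) * t) = e * t ^+ 2 * (4 * (w + h) ^+ 2 / K).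
    by field; lra.
  rewrite ler_piMr ?ler_pdivrMr ?mul1r //; last by rewrite /K; lra.
  by rewrite mulr_ge0 ?sqr_ge0 // ltW.
Qed.

(** Made for the Cauchy kernel, which is only known to be continuous at its removable singularity. A
    thin strip around the line is cut out: its horizontal sides are short, and its two vertical
    sides carry nearly equal values. *)
Lemma goursat_line G x0 x1 x2 y1 y2 : x1 < x0 < x2 -> y1 <= y2 ->
  (forall x y, rect x1 x2 y1 y2 x y -> x != x0 -> rdiff G x1 x2 y1 y2 x y) ->
  (forall x y, rect x1 x2 y1 y2 x y -> rcont G x1 x2 y1 y2 x y) ->
  boundary G x1 x2 y1 y2 = 0.
Proof.
move=> /andP[hx1 hx2] hy.
have [h h0 ->] : exists2 h, 0 <= h & y2 = y1 + h by exists (y2 - y1); lra.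
move: y2 hy => _ _ hG cG.
have hy : y1 <= y1 + h by lra.
apply: nm_eps_eq => e e0; rewrite subr0.
pose eta := e / (4 * h + 2).
have eta0 : 0 < eta by rewrite divr_gt0 //; lra.
pose P (a c t : R) := exists M d : R, [/\ 0 < d, 0 <= M & forall x y, x0 - d < x < x0 + d ->
   c <= y <= c + h * t -> nm (G x y) <= M /\ nm (G x y - G x0 y) <= eta / 2].
(* A common bound and a uniform closeness to the values on the line, near the whole vertical
   segment, by bisection with width 0. *)
have [M [d [d0 M0 hMd]]] : P 0 y1 1.
  apply: (@cousin R P 0 y1 0 h (lexx 0) h0).
  - move=> a c t t0 _ [M [d [d0 M0 h1]]] _ [M' [d' [d'0 M'0 h2]]] _.
    exists (M + M'), (Num.min d d'); split; first by rewrite lt_min d0.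
      by rewrite addr_ge0.
    move=> x y; rewrite ltrBlDr -ltrBlDl => hx hyy.
    have [hx' hx''] : x0 - d < x < x0 + d /\ x0 - d' < x < x0 + d'.
      have h3 : Num.min d d' <= d by rewrite ge_min lexx.
      have h4 : Num.min d d' <= d' by rewrite ge_min lexx orbT.
      by split; lra.
    case: (lerP y (c + h * t)) => hc.
      have [|k1 k2] := h1 x y hx'; first by lra.
      by split=> //; lra.
    have [|k1 k2] := h2 x y hx''; first by move: hyy; rewrite mulrnAr mulr2n; lra.
    by split=> //; lra.
  - move=> x y _ ry.
    have rr : rect x1 x2 y1 (y1 + h) x0 y by apply/andP; split => //; lra.
    have [d d0 hd] := cG x0 y rr _ (divr_gt0 (divr_gt0 eta0 (ltr0n R 2)) (ltr0n R 2)).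
    pose d2 := Num.min d (Num.min (x0 - x1) (x2 - x0)).
    have d20 : 0 < d2 by rewrite /d2 !lt_min d0 !subr_gt0 hx1.
    have l1 : d2 <= d by rewrite /d2 ge_min lexx.
    have l2 : d2 <= x0 - x1 by rewrite /d2 !ge_min lexx orbT.
    have l3 : d2 <= x2 - x0 by rewrite /d2 !ge_min lexx !orbT.
    exists (d / (h + 1)); first by rewrite divr_gt0 //; lra.
    move=> a c t /andP[t0]; rewrite ltr_pdivlMr; last by lra.
    move=> td [_ _ i3 i4] _ cy.
    have ht : 0 <= h * t by rewrite mulr_ge0 // ltW.
    exists (nm (G x0 y) + eta / 4), d2; split => //; first by have := nm_ge0 (G x0 y); lra.
    move=> x' y' hx' hy'.
    have td' : h * t + t < d by rewrite mulrDr mulr1 mulrC in td.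
    have yy : `|y' - y| < d by rewrite ltr_norml; lra.
    have h1 : nm (G x' y' - G x0 y) <= eta / 2 / 2.
      apply: hd => //; last by rewrite ltr_norml; lra.
      by apply/andP; split; lra.
    have h2 : nm (G x0 y' - G x0 y) <= eta / 2 / 2.
      apply: hd => //; last by rewrite subrr normr0.
      by apply/andP; split; lra.
    split; first by have := nm_rev (G x' y') (G x0 y); lra.
    by have := nm_dist (G x0 y) (G x' y') (G x0 y'); rewrite (nmB (G x0 y) (G x0 y')); lra.
pose d2 := Num.min (d / 2) (Num.min (x0 - x1) (Num.min (x2 - x0) (e / (16 * M + 1)))).
have d20 : 0 < d2 by rewrite /d2 !lt_min divr_gt0 // !subr_gt0 hx1 hx2 divr_gt0 //; lra.
have l1 : d2 <= d / 2 by rewrite /d2 ge_min lexx.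
have l2 : d2 <= x0 - x1 by rewrite /d2 !ge_min lexx orbT.
have l3 : d2 <= x2 - x0 by rewrite /d2 !ge_min lexx !orbT.
have l4 : d2 <= e / (16 * M + 1) by rewrite /d2 !ge_min lexx !orbT.
rewrite (@boundary_split_h _ G x1 (x0 - d2)) //; last by lra.
have c2 : rcontinuous G (x0 - d2) x2 y1 (y1 + h) by apply: rcontinuous_sub cG; lra.
rewrite (@boundary_split_h _ G (x0 - d2) (x0 + d2) x2) //; last by lra.
have gs u1 u2 : x1 <= u1 -> u1 <= u2 -> u2 <= x2 -> (u2 < x0 \/ x0 < u1) -> boundary G u1 u2 y1 (y1 + h) = 0.
  move=> k1 k2 k3 k4; apply: goursat => // x y /andP[rx ry].
  have [||l hl] := hG x y; first by apply/andP; split => //; lra.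
    by case: k4 => k4; [rewrite lt_eqF|rewrite gt_eqF] => //; lra.
  exists l => e' /hl[d' d'0 hd']; exists d' => // x' y' /andP[rx' ry']; apply: hd'.
  by apply/andP; split=> //; lra.
rewrite gs ?add0r; try lra; rewrite (gs (x0 + d2)) ?addr0; try lra.
have cm : rcontinuous G (x0 - d2) (x0 + d2) y1 (y1 + h) by apply: rcontinuous_sub cG; lra.
have hMd' x y : rect (x0 - d2) (x0 + d2) y1 (y1 + h) x y ->
    nm (G x y) <= M /\ nm (G x y - G x0 y) <= eta / 2.
  by move=> /andP[rx ry]; apply: hMd; rewrite ?mulr1 //; lra.
rewrite /boundary.
have hb y : y1 <= y <= (y1 + h) -> nm (ci (fun x => G x y) (x0 - d2) (x0 + d2)) <= 2 * M * (2 * d2).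
  move=> ry; have -> : 2 * d2 = (x0 + d2) - (x0 - d2) by ring.
  apply: ci_bound; [lra|exact: (rcont_con_h cm)|move=> x rx].
  by case: (hMd' x y) => //; apply/andP.
have hv : nm (ci (G (x0 + d2)) y1 (y1 + h) - ci (G (x0 - d2)) y1 (y1 + h)) <= 2 * eta * h.
  have k1 : con y1 (y1 + h) (G (x0 + d2)) by apply: (rcont_con_v cm); lra.
  have k2 : con y1 (y1 + h) (G (x0 - d2)) by apply: (rcont_con_v cm); lra.
  rewrite -[- ci _ _ _]mulN1r -ciZ // -ciD //; last exact: conZ.
  have -> : 2 * eta * h = 2 * eta * (y1 + h - y1) by ring.
  apply: ci_bound => //; first by apply: conD => //; exact: conZ.
  move=> y ry; rewrite mulN1r.
  have [|_ h1] := hMd' (x0 + d2) y; first by apply/andP; split => //; lra.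
  have [|_ h2] := hMd' (x0 - d2) y; first by apply/andP; split => //; lra.
  have := nm_dist (G x0 y) (G (x0 + d2) y) (G (x0 - d2) y); rewrite (nmB (G x0 y)); lra.
apply: le_trans (nmD _ _) _; rewrite nmM nm_ii mul1r.
apply: le_trans (lerD (nm_sub _ _) hv) _.
have := hb y1; have := hb (y1 + h); rewrite !lexx hy => /(_ isT) h1 /(_ isT) h2.
have h3 : 8 * M * d2 <= e / 2.
  move: l4; rewrite ler_pdivlMr; last by lra.
  by rewrite mulrDr mulr1 mulrCA [d2 * _]mulrC; lra.
have h4 : 2 * eta * h <= e / 2.
  rewrite /eta; have -> : 2 * (e / (4 * h + 2)) * h = e / 2 * (4 * h / (4 * h + 2)) by field; lra.
  by rewrite ler_piMr ?ler_pdivrMr; lra.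
lra.
Qed.

End GoursatLine.

(** * Complex derivatives and the complex exponential *)

Section ComplexDiff.
Context {R : realType}.
Local Notation C := (Cplx R).
Implicit Types (f g : C -> C) (z w : C).

Definition ccont f z := forall e : R, 0 < e -> exists2 d : R, 0 < d &
  forall h, nm h < d -> nm (f (z + h) - f z) <= e.

Definition cderiv f z (l : C) := forall e : R, 0 < e -> exists2 d : R, 0 < d &
  forall h, nm h < d -> nm (f (z + h) - f z - l * h) <= e * nm h.

Definition cdiff f z := exists l, cderiv f z l.

Lemma cdiff_ccont f z : cdiff f z -> ccont f z.
Proof.
move=> [l hl] e e0; have [d d0 hd] := hl 1 ltr01.
have k0 : 0 < nm l + 1 by have := nm_ge0 l; lra.
exists (Num.min d (e / (nm l + 1))); first by rewrite lt_min d0 divr_gt0.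
move=> h; rewrite lt_min => /andP[/hd h1]; rewrite ltr_pdivlMr // => h2.
have := nmD (f (z + h) - f z - l * h) (l * h); rewrite subrK nmM => h3.
by have := nm_ge0 h; lra.
Qed.

Lemma cderiv_ext (U : C -> Prop) f g z l (d : R) : 0 < d ->
  (forall h, nm h < d -> f (z + h) = g (z + h)) -> cderiv f z l -> cderiv g z l.
Proof.
move=> d0 fg hf e /hf[d' d'0 hd']; exists (Num.min d d'); first by rewrite lt_min d0.
move=> h; rewrite lt_min => /andP[h1 h2]; rewrite -fg //.
by have := fg 0; rewrite nm0 addr0 => <- //; exact: hd'.
Qed.

Lemma cderiv_cst c z : cderiv (fun=> c) z 0.
Proof.
by move=> e e0; exists 1 => // h _; rewrite subrr mul0r subrr nm0 mulr_ge0 ?nm_ge0 // ltW.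
Qed.

Lemma cderiv_id z : cderiv id z 1.
Proof.
move=> e e0; exists 1 => // h _; have -> : id (z + h) - id z - 1 * h = 0 by rewrite /=; ring.
rewrite nm0.
by rewrite mulr_ge0 ?nm_ge0 // ltW.
Qed.

Lemma cderivD f g z l m : cderiv f z l -> cderiv g z m ->
  cderiv (fun z => f z + g z) z (l + m).
Proof.
move=> hf hg e e0; have [d d0 hd] := hf _ (divr_gt0 e0 (ltr0n R 2)).
have [d' d'0 hd'] := hg _ (divr_gt0 e0 (ltr0n R 2)).
exists (Num.min d d'); first by rewrite lt_min d0.
move=> h; rewrite lt_min => /andP[/hd h1 /hd' h2].
have -> : f (z + h) + g (z + h) - (f z + g z) - (l + m) * h =
  (f (z + h) - f z - l * h) + (g (z + h) - g z - m * h) by ring.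
by have := nmD (f (z + h) - f z - l * h) (g (z + h) - g z - m * h); lra.
Qed.

Lemma cderivM f g z l m : cderiv f z l -> cderiv g z m ->
  cderiv (fun z => f z * g z) z (l * g z + f z * m).
Proof.
move=> hf hg e e0.
have fg0 := nm_ge0 (f z); have gg0 := nm_ge0 (g z); have l0 := nm_ge0 l.
pose a := nm (g z) + 1; pose b := nm (f z) + 1; pose c := nm l + 1.
have a0 : 0 < a by rewrite /a; lra.
have b0 : 0 < b by rewrite /b; lra.
have c0 : 0 < c by rewrite /c; lra.
have [d1 d10 h1] := hf _ (divr_gt0 (divr_gt0 e0 (ltr0n R 3)) a0).
have [d2 d20 h2] := hg _ (divr_gt0 (divr_gt0 e0 (ltr0n R 3)) b0).
have [d3 d30 h3] := cdiff_ccont (ex_intro _ m hg) (divr_gt0 (divr_gt0 e0 (ltr0n R 3)) c0).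
have [d4 d40 h4] := cdiff_ccont (ex_intro _ m hg) ltr01.
exists (Num.min (Num.min d1 d2) (Num.min d3 d4)); first by rewrite !lt_min d10 d20 d30.
move=> h; rewrite !lt_min => /andP[/andP[k1 k2] /andP[k3 k4]].
have -> : f (z + h) * g (z + h) - f z * g z - (l * g z + f z * m) * h =
  (f (z + h) - f z - l * h) * g (z + h) + f z * (g (z + h) - g z - m * h) +
  l * h * (g (z + h) - g z) by ring.
apply: le_trans (nmD _ _) _; apply: le_trans (lerD (nmD _ _) (lexx _)) _.
rewrite !nmM.
have b1 : nm (g (z + h)) <= a.
  by have := nm_rev (g (z + h)) (g z); have := h4 h k4; rewrite /a; lra.
have e1 : nm (f (z + h) - f z - l * h) * nm (g (z + h)) <= (e / 3 / a * nm h) * a.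
  by apply: ler_pM; rewrite ?nm_ge0 // h1.
have e2 : nm (f z) * nm (g (z + h) - g z - m * h) <= b * (e / 3 / b * nm h).
  by apply: ler_pM; rewrite ?nm_ge0 ?h2 // /b lerDl.
have e3 : nm l * nm h * nm (g (z + h) - g z) <= c * nm h * (e / 3 / c).
  apply: ler_pM; rewrite ?mulr_ge0 ?nm_ge0 ?h3 //.
  by rewrite ler_wpM2r ?nm_ge0 // /c lerDl.
apply: le_trans (lerD (lerD e1 e2) e3) _.
rewrite le_eqVlt; apply/orP; left; apply/eqP; field.
by rewrite !gt_eqF.
Qed.

Lemma cderiv_comp f g z l m : cderiv f z l -> cderiv g (f z) m ->
  cderiv (g \o f) z (m * l).
Proof.
move=> hf hg e e0.
have m0 := nm_ge0 m; have l0 := nm_ge0 l.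
pose a := nm l + 1; pose b := nm m + 1.
have a0 : 0 < a by rewrite /a; lra.
have b0 : 0 < b by rewrite /b; lra.
have [d1 d10 h1] := hg _ (divr_gt0 (divr_gt0 e0 (ltr0n R 2)) a0).
have [d2 d20 h2] := hf _ (divr_gt0 (divr_gt0 e0 (ltr0n R 2)) b0).
have [d3 d30 h3] := hf _ ltr01.
exists (Num.min (Num.min d2 d3) (d1 / a)); first by rewrite !lt_min d20 d30 divr_gt0.
move=> h; rewrite !lt_min => /andP[/andP[k2 k3]]; rewrite ltr_pdivlMr // => k1.
pose k := f (z + h) - f z.
have hk : nm k <= nm h * a.
  have := nmD (k - l * h) (l * h); rewrite subrK nmM.
  by have := h3 h k3; rewrite -/k /a; lra.
have := h1 k (le_lt_trans hk k1); rewrite /k subrKC -/k => k4.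
have -> : (g \o f) (z + h) - (g \o f) z - m * l * h =
  (g (f (z + h)) - g (f z) - m * k) + m * (f (z + h) - f z - l * h) by rewrite /k /=; ring.
apply: le_trans (nmD _ _) _; rewrite nmM.
have e1 : e / 2 / a * nm k <= e / 2 / a * (nm h * a).
  by rewrite ler_wpM2l // !divr_ge0 // ltW.
have e2 : nm m * nm (f (z + h) - f z - l * h) <= b * (e / 2 / b * nm h).
  by apply: ler_pM; rewrite ?nm_ge0 ?h2 // /b lerDl.
apply: le_trans (lerD (le_trans k4 e1) e2) _.
rewrite le_eqVlt; apply/orP; left; apply/eqP; field.
by rewrite !gt_eqF.
Qed.

Lemma cderivV z : z != 0 -> cderiv (fun z => z^-1) z (- z ^- 2).
Proof.
rewrite -nm_gt0 => z0 e e0.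
pose d := Num.min (nm z / 2) (e * nm z ^+ 3 / 2).
have d0 : 0 < d by rewrite lt_min !divr_gt0 // mulr_gt0 // exprn_gt0.
have l1 : d <= nm z / 2 by rewrite /d ge_min lexx.
have l2 : d <= e * nm z ^+ 3 / 2 by rewrite /d ge_min lexx orbT.
exists d => // h hd.
have zh : nm z / 2 <= nm (z + h).
  by have := nm_rev z (- h); rewrite opprK nmN; lra.
have zh0 : 0 < nm (z + h) by lra.
have -> : (z + h)^-1 - z^-1 - - z ^- 2 * h = h ^+ 2 / (z ^+ 2 * (z + h)).
  have zn : z != 0 by rewrite -nm_gt0.
  have zhn : z + h != 0 by rewrite -nm_gt0.
  by field; rewrite ?zn ?zhn.
rewrite nmM nmV nmM !nmX ler_pdivrMr; last by rewrite mulr_gt0 // exprn_gt0.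
rewrite expr2 mulrAC ler_wpM2r ?nm_ge0 //.
apply: (@le_trans _ _ (e * (nm z ^+ 2 * (nm z / 2)))); last first.
  by apply: ler_wpM2l; [exact: ltW|apply: ler_wpM2l; rewrite ?exprn_ge0 // ltW].
have -> : e * (nm z ^+ 2 * (nm z / 2)) = e * nm z ^+ 3 / 2 by field.
lra.
Qed.

Lemma cdiff_cst c z : cdiff (fun=> c) z. Proof. by exists 0; exact: cderiv_cst. Qed.
Lemma cdiff_id z : cdiff id z. Proof. by exists 1; exact: cderiv_id. Qed.
Lemma cdiffD f g z : cdiff f z -> cdiff g z -> cdiff (fun z => f z + g z) z.
Proof. by move=> [l hl] [m hm]; exists (l + m); exact: cderivD. Qed.
Lemma cdiffM f g z : cdiff f z -> cdiff g z -> cdiff (fun z => f z * g z) z.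
Proof. by move=> [l hl] [m hm]; exists (l * g z + f z * m); exact: cderivM. Qed.
Lemma cdiffB f g z : cdiff f z -> cdiff g z -> cdiff (fun z => f z - g z) z.
Proof.
move=> hf hg; have := cdiffD hf (cdiffM (cdiff_cst (-1) z) hg).
by under eq_fun do rewrite mulN1r.
Qed.
Lemma cdiffV f z : cdiff f z -> f z != 0 -> cdiff (fun z => (f z)^-1) z.
Proof.
by move=> [l hl] fz; exists (- f z ^- 2 * l); exact: (cderiv_comp hl (cderivV fz)).
Qed.
Lemma cdiff_comp f g z : cdiff f z -> cdiff g (f z) -> cdiff (fun z => g (f z)) z.
Proof. by move=> [l hl] [m hm]; exists (m * l); exact: (cderiv_comp hl hm). Qed.

Lemma real_deriv_eps (f : R -> R) x df : is_derive x (1 : R) f df ->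
  forall e, 0 < e -> exists2 d, 0 < d & forall h, `|h| < d ->
    `|f (x + h) - f x - df * h| <= e * `|h|.
Proof.
move=> [hf hdf] e e0.
have : h^-1 *: (f (h *: (1 : R) + x) - f x) @[h --> 0^'] --> df.
  by rewrite -hdf; exact: hf.
move=> /cvgrPdist_le /(_ e e0) [d /= d0 hd].
exists d => // h hh; have [->|h0] := eqVneq h 0.
  by rewrite addr0 subrr mulr0 subrr normr0 mulr0.
have := hd h; rewrite /= sub0r normrN => /(_ hh h0).
rewrite /GRing.scale /= mulr1 (addrC h x) => k.
have -> : f (x + h) - f x - df * h = - (df - h^-1 * (f (x + h) - f x)) * h.
  by field.
by rewrite normrM normrN ler_wpM2r.
Qed.

Lemma cexp0 : cexp (0 : C) = 1.
Proof. by rewrite /cexp /= expR0 cos0 sin0 mulr1 mulr0. Qed.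

Lemma cexpD z w : cexp (z + w) = cexp z * cexp w.
Proof.
rewrite /cexp ReD ImD expRD cosD sinD.
by apply: complexP; rewrite ?ReM ?ImM /=; ring.
Qed.

Lemma nm_cexp z : nm (cexp z) = expR (complex.Re z).
Proof.
rewrite nmE /= !exprMn -mulrDr cos2Dsin2 mulr1 sqrtr_sqr ger0_norm ?expR_ge0 //.
Qed.

Lemma cexp_neq0 z : cexp z != 0.
Proof. by rewrite -nm_gt0 nm_cexp expR_gt0. Qed.

Lemma cexpN z : cexp (- z) = (cexp z)^-1.
Proof.
have := cexpD z (- z); rewrite subrr cexp0 => /esym h.
by rewrite -[LHS](mulKf (cexp_neq0 z)) h mulr1.
Qed.

Lemma cexpMn z n : cexp (z *+ n) = cexp z ^+ n.
Proof. by elim: n => [|n IH]; rewrite ?cexp0 // mulrS cexpD IH exprS. Qed.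

Lemma cexp_real (x : R) : cexp (rc x) = rc (expR x).
Proof. by rewrite /cexp /= cos0 sin0 mulr1 mulr0. Qed.

Lemma cderiv_cexp0 : cderiv (@cexp R) 0 1.
Proof.
move=> e e0.
(* The two components contribute at most [3 * (e' * n)] each, and 6 / 8 is below 1; the bound by 1
   keeps [E] at most 2. *)
pose e' := Num.min (e / 8) 1.
have e'0 : 0 < e' by rewrite lt_min divr_gt0 //=.
have e1 : e' <= e / 8 by rewrite /e' ge_min lexx.
have e2 : e' <= 1 by rewrite /e' ge_min lexx orbT.
have [d1 d10 h1] := real_deriv_eps (is_derive_expR (0 : R)) e'0.
have [d2 d20 h2] := real_deriv_eps (is_derive_cos (0 : R)) e'0.
have [d3 d30 h3] := real_deriv_eps (is_derive_sin (0 : R)) e'0.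
pose d := Num.min (Num.min d1 d2) (Num.min d3 (e' / 2)).
exists d; first by rewrite /d !lt_min d10 d20 d30 divr_gt0.
move=> h; rewrite /d !lt_min => /andP[/andP[k1 k2] /andP[k3 k4]].
have rh := Re_le_nm h; have ih := Im_le_nm h.
case: h k1 k2 k3 k4 rh ih => x y k1 k2 k3 k4 rh ih; rewrite /= in rh ih.
set n := nm _ in k1 k2 k3 k4 rh ih *.
have := h1 x (le_lt_trans rh k1); have := h2 y (le_lt_trans ih k2).
have := h3 y (le_lt_trans ih k3).
rewrite !add0r expR0 cos0 sin0 oppr0 !mul0r !mul1r !subr0 ?addr0.
set E := expR x; set c := cos y; set s := sin y => hs hc hE.
rewrite cexp0.
have -> : cexp (Complex x y) - 1 - Complex x y = (Complex (E * c - 1 - x) (E * s - y) : C).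
  by rewrite /cexp; apply: complexP; rewrite ?ReB ?ImB /= -/E -/c -/s; ring.
apply: le_trans (nm_le_ReIm _) _ => /=.
have n0 : 0 <= n by exact: nm_ge0.
have E0 : 0 <= E by exact: expR_ge0.
have ehx : e' * `|x| <= e' * n by rewrite ler_wpM2l // ltW.
have ehy : e' * `|y| <= e' * n by rewrite ler_wpM2l // ltW.
have en : e' * n <= 1 * n by rewrite ler_wpM2r.
have E2 : `|E - 1| <= 2 * n.
  have := ler_normD (E - 1 - x) x; rewrite subrK; lra.
have E3 : E <= 2 by move: E2; rewrite ler_norml; lra.
have t1 : `|E * c - 1 - x| <= e' * n + 2 * (e' * n).
  have -> : E * c - 1 - x = (E - 1 - x) + E * (c - 1) by ring.
  apply: le_trans (ler_normD _ _) _; apply: lerD; first by lra.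
  rewrite normrM (ger0_norm E0).
  by apply: ler_pM => //; lra.
have t2 : `|E * s - y| <= 2 * (e' * n) + e' * n.
  have -> : E * s - y = E * (s - y) + (E - 1) * y by ring.
  apply: le_trans (ler_normD _ _) _; apply: lerD.
    by rewrite normrM (ger0_norm E0); apply: ler_pM => //; lra.
  rewrite normrM; apply: ler_pM => //; lra.
have en' : e' * n <= e / 8 * n by rewrite ler_wpM2r.
apply: le_trans (lerD t1 t2) _.
have : 0 <= e * n by rewrite mulr_ge0 // ltW.
lra.
Qed.

Lemma cderiv_cexp z : cderiv (@cexp R) z (cexp z).
Proof.
move=> e e0; have z0 : 0 < nm (cexp z) by rewrite nm_gt0 cexp_neq0.
have [d d0 hd] := cderiv_cexp0 (divr_gt0 e0 z0).
exists d => // h /hd; rewrite add0r cexp0 mul1r => k.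
have -> : cexp (z + h) - cexp z - cexp z * h = cexp z * (cexp h - 1 - h).
  by rewrite cexpD; ring.
rewrite nmM; apply: le_trans (ler_wpM2l (nm_ge0 _) k) _.
by rewrite mulrA mulrCA divff ?mulr1 // gt_eqF.
Qed.

Lemma cdiff_cexp z : cdiff (@cexp R) z.
Proof. by exists (cexp z); exact: cderiv_cexp. Qed.

Lemma cdiff_rdiff g x1 x2 y1 y2 x y : cdiff g (Complex x y) ->
  rdiff (fun x y => g (Complex x y)) x1 x2 y1 y2 x y.
Proof.
move=> [l hl]; exists l => e e0; have [d d0 hd] := hl e e0.
exists (d / 2); first by rewrite divr_gt0.
move=> x' y' _ hx hy.
have h1 := nm_le_ReIm (Complex (x' - x) (y' - y) : C); rewrite /= in h1.
have -> : (Complex x' y' : C) = Complex x y + Complex (x' - x) (y' - y).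
  by apply: complexP; rewrite ?ReD ?ImD /=; ring.
apply: le_trans (hd _ _) _; first by lra.
by rewrite ler_wpM2l // ltW.
Qed.

Lemma ccont_rcont g x1 x2 y1 y2 x y : ccont g (Complex x y) ->
  rcont (fun x y => g (Complex x y)) x1 x2 y1 y2 x y.
Proof.
move=> hl e e0; have [d d0 hd] := hl e e0.
exists (d / 2); first by rewrite divr_gt0.
move=> x' y' _ hx hy.
have h1 := nm_le_ReIm (Complex (x' - x) (y' - y) : C); rewrite /= in h1.
have -> : (Complex x' y' : C) = Complex x y + Complex (x' - x) (y' - y).
  by apply: complexP; rewrite ?ReD ?ImD /=; ring.
apply: hd; lra.
Qed.

Lemma ccont_comp f g z : ccont f z -> ccont g (f z) -> ccont (fun z => g (f z)) z.
Proof.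
move=> hf hg e /hg[d d0 hd]; have [d' d'0 hd'] := hf _ (divr_gt0 d0 (ltr0n R 2)).
exists d' => // h /hd' k; rewrite -[X in g X](subrKC (f z)); apply: hd; lra.
Qed.

End ComplexDiff.

(** * Cauchy's formula and the Taylor expansion with remainder *)

Section CauchyTaylor.
Context {R : realType}.
Local Notation C := (Cplx R).
Local Notation tpi := (2 * pi : R).

Lemma tpi_gt0 : 0 < tpi. Proof. by rewrite mulr_gt0 ?pi_gt0. Qed.

Lemma cexp_period (z : C) : cexp (z + ii * rc tpi) = cexp z.
Proof.
rewrite cexpD; have -> : cexp (ii * rc tpi) = (1 : C); last by rewrite mulr1.
have -> : ii * rc tpi = (Complex 0 tpi : C) by apply: complexP; rewrite ?ReM ?ImM /=; ring.
by rewrite /cexp /= expR0 !mul1r !mulr_natl cos2pi sin2pi.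
Qed.

(** In logarithmic coordinates a rectangle of height 2 pi is an annulus: the horizontal sides cancel
    by periodicity, which leaves the difference of two circle integrals. Goursat's lemma then says
    that such an integral does not depend on the radius. *)
Lemma boundary_periodic (g : C -> C) x1 x2 :
  boundary (fun x y => g (cexp (Complex x y))) x1 x2 0 tpi =
  ii * (ci (fun y => g (cexp (Complex x2 y))) 0 tpi
      - ci (fun y => g (cexp (Complex x1 y))) 0 tpi).
Proof.
rewrite /boundary (@ci_ext _ _ _ (fun x => g (cexp (Complex x 0)))
  (fun x => g (cexp (Complex x tpi)))) ?subrr ?add0r // => x _.
by rewrite (ComplexE x tpi) cexp_period /rc.
Qed.

Lemma ii_neq0 : (ii : C) != 0. Proof. by rewrite -nm_gt0 nm_ii. Qed.

(** Passing from radius 1 to radius e multiplies the integral by e to the power -(k + 1), but by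
    Goursat's lemma it does not change; so it is 0. *)
Lemma ci_cexp_pow k : ci (fun y => cexp (Complex 0 y : C) ^- k.+1) 0 tpi = 0.
Proof.
pose g (w : C) := cexp (- (w *+ k.+1)).
have gE (w : C) : g w = (cexp w)^-1 ^+ k.+1 by rewrite /g cexpN cexpMn exprVn.
have dg w : cdiff g w.
  apply: (@cdiff_comp _ (fun w => - (w *+ k.+1)) (@cexp R)); last exact: cdiff_cexp.
  have -> : (fun w : C => - (w *+ k.+1)) = (fun w => (- k.+1%:R) * w).
    by apply/funext => z; rewrite mulNr mulr_natl.
  by apply: cdiffM; [exact: cdiff_cst|exact: cdiff_id].
have h : boundary (fun x y => g (Complex x y)) 0 1 0 tpi = 0.
  by apply: goursat => // [|x y _]; [exact: ltW tpi_gt0|exact: cdiff_rdiff].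
have gE' : (fun x y => g (Complex x y)) = (fun x y => (fun z : C => z^-1 ^+ k.+1) (cexp (Complex x y))).
  by apply/funext => x; apply/funext => y; rewrite gE.
move: h; rewrite gE' (boundary_periodic (fun z => z^-1 ^+ k.+1)) => /eqP; rewrite mulf_eq0 (negPf ii_neq0) /=.
have -> : ci (fun y => (cexp (Complex 1 y : C))^-1 ^+ k.+1) 0 tpi =
    rc (expR 1) ^- k.+1 * ci (fun y => (cexp (Complex 0 y : C))^-1 ^+ k.+1) 0 tpi.
  rewrite -ciZ.
    apply: ci_ext => y _; rewrite (ComplexE 1) cexpD cexp_real -[Complex 0 y]add0r.
    by rewrite (ComplexE 0) rc0 add0r add0r exprVn exprMn invfM exprVn.
  rewrite (_ : (fun y => _) = (fun y => g (Complex 0 y))); last first.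
    by apply/funext => y; rewrite gE.
  apply: (@rcont_con_v _ (fun x y => g (Complex x y)) 0 1 0 tpi 0) => [x y _|].
    by apply: ccont_rcont; apply: cdiff_ccont.
  by rewrite lexx ler01.
set I0 := ci _ _ _; rewrite [_ ^- _ * I0 - I0](_ : _ = (rc (expR 1) ^- k.+1 - 1) * I0); last by ring.
rewrite mulf_eq0 => /orP[|/eqP <-]; last by apply: ci_ext => y _; rewrite exprVn.
rewrite subr_eq0 => /eqP /(congr1 nm); rewrite nmV nmX nm_rc nm1 ger0_norm ?expR_ge0 // => h.
exfalso; have h1 : 1 < expR 1 ^+ k.+1 :> R.
  by rewrite exprn_egt1 // -expR0 ltr_expR.
move: h => /(congr1 (fun x => x^-1)); rewrite invrK invr1 => h.
by rewrite h ltxx in h1.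
Qed.

Variables (f : C -> C) (Rr r B : R).
Hypothesis r_bnd : 0 < r < Rr.
Hypothesis df : forall z, nm z < Rr -> cdiff f z.
Hypothesis Bf : forall z, nm z < Rr -> nm (f z) <= B.

Let zt (y : R) : C := cexp (Complex (ln r) y).

Let r0 : 0 < r. Proof. by case/andP: r_bnd. Qed.

Let nm_zt y : nm (zt y) = r.
Proof. by rewrite nm_cexp /= lnK // posrE. Qed.

Let zt_neq0 y : zt y != 0. Proof. exact: cexp_neq0. Qed.

Let con_zt (g : C -> C) : (forall z, nm z = r -> ccont g z) -> con 0 tpi (fun y => g (zt y)).
Proof.
move=> hg; apply: (@rcont_con_v _ (fun x y => g (cexp (Complex x y))) (ln r) (ln r) 0 tpi (ln r)).
  move=> x y /andP[/andP[h1 h2] _]; apply: (@ccont_rcont _ (fun z => g (cexp z))).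
  apply: ccont_comp; first by apply: cdiff_ccont; exact: cdiff_cexp.
  apply: hg; rewrite nm_cexp /=; have -> : x = ln r by apply/eqP; rewrite eq_le h1 h2.
  by rewrite lnK // posrE.
by rewrite lexx.
Qed.

Let B0 : 0 <= B.
Proof. by apply: le_trans (nm_ge0 (f 0)) (Bf _); rewrite nm0; case/andP: r_bnd; lra. Qed.

(** Cauchy's formula in the form used below. The integral over the angle does not depend on the
    radius, not even across |z| = |z0|, since the integrand extends continuously to [z0]; and it
    tends to 0 with the radius. *)
Let ci_kernel_zero z0 : nm z0 < r ->
  ci (fun y => (f (zt y) - f z0) * (zt y / (zt y - z0))) 0 tpi = 0.
Proof.
move=> hz0; have B00 := B0; have r00 := r0.
have rR : r < Rr by case/andP: r_bnd.
have [l hl] : cdiff f z0 by apply: df; lra.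
(* The value at [z0] is the one that removes the singularity. The origin is not reached by [cexp]
   and matters only through the limit [q0]. *)
pose q z := if z == z0 then z0 * l else (f z - f z0) * (z / (z - z0)).
have qd z : nm z < Rr -> z != z0 -> cdiff q z.
  move=> hz zz0.
  have h : cdiff (fun z => (f z - f z0) * (z * (z - z0)^-1)) z.
    apply: cdiffM; first by apply: cdiffB; [exact: df|exact: cdiff_cst].
    apply: cdiffM; first exact: cdiff_id.
    apply: (@cdiffV _ (fun z => z - z0)); last by rewrite subr_eq0.
    by apply: (@cdiffB _ id (fun=> z0)); [exact: cdiff_id|exact: cdiff_cst].
  move: h => [m hm]; exists m.
  have zp : 0 < nm (z - z0) by rewrite nm_gt0 subr_eq0.
  apply: (@cderiv_ext _ (fun=> True) _ _ _ _ _ zp _ hm) => h hh.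
  rewrite /q; case: eqP => // e; exfalso.
  by move: hh; rewrite -e nmB addrC addKr ltxx.
have qc z : nm z < Rr -> z != 0 -> ccont q z.
  move=> hz zn0; have [zz0|] := eqVneq z z0; last by move=> /(qd _ hz)/cdiff_ccont.
  move=> e e0; rewrite -zz0 in hl.
  have [d d0 hd] := hl (e / (2 * (nm z + nm z))) ltac:(by rewrite divr_gt0 // mulr_gt0 // addr_gt0 // nm_gt0).
  have k0 : 0 < 2 * (nm l + 1) by have := nm_ge0 l; lra.
  exists (Num.min (Num.min d (nm z)) (e / (2 * (nm l + 1)))).
    by rewrite !lt_min d0 nm_gt0 zn0 divr_gt0.
  move=> h; rewrite !lt_min => /andP[/andP[h1 h2]]; rewrite ltr_pdivlMr // => h3.
  rewrite /q -zz0 eqxx; case: eqP => [|/eqP hn]; first by rewrite subrr nm0 ltW.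
  have hn0 : h != 0 by apply: contra hn => /eqP->; rewrite addr0.
  have -> : (f (z + h) - f z) * ((z + h) / (z + h - z)) - z * l =
     (f (z + h) - f z - l * h) / h * (z + h) + l * h.
    have hn1 : z + h - z != 0 by rewrite addrC addKr.
    by field; rewrite ?hn0 ?hn1.
  apply: le_trans (nmD _ _) _; rewrite !nmM nmV.
  have hp : 0 < nm h by rewrite nm_gt0.
  have zp : 0 < nm z by rewrite nm_gt0.
  have e1 : nm (f (z + h) - f z - l * h) / nm h <= e / (2 * (nm z + nm z)).
    by rewrite ler_pdivrMr // hd.
  have e2 : nm (z + h) <= nm z + nm z by have := nmD z h; lra.
  have e3 : nm (f (z + h) - f z - l * h) / nm h * nm (z + h) <=
      e / (2 * (nm z + nm z)) * (nm z + nm z).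
    by apply: ler_pM; rewrite ?nm_ge0 ?divr_ge0 ?nm_ge0.
  have e4 : e / (2 * (nm z + nm z)) * (nm z + nm z) = e / 2 by field; lra.
  have := nm_ge0 l; lra.
have q0 e : 0 < e -> exists2 d, 0 < d & forall z, 0 < nm z < d -> nm (q z) <= e.
  move=> e0; have [z00|z0n] := eqVneq z0 0.
    have df0 : cdiff f 0 by apply: df; rewrite nm0; apply: lt_trans rR.
    have [d d0 hd] := cdiff_ccont df0 e0.
    exists d => // z /andP[zp zd]; rewrite /q z00 -nm_eq0 gt_eqF //.
    rewrite subr0 divff ?mulr1 -?nm_gt0 //.
    by rewrite -[z]add0r; apply: hd.
  have zp : 0 < nm z0 by rewrite nm_gt0.
  have k0 : 0 < 4 * B + 1 by lra.
  exists (Num.min (nm z0 / 2) (e * nm z0 / (4 * B + 1))).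
    by rewrite lt_min !divr_gt0 // mulr_gt0.
  move=> z /andP[zz]; rewrite lt_min => /andP[h1]; rewrite ltr_pdivlMr // => h2.
  have zd : nm z0 / 2 <= nm (z - z0) by have := nm_rev z0 z; rewrite nmB; lra.
  rewrite /q; case: eqP => [zE|_]; first by rewrite zE in h1; lra.
  rewrite !nmM nmV mulrA ler_pdivrMr; last by lra.
  have b1 : nm (f z - f z0) <= 2 * B.
    by apply: le_trans (nm_sub _ _) _; have := Bf (z := z); have := Bf (z := z0); lra.
  have b2 : nm (f z - f z0) * nm z <= 2 * B * nm z by rewrite ler_wpM2r ?nm_ge0.
  have b3 : e * (nm z0 / 2) <= e * nm (z - z0) by rewrite ler_wpM2l // ltW.
  lra.
(* The circle through [z0] in logarithmic coordinates; if [z0] is 0 there is none, and any abscissa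
   left of [ln r] will do. *)
pose x0 := if z0 == 0 then ln r - 1 else ln (nm z0).
have x0r : x0 < ln r.
  rewrite /x0; case: eqP => [_|/eqP z0n]; first by lra.
  by rewrite ltr_ln // posrE // nm_gt0.
have expx x y : x <= ln r -> nm (cexp (Complex x y : C)) <= r.
  by rewrite nm_cexp /= => h; rewrite -[leRHS](@lnK R r) ?posrE // ler_expR.
have const X : X < x0 -> ci (fun y => q (zt y)) 0 tpi = ci (fun y => q (cexp (Complex X y))) 0 tpi.
  move=> Xx0.
  have : boundary (fun x y => q (cexp (Complex x y))) X (ln r) 0 tpi = 0.
    apply: (@goursat_line _ _ x0); [by rewrite Xx0|exact: ltW tpi_gt0|move=> x y|move=> x y].
      move=> /andP[/andP[_ hx] _] xx0; apply: (@cdiff_rdiff _ (fun z => q (cexp z))).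
      apply: cdiff_comp; first exact: cdiff_cexp.
      apply: qd; first by have := expx x y hx; lra.
      apply: contra xx0 => /eqP h; rewrite /x0 -h (negPf (cexp_neq0 _)) nm_cexp /=.
      by rewrite expRK.
    move=> /andP[/andP[_ hx] _]; apply: (@ccont_rcont _ (fun z => q (cexp z))).
    apply: ccont_comp; first by apply: cdiff_ccont; exact: cdiff_cexp.
    apply: qc; last exact: cexp_neq0.
    by have := expx x y hx; lra.
  rewrite (boundary_periodic q) => /eqP; rewrite mulf_eq0 (negPf ii_neq0) /= subr_eq0.
  by move=> /eqP.
have -> : ci (fun y => (f (zt y) - f z0) * (zt y / (zt y - z0))) 0 tpi = ci (fun y => q (zt y)) 0 tpi.
  apply: ci_ext => y _; rewrite /q; case: eqP => // e.
  by move: hz0; rewrite -e nm_zt ltxx.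
apply: nm_eps_eq => e e0; rewrite subr0.
have t0 := tpi_gt0.
have [d d0 hd] := q0 (e / (2 * tpi)) (divr_gt0 e0 (mulr_gt0 (ltr0n R 2) t0)).
pose X := Num.min (x0 - 1) (ln (d / 2)).
have X1 : X <= x0 - 1 by rewrite /X ge_min lexx.
have X2 : X <= ln (d / 2) by rewrite /X ge_min lexx orbT.
rewrite (const X); last by lra.
have -> : e = 2 * (e / (2 * tpi)) * (tpi - 0) by move: tpi t0 {hd} => t t0; field; lra.
apply: ci_bound; first exact: ltW.
  apply: (@rcont_con_v _ (fun x y => q (cexp (Complex x y))) X X 0 tpi X); last by rewrite lexx.
  move=> x y /andP[/andP[_ hx] _]; apply: (@ccont_rcont _ (fun z => q (cexp z))).
  apply: ccont_comp; first by apply: cdiff_ccont; exact: cdiff_cexp.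
  apply: qc; last exact: cexp_neq0.
  by have := expx x y; lra.
move=> y _; apply: hd; rewrite nm_cexp /= expR_gt0 /=.
have : expR X <= d / 2 by rewrite -[leRHS]lnK ?posrE ?divr_gt0 // ler_expR.
lra.
Qed.

Let cf (k : nat) : C := (rc tpi)^-1 * ci (fun y => f (zt y) * zt y ^- k) 0 tpi.

Let ccont_f z : nm z = r -> ccont f z.
Proof. by move=> h; apply/cdiff_ccont/df; rewrite h; case/andP: r_bnd. Qed.

Let cdiff_pow (z : C) k : z != 0 -> cdiff (fun z => z ^- k) z.
Proof.
move=> z0; apply: (@cdiffV _ (fun z => z ^+ k)); last by rewrite expf_neq0.
elim: k => [|k IH]; first exact: cdiff_cst.
have -> : (fun z : C => z ^+ k.+1) = (fun z => z * z ^+ k) by apply/funext => w; rewrite exprS.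
by apply: cdiffM => //; exact: cdiff_id.
Qed.

Let nm_neq0 (z : C) : nm z = r -> z != 0.
Proof. by move=> h; rewrite -nm_gt0 h. Qed.

Let con_fk k : con 0 tpi (fun y => f (zt y) * zt y ^- k).
Proof.
apply: (@con_zt (fun z => f z * z ^- k)) => z hz; apply: cdiff_ccont; apply: cdiffM.
  by apply: df; rewrite hz; case/andP: r_bnd.
by apply: cdiff_pow; exact: nm_neq0.
Qed.

Let cf_bound k : nm (cf k) <= 2 * B / r ^+ k.
Proof.
have t0 := tpi_gt0.
rewrite /cf nmM nmV nm_rc ger0_norm ?(ltW t0) // [_^-1 * _]mulrC ler_pdivrMr //.
have -> : 2 * B / r ^+ k * tpi = 2 * (B / r ^+ k) * (tpi - 0) by ring.
apply: ci_bound => [| |y _]; [exact: ltW|exact: con_fk|].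
rewrite nmM nmV nmX nm_zt ler_pM2r ?invr_gt0 ?exprn_gt0 //.
by apply: Bf; rewrite nm_zt; case/andP: r_bnd.
Qed.

Let ci_zt_pow k : ci (fun y => zt y ^- k) 0 tpi = rc tpi * (k == 0%N)%:R.
Proof.
case: k => [|k].
  rewrite (@ci_ext _ _ _ _ (fun=> 1)); last by move=> y _; rewrite expr0 invr1.
  by rewrite ci_cst ?mul1r ?subr0 ?mulr1 // ltW // tpi_gt0.
rewrite mulr0.
rewrite (@ci_ext _ _ _ _ (fun y => rc r ^- k.+1 * cexp (Complex 0 y : C) ^- k.+1)).
  rewrite ciZ ?ci_cexp_pow ?mulr0 //.
  apply: (@rcont_con_v _ (fun x y => cexp (Complex x y) ^- k.+1) 0 0 0 tpi 0).
    move=> x y _; apply: (@ccont_rcont _ (fun z => cexp z ^- k.+1)).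
    apply: cdiff_ccont; apply: (@cdiff_comp _ (@cexp R) (fun z => z ^- k.+1)).
      exact: cdiff_cexp.
    by apply: cdiff_pow; exact: cexp_neq0.
  by rewrite lexx.
move=> y _; have -> : zt y = rc r * cexp (Complex 0 y).
  by rewrite /zt (ComplexE (ln r)) cexpD cexp_real lnK ?posrE // (ComplexE 0) rc0 add0r.
by rewrite exprMn invfM.
Qed.

(** The kernel z / (z - z0) is a truncated geometric series in z0 / z plus a tail. Since f(z) -
    f(z0) has integral 0 against the whole kernel, f(z0) minus the Taylor polynomial is the integral
    against the tail, divided by 2 pi. *)
Let taylor_rem z0 K : nm z0 < r ->
  nm (f z0 - \sum_(k < K) cf k * z0 ^+ k) <= 4 * B * (nm z0 / r) ^+ K / (1 - nm z0 / r).
Proof.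
move=> hz0; have t0 := tpi_gt0; have B00 := B0; have r00 := r0.
pose rho := nm z0 / r.
have rho1 : rho < 1 by rewrite ltr_pdivrMr // mul1r.
have rho0 : 0 <= rho by rewrite divr_ge0 ?nm_ge0 // ltW.
(* Without the term of degree 0 the identity below would lose [f z0], so the empty sum is estimated
   directly. *)
case: K => [|K].
  rewrite big_ord0 subr0 expr0 mulr1 -/rho ler_pdivlMr; last by lra.
  have b1 : nm (f z0) <= B by apply: Bf; case/andP: r_bnd => _; lra.
  apply: (@le_trans _ _ (B * 1)); last by lra.
  by apply: ler_pM; rewrite ?nm_ge0; lra.
set K1 := K.+1.
have ztz0 y : zt y - z0 != 0.
  by rewrite subr_eq0; apply/eqP => h; move: hz0; rewrite -h nm_zt ltxx.
pose rem y := (f (zt y) - f z0) * ((z0 / zt y) ^+ K1 * (zt y / (zt y - z0))).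
have con_rem : con 0 tpi rem.
  apply: (@con_zt (fun z => (f z - f z0) * ((z0 / z) ^+ K1 * (z / (z - z0))))) => z hz.
  apply: cdiff_ccont; apply: cdiffM.
    by apply: cdiffB; [apply: df; rewrite hz; case/andP: r_bnd|exact: cdiff_cst].
  apply: cdiffM.
    have -> : (fun z => (z0 / z) ^+ K1) = (fun z => z0 ^+ K1 * z ^- K1).
      by apply/funext => w; rewrite expr_div_n.
    by apply: cdiffM; [exact: cdiff_cst|apply: cdiff_pow; exact: nm_neq0].
  apply: (@cdiffM _ id); first exact: cdiff_id.
  apply: (@cdiffV _ (fun z => z - z0)).
    by apply: (@cdiffB _ id (fun=> z0)); [exact: cdiff_id|exact: cdiff_cst].
  by rewrite subr_eq0; apply/eqP => h; move: hz0; rewrite -h hz ltxx.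
have con_k k : con 0 tpi (fun y => z0 ^+ k * (f (zt y) * zt y ^- k) + (- f z0 * z0 ^+ k) * zt y ^- k).
  apply: conD; first by apply: conZ; exact: con_fk.
  apply: conZ; apply: (@con_zt (fun z => z ^- k)) => z hz.
  by apply: cdiff_ccont; apply: cdiff_pow; exact: nm_neq0.
have key n : (n <= K1)%N -> con 0 tpi (fun y => \sum_(k < n) (z0 ^+ k * (f (zt y) * zt y ^- k) + (- f z0 * z0 ^+ k) * zt y ^- k)) /\
   ci (fun y => \sum_(k < n) (z0 ^+ k * (f (zt y) * zt y ^- k) + (- f z0 * z0 ^+ k) * zt y ^- k)) 0 tpi
   = rc tpi * (\sum_(k < n) cf k * z0 ^+ k - f z0 * (n != 0%N)%:R).
  elim: n => [|n IH] hn.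
    have -> : (fun y => \sum_(k < 0) (z0 ^+ k * (f (zt y) * zt y ^- k) + (- f z0 * z0 ^+ k) * zt y ^- k)) = fun=> 0.
      by apply/funext => y; rewrite big_ord0.
    split; first exact: con_cst.
    by rewrite ci_cst ?ltW // mul0r big_ord0 mulr0 subrr mulr0.
  have [|c1 c2] := IH; first by rewrite ltnW.
  have -> : (fun y => \sum_(k < n.+1) (z0 ^+ k * (f (zt y) * zt y ^- k) + (- f z0 * z0 ^+ k) * zt y ^- k)) =
   (fun y => \sum_(k < n) (z0 ^+ k * (f (zt y) * zt y ^- k) + (- f z0 * z0 ^+ k) * zt y ^- k) +
     (z0 ^+ n * (f (zt y) * zt y ^- n) + (- f z0 * z0 ^+ n) * zt y ^- n)).
    by apply/funext => y; rewrite big_ord_recr.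
  split; first exact: conD.
  have cz : con 0 tpi (fun y => zt y ^- n).
    apply: (@con_zt (fun z => z ^- n)) => z hz.
    by apply: cdiff_ccont; apply: cdiff_pow; exact: nm_neq0.
  have cfk := con_fk n.
  rewrite ciD // c2 ciD //; [|exact: conZ|exact: conZ].
  rewrite !ciZ //.
  have tn0 : rc tpi != 0 by rewrite -nm_gt0 nm_rc ger0_norm ?(ltW t0).
  rewrite ci_zt_pow big_ord_recr /= /cf.
  case: n {IH hn c1 c2 cz cfk} => [|n] /=; rewrite ?expr0 ?mulr0 ?mulr1; by field.
have [c1 c2] := key K1 (leqnn _).
have : ci (fun y => \sum_(k < K1) (z0 ^+ k * (f (zt y) * zt y ^- k) + (- f z0 * z0 ^+ k) * zt y ^- k)) 0 tpi + ci rem 0 tpi = 0.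
  apply: (etrans _ (ci_kernel_zero hz0)); rewrite -ciD //; apply: ci_ext => y _.
  have -> : \sum_(k < K1) (z0 ^+ k * (f (zt y) * zt y ^- k) + (- f z0 * z0 ^+ k) * zt y ^- k)
    = (f (zt y) - f z0) * \sum_(k < K1) (z0 / zt y) ^+ k.
    by rewrite mulr_sumr; apply: eq_bigr => k _; rewrite expr_div_n; ring.
  rewrite /rem -mulrDr; congr (_ * _).
  have h1 : 1 - z0 / zt y != 0.
    by rewrite subr_eq0 eq_sym; apply: contra (ztz0 y) => /eqP h; rewrite -(divfK (zt_neq0 y) z0) h mul1r subrr.
  have -> : \sum_(k < K1) (z0 / zt y) ^+ k = (1 - (z0 / zt y) ^+ K1) / (1 - z0 / zt y).
    rewrite -[X in X - _](expr1n _ K1) subrXX mulrAC divff // mul1r.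
    by apply: eq_bigr => k _; rewrite expr1n mul1r.
  have -> : zt y / (zt y - z0) = (1 - z0 / zt y)^-1.
    by field; rewrite zt_neq0 ztz0.
  by rewrite -mulrDl subrK mul1r.
rewrite c2 mulr1 => /eqP; rewrite addr_eq0 => /eqP h.
have tn0 : rc tpi != 0 by rewrite -nm_gt0 nm_rc ger0_norm ?(ltW t0).
have -> : f z0 - \sum_(k < K1) cf k * z0 ^+ k = (rc tpi)^-1 * ci rem 0 tpi.
  by rewrite -[ci rem _ _]opprK -h; field.
rewrite nmM nmV nm_rc ger0_norm ?(ltW t0) // [_^-1 * _]mulrC ler_pdivrMr // -/rho.
have -> : 4 * B * rho ^+ K1 / (1 - rho) * tpi = 2 * (2 * B * (rho ^+ K1 * (1 - rho)^-1)) * (tpi - 0) by field; lra.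
apply: ci_bound => // [|y _]; first exact: ltW.
rewrite /rem nmM; apply: ler_pM; rewrite ?nm_ge0 //.
  apply: le_trans (nm_sub _ _) _.
  have := Bf (z := zt y); have := Bf (z := z0); rewrite nm_zt; case/andP: r_bnd; lra.
rewrite nmM nmX nmM nmV nm_zt -/rho; apply: ler_pM; rewrite ?nm_ge0 ?exprn_ge0 //.
have -> : zt y / (zt y - z0) = (1 - z0 / zt y)^-1.
  by field; rewrite zt_neq0 ztz0.
have low : 1 - rho <= nm (1 - z0 / zt y).
  by have := nm_rev 1 (z0 / zt y); rewrite nm1 nmM nmV nm_zt.
by rewrite nmV lef_pV2 // posrE; lra.
Qed.

Lemma cauchy_taylor : exists c : nat -> C, (forall k, nm (c k) <= 2 * B / r ^+ k) /\
  forall z K, nm z < r ->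
    nm (f z - \sum_(k < K) c k * z ^+ k) <= 4 * B * (nm z / r) ^+ K / (1 - nm z / r).
Proof. by exists cf; split. Qed.

End CauchyTaylor.

(** * Unordered summation *)

Section HasSum.
Context {R : realType}.
Local Notation C := (Cplx R).

(** Convergence along the directed family of finite subsets, given as duplicate-free lists. It
    refers to no enumeration, which makes reindexing easy. *)
Definition has_sum (I : eqType) (f : I -> C) (l : C) : Prop :=
  forall e : R, 0 < e -> exists s0 : seq I, forall s, uniq s -> {subset s0 <= s} ->
    nm (\sum_(i <- s) f i - l) <= e.

Definition abs_bounded (I : eqType) (f : I -> C) (B : R) : Prop :=
  forall s : seq I, uniq s -> \sum_(i <- s) nm (f i) <= B.

Definition exhaustion (I : eqType) (bx : nat -> seq I) : Prop :=
  (forall M, uniq (bx M)) /\ (forall i, exists M0, forall M, (M0 <= M)%N -> i \in bx M).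

Lemma exhaustion_sub (I : eqType) (bx : nat -> seq I) (s : seq I) : exhaustion bx ->
  exists M0, forall M, (M0 <= M)%N -> {subset s <= bx M}.
Proof.
move=> [_ h]; elim: s => [|i s [M0 IH]]; first by exists 0%N.
have [M1 h1] := h i; exists (maxn M0 M1) => M; rewrite geq_max => /andP[m0 m1] j.
by rewrite inE => /predU1P[->|/(IH _ m0)//]; exact: h1.
Qed.

Section OneIndex.
Context {I : eqType}.
Implicit Types (f g : I -> C) (bx : nat -> seq I).

Lemma sum_split_sub (V : zmodType) (f : I -> V) (s t : seq I) : uniq s -> uniq t ->
  {subset s <= t} ->
  \sum_(i <- t) f i = \sum_(i <- s) f i + \sum_(i <- [seq i <- t | i \notin s]) f i.
Proof.
move=> us ut st; rewrite (bigID (fun i => i \in s)) /= big_filter; congr (_ + _).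
rewrite -big_filter; apply: perm_big; apply: uniq_perm => //; first exact: filter_uniq.
move=> i; rewrite mem_filter; have [/st ->//|//] := boolP (i \in s).
Qed.

Lemma abs_bounded_ge0 f B : abs_bounded f B -> 0 <= B.
Proof. by move=> /(_ [::] isT); rewrite big_nil. Qed.

Lemma abs_tail f B bx : exhaustion bx -> abs_bounded f B -> forall e : R, 0 < e ->
  exists M0, forall s, uniq s -> (forall i, i \in s -> i \notin bx M0) ->
    \sum_(i <- s) nm (f i) <= e.
Proof.
move=> hb hB e e0.
pose E := [set x : R | exists2 s : seq I, uniq s & x = \sum_(i <- s) nm (f i)].
have Eub : ubound E B by move=> _ [s us ->]; exact: hB.
have hE : has_sup E by split; [exists 0; exists [::] => //; rewrite big_nil|exists B].
have [_ [s us ->] hs] := sup_adherent e0 hE.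
have [M0 hM] := exhaustion_sub s hb; exists M0 => t ut ht.
have : \sum_(i <- s ++ t) nm (f i) <= sup E.
  apply: ub_le_sup; first by exists B.
  exists (s ++ t) => //; rewrite cat_uniq us ut andbT /=.
  by apply/hasPn => i it; apply: contra (ht i it) => /(hM M0 (leqnn _)).
by rewrite big_cat /=; lra.
Qed.

Lemma has_sum_exists f B bx : exhaustion bx -> abs_bounded f B -> exists l, has_sum f l.
Proof.
move=> hb hB.
have tail := abs_tail hb hB.
have close e : 0 < e -> exists M0, forall s, uniq s -> {subset bx M0 <= s} ->
    nm (\sum_(i <- s) f i - \sum_(i <- bx M0) f i) <= e.
  move=> /tail[M0 hM]; exists M0 => s us sub.
  rewrite (@sum_split_sub _ f (bx M0) s) ?(hb.1 _) // addrC addKr.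
  apply: le_trans (nm_sum _ _ _) _; apply: hM; first exact: filter_uniq.
  by move=> i; rewrite mem_filter => /andP[].
have [l hl] : exists l, clim (fun M => \sum_(i <- bx M) f i) l.
  apply: ccauchy => e e0; have [M0 hM] := close _ (divr_gt0 e0 (ltr0n R 2)).
  have [M1 hM1] := exhaustion_sub (bx M0) hb.
  exists M1 => m n hm hn.
  have := hM _ (hb.1 m) (hM1 m hm); have := hM _ (hb.1 n) (hM1 n hn).
  set a := \sum_(i <- bx m) _; set b := \sum_(i <- bx n) _; set c := \sum_(i <- bx M0) _.
  by have := nm_dist c a b; rewrite (nmB c b); lra.
exists l => e e0; have [M0 hM] := close _ (divr_gt0 e0 (ltr0n R 3)).
have [N hN] := hl _ (divr_gt0 e0 (ltr0n R 3)).
have [M1 hM1] := exhaustion_sub (bx M0) hb.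
exists (bx M0) => s us sub.
have := hM s us sub; have := hN (maxn N M1) (leq_maxl _ _).
have := hM _ (hb.1 (maxn N M1)) (hM1 _ (leq_maxr _ _)).
set a := \sum_(i <- s) _; set b := \sum_(i <- bx M0) _; set c := \sum_(i <- bx _) _.
have := nm_dist b a l; have := nm_dist c b l; rewrite (nmB b c); lra.
Qed.

Lemma has_sum_clim f l bx : exhaustion bx -> has_sum f l ->
  clim (fun M => \sum_(i <- bx M) f i) l.
Proof.
move=> hb hf e /hf[s0 hs]; have [M0 hM] := exhaustion_sub s0 hb.
by exists M0 => M /hM; apply: hs; exact: hb.1.
Qed.

Lemma clim_has_sum f B l bx : exhaustion bx -> abs_bounded f B ->
  clim (fun M => \sum_(i <- bx M) f i) l -> has_sum f l.
Proof.
move=> hb hB hl; have [l' hl'] := has_sum_exists hb hB.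
by rewrite (clim_uniq hl (has_sum_clim hb hl')).
Qed.

Lemma has_sum_uniq f l l' bx : exhaustion bx -> has_sum f l -> has_sum f l' -> l = l'.
Proof. by move=> hb h h'; exact: clim_uniq (has_sum_clim hb h) (has_sum_clim hb h'). Qed.

(** Bridge to the summation of the statement: it amounts to absolute boundedness together with
    unordered summation, neither of which mentions the exhaustion. *)
Lemma has_abs_sumP f l bx : exhaustion bx ->
  has_abs_sum bx f l <-> (exists B, abs_bounded f B) /\ has_sum f l.
Proof.
move=> hb; split.
  move=> [[Bc hBc] /climP hl].
  have hB : abs_bounded f (complex.Re Bc).
    move=> s us; have [M0 hM] := exhaustion_sub s hb.
    have : \sum_(i <- bx M0) nm (f i) <= complex.Re Bc.
      have := hBc M0; rewrite (eq_bigr (fun i => rc (nm (f i)))); last by move=> i _; exact: normC_nm.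
      by rewrite -rc_sum => /cle_real[d hd ->].
    apply: le_trans.
    rewrite (@sum_split_sub _ (fun i => nm (f i)) s (bx M0)) ?(hb.1 _) //; last exact: hM.
    by rewrite lerDl; apply: sumr_ge0 => i _; exact: nm_ge0.
  by split; [exists (complex.Re Bc)|exact: clim_has_sum hb hB hl].
move=> [[B hB] hl]; split.
  exists (rc B) => M; rewrite (eq_bigr (fun i => rc (nm (f i)))); last by move=> i _; exact: normC_nm.
  by rewrite -rc_sum rc_le; apply: hB; exact: hb.1.
by apply/climP; exact: has_sum_clim.
Qed.

Lemma has_sum_nm f l B : has_sum f l -> abs_bounded f B -> nm l <= B.
Proof.
move=> hl hB; rewrite -subr_le0; apply: ge0_le_eps => e /hl[s0 hs].
have := hs (undup s0) (undup_uniq _) (fun x => etrans (mem_undup _ _)).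
have := hB (undup s0) (undup_uniq _); have := nm_sum (undup s0) xpredT f.
set a := \sum_(i <- _) f i => h1 h2 h3.
by have := nm_rev l a; rewrite nmB; lra.
Qed.

Lemma eq_has_sum f g l : (forall i, f i = g i) -> has_sum f l -> has_sum g l.
Proof. by move=> h; have -> : g = f by apply/funext. Qed.

Lemma has_sum0 : has_sum (fun _ : I => 0) 0.
Proof. by move=> e e0; exists [::] => s _ _; rewrite big1 // subrr nm0 ltW. Qed.

Lemma has_sumD f g l m : has_sum f l -> has_sum g m -> has_sum (fun i => f i + g i) (l + m).
Proof.
move=> hf hg e e0; have [s1 h1] := hf _ (divr_gt0 e0 (ltr0n R 2)).
have [s2 h2] := hg _ (divr_gt0 e0 (ltr0n R 2)).
exists (s1 ++ s2) => s us sub; rewrite big_split /=.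
have := h1 s us (fun i hi => sub i ltac:(by rewrite mem_cat hi)).
have := h2 s us (fun i hi => sub i ltac:(by rewrite mem_cat hi orbT)).
set a := \sum_(i <- s) f i; set b := \sum_(i <- s) g i.
have -> : a + b - (l + m) = (a - l) + (b - m) by ring.
by have := nmD (a - l) (b - m); lra.
Qed.

Lemma has_sumZ c f l : has_sum f l -> has_sum (fun i => c * f i) (c * l).
Proof.
move=> hf e e0; have c1 : 0 < nm c + 1 by have := nm_ge0 c; lra.
have [s1 h1] := hf _ (divr_gt0 e0 c1); exists s1 => s us sub.
rewrite -mulr_sumr -mulrBr nmM.
apply: (@le_trans _ _ ((nm c + 1) * (e / (nm c + 1)))).
  by apply: ler_pM (h1 s us sub); rewrite ?nm_ge0 // lerDl.
by rewrite mulrC divfK ?gt_eqF.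
Qed.

Lemma has_sumB f g l m : has_sum f l -> has_sum g m -> has_sum (fun i => f i - g i) (l - m).
Proof.
move=> hf /(has_sumZ (-1)) hg; have := has_sumD hf hg; rewrite mulN1r.
by apply: eq_has_sum => i; rewrite mulN1r.
Qed.

Lemma has_sum_sum (J : Type) (r : seq J) (P : pred J) (F : J -> I -> C) (l : J -> C) :
  (forall j, P j -> has_sum (F j) (l j)) ->
  has_sum (fun i => \sum_(j <- r | P j) F j i) (\sum_(j <- r | P j) l j).
Proof.
move=> h; elim: r => [|j r IH].
  by rewrite big_nil; apply: (@eq_has_sum (fun=> 0)) => [i|]; [rewrite big_nil|exact: has_sum0].
rewrite big_cons; case: ifP => Pj; last first.
  by apply: eq_has_sum IH => i; rewrite big_cons Pj.
by apply: eq_has_sum (has_sumD (h j Pj) IH) => i; rewrite big_cons Pj.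
Qed.

Lemma abs_bounded_le f (b : I -> R) B : (forall i, nm (f i) <= b i) ->
  (forall s, uniq s -> \sum_(i <- s) b i <= B) -> abs_bounded f B.
Proof. by move=> h hb s us; apply: le_trans (hb s us); exact: ler_sum. Qed.

Lemma abs_boundedD f g B B' : abs_bounded f B -> abs_bounded g B' ->
  abs_bounded (fun i => f i + g i) (B + B').
Proof.
move=> hf hg s us; apply: le_trans (lerD (hf s us) (hg s us)).
by rewrite -big_split; apply: ler_sum => i _; exact: nmD.
Qed.

Lemma abs_boundedZ c f B : abs_bounded f B -> abs_bounded (fun i => c * f i) (nm c * B).
Proof.
move=> hf s us; rewrite (eq_bigr (fun i => nm c * nm (f i))); last by move=> i _; rewrite nmM.
by rewrite -mulr_sumr ler_wpM2l ?nm_ge0 ?hf.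
Qed.

End OneIndex.

Section Reindex.
Context {I J : eqType} (phi : J -> I).
Hypothesis phi_inj : injective phi.

Lemma preim_seq (s : seq I) : uniq s -> exists t : seq J, [/\ uniq t,
  (forall j, (j \in t) = (phi j \in s)) &
  forall (V : zmodType) (f : I -> V), (forall i, (forall j, phi j <> i) -> f i = 0) ->
    \sum_(i <- s) f i = \sum_(j <- t) f (phi j)].
Proof.
elim: s => [|i s IH] /=; first by exists [::]; split => // V f _; rewrite !big_nil.
move=> /andP[nis us]; have [t [ut ht hs]] := IH us.
have [[j ji]|nj] := pselect (exists j, phi j = i).
  exists (j :: t); split.
  - by rewrite /= ut ht ji nis.
  - by move=> j'; rewrite !inE ht -ji (inj_eq phi_inj).
  - by move=> V f hf; rewrite !big_cons hs // ji.
exists t; split => //.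
  move=> j; rewrite inE ht; case: eqP => // h; exfalso; apply: nj; by exists j.
move=> V f hf; rewrite big_cons hs // hf ?add0r // => j h; apply: nj; by exists j.
Qed.

Lemma has_sum_reindex (f : I -> C) l : (forall i, (forall j, phi j <> i) -> f i = 0) ->
  has_sum f l <-> has_sum (f \o phi) l.
Proof.
move=> hf; split=> h e /h[s0 h0].
  have [t0 [_ ht0 _]] := preim_seq (undup_uniq s0).
  exists t0 => t ut sub.
  pose s := map phi t ++ [seq i <- undup s0 | i \notin map phi t].
  have us : uniq s.
    rewrite cat_uniq map_inj_uniq // ut filter_uniq ?undup_uniq // andbT.
    by apply/hasPn => i; rewrite mem_filter => /andP[].
  have ss : {subset s0 <= s}.
    move=> i hi; rewrite mem_cat mem_filter mem_undup hi andbT.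
    by case: (i \in map phi t).
  have := h0 s us ss; rewrite big_cat big_map /= [X in _ + X - _]big1_seq ?addr0 //.
  move=> i /=; rewrite mem_filter mem_undup => /andP[it is0].
  apply: hf => j ji; move/negP: it; apply; rewrite -ji map_f //.
  by apply: sub; rewrite ht0 mem_undup ji.
exists (map phi s0) => s us sub.
have [t [ut ht hs]] := preim_seq us; rewrite hs //; apply: h0 => // j hj.
by rewrite ht; apply: sub; exact: map_f.
Qed.

Lemma abs_bounded_reindex (f : I -> C) B : (forall i, (forall j, phi j <> i) -> f i = 0) ->
  abs_bounded (f \o phi) B -> abs_bounded f B.
Proof.
move=> hf hB s us; have [t [ut ht hs]] := preim_seq us.
by rewrite (hs _ (fun i => nm (f i))) ?hB // => i hi; rewrite hf ?nm0.
Qed.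

Lemma abs_bounded_comp (f : I -> C) B : abs_bounded f B -> abs_bounded (f \o phi) B.
Proof.
move=> hB t ut; have := hB (map phi t); rewrite big_map; apply.
by rewrite map_inj_uniq.
Qed.

End Reindex.
End HasSum.

(** * Exhaustions by boxes, sums of products, sums over fibres *)

Section Boxes.
Context {R : realType}.
Local Notation C := (Cplx R).

Definition nat_box (I : finType) (M : nat) : seq {ffun I -> nat} :=
  [seq [ffun i => val (e i)] | e : {ffun I -> 'I_M}].

Lemma nat_box_uniq (I : finType) M : uniq (nat_box I M).
Proof.
rewrite map_inj_uniq ?enum_uniq // => e e' /ffunP h.
by apply/ffunP => i; apply/val_inj; have := h i; rewrite !ffunE.
Qed.

Lemma mem_nat_box (I : finType) M (e : {ffun I -> nat}) : (forall i, (e i < M)%N) -> e \in nat_box I M.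
Proof.
move=> h; apply/mapP; exists [ffun i => Ordinal (h i)]; first exact: mem_enum.
by apply/ffunP => i; rewrite !ffunE.
Qed.

Lemma ffun_bounded (I : finType) (e : I -> nat) : exists M, forall i, (e i < M)%N.
Proof. by exists (\max_i e i).+1 => i; rewrite ltnS leq_bigmax. Qed.

Lemma nat_box_exhaustion (I : finType) : exhaustion (nat_box I).
Proof.
split; first exact: nat_box_uniq.
move=> e; have [M hM] := ffun_bounded e; exists M => M' hM'.
by apply: mem_nat_box => i; exact: leq_trans (hM i) hM'.
Qed.

Lemma iota_exhaustion : exhaustion (iota 0).
Proof.
split; first by move=> M; exact: iota_uniq.
by move=> i; exists i.+1 => M h; rewrite mem_iota.
Qed.

Lemma int_interval_exhaustion : exhaustion int_interval.
Proof.
split=> [M|i]; first by rewrite map_inj_uniq ?iota_uniq // => a b; lia.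
exists (absz i) => M hM; apply/mapP; exists (absz (i + M%:Z)); last by lia.
by rewrite mem_iota; lia.
Qed.

Lemma int_box_exhaustion k : exhaustion (int_box k).
Proof.
split=> [M|e].
  rewrite map_inj_uniq ?enum_uniq // => a b /ffunP h; apply/ffunP => j; apply/val_inj.
  by have := h j; rewrite !ffunE /=; lia.
have [M0 hM0] := ffun_bounded (fun i => absz (e i)); exists M0 => M hM.
have hj j : (absz (e j + M%:Z)%R < M.*2.+1)%N by have := hM0 j; lia.
apply/mapP; exists [ffun j => Ordinal (hj j)]; first exact: mem_enum.
apply/ffunP => j; rewrite !ffunE /=; have := hM0 j; move: (e j) hM => x hM hx.
by rewrite gez0_abs; lia.
Qed.

(** A finite family lies in a box, where the sum of the products is the product of the sums. *)
Lemma sum_prod_bound (I : finType) (b : I -> nat -> R) (S : I -> R) :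
  (forall i m, 0 <= b i m) -> (forall i M, \sum_(m < M) b i m <= S i) ->
  forall s : seq {ffun I -> nat}, uniq s -> \sum_(e <- s) \prod_i b i (e i) <= \prod_i S i.
Proof.
move=> b0 bS s us.
have [M0 hM] := exhaustion_sub s (nat_box_exhaustion I).
have p0 e : 0 <= \prod_i b i (e i) by apply: prodr_ge0 => i _.
apply: (@le_trans _ _ (\sum_(e <- nat_box I M0) \prod_i b i (e i))).
  rewrite (@sum_split_sub _ _ (fun e : {ffun I -> nat} => \prod_i b i (e i)) s (nat_box I M0)) ?nat_box_uniq //.
    by rewrite lerDl; apply: sumr_ge0.
  exact: hM.
rewrite big_map big_enum /=.
under eq_bigr do under eq_bigr do rewrite ffunE.
rewrite -(bigA_distr_bigA (fun i (m : 'I_M0) => b i m)) /=.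
by apply: ler_prod => i _; rewrite bS andbT; apply: sumr_ge0.
Qed.

Lemma geom_sum_bound (q : R) M : 0 <= q < 1 -> \sum_(m < M) q ^+ m <= (1 - q)^-1.
Proof.
move=> /andP[q0 q1]; rewrite -[leRHS]mul1r ler_pdivlMr ?subr_gt0 //.
have -> : (\sum_(m < M) q ^+ m) * (1 - q) = 1 - q ^+ M.
  rewrite -[1 in RHS](expr1n _ M) subrXX mulrC; congr (_ * _).
  by apply: eq_bigr => i _; rewrite expr1n mul1r.
by rewrite gerBl exprn_ge0.
Qed.

Lemma inv_sq_sum_bound M : \sum_(m < M) (m.+1%:R ^- 2 : R) <= 2.
Proof.
(* The correction term telescopes against the next summand, so that the induction closes. *)
suff h : \sum_(m < M.+1) (m.+1%:R ^- 2 : R) <= 2 - M.+1%:R^-1.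
  apply: le_trans (le_trans h _); last by rewrite gerBl invr_ge0.
  by rewrite big_ord_recr /= lerDl invr_ge0 exprn_ge0.
elim: M => [|M IH]; first by rewrite big_ord_recr big_ord0 /= expr1n invr1; lra.
rewrite big_ord_recr /=; apply: le_trans (lerD IH (lexx _)) _.
have a0 : 0 < M.+1%:R :> R by [].
have -> : M.+2%:R = M.+1%:R + 1 :> R by rewrite -natr1.
move: (M.+1%:R : R) a0 => a a0.
have -> : 2 - a^-1 + (a + 1) ^- 2 = 2 - (a + 1)^-1 - (a * (a + 1) ^+ 2)^-1.
  by field; lra.
by rewrite gerBl invr_ge0 mulr_ge0 ?sqr_ge0 // ltW.
Qed.

Lemma sum_flatten_fibers (I J : eqType) (pr : I -> J) (s : J -> seq I) (t : seq J) :
  uniq t -> (forall j, uniq (s j)) -> (forall j i, i \in s j -> pr i = j) ->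
  uniq (flatten [seq s j | j <- t]).
Proof.
move=> ut us hpr; elim: t ut => [|j t IH] //= /andP[njt ut].
rewrite cat_uniq us IH // andbT; apply/hasPn => i /flatten_mapP[j' j't ij'].
by apply/negP => ij; move: njt; rewrite -(hpr _ _ ij) (hpr _ _ ij') j't.
Qed.

(** Half of Fubini's theorem, the sums over the fibres of [pr] being given. For finitely many fibres
    the tolerance e / 2 is shared equally, and each fibre list is enlarged to contain its part of
    [s0]. *)
Lemma has_sum_fiber (I J : eqType) (pr : I -> J) (F : I -> C) (G : J -> C) l :
  has_sum F l -> (forall j, has_sum (fun i => if pr i == j then F i else 0) (G j)) ->
  has_sum G l.
Proof.
move=> hF hG e e0; have [s0 h0] := hF _ (divr_gt0 e0 (ltr0n R 2)).
exists (map pr s0) => t ut sub.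
pose N : R := (size t).+1%:R.
have N0 : 0 < N by [].
have [sj hsj] := choice (fun j => hG j _ (divr_gt0 (divr_gt0 e0 (ltr0n R 2)) N0)).
pose s j := undup [seq i <- s0 ++ sj j | pr i == j].
have s_pr j i : i \in s j -> pr i = j by rewrite mem_undup mem_filter => /andP[/eqP].
have uS := sum_flatten_fibers ut (fun j => undup_uniq _ : uniq (s j)) s_pr.
have sS : {subset s0 <= flatten [seq s j | j <- t]}.
  move=> i hi; apply/flatten_mapP; exists (pr i); first by apply: sub; exact: map_f.
  by rewrite mem_undup mem_filter eqxx mem_cat hi.
have := h0 _ uS sS; rewrite big_flatten big_map => h1.
have h2 j : nm (\sum_(i <- s j) F i - G j) <= e / 2 / N.
  pose s' := undup (s0 ++ sj j).
  have sub' : {subset sj j <= s'} by move=> i hi; rewrite mem_undup mem_cat hi orbT.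
  have := hsj j s' (undup_uniq _) sub'.
  rewrite -big_mkcond -big_filter.
  suff -> : [seq i <- s' | pr i == j] = s j by [].
  by rewrite /s' /s filter_undup.
have h3 : nm (\sum_(j <- t) \sum_(i <- s j) F i - \sum_(j <- t) G j) <= e / 2.
  rewrite -sumrB; apply: le_trans (nm_sum _ _ _) _.
  apply: (@le_trans _ _ (\sum_(j <- t) e / 2 / N)); first by apply: ler_sum.
  rewrite big_const_seq count_predT iter_addr addr0 -[_ *+ _]mulr_natr mulrAC ler_pdivrMr //.
  by rewrite ler_wpM2l ?divr_ge0 ?(ltW e0) // /N ler_nat.
move: h1 h3; set a := \big[_/_]_(j <- t) _; set b := \sum_(j <- t) G j => h1 h3.
by have := nm_dist a b l; rewrite (nmB b a); lra.
Qed.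

End Boxes.

(** * Several complex variables *)

Section LinearForm.
Context {K : comNzRingType} {n : nat}.

Definition linform (l : 'I_n -> K) (h : 'rV[K]_n) : K := \sum_j l j * h 0 j.

Lemma linform_linear l : linear (linform l : _ -> K^o).
Proof.
move=> a u v; rewrite /linform /GRing.scale /= mulr_sumr -big_split; apply: eq_bigr => j _.
by rewrite !mxE mulrDr; congr (_ + _); rewrite mulrCA.
Qed.

HB.instance Definition _ l := GRing.isLinear.Build _ _ _ _ (linform l : _ -> K^o) (linform_linear l).

End LinearForm.

Lemma differentiable_of_eps (K : numFieldType) (V W : normedModType K)
    (f : V -> W) (df : {linear V -> W}) (s : V) : continuous df ->
  (forall e, 0 < e -> \forall k \near (0 : V), `|f (s + k) - f s - df k| <= e * `|k|) ->
  differentiable f s.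
Proof.
move=> cdf h.
have dfE : f \o shift s = cst (f s) + df +o_ 0 id.
  apply/eqaddoP => e /h; apply: filterS => k; apply: le_trans.
  rewrite (_ : (_ - _) k = f (s + k) - (f s + df k)); last by rewrite (addrC s).
  by rewrite opprD addrA.
have dE := diff_unique cdf dfE.
by apply/diff_locallyP; split; rewrite dE.
Qed.

(** * The real-valued norm on C^n and complex differentials *)

Section RowNorm.
Context {R : realType} {n : nat}.
Local Notation C := (Cplx R).
Local Notation Cn := 'rV[C]_n.
Implicit Types (u v s : Cn) (f g : Cn -> C).

Definition vn v : R := complex.Re `|v|.

Lemma normv_vn v : `|v| = rc (vn v).
Proof.
have := normr_ge0 v; rewrite /vn; case: `|v| => a b; rewrite lecE /= => /andP[/eqP -> _].
by [].
Qed.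

Lemma vn_ge0 v : 0 <= vn v.
Proof. by rewrite -rc_le -normv_vn rc0. Qed.

Lemma vn0 : vn 0 = 0. Proof. by rewrite /vn normr0. Qed.
Lemma vnB u v : vn (u - v) = vn (v - u). Proof. by rewrite /vn distrC. Qed.
Lemma vnD u v : vn (u + v) <= vn u + vn v.
Proof. by rewrite -rc_le rcD -!normv_vn ler_normD. Qed.
Lemma vnZ c v : vn (c *: v) = nm c * vn v.
Proof. by apply: rc_inj; rewrite rcM -normC_nm -!normv_vn normrZ. Qed.
Lemma vn_dist v u w : vn (u - w) <= vn (u - v) + vn (v - w).
Proof. by apply: le_trans (vnD _ _); rewrite addrA subrK. Qed.

Lemma vn_lt v (x : R) : 0 < x -> (vn v < x) <-> (forall j, nm (v 0 j) < x).
Proof.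
move=> x0; rewrite -rc_lt -normv_vn.
have -> : (`|v| < rc x) <-> ball (0 : Cn) (rc x) v.
  by rewrite -ball_normE /ball_ /= sub0r normrN.
split=> [[_ h] j|h].
  by have := h 0 j; rewrite mxE -ball_normE /ball_ /= sub0r normrN normC_nm rc_lt.
split=> [|i j]; first by rewrite -rc0 rc_lt.
by rewrite (ord1 i) mxE -ball_normE /ball_ /= sub0r normrN normC_nm rc_lt.
Qed.

Lemma vn_coord v j : nm (v 0 j) <= vn v.
Proof.
rewrite leNgt; apply/negP => h.
have h0 : 0 < nm (v 0 j) by apply: le_lt_trans h; exact: vn_ge0.
by have := (vn_lt v h0).1 h j; rewrite ltxx.
Qed.

Lemma vn_le v (x : R) : 0 <= x -> (forall j, nm (v 0 j) <= x) -> vn v <= x.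
Proof.
move=> x0 h; rewrite leNgt; apply/negP => hx.
have h0 : 0 < vn v by apply: le_lt_trans hx.
have : vn v < vn v by rewrite vn_lt // => j; exact: le_lt_trans (h j) hx.
by rewrite ltxx.
Qed.

Lemma near_vnP (s : Cn) (P : Cn -> Prop) :
  (\forall x \near s, P x) <-> exists2 d : R, 0 < d & forall x, vn (x - s) < d -> P x.
Proof.
split.
  move=> /nbhs_ballP[e /= /cgt0P[d d0 ->] h]; exists d => // x hx; apply: h.
  by rewrite -ball_normE /ball_ /= distrC normv_vn rc_lt.
move=> [d d0 h]; apply/nbhs_ballP; exists (rc d); first by rewrite /= -rc0 rc_lt.
by move=> x; rewrite -ball_normE /ball_ /= distrC normv_vn rc_lt => /h.
Qed.

Definition hderiv f s (l : 'I_n -> C) := forall e : R, 0 < e -> exists2 d : R, 0 < d &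
  forall h, vn h < d -> nm (f (s + h) - f s - linform l h) <= e * vn h.

Definition hdiff f s := exists l, hderiv f s l.

Lemma nm_linform l (h : Cn) : nm (linform l h) <= (\sum_j nm (l j)) * vn h.
Proof.
apply: le_trans (nm_sum _ _ _) _; rewrite mulr_suml; apply: ler_sum => j _.
by rewrite nmM ler_wpM2l ?nm_ge0 ?vn_coord.
Qed.

Lemma sum_nm_ge0 (l : 'I_n -> C) : 0 <= \sum_j nm (l j).
Proof. by apply: sumr_ge0 => j _; exact: nm_ge0. Qed.

Lemma linform_continuous (l : 'I_n -> C) : continuous (linform l : Cn -> C^o).
Proof.
move=> s; apply/(@cvgrPdist_le C C^o Cn (nbhs s) _) => e /cgt0P[d d0 ->]; apply/near_vnP.
have := sum_nm_ge0 l; set S := \sum_j _ => S0.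
have S1 : 0 < S + 1 by lra.
exists (d / (S + 1)); first by rewrite divr_gt0.
move=> x; rewrite ltr_pdivlMr // => hx.
rewrite -(linearB (linform l : {linear Cn -> C^o})) normC_nm rc_le.
apply: le_trans (nm_linform _ _) _; rewrite vnB -/S.
by have := vn_ge0 (x - s); lra.
Qed.

(** Bridge between [differentiable], used in the statement, and the explicit form, in which the
    differential is a vector of coefficients. *)
Lemma hdiffP f s : differentiable f s <-> hdiff f s.
Proof.
split.
  move=> /diff_locallyP[_ /eqaddoP h].
  exists (fun j => 'd f s (delta_mx 0 j)) => e e0.
  have e0' : 0 < rc e by rewrite -rc0 rc_lt.
  have /near_vnP[d d0 hd] := h _ e0'.
  exists d => // k hk; have := hd k; rewrite subr0 => /(_ hk).
  rewrite /= normC_nm normv_vn -rcM rc_le.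
  rewrite (_ : (_ - _) k = f (s + k) - (f s + 'd f s k)); last by rewrite (addrC s).
  have -> : linform (fun j => 'd f s (delta_mx 0 j)) k = 'd f s k.
    rewrite [k in RHS]row_sum_delta linear_sum /linform; apply: eq_bigr => j _.
    by rewrite linearZ /= mulrC.
  by rewrite opprD addrA.
move=> [l hl].
apply: (differentiable_of_eps (df := linform l : {linear Cn -> C^o})).
  exact: linform_continuous.
move=> e /cgt0P[d d0 ->]; apply/near_vnP.
have [d' d'0 hd'] := hl d d0; exists d' => // k; rewrite subr0 => /hd'.
by rewrite /= normC_nm normv_vn -rcM rc_le.
Qed.

End RowNorm.

(** * Rules of differentiation and Weierstrass's convergence theorem *)

Section Hdiff.
Context {R : realType} {n : nat}.
Local Notation C := (Cplx R).
Local Notation Cn := 'rV[C]_n.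
Implicit Types (u v s : Cn) (f g : Cn -> C).

Lemma linformD l m (h : Cn) : linform (fun j => l j + m j) h = linform l h + linform m h.
Proof. by rewrite /linform -big_split; apply: eq_bigr => j _; rewrite mulrDl. Qed.
Lemma linformZ c l (h : Cn) : linform (fun j => c * l j) h = c * linform l h.
Proof. by rewrite /linform mulr_sumr; apply: eq_bigr => j _; rewrite mulrA. Qed.
Lemma linform0 (h : Cn) : linform (fun=> 0) h = 0.
Proof. by rewrite /linform big1 // => j _; rewrite mul0r. Qed.
Lemma linform_scale l c (h : Cn) : linform l (c *: h) = c * linform l h.
Proof. by rewrite /linform mulr_sumr; apply: eq_bigr => j _; rewrite mxE mulrCA. Qed.

Lemma hdiff_cont f s : hdiff f s -> forall e : R, 0 < e -> exists2 d : R, 0 < d &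
  forall h, vn h < d -> nm (f (s + h) - f s) <= e.
Proof.
move=> [l hl] e e0; have [d d0 hd] := hl 1 ltr01.
have := sum_nm_ge0 l; set S := \sum_j _ => S0; have k0 : 0 < S + 1 by lra.
exists (Num.min d (e / (S + 1))); first by rewrite lt_min d0 divr_gt0.
move=> h; rewrite lt_min => /andP[/hd h1]; rewrite ltr_pdivlMr // => h2.
have := nmD (f (s + h) - f s - linform l h) (linform l h); rewrite subrK => h3.
have := nm_linform l h; rewrite -/S => h4.
by have := vn_ge0 h; lra.
Qed.

Lemma hderiv_ext f g s l (d : R) : 0 < d ->
  (forall h, vn h < d -> f (s + h) = g (s + h)) -> hderiv f s l -> hderiv g s l.
Proof.
move=> d0 fg hf e /hf[d' d'0 hd']; exists (Num.min d d'); first by rewrite lt_min d0.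
move=> h; rewrite lt_min => /andP[h1 h2]; rewrite -fg //.
by have := fg 0; rewrite vn0 addr0 => <- //; exact: hd'.
Qed.

Lemma hdiff_ext f g s (d : R) : 0 < d ->
  (forall x, vn (x - s) < d -> f x = g x) -> hdiff f s -> hdiff g s.
Proof.
move=> d0 fg [l hl]; exists l; apply: hderiv_ext d0 _ hl => h hh.
by apply: fg; rewrite addrC addKr.
Qed.

Lemma hderiv_cst c s : hderiv (fun=> c) s (fun=> 0).
Proof.
move=> e e0; exists 1 => // h _; rewrite linform0 !subrr nm0 mulr_ge0 ?vn_ge0 //.
exact: ltW.
Qed.

Lemma hderiv_linform l s : hderiv (linform l) s l.
Proof.
move=> e e0; exists 1 => // h _.
have -> : linform l (s + h) - linform l s - linform l h = 0.
  rewrite (linearD (linform l : {linear Cn -> C^o})); ring.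
by rewrite nm0; apply: mulr_ge0; [exact: ltW|exact: vn_ge0].
Qed.

Lemma hderivD f g s l m : hderiv f s l -> hderiv g s m ->
  hderiv (fun z => f z + g z) s (fun j => l j + m j).
Proof.
move=> hf hg e e0; have [d d0 hd] := hf _ (divr_gt0 e0 (ltr0n R 2)).
have [d' d'0 hd'] := hg _ (divr_gt0 e0 (ltr0n R 2)).
exists (Num.min d d'); first by rewrite lt_min d0.
move=> h; rewrite lt_min linformD => /andP[/hd h1 /hd' h2].
have -> : f (s + h) + g (s + h) - (f s + g s) - (linform l h + linform m h) =
  (f (s + h) - f s - linform l h) + (g (s + h) - g s - linform m h) by ring.
by have := nmD (f (s + h) - f s - linform l h) (g (s + h) - g s - linform m h); lra.
Qed.

Lemma hderiv_comp f (g : C -> C) s l m : hderiv f s l -> cderiv g (f s) m ->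
  hderiv (fun z => g (f z)) s (fun j => m * l j).
Proof.
move=> hf hg e e0.
have m0 := nm_ge0 m; have := sum_nm_ge0 l; set S := \sum_j _ => l0.
pose a := S + 1; pose b := nm m + 1.
have a0 : 0 < a by rewrite /a; lra.
have b0 : 0 < b by rewrite /b; lra.
have [d1 d10 h1] := hg _ (divr_gt0 (divr_gt0 e0 (ltr0n R 2)) a0).
have [d2 d20 h2] := hf _ (divr_gt0 (divr_gt0 e0 (ltr0n R 2)) b0).
have [d3 d30 h3] := hf _ ltr01.
exists (Num.min (Num.min d2 d3) (d1 / a)); first by rewrite !lt_min d20 d30 divr_gt0.
move=> h; rewrite !lt_min => /andP[/andP[k2 k3]]; rewrite ltr_pdivlMr // => k1.
pose k := f (s + h) - f s.
have hk : nm k <= vn h * a.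
  have := nmD (k - linform l h) (linform l h); rewrite subrK.
  have := nm_linform l h; rewrite -/S.
  by have := h3 h k3; rewrite -/k /a; lra.
have := h1 k (le_lt_trans hk k1); rewrite /k subrKC -/k => k4.
have -> : g (f (s + h)) - g (f s) - linform (fun j => m * l j) h =
  (g (f (s + h)) - g (f s) - m * k) + m * (f (s + h) - f s - linform l h).
  by rewrite linformZ /k /=; ring.
apply: le_trans (nmD _ _) _; rewrite nmM.
have e1 : e / 2 / a * nm k <= e / 2 / a * (vn h * a).
  by rewrite ler_wpM2l // !divr_ge0 // ltW.
have e2 : nm m * nm (f (s + h) - f s - linform l h) <= b * (e / 2 / b * vn h).
  by apply: ler_pM; rewrite ?nm_ge0 ?h2 // /b lerDl.
apply: le_trans (lerD (le_trans k4 e1) e2) _.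
rewrite le_eqVlt; apply/orP; left; apply/eqP; field.
by rewrite !gt_eqF.
Qed.

Lemma hdiff_cst c s : hdiff (fun=> c) s.
Proof. by exists (fun=> 0); exact: hderiv_cst. Qed.
Lemma hdiff_linform l s : hdiff (linform l) s.
Proof. by exists l; exact: hderiv_linform. Qed.
Lemma hdiff_coord j s : hdiff (fun s : Cn => s 0 j) s.
Proof.
have -> : (fun s : Cn => s 0 j) = linform (fun i => (i == j)%:R).
  apply/funext => z; rewrite /linform (bigD1 j) //= eqxx mul1r big1 ?addr0 // => i /negPf->.
  by rewrite mul0r.
exact: hdiff_linform.
Qed.
Lemma hdiffD f g s : hdiff f s -> hdiff g s -> hdiff (fun z => f z + g z) s.
Proof. by move=> [l hl] [m hm]; exists (fun j => l j + m j); exact: hderivD. Qed.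
Lemma hdiff_comp f (g : C -> C) s : hdiff f s -> cdiff g (f s) -> hdiff (fun z => g (f z)) s.
Proof. by move=> [l hl] [m hm]; exists (fun j => m * l j); exact: hderiv_comp. Qed.
Lemma hdiffZ c f s : hdiff f s -> hdiff (fun z => c * f z) s.
Proof.
move=> hf; apply: (@hdiff_comp f (fun z => c * z)) => //.
by apply: (@cdiffM _ (fun=> c) id); [exact: cdiff_cst|exact: cdiff_id].
Qed.
Lemma hdiffV f s : hdiff f s -> f s != 0 -> hdiff (fun z => (f z)^-1) s.
Proof.
move=> hf fs; apply: (@hdiff_comp f (fun z => z^-1)) => //.
by apply: (@cdiffV _ id); [exact: cdiff_id|].
Qed.
Lemma hdiffB f g s : hdiff f s -> hdiff g s -> hdiff (fun z => f z - g z) s.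
Proof.
move=> hf /(hdiffZ (-1)) hg.
rewrite (_ : (fun z => _) = fun z => f z + -1 * g z); first exact: hdiffD.
by apply/funext => z; rewrite mulN1r.
Qed.
(* Polarisation reduces products to squares. *)
Lemma hdiffM f g s : hdiff f s -> hdiff g s -> hdiff (fun z => f z * g z) s.
Proof.
move=> hf hg.
have sq k : hdiff k s -> hdiff (fun z => k z * k z) s.
  move=> hk; apply: (@hdiff_comp k (fun z => z * z)) => //.
  by apply: (@cdiffM _ id id); exact: cdiff_id.
have := hdiffZ (2^-1) (hdiffB (hdiffB (sq _ (hdiffD hf hg)) (sq _ hf)) (sq _ hg)).
rewrite (_ : (fun z => _) = fun z => f z * g z) //.
by apply/funext => z; field.
Qed.
Lemma hdiff_sum (I : Type) (r : seq I) (P : pred I) (F : I -> Cn -> C) s :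
  (forall i, P i -> hdiff (F i) s) -> hdiff (fun z => \sum_(i <- r | P i) F i z) s.
Proof.
move=> h; elim: r => [|i r IH].
  rewrite (_ : (fun z => _) = fun=> 0); first exact: hdiff_cst.
  by apply/funext => z; rewrite big_nil.
have [Pi|nPi] := boolP (P i); last first.
  by rewrite (_ : (fun z => _) = fun z => \sum_(i <- r | P i) F i z) //;
     apply/funext => z; rewrite big_cons (negPf nPi).
rewrite (_ : (fun z => _) = fun z => F i z + \sum_(i <- r | P i) F i z).
  by apply: hdiffD => //; exact: h.
by apply/funext => z; rewrite big_cons Pi.
Qed.
Lemma hdiff_prod (I : eqType) (r : seq I) (P : pred I) (F : I -> Cn -> C) s :
  (forall i, i \in r -> P i -> hdiff (F i) s) -> hdiff (fun z => \prod_(i <- r | P i) F i z) s.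
Proof.
elim: r => [|i r IH] h.
  rewrite (_ : (fun z => _) = fun=> 1); first exact: hdiff_cst.
  by apply/funext => z; rewrite big_nil.
have IHr := IH (fun j jr => h j (mem_behead (s := i :: r) jr)).
have [Pi|nPi] := boolP (P i); last first.
  by rewrite (_ : (fun z => _) = fun z => \prod_(i <- r | P i) F i z) //;
     apply/funext => z; rewrite big_cons (negPf nPi).
rewrite (_ : (fun z => _) = fun z => F i z * \prod_(i <- r | P i) F i z).
  by apply: hdiffM => //; apply: h; rewrite ?mem_head.
by apply/funext => z; rewrite big_cons Pi.
Qed.

Lemma hdiff_line f s v t : hdiff f (s + t *: v) -> cdiff (fun t => f (s + t *: v)) t.
Proof.
move=> [l hl]; exists (linform l v) => e e0.
have v1 : 0 < vn v + 1 by have := vn_ge0 v; lra.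
have [d d0 hd] := hl _ (divr_gt0 e0 v1).
exists (d / (vn v + 1)); first by rewrite divr_gt0.
move=> h; rewrite ltr_pdivlMr // => hh.
have hv : vn (h *: v) <= nm h * (vn v + 1).
  by rewrite vnZ ler_wpM2l ?nm_ge0 // lerDl.
have := hd (h *: v) (le_lt_trans hv hh).
rewrite scalerDl addrA linform_scale [h * _]mulrC => k; apply: le_trans k _.
apply: (@le_trans _ _ (e / (vn v + 1) * (nm h * (vn v + 1)))).
  by rewrite ler_wpM2l // divr_ge0 // ltW.
by rewrite mulrCA mulrC divfK // gt_eqF.
Qed.

Definition hol (p : Cn) (rho : R) f := forall s, vn (s - p) < rho -> hdiff f s.

(** A second-order estimate that depends on [f] only through its bound [B]: the Taylor formula of
    order 2 and radius [eta / 2] on the complex line through [s] in the direction of [h]. For steps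
    up to half that radius the geometric tail costs a factor 2, whence 32 = 4 * 4 * 2. *)
Lemma cauchy_quadratic f s l (eta B : R) : 0 < eta ->
  (forall x, vn (x - s) < eta -> hdiff f x) ->
  (forall x, vn (x - s) < eta -> nm (f x) <= B) ->
  hderiv f s l -> forall h, vn h <= eta / 4 ->
  nm (f (s + h) - f s - linform l h) <= 32 * B / eta ^+ 2 * vn h ^+ 2.
Proof.
move=> eta0 df Bf hl h hh.
have [h0|h0] := eqVneq (vn h) 0.
  have -> : h = 0.
    apply/eqP; rewrite -normr_eq0 normv_vn h0 rc0; exact: eqxx.
  have -> : linform l 0 = 0.
    by rewrite -[X in linform l X](scale0r (0 : Cn)) linform_scale mul0r.
  by rewrite addr0 !subrr nm0 vn0 expr0n mulr0.
have hp : 0 < vn h by rewrite lt_def h0 vn_ge0.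
pose v := rc (vn h)^-1 *: h.
have vv : vn v = 1 by rewrite vnZ nm_rc ger0_norm ?invr_ge0 ?ltW // mulVf.
have hv : h = rc (vn h) *: v by rewrite scalerA -rcM divff // scale1r.
pose phi t := f (s + t *: v).
have rr : 0 < eta / 2 < eta by lra.
have dphi t : nm t < eta -> cdiff phi t.
  move=> ht; apply: hdiff_line; apply: df.
  by rewrite addrC addKr vnZ vv mulr1.
have Bphi t : nm t < eta -> nm (phi t) <= B.
  by move=> ht; apply: Bf; rewrite addrC addKr vnZ vv mulr1.
have [c [_ hc]] := cauchy_taylor rr dphi Bphi.
have B0 : 0 <= B by apply: le_trans (Bphi 0 _); rewrite ?nm_ge0 ?nm0.
have bnd t : nm t <= eta / 4 -> nm (phi t - c 0%N - c 1%N * t) <= 32 * B / eta ^+ 2 * nm t ^+ 2.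
  move=> ht; have := hc t 2%N; rewrite !big_ord_recr big_ord0 /= expr0 expr1 add0r mulr1 opprD addrA.
  move=> k; apply: le_trans (k _) _; first by lra.
  have q1 : nm t / (eta / 2) <= 1 / 2 by rewrite ler_pdivrMr; lra.
  rewrite ler_pdivrMr; last by lra.
  have -> : 4 * B * (nm t / (eta / 2)) ^+ 2 = 32 * B / eta ^+ 2 * nm t ^+ 2 * (1 / 2).
    by field; lra.
  apply: ler_wpM2l; last by lra.
  by rewrite !mulr_ge0 ?sqr_ge0 ?invr_ge0 ?exprn_ge0 ?nm_ge0 // ltW.
have c0 : c 0%N = phi 0.
  apply/esym/eqP; rewrite -subr_eq0 -nm_eq0 eq_le nm_ge0 andbT.
  have := bnd 0; rewrite nm0 mulr0 subr0 expr0n mulr0; apply; lra.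
(* The linear coefficient on the line is the directional derivative: both first-order expansions are
   compared at a small real [t]. *)
have c1 : c 1%N = linform l v.
  apply: nm_eps_eq => e e0; have e20 : 0 < e / 2 by rewrite divr_gt0.
  have [d d0 hd] := hl _ e20.
  pose K := 32 * B / eta ^+ 2.
  have K0 : 0 <= K by rewrite !mulr_ge0 ?invr_ge0 ?exprn_ge0 // ltW.
  pose t := Num.min (d / 2) (Num.min (eta / 4) (e / 2 / (K + 1))).
  have t0 : 0 < t by rewrite !lt_min !divr_gt0 //; lra.
  have t1 : t <= d / 2 by rewrite /t ge_min lexx.
  have t2 : t <= eta / 4 by rewrite /t !ge_min lexx orbT.
  have t3 : t <= e / 2 / (K + 1) by rewrite /t !ge_min lexx !orbT.
  have nt : nm (rc t) = t by rewrite nm_rc ger0_norm // ltW.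
  have b1 := bnd (rc t); rewrite nt in b1; have {}b1 := b1 t2.
  have b2 := hd (rc t *: v); rewrite vnZ vv nt mulr1 in b2.
  have {}b2 : nm (f (s + rc t *: v) - f s - linform l (rc t *: v)) <= e / 2 * t by apply: b2; lra.
  rewrite linform_scale -/(phi (rc t)) in b2.
  have ps : phi 0 = f s by rewrite /phi scale0r addr0.
  rewrite c0 ps in b1.
  have -> : c 1%N - linform l v = ((phi (rc t) - f s - rc t * linform l v) - (phi (rc t) - f s - c 1%N * rc t)) / rc t.
    by field; rewrite -nm_gt0 nt.
  rewrite nmM nmV nt ler_pdivrMr //; apply: le_trans (nm_sub _ _) _.
  have : K * t ^+ 2 <= e / 2 * t.
    rewrite expr2 mulrA ler_wpM2r ?ltW //.
    move: t3; rewrite ler_pdivlMr; lra.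
  rewrite /K; lra.
have := bnd (rc (vn h)); rewrite nm_rc ger0_norm ?vn_ge0 // c0 c1 => /(_ hh).
by rewrite /phi -hv scale0r addr0 mulrC -linform_scale -hv.
Qed.

Lemma linform_delta l j (t : C) : linform l (t *: delta_mx 0 j : Cn) = t * l j.
Proof.
rewrite linform_scale /linform (bigD1 j) //= mxE !eqxx mulr1 big1 ?addr0 //.
by move=> i /negPf h; rewrite mxE h andbF mulr0.
Qed.

Lemma vn_delta j : vn (delta_mx 0 j : Cn) <= 1.
Proof.
by apply: vn_le => // i; rewrite mxE; case: (_ && _); rewrite ?nm1 ?nm0.
Qed.

(** Pointwise convergence and a common bound suffice: the quadratic estimate holds with one constant
    for all [fn k], so the coefficients of their differentials are Cauchy sequences and the estimate
    passes to the limit. *)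
Lemma weierstrass p rho (fn : nat -> Cn -> C) f B :
  (forall k, hol p rho (fn k)) ->
  (forall k s, vn (s - p) < rho -> nm (fn k s) <= B) ->
  (forall s, vn (s - p) < rho -> clim (fn^~ s) (f s)) ->
  hol p rho f.
Proof.
move=> hfn hB hlim s hs.
pose eta := rho - vn (s - p).
have eta0 : 0 < eta by rewrite /eta; lra.
have inb x : vn (x - s) < eta -> vn (x - p) < rho.
  by have := vn_dist s x p; rewrite /eta; lra.
have B0 : 0 <= B by apply: le_trans (nm_ge0 (fn 0%N s)) (hB _ _ hs).
have /choice[l hl] : forall k, exists l, hderiv (fn k) s l by move=> k; apply: hfn.
pose K := 32 * B / eta ^+ 2.
have K0 : 0 <= K by rewrite !mulr_ge0 ?invr_ge0 ?exprn_ge0 // ltW.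
have quad k h : vn h <= eta / 4 -> nm (fn k (s + h) - fn k s - linform (l k) h) <= K * vn h ^+ 2.
  by apply: cauchy_quadratic => // x /inb; [exact: hfn|exact: hB].
have /choice[L hL] : forall j, exists L, clim (fun k => l k j) L.
  move=> j; apply: ccauchy => e e0.
  pose t := Num.min (eta / 4) (e / 4 / (K + 1)).
  have t0 : 0 < t by rewrite !lt_min !divr_gt0 //; lra.
  have t2 : t <= eta / 4 by rewrite /t ge_min lexx.
  have t3 : t <= e / 4 / (K + 1) by rewrite /t ge_min lexx orbT.
  have nt : nm (rc t) = t by rewrite nm_rc ger0_norm // ltW.
  pose h : Cn := rc t *: delta_mx 0 j.
  have vh : vn h <= t.
    by rewrite vnZ nt -[leRHS]mulr1; apply: ler_wpM2l; [exact: ltW|exact: vn_delta].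
  have hh : vn (s + h - s) < eta by rewrite addrC addKr; lra.
  have et0 : 0 < e * t / 8 by rewrite divr_gt0 // mulr_gt0.
  have [N1 hN1] := hlim _ (inb _ hh) _ et0.
  have [N2 hN2] := hlim _ hs _ et0.
  exists (maxn N1 N2) => a b; rewrite !geq_max => /andP[a1 a2] /andP[b1 b2].
  have Kt : K * vn h ^+ 2 <= e / 4 * t.
    apply: (@le_trans _ _ (K * t ^+ 2)).
      by apply: ler_wpM2l => //; rewrite ler_sqr ?nnegrE ?vn_ge0 // ltW.
    rewrite expr2 mulrA ler_wpM2r ?(ltW t0) //.
    by move: t3; rewrite ler_pdivlMr; lra.
  have lE k : l k j = linform (l k) h / rc t.
    by rewrite linform_delta mulrAC divff ?mul1r // -nm_gt0 nt.
  rewrite !lE -mulrBl nmM nmV nt ler_pdivrMr //.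
  have -> : linform (l a) h - linform (l b) h =
     (fn b (s + h) - fn b s - linform (l b) h) - (fn a (s + h) - fn a s - linform (l a) h)
     + ((fn a (s + h) - f (s + h)) - (fn b (s + h) - f (s + h)))
     - ((fn a s - f s) - (fn b s - f s)) by ring.
  apply: le_trans (nm_sub _ _) _; apply: le_trans (lerD (nmD _ _) (nm_sub _ _)) _.
  apply: le_trans (lerD (lerD (nm_sub _ _) (nm_sub _ _)) (lexx _)) _.
  have := quad a h (le_trans vh t2); have := quad b h (le_trans vh t2).
  have := hN1 a a1; have := hN1 b b1; have := hN2 a a2; have := hN2 b b2; lra.
exists L => e e0.
exists (Num.min (eta / 4) (e / (K + 1))); first by rewrite !lt_min !divr_gt0 //; lra.
move=> h; rewrite lt_min => /andP[h1 h2'].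
have h2 : vn h * (K + 1) < e by rewrite -ltr_pdivlMr //; lra.
have hh : vn (s + h - s) < eta by rewrite addrC addKr; lra.
have lim1 : clim (fun k => fn k (s + h) - fn k s - linform (l k) h) (f (s + h) - f s - linform L h).
  apply: climB; first by apply: climB; apply: hlim => //; exact: inb.
  apply: clim_sum => j _.
  rewrite (_ : (fun k => _) = (fun k => h 0 j * l k j)); last by apply/funext => k; rewrite mulrC.
  by rewrite mulrC; exact: climZ.
apply: (clim_nm_le lim1) => k; apply: le_trans (quad k h (ltW h1)) _.
rewrite expr2 mulrA ler_wpM2r ?vn_ge0 //.
by have := vn_ge0 h; lra.
Qed.

End Hdiff.

(** * The identity theorem *)

Section Identity.
Context {R : realType}.
Local Notation C := (Cplx R).

(** The Taylor coefficients vanish one after the other: once the lower ones are 0, the remainder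
    estimate bounds the next by a multiple of [t] for all small [t]. *)
Lemma power_series_zero (f : C -> C) (eta delta B : R) : 0 < eta -> 0 < delta ->
  (forall z, nm z < eta -> cdiff f z) -> (forall z, nm z < eta -> nm (f z) <= B) ->
  (forall z, nm z < delta -> f z = 0) -> forall z, nm z < eta / 2 -> f z = 0.
Proof.
move=> eta0 delta0 df Bf f0.
have rr : 0 < eta / 2 < eta by lra.
have [c [_ hc]] := cauchy_taylor rr df Bf.
have B0 : 0 <= B by apply: le_trans (Bf 0 _); rewrite ?nm_ge0 ?nm0.
have r0 : 0 < eta / 2 by lra.
move: (eta / 2) r0 rr hc => r r0 rr hc.
have c0 k : c k = 0.
  elim/ltn_ind: k => k IH; apply: nm_eps_eq => e e0; rewrite subr0.
  pose K := 8 * B / r ^+ k.+1.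
  have K0 : 0 <= K by rewrite !mulr_ge0 ?invr_ge0 ?exprn_ge0 // ltW.
  pose t := Num.min (r / 2) (Num.min (delta / 2) (e / (K + 1))).
  have t0 : 0 < t by rewrite !lt_min !divr_gt0 //; lra.
  have t1 : t <= r / 2 by rewrite /t ge_min lexx.
  have t2 : t <= delta / 2 by rewrite /t !ge_min lexx orbT.
  have t3 : t <= e / (K + 1) by rewrite /t !ge_min lexx !orbT.
  have nt : nm (rc t) = t by rewrite nm_rc ger0_norm // ltW.
  have := hc (rc t) k.+1; rewrite nt f0 ?nt; last by lra.
  rewrite big_ord_recr /= big1 ?add0r; last by move=> i _; rewrite IH // mul0r.
  rewrite nmN nmM nmX nt => h.
  have {}h : nm (c k) * t ^+ k <= K * t ^+ k.+1.
    apply: le_trans (h _) _; first by lra.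
    have q1 : t / r <= 1 / 2 by rewrite ler_pdivrMr; lra.
    rewrite ler_pdivrMr; last by lra.
    have -> : 4 * B * (t / r) ^+ k.+1 = K * t ^+ k.+1 * (1 / 2).
      by rewrite /K expr_div_n; field; rewrite expf_neq0 // gt_eqF.
    apply: ler_wpM2l; last by lra.
    by apply: mulr_ge0 => //; apply: exprn_ge0; exact: ltW.
  have : nm (c k) <= K * t.
    by move: h; rewrite exprS mulrA ler_pM2r // exprn_gt0.
  move: t3; rewrite ler_pdivlMr; lra.
move=> z hz; apply: nm_eps_eq => e e0; rewrite subr0.
pose q := nm z / r.
have q1 : q < 1 by rewrite ltr_pdivrMr // mul1r.
have q0 : 0 <= q by rewrite divr_ge0 ?nm_ge0 // ltW.
have k0 : 0 < 4 * B + 1 by lra.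
have [N /(_ N (leqnn _)) hN] := geom_small (introT andP (conj q0 q1)) (mulr_gt0 (divr_gt0 e0 k0) (ltac:(lra) : 0 < 1 - q)).
have := hc z N hz; rewrite big1 ?subr0; last by move=> i _; rewrite c0 mul0r.
move=> h; apply: le_trans h _; rewrite -/q ler_pdivrMr; last by lra.
apply: (@le_trans _ _ ((4 * B + 1) * (e / (4 * B + 1) * (1 - q)))).
  by apply: ler_pM => //; rewrite ?exprn_ge0 //; lra.
by rewrite mulrA [_ * (e / _)]mulrC divfK // gt_eqF.
Qed.

Lemma line_identity (phi : C -> C) :
  (forall t : R, 0 <= t <= 1 -> exists2 d : R, 0 < d & exists B, forall z, nm (z - rc t) < d ->
     cdiff phi z /\ nm (phi z) <= B) ->
  (exists2 d : R, 0 < d & forall z, nm z < d -> phi z = 0) -> phi 1 = 0.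
Proof.
move=> hphi [d0 d00 h0].
pose Z (t : R) := exists2 d : R, 0 < d & forall z, nm (z - rc t) < d -> phi z = 0.
(* The bisection principle is applied to an implication between the end points of an interval, which
   composes over adjacent intervals. *)
suff : Z 0 -> Z (0 + 1 * 1).
  case; first by exists d0 => // z; rewrite rc0 subr0; exact: h0.
  by move=> d dp; apply; rewrite mulr1 add0r rc1 subrr nm0.
apply: (@cousin R (fun a _ t => Z a -> Z (a + 1 * t)) 0 0 1 0) => //.
  move=> a c t t0 _ h1 h2 _ _ /h1/h2; by rewrite -addrA -mulrDr -mulr2n.
move=> x y hx _; have [|d dp [B hB]] := hphi x; first by lra.
exists (d / 4); first by lra.
move=> a c t /andP[t0 t1] [i1 i2 _ _] ax _ [e e0 he].
have dist z : nm (z - rc x) <= nm (z - rc a) + d / 4.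
  apply: le_trans (nm_dist (rc a) _ _) _; rewrite lerD2l -rcB nm_rc ler_norml; lra.
have key : forall z, nm z < d / 2 / 2 -> phi (rc a + z) = 0.
  have d20 : 0 < d / 2 by lra.
  apply: (@power_series_zero (fun z => phi (rc a + z)) (d / 2) e B) => //.
  - move=> z hz; have [|cz _] := hB (rc a + z).
      by have := dist (rc a + z); rewrite [rc a + z - rc a]addrC addKr; lra.
    apply: (@cdiff_comp _ (fun z => rc a + z)) => //.
    by apply: (@cdiffD _ (fun=> rc a) id); [exact: cdiff_cst|exact: cdiff_id].
  - move=> z hz; have [|_ //] := hB (rc a + z).
    by have := dist (rc a + z); rewrite [rc a + z - rc a]addrC addKr; lra.
  - by move=> z hz; apply: he; rewrite addrC addKr.
exists (d / 4 - t); first by lra.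
move=> z hz; rewrite -(subrKC (rc a) z); apply: key.
have := nm_dist (rc (a + 1 * t)) z (rc a).
rewrite -[rc (a + _) - rc a]rcB nm_rc (_ : a + 1 * t - a = t); last by ring.
rewrite ger0_norm ?(ltW t0) //; lra.
Qed.

(** A ball is convex, so the segment from [q] to [s] stays inside and the one-variable case applies
    on the complex line through them. *)
Lemma identity_ball (n : nat) (p q : 'rV[C]_n) (rho delta : R) f :
  hol p rho f -> vn (q - p) < rho -> 0 < delta ->
  (forall x, vn (x - q) < delta -> vn (x - p) < rho -> f x = 0) ->
  forall s, vn (s - p) < rho -> f s = 0.
Proof.
move=> hf hq d0 hz s hs.
have -> : f s = (fun t => f (q + t *: (s - q))) 1 by rewrite scale1r addrC subrK.
pose v := s - q; have v0 := vn_ge0 v.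
have v1 : 0 < vn v + 1 by lra.
apply: (@line_identity (fun t => f (q + t *: (s - q)))); last first.
  pose eta := rho - vn (q - p); have eta0 : 0 < eta by rewrite /eta; lra.
  exists (Num.min (delta / (vn v + 1)) (eta / (vn v + 1))); first by rewrite lt_min !divr_gt0.
  move=> t; rewrite lt_min => /andP[]; rewrite !ltr_pdivlMr // => h1 h2.
  have h3 : vn (q + t *: v - q) <= nm t * (vn v + 1).
    by rewrite addrC addKr vnZ ler_wpM2l ?nm_ge0 // lerDl.
  apply: hz; first by lra.
  by have := vn_dist q (q + t *: v) p; rewrite /eta in h2; lra.
move=> t ht; pose x := q + rc t *: v.
have hx : vn (x - p) < rho.
  have -> : x - p = rc (1 - t) *: (q - p) + rc t *: (s - p).
    rewrite /x /v rcB rc1; apply/rowP => j; rewrite !mxE; ring.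
  apply: le_lt_trans (vnD _ _) _; rewrite !vnZ !nm_rc !ger0_norm; [|lra..].
  have [->|tn] := eqVneq t 0; first by rewrite subr0 mul1r mul0r addr0.
  have t0 : 0 < t by rewrite lt_def tn; lra.
  have : (1 - t) * vn (q - p) <= (1 - t) * rho by apply: ler_wpM2l; lra.
  have : t * vn (s - p) < t * rho by rewrite ltr_pM2l.
  lra.
pose eta := rho - vn (x - p); have eta0 : 0 < eta by rewrite /eta; lra.
have [d dp hd] := hdiff_cont (hf x hx) ltr01.
exists (Num.min (d / (vn v + 1)) (eta / (vn v + 1))); first by rewrite lt_min !divr_gt0.
exists (nm (f x) + 1) => z; rewrite lt_min => /andP[]; rewrite !ltr_pdivlMr // => h1 h2.
have zE : q + z *: v = x + (z - rc t) *: v.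
  by rewrite /x -addrA -scalerDl; congr (_ + _ *: _); ring.
have h3 : vn ((z - rc t) *: v) <= nm (z - rc t) * (vn v + 1).
  by rewrite vnZ ler_wpM2l ?nm_ge0 // lerDl.
split.
  apply: hdiff_line; apply: hf; rewrite zE.
  by rewrite addrAC; apply: le_lt_trans (vnD _ _) _; rewrite -ltrBrDl; exact: le_lt_trans h3 h2.
rewrite -/v zE; have := hd _ (le_lt_trans h3 h1).
have := nm_rev (f (x + (z - rc t) *: v)) (f x); lra.
Qed.

End Identity.

(** * Taylor coefficients in one of several variables *)

Section Coefficients.
Context {R : realType} {n : nat}.
Local Notation C := (Cplx R).
Local Notation Cn := 'rV[C]_n.

Lemma vn_mulmx m (A : 'M[C]_(n, m)) : exists2 K : R, 0 <= K & forall h : Cn, vn (h *m A) <= K * vn h.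
Proof.
exists (\sum_i \sum_j nm (A i j)).
  by apply: sumr_ge0 => i _; apply: sumr_ge0 => j _; exact: nm_ge0.
move=> h; apply: vn_le => [|j].
  by rewrite mulr_ge0 ?vn_ge0 //; apply: sumr_ge0 => i _; apply: sumr_ge0 => j _; exact: nm_ge0.
rewrite mxE; apply: le_trans (nm_sum _ _ _) _; rewrite mulr_suml; apply: ler_sum => i _.
rewrite nmM mulrC; apply: ler_pM; rewrite ?nm_ge0 ?vn_coord //.
by rewrite (bigD1 j) //= lerDl; apply: sumr_ge0 => k _; exact: nm_ge0.
Qed.

Lemma hdiff_affine m (A : 'M[C]_(n, m)) (b : 'rV[C]_m) (g : 'rV[C]_m -> C) (s : Cn) :
  hdiff g (s *m A + b) -> hdiff (fun s => g (s *m A + b)) s.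
Proof.
move=> [l hl]; exists (fun i => \sum_j A i j * l j) => e e0.
have [K K0 vA] := vn_mulmx A; have K1 : 0 < K + 1 by lra.
have [d d0 hd] := hl _ (divr_gt0 e0 K1).
exists (d / (K + 1)); first by rewrite divr_gt0.
move=> h; rewrite ltr_pdivlMr // => hh.
have hA : vn (h *m A) < d by have := vA h; have := vn_ge0 h; lra.
have := hd _ hA; rewrite mulmxDl (addrAC (s *m A) (h *m A) b).
have -> : linform l (h *m A) = linform (fun i => \sum_j A i j * l j) h.
  rewrite /linform; under eq_bigr do rewrite mxE mulr_sumr.
  rewrite exchange_big /=; apply: eq_bigr => i _; rewrite mulr_suml.
  by apply: eq_bigr => j _; ring.
move=> k; apply: le_trans k _.
apply: (@le_trans _ _ (e / (K + 1) * ((K + 1) * vn h))).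
  apply: ler_wpM2l; first by rewrite divr_ge0 // ltW.
  by have := vA h; have := vn_ge0 h; lra.
by rewrite mulrA divfK // gt_eqF.
Qed.

Definition upd (y : Cn) (j : 'I_n) (t : C) : Cn := \row_i (if i == j then t else y 0 i).

Lemma upd_affine j t : exists A, forall y, upd y j t = y *m A + t *: delta_mx 0 j.
Proof.
exists (1%:M - delta_mx j j) => y; apply/rowP => i; rewrite mulmxBr mulmx1 !mxE eqxx /=.
rewrite (bigD1 j) //= !mxE eqxx big1; last first.
  by move=> k kj; rewrite mxE (negPf kj) mulr0.
case: (eqVneq i j) => [->|ij] /=; ring.
Qed.

Lemma upd_upd y j t u : upd (upd y j t) j u = upd y j u.
Proof. by apply/rowP => i; rewrite !mxE; case: eqP. Qed.

Lemma upd_id y j : upd y j (y 0 j) = y.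
Proof. by apply/rowP => i; rewrite !mxE; case: eqP => // ->. Qed.

Lemma upd_ball (q y : Cn) j t rho : q 0 j = 0 -> nm t < rho -> vn (y - q) < rho ->
  vn (upd y j t - q) < rho.
Proof.
move=> qj ht hy; have r0 : 0 < rho by apply: le_lt_trans ht; exact: nm_ge0.
rewrite vn_lt // => i; rewrite !mxE; case: eqP => [->|_]; first by rewrite qj subr0.
by move: hy; rewrite vn_lt // => /(_ i); rewrite !mxE.
Qed.

Lemma hol_upd (q : Cn) rho g j t : hol q rho g -> q 0 j = 0 -> nm t < rho ->
  hol q rho (fun y => g (upd y j t)).
Proof.
move=> hg qj ht y hy; have [A hA] := upd_affine j t.
rewrite (_ : (fun y => _) = (fun y => g (y *m A + t *: delta_mx 0 j))).
  by apply: hdiff_affine; rewrite -hA; apply: hg; exact: upd_ball.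
by apply/funext => z; rewrite hA.
Qed.

(** The Taylor formula on the lines parallel to axis [j]. Each coefficient is holomorphic in all
    variables, by induction on [e]: it is the limit, as h tends to 0, of the remainder of order [e]
    at h divided by h^e, and [weierstrass] applies. *)
Lemma coord_coeffs (g : Cn -> C) q (rho r B : R) j : hol q rho g ->
  (forall y, vn (y - q) < rho -> nm (g y) <= B) -> q 0 j = 0 -> 0 < r < rho ->
  exists c : nat -> Cn -> C, [/\
    forall e, hol q rho (c e),
    forall e y, vn (y - q) < rho -> nm (c e y) <= 2 * B / r ^+ e,
    forall e y t, c e (upd y j t) = c e y,
    forall i, (forall y t, g (upd y i t) = g y) -> forall e y t, c e (upd y i t) = c e y &
    forall y K, vn (y - q) < rho -> nm (y 0 j) < r ->
      nm (g y - \sum_(e < K) c e y * y 0 j ^+ e) <= 4 * B * (nm (y 0 j) / r) ^+ K / (1 - nm (y 0 j) / r)].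
Proof.
move=> hg hB qj rr; have [r0 rrho] := andP rr.
(* The coefficients are chosen as a function of the restriction of g to the line. *)
have ex (phi : C -> C) : exists c : nat -> C,
   (exists2 y, vn (y - q) < rho & phi = fun z => g (upd y j z)) ->
   (forall k, nm (c k) <= 2 * B / r ^+ k) /\ forall z K, nm z < r ->
    nm (phi z - \sum_(k < K) c k * z ^+ k) <= 4 * B * (nm z / r) ^+ K / (1 - nm z / r).
  have [[y hy ->]|no] := pselect (exists2 y, vn (y - q) < rho & phi = fun z => g (upd y j z)); last first.
    by exists (fun=> 0).
  have dphi z : nm z < rho -> cdiff (fun z => g (upd y j z)) z.
    move=> hz; have uE u : upd y j u = upd y j 0 + u *: delta_mx 0 j.
      apply/rowP => i; rewrite !mxE eqxx /=.
      by case: eqP => _; rewrite ?mulr1 ?mulr0 ?add0r ?addr0.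
    rewrite (_ : (fun z => _) = (fun z => g (upd y j 0 + z *: delta_mx 0 j))); last first.
      by apply/funext => u; rewrite uE.
    by apply: hdiff_line; rewrite -uE; apply: hg; exact: upd_ball.
  have Bphi z : nm z < rho -> nm (g (upd y j z)) <= B.
    by move=> hz; apply: hB; exact: upd_ball.
  by have [c hc] := cauchy_taylor rr dphi Bphi; exists c.
have [c0 hc0'] := choice ex.
pose c e y := c0 (fun z => g (upd y j z)) e.
have hc0 y : vn (y - q) < rho -> (forall k, nm (c k y) <= 2 * B / r ^+ k) /\ forall z K, nm z < r ->
    nm (g (upd y j z) - \sum_(k < K) c k y * z ^+ k) <= 4 * B * (nm z / r) ^+ K / (1 - nm z / r).
  by move=> hy; apply: hc0'; exists y.
have bnd e y : vn (y - q) < rho -> nm (c e y) <= 2 * B / r ^+ e.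
  by move=> /hc0[h _]; exact: h.
have rem y z K : vn (y - q) < rho -> nm z < r ->
    nm (g (upd y j z) - \sum_(k < K) c k y * z ^+ k) <= 4 * B * (nm z / r) ^+ K / (1 - nm z / r).
  by move=> /hc0[_ h] hz; exact: h.
exists c; split => //; last 3 first.
- by move=> e y t; rewrite /c; under eq_fun do rewrite upd_upd.
- move=> i hi e y t; have [->|ij] := eqVneq i j.
    by rewrite /c; under eq_fun do rewrite upd_upd.
  rewrite /c; under eq_fun => z.
    rewrite (_ : upd (upd y i t) j z = upd (upd y j z) i t) ?hi; first over.
    by apply/rowP => k; rewrite !mxE; case: (eqVneq k j) => [->|//]; rewrite eq_sym (negPf ij).
  by [].
- by move=> y K hy hj; have := rem y (y 0 j) K hy hj; rewrite upd_id.
elim/ltn_ind => e IH.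
(* A sequence tending to 0 within radius [r / 2], where the geometric tail costs at most a factor
   2. *)
pose h (m : nat) : C := rc (r / 2 ^+ m.+1).
have h0 m : 0 < r / 2 ^+ m.+1 by rewrite divr_gt0 // exprn_gt0.
have nh m : nm (h m) = r / 2 ^+ m.+1 by rewrite nm_rc ger0_norm // ltW.
have hr m : nm (h m) <= r / 2.
  by rewrite nh exprS invfM mulrA ler_piMr ?invf_le1 ?exprn_ege1 ?exprn_gt0 //; lra.
have hn0 m : h m != 0 by rewrite -nm_gt0 nh.
have q2 m : nm (h m) / r <= 1 / 2 by rewrite ler_pdivrMr //; have := hr m; lra.
pose u m y := (g (upd y j (h m)) - \sum_(k < e) c k y * h m ^+ k) * h m ^- e.
have rem2 y m K : vn (y - q) < rho ->
    nm (g (upd y j (h m)) - \sum_(k < K) c k y * h m ^+ k) <= 8 * `|B| * (nm (h m) / r) ^+ K.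
  move=> hy; apply: le_trans (rem _ _ _ hy _) _; first by have := hr m; lra.
  rewrite ler_pdivrMr; last by have := q2 m; lra.
  apply: (@le_trans _ _ (4 * `|B| * (nm (h m) / r) ^+ K)).
    rewrite ler_wpM2r ?exprn_ge0 ?divr_ge0 ?nm_ge0 ?(ltW r0) //.
    by rewrite ler_wpM2l // ler_norm.
  have -> : 4 * `|B| * (nm (h m) / r) ^+ K = 8 * `|B| * (nm (h m) / r) ^+ K * (1 / 2) by move: ((nm (h m) / r) ^+ K) => w; field.
  apply: ler_wpM2l; last by have := q2 m; lra.
  by rewrite mulr_ge0 ?mulr_ge0 ?exprn_ge0 ?divr_ge0 ?nm_ge0 ?(ltW r0).
apply: (@weierstrass _ _ q rho u (c e) (8 * `|B| / r ^+ e)).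
- move=> m y hy; apply: hdiffM; last exact: hdiff_cst.
  apply: hdiffB; first by apply: (hol_upd hg qj _ hy); have := hr m; lra.
  apply: hdiff_sum => k _; apply: hdiffM; last exact: hdiff_cst.
  by apply: IH.
- move=> m y hy; rewrite nmM nmV nmX ler_pdivrMr ?exprn_gt0 ?nm_gt0 //.
  by apply: le_trans (rem2 y m e hy) _; rewrite expr_div_n mulrA mulrAC.
move=> y hy eps eps0.
have k0 : 0 < 8 * `|B| / r ^+ e + 1.
  have : 0 <= 8 * `|B| / r ^+ e by rewrite !mulr_ge0 ?invr_ge0 ?exprn_ge0 // ltW.
  lra.
have [|N hN] := @geom_small R (2^-1) _ _ (divr_gt0 eps0 k0); first by lra.
exists N => m hm.
have -> : u m y - c e y = (g (upd y j (h m)) - \sum_(k < e.+1) c k y * h m ^+ k) * h m ^- e.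
  by rewrite /u big_ord_recr /=; field; rewrite expf_neq0.
rewrite nmM nmV nmX ler_pdivrMr ?exprn_gt0 ?nm_gt0 //.
apply: le_trans (rem2 y m e.+1 hy) _.
have -> : 8 * `|B| * (nm (h m) / r) ^+ e.+1 = (8 * `|B| / r ^+ e) * (nm (h m) / r) * nm (h m) ^+ e.
  by rewrite exprS expr_div_n; ring.
rewrite ler_wpM2r ?exprn_ge0 ?nm_ge0 //.
have -> : nm (h m) / r = 2^-1 ^+ m.+1 by rewrite nh exprVn; field; rewrite expf_neq0 ?gt_eqF.
have := hN m.+1 (leqW hm); set w := 2^-1 ^+ m.+1 => hw.
have w0 : 0 <= w by rewrite exprn_ge0.
apply: (@le_trans _ _ ((8 * `|B| / r ^+ e + 1) * (eps / (8 * `|B| / r ^+ e + 1)))).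
  apply: ler_pM => //; last by lra.
  by rewrite !mulr_ge0 ?invr_ge0 ?exprn_ge0 // ltW.
by rewrite mulrC divfK // gt_eqF.
Qed.

End Coefficients.

(** * Power series in several variables *)

Section MultiSeries.
Context {R : realType} {n : nat}.
Local Notation C := (Cplx R).
Local Notation Cn := 'rV[C]_n.
Local Notation ix := {ffun 'I_n -> nat}.

Definition mon (y : Cn) (e : ix) : C := \prod_i y 0 i ^+ e i.

Definition setx (e : ix) (j : 'I_n) (m : nat) : ix := [ffun i => if i == j then m else e i].

Lemma sum_iota (V : nmodType) (F : nat -> V) M : \sum_(e <- iota 0 M) F e = \sum_(e < M) F e.
Proof. by rewrite -(big_mkord xpredT) /index_iota subn0. Qed.

Lemma power_abs_bounded (c : nat -> C) (z : C) (B r : R) : 0 < r -> nm z < r -> 0 <= B ->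
  (forall e, nm (c e) <= B / r ^+ e) ->
  abs_bounded (fun e => c e * z ^+ e) (B * (1 - nm z / r)^-1).
Proof.
move=> r0 zr B0 hc.
have q1 : 0 <= nm z / r < 1 by rewrite divr_ge0 ?nm_ge0 ?(ltW r0) //= ltr_pdivrMr // mul1r.
move=> s us; have [M hM] := exhaustion_sub s iota_exhaustion.
have le1 e : nm (c e * z ^+ e) <= B * (nm z / r) ^+ e.
  rewrite nmM nmX expr_div_n mulrA mulrAC ler_wpM2r ?exprn_ge0 ?nm_ge0 //.
apply: (@le_trans _ _ (\sum_(e <- s) B * (nm z / r) ^+ e)); first exact: ler_sum.
apply: (@le_trans _ _ (\sum_(e <- iota 0 M) B * (nm z / r) ^+ e)).
  rewrite (@sum_split_sub _ _ (fun e => B * (nm z / r) ^+ e) s (iota 0 M)) ?iota_uniq //.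
    rewrite lerDl; apply: sumr_ge0 => e _; apply: mulr_ge0 => //; apply: exprn_ge0.
    by case/andP: q1.
  exact: hM.
rewrite -mulr_sumr ler_wpM2l //.
rewrite sum_iota; exact: geom_sum_bound.
Qed.

Lemma has_sum_nat (c : nat -> C) (z l : C) (A B r : R) : 0 < r -> nm z < r -> 0 <= B ->
  (forall e, nm (c e) <= B / r ^+ e) ->
  (forall K, nm (l - \sum_(e < K) c e * z ^+ e) <= A * (nm z / r) ^+ K / (1 - nm z / r)) ->
  has_sum (fun e => c e * z ^+ e) l.
Proof.
move=> r0 zr B0 hc hl.
have q1 : 0 <= nm z / r < 1 by rewrite divr_ge0 ?nm_ge0 ?(ltW r0) //= ltr_pdivrMr // mul1r.
apply: (clim_has_sum iota_exhaustion (power_abs_bounded r0 zr B0 hc)).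
move=> eps eps0.
have A1 : 0 < `|A| + 1 by have := normr_ge0 A; lra.
have q2 : 0 < 1 - nm z / r by lra.
have [N hN] := geom_small q1 (mulr_gt0 (divr_gt0 eps0 A1) q2).
exists N => K hK; rewrite sum_iota nmB.
apply: le_trans (hl K) _; rewrite ler_pdivrMr //.
apply: (@le_trans _ _ ((`|A| + 1) * (eps / (`|A| + 1) * (1 - nm z / r)))).
  apply: (@le_trans _ _ (`|A| * (nm z / r) ^+ K)).
    by apply: ler_wpM2r (ler_norm _); apply: exprn_ge0; case/andP: q1.
  by apply: ler_pM (hN K hK); rewrite ?lerDl // exprn_ge0 //; case/andP: q1.
by rewrite mulrA [_ * (eps / _)]mulrC divfK // gt_eqF.
Qed.

Lemma multi_abs_bounded k (c : ix -> C) (y : Cn) (B r : R) : 0 < r -> 0 <= B ->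
  (forall e, nm (c e) <= B / r ^+ (\sum_i e i)) ->
  (forall (e : ix) (j : 'I_n), (k <= j)%N -> e j != 0%N -> c e = 0) ->
  (forall j : 'I_n, (j < k)%N -> nm (y 0 j) < r) ->
  exists B', abs_bounded (fun e => c e * mon y e) B'.
Proof.
move=> r0 B0 hc c0 hy.
pose b (j : 'I_n) m : R := if (j < k)%N then (nm (y 0 j) / r) ^+ m else (m == 0%N)%:R.
pose S (j : 'I_n) : R := if (j < k)%N then (1 - nm (y 0 j) / r)^-1 else 1.
have q1 (j : 'I_n) : (j < k)%N -> 0 <= nm (y 0 j) / r < 1.
  by move=> jk; rewrite divr_ge0 ?nm_ge0 ?(ltW r0) //= ltr_pdivrMr // mul1r hy.
exists (B * \prod_j S j).
apply: (@abs_bounded_le _ _ _ (fun e : ix => B * \prod_j b j (e j))).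
  move=> e; have [/existsP[j /andP[kj ej]]|/existsPn ne] := boolP [exists j : 'I_n, (k <= j)%N && (e j != 0%N)].
    rewrite (c0 e j) // mul0r nm0 mulr_ge0 // prodr_ge0 // => i _.
    by rewrite /b; case: ifP => // /q1 /andP[h _]; exact: exprn_ge0.
  have -> : \prod_j b j (e j) = (\prod_j nm (y 0 j) ^+ e j) / r ^+ (\sum_i e i).
    rewrite -prodrXr -prodf_div; apply: eq_bigr => j _; rewrite /b.
    case: ltnP => [jk|kj]; first by rewrite expr_div_n.
    by have := ne j; rewrite kj /= negbK => /eqP ->; rewrite expr0 divr1.
  rewrite nmM /mon nm_prod; under eq_bigr do rewrite nmX.
  rewrite mulrA mulrAC ler_wpM2r ?hc //.
  by apply: prodr_ge0 => j _; rewrite exprn_ge0 ?nm_ge0.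
move=> s us; rewrite -mulr_sumr ler_wpM2l //; apply: (@sum_prod_bound R _ b S) => //.
  by move=> i m; rewrite /b; case: ifP => // /q1 /andP[h _]; exact: exprn_ge0.
move=> i M; rewrite /b /S; case: ifP => [/q1|_]; first exact: geom_sum_bound.
case: M => [|M]; first by rewrite big_ord0.
rewrite big_ord_recl /= big1 ?addr0 //.
Qed.

(** Induction on the number [k] of variables expanded so far. Exponents are indexed by all [n]
    variables, and coefficients vanish unless the exponents of the variables not yet expanded are 0,
    so that the index type does not change with [k]. *)
Lemma multi_series k (g : Cn -> C) q (rho r B : R) : (k <= n)%N -> hol q rho g ->
  (forall y, vn (y - q) < rho -> nm (g y) <= B) ->
  (forall j : 'I_n, (j < k)%N -> q 0 j = 0) -> 0 < r < rho ->
  exists c : ix -> Cn -> C, [/\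
    forall e, hol q rho (c e),
    forall e y, vn (y - q) < rho -> nm (c e y) <= 2 ^+ k * B / r ^+ (\sum_i e i),
    forall e y (j : 'I_n) t, (j < k)%N -> c e (upd y j t) = c e y,
    forall (e : ix) (j : 'I_n), (k <= j)%N -> e j != 0%N -> forall y, c e y = 0 &
    forall y, vn (y - q) < rho -> (forall j : 'I_n, (j < k)%N -> nm (y 0 j) < r) ->
      has_sum (fun e => c e y * mon y e) (g y)].
Proof.
move=> kn hg hB q0 rr; have [r0 rrho] := andP rr.
have rho0 : 0 < rho by lra.
have B0 : 0 <= B by apply: le_trans (nm_ge0 (g q)) (hB q _); rewrite subrr vn0.
elim: k kn q0 => [|k IH] kn q0.
  exists (fun e => if e == [ffun=> 0%N] then g else fun=> 0); split.
  - by move=> e; case: ifP => _ //; move=> s _; exact: hdiff_cst.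
  - move=> e y hy; rewrite expr0 mul1r; case: eqP => [->|_].
      rewrite big1 ?expr0 ?divr1 ?hB // => i _; by rewrite ffunE.
    by rewrite nm0 divr_ge0 // exprn_ge0 // ltW.
  - by [].
  - by move=> e j _ ej y; case: eqP => // h; rewrite h ffunE in ej.
  - move=> y hy _ eps eps0; exists [:: [ffun=> 0%N]] => s us sub.
    rewrite (bigD1_seq [ffun=> 0%N]) ?(sub _ (mem_head _ _)) //= eqxx big1.
      rewrite addr0 /mon big1 ?mulr1 ?subrr ?nm0 ?ltW // => i _; by rewrite ffunE.
    by move=> e /negPf ->; rewrite mul0r.
have [||c [c1 c2 c3 c4 c5]] := IH; first exact: ltnW.
  by move=> j jk; apply: q0; exact: leqW.
pose jk := Ordinal kn.
have qj : q 0 jk = 0 by exact: q0.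
have /choice[d hd] e := coord_coeffs (c1 e) (c2 e) qj rr.
pose hi (e : ix) := [exists j : 'I_n, (k < j)%N && (e j != 0%N)].
pose c' e y := if hi e then 0 else d (setx e jk 0) (e jk) y.
have sumE (e : ix) : (\sum_i e i = \sum_i setx e jk 0 i + e jk)%N.
  rewrite (bigD1 jk) //= [in RHS](bigD1 jk) //= ffunE eqxx add0n addnC; congr (_ + _)%N.
  by apply: eq_bigr => i ij; rewrite ffunE (negPf ij).
have b0 m : 0 <= 2 ^+ m * B / r ^+ 0 by rewrite expr0 divr1 mulr_ge0 ?exprn_ge0.
have bnd e y : vn (y - q) < rho -> nm (c' e y) <= 2 ^+ k.+1 * B / r ^+ (\sum_i e i).
  move=> hy; rewrite /c'; case: ifP => _.
    by rewrite nm0 divr_ge0 ?mulr_ge0 ?exprn_ge0 // ltW.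
  have [_ d2 _ _ _] := hd (setx e jk 0); apply: le_trans (d2 (e jk) y hy) _.
  by rewrite (sumE e) exprD exprS invfM !mulrA.
have vanish (e : ix) (j : 'I_n) : (k.+1 <= j)%N -> e j != 0%N -> forall y, c' e y = 0.
  move=> kj ej y; rewrite /c'; case: ifP => // /existsP; case; exists j; by rewrite kj.
exists c'; split => //.
- move=> e; rewrite /c'; case: (hi e); first by move=> s _; exact: hdiff_cst.
  by have [d1 _ _ _ _] := hd (setx e jk 0); exact: d1.
- move=> e y j t; rewrite ltnS leq_eqVlt => /predU1P[jE|jk'].
    have -> : j = jk by apply/val_inj.
    by rewrite /c'; case: ifP => // _; have [_ _ d3 _ _] := hd (setx e jk 0); exact: d3.
  rewrite /c'; case: ifP => // _; have [_ _ _ d4 _] := hd (setx e jk 0).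
  by apply: d4 => y' t'; exact: c3.
move=> y hy hyr.
have [B' hB'] : exists B', abs_bounded (fun e => c' e y * mon y e) B'.
  apply: (@multi_abs_bounded k.+1 (c'^~ y) y (2 ^+ k.+1 * B) r) => //.
  - by rewrite mulr_ge0 ?exprn_ge0.
  - by move=> e; exact: bnd.
  - by move=> e j kj ej; exact: (vanish _ _ kj ej y).
have [l hl] := has_sum_exists (nat_box_exhaustion 'I_n) hB'.
have hg' : has_sum (fun e => c e y * mon y e) (g y).
  by apply: c5 => // j h; apply: hyr; exact: leqW.
suff : has_sum (fun e => c e y * mon y e) l.
  by move=> /(has_sum_uniq (nat_box_exhaustion 'I_n) hg') ->.
(* The exponent of the new variable is summed first: the fibres are those of resetting it to 0. *)
apply: (has_sum_fiber (pr := fun e => setx e jk 0) hl) => e0.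
have [ek|ek] := eqVneq (e0 jk) 0%N; last first.
  rewrite (c4 e0 jk) // mul0r; apply: eq_has_sum has_sum0 => e.
  by case: eqP => // h; rewrite -h ffunE eqxx in ek.
have set0E m : setx (setx e0 jk m) jk 0 = e0.
  by apply/ffunP => i; rewrite !ffunE; case: eqP => // ->.
have set_inj : injective (setx e0 jk).
  by move=> a b /ffunP /(_ jk); rewrite !ffunE eqxx.
apply/(has_sum_reindex set_inj).
  move=> e he; case: eqP => // h; exfalso; apply: (he (e jk)).
  by rewrite -h; apply/ffunP => i; rewrite !ffunE; case: eqP => // ->.
have monE m : mon y (setx e0 jk m) = mon y e0 * y 0 jk ^+ m.
  rewrite /mon (bigD1 jk) //= ffunE eqxx [in RHS](bigD1 jk) //= ek expr0 mul1r mulrC.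
  by congr (_ * _); apply: eq_bigr => i ij; rewrite ffunE (negPf ij).
have hiE m : hi (setx e0 jk m) = hi e0.
  apply: eq_existsb => i; rewrite ffunE; case: (eqVneq i jk) => [->|//].
  by rewrite ltnn.
apply: (@eq_has_sum _ _ (fun m => mon y e0 * ((if hi e0 then 0 else d e0 m y) * y 0 jk ^+ m))).
  move=> m /=; rewrite set0E eqxx /c' hiE set0E ffunE eqxx monE. case: (hi e0); ring.
rewrite mulrC; apply: has_sumZ.
have [h|nh] := boolP (hi e0).
  have -> : c e0 y = 0.
    by move/existsP: h => [j /andP[kj ej]]; apply: (c4 _ j _ ej); exact: ltnW.
  by apply: eq_has_sum has_sum0 => m; rewrite mul0r.
have [_ d2 _ _ d5] := hd e0.
apply: (@has_sum_nat (fun m => d e0 m y) _ _ _ (2 * (2 ^+ k * B / r ^+ (\sum_i e0 i))) r r0 _ _ _).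
- by apply: hyr.
- by rewrite !mulr_ge0 ?invr_ge0 ?exprn_ge0 // ltW.
- by move=> m; exact: d2.
- by move=> K; apply: d5 => //; exact: hyr.
Qed.

End MultiSeries.

(** * Complex powers and the binomial expansion *)

Section ComplexPowers.
Context {R : realType}.
Local Notation C := (Cplx R).
Implicit Types (z w : C) (x y : R).

Lemma cpowE x z : cpow x z = cexp (z * rc (ln x)). Proof. by []. Qed.

Lemma cpowD x z w : cpow x (z + w) = cpow x z * cpow x w.
Proof. by rewrite !cpowE mulrDl cexpD. Qed.

Lemma cpowM x y z : 0 < x -> 0 < y -> cpow (x * y) z = cpow x z * cpow y z.
Proof. by move=> x0 y0; rewrite !cpowE lnM ?posrE // rcD mulrDr cexpD. Qed.

Lemma cpowN x z : cpow x (- z) = (cpow x z)^-1.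
Proof. by rewrite !cpowE mulNr cexpN. Qed.

Lemma cpow_nat x n : 0 < x -> cpow x n%:R = rc x ^+ n.
Proof. by move=> x0; rewrite cpowE mulr_natl cexpMn cexp_real lnK ?posrE. Qed.

Lemma cpow_int x (k : int) : 0 < x -> cpow x k%:~R = rc x ^ k.
Proof.
move=> x0; case: (intP k) => [|m|m]; first by rewrite expr0z cpowE mul0r cexp0.
  by rewrite -exprnP -cpow_nat.
by rewrite -exprnN rmorphN /= cpowN -cpow_nat.
Qed.

Lemma cpow0 x : cpow x 0 = 1 :> C. Proof. by rewrite cpowE mul0r cexp0. Qed.

Lemma nm_cpow x z : nm (cpow x z) = expR (complex.Re z * ln x).
Proof. by rewrite cpowE nm_cexp ReM /= mulr0 subr0. Qed.

Definition rder (g : R -> C) x (l : C) := forall e : R, 0 < e -> exists2 d : R, 0 < d &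
  forall h, `|h| < d -> nm (g (x + h) - g x - l * rc h) <= e * `|h|.

(** The inequality is additive over adjacent intervals and holds locally up to e times the length,
    so the bisection principle on a segment applies. *)
Lemma mean_value (g : R -> C) a b M : a <= b ->
  (forall x, a <= x <= b -> exists2 l, nm l <= M & rder g x l) ->
  nm (g b - g a) <= M * (b - a).
Proof.
move=> ab hg; have [->|ba] := eqVneq b a; first by rewrite !subrr nm0 mulr0.
have w0 : 0 < b - a by rewrite subr_gt0 lt_def ba.
rewrite -subr_le0; apply: ge0_le_eps => e e0; rewrite lerBlDr.
have e1 : 0 < e / (b - a) by rewrite divr_gt0.
pose P u (c t : R) := nm (g (u + (b - a) * t) - g u) <= (M + e / (b - a)) * ((b - a) * t).
suff : P a 0 1.
  by rewrite /P mulr1 subrKC mulrDl divfK ?gt_eqF // => h; rewrite [leRHS]addrC.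
apply: (@cousin R P a 0 (b - a) 0) => //; first exact: ltW.
  move=> u c t t0 _ h1 h2 _ _; rewrite /P in h1 h2 *.
  rewrite mulrnAr mulr2n addrA mulrDr.
  by apply: le_trans (nm_dist (g (u + (b - a) * t)) _ _) _; exact: lerD.
move=> x y hx _; have [|l lM hl] := hg x; first by lra.
have [d d0 hd] := hl _ e1.
exists (d / (b - a)); first by rewrite divr_gt0.
move=> u c t /andP[t0]; rewrite ltr_pdivlMr // mulrC => td _ hu _; rewrite /P.
set v := (b - a) * t in td hu *.
have h1 := hd (u + v - x); have h2 := hd (u - x).
rewrite !subrKC in h1 h2.
have n1 : `|u + v - x| = u + v - x by rewrite ger0_norm; lra.
have {}h1 : nm (g (u + v) - g x - l * rc (u + v - x)) <= e / (b - a) * (u + v - x).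
  by rewrite n1 in h1; apply: h1; lra.
have {}h2 : nm (g u - g x - l * rc (u - x)) <= e / (b - a) * (x - u).
  have -> : x - u = `|u - x| by rewrite ler0_norm; lra.
  by apply: h2; rewrite ler0_norm; lra.
have -> : g (u + v) - g u = (g (u + v) - g x - l * rc (u + v - x)) - (g u - g x - l * rc (u - x)) + l * rc v.
  by rewrite !rcB !rcD; ring.
apply: le_trans (nmD _ _) _; apply: le_trans (lerD (nm_sub _ _) (lexx _)) _.
have v0 : 0 <= v by lra.
have h3 : nm (l * rc v) <= M * v by rewrite nmM nm_rc ger0_norm // ler_wpM2r.
apply: le_trans (lerD (lerD h1 h2) h3) _.
by rewrite le_eqVlt; apply/orP; left; apply/eqP; ring.
Qed.

Lemma rder_comp (f : C -> C) (u : R -> R) x (l : C) u' : is_derive x (1 : R) u u' ->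
  cderiv f (rc (u x)) l -> rder (fun x => f (rc (u x))) x (l * rc u').
Proof.
move=> hu hf e e0.
have l0 := nm_ge0 l; have u0 := normr_ge0 u'.
pose a := `|u'| + 1; pose b := nm l + 1.
have a0 : 0 < a by rewrite /a; lra.
have b0 : 0 < b by rewrite /b; lra.
have [d1 d10 h1] := hf _ (divr_gt0 (divr_gt0 e0 (ltr0n R 2)) a0).
have [d2 d20 h2] := real_deriv_eps hu (divr_gt0 (divr_gt0 e0 (ltr0n R 2)) b0).
have [d3 d30 h3] := real_deriv_eps hu ltr01.
exists (Num.min (Num.min d2 d3) (d1 / a)); first by rewrite !lt_min d20 d30 divr_gt0.
move=> h; rewrite !lt_min => /andP[/andP[k2 k3]]; rewrite ltr_pdivlMr // => k1.
pose k := u (x + h) - u x.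
have hk : `|k| <= `|h| * a.
  have := ler_normD (k - u' * h) (u' * h); rewrite subrK normrM.
  by have := h3 h k3; rewrite -/k /a; lra.
have := h1 (rc k); rewrite nm_rc => /(_ (le_lt_trans hk k1)).
rewrite -rcD /k subrKC -/k => k4.
have -> : f (rc (u (x + h))) - f (rc (u x)) - l * rc u' * rc h =
  (f (rc (u (x + h))) - f (rc (u x)) - l * rc k) + l * rc (u (x + h) - u x - u' * h).
  by rewrite /k !rcB rcM /=; ring.
apply: le_trans (nmD _ _) _; rewrite nmM nm_rc.
have e1 : e / 2 / a * `|k| <= e / 2 / a * (`|h| * a).
  by rewrite ler_wpM2l // !divr_ge0 // ltW.
have e2 : nm l * `|u (x + h) - u x - u' * h| <= b * (e / 2 / b * `|h|).
  by apply: ler_pM; rewrite ?nm_ge0 ?h2 // /b lerDl.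
apply: le_trans (lerD (le_trans k4 e1) e2) _.
rewrite le_eqVlt; apply/orP; left; apply/eqP; field.
by rewrite !gt_eqF.
Qed.

Lemma rderB (f g : R -> C) x l m : rder f x l -> rder g x m ->
  rder (fun x => f x - g x) x (l - m).
Proof.
move=> hf hg e e0; have [d d0 hd] := hf _ (divr_gt0 e0 (ltr0n R 2)).
have [d' d'0 hd'] := hg _ (divr_gt0 e0 (ltr0n R 2)).
exists (Num.min d d'); first by rewrite lt_min d0.
move=> h; rewrite lt_min => /andP[/hd h1 /hd' h2].
have -> : f (x + h) - g (x + h) - (f x - g x) - (l - m) * rc h =
  (f (x + h) - f x - l * rc h) - (g (x + h) - g x - m * rc h) by ring.
by have := nm_sub (f (x + h) - f x - l * rc h) (g (x + h) - g x - m * rc h); lra.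
Qed.

Lemma cderiv_pow z n : cderiv (fun z => z ^+ n) z (n%:R * z ^+ n.-1).
Proof.
elim: n => [|n IH]; first by rewrite mul0r; exact: cderiv_cst.
have -> : (fun z : C => z ^+ n.+1) = (fun z => id z * z ^+ n) by apply/funext => w; rewrite exprS.
have -> : n.+1%:R * z ^+ n.+1.-1 = 1 * z ^+ n + id z * (n%:R * z ^+ n.-1).
  case: n {IH} => [|n] /=; first by rewrite mul0r mulr0 addr0.
  by rewrite exprS -natr1; ring.
exact: cderivM (cderiv_id z) IH.
Qed.

Lemma cderiv_sum (I : Type) (s : seq I) (F : I -> C -> C) (l : I -> C) z :
  (forall i, cderiv (F i) z (l i)) -> cderiv (fun z => \sum_(i <- s) F i z) z (\sum_(i <- s) l i).
Proof.
move=> h; elim: s => [|i s IH].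
  rewrite big_nil (_ : (fun z => _) = fun=> 0); first exact: cderiv_cst.
  by apply/funext => w; rewrite big_nil.
rewrite big_cons (_ : (fun z => _) = fun z => F i z + \sum_(i <- s) F i z); first exact: cderivD.
by apply/funext => w; rewrite big_cons.
Qed.

(** The binomial coefficient of [- z] over [q]; the recursion through [z + 1] matches the derivative
    of (1 + X)^(-z). *)
Fixpoint binc z (q : nat) : C := if q is q'.+1 then - z / q%:R * binc (z + 1) q' else 1.

Definition tay M X z : C := \sum_(q < M) binc z q * rc X ^+ q.

Lemma tay_deriv M z (X : R) : rder (fun X => tay M.+1 X z) X (- z * tay M X (z + 1)).
Proof.
have h : cderiv (fun w => \sum_(q < M.+1) binc z q * w ^+ q) (rc X)
   (\sum_(q < M.+1) (0 * rc X ^+ q + binc z q * (q%:R * rc X ^+ q.-1))).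
  by apply: cderiv_sum => q; apply: (@cderivM _ (fun=> binc z q)); [exact: cderiv_cst|exact: cderiv_pow].
have := rder_comp (is_derive_id X (1 : R)) h; rewrite rc1 mulr1.
rewrite (_ : \sum_(q < M.+1) _ = - z * tay M X (z + 1)) //.
rewrite big_ord_recl /= !(mul0r, mulr0, addr0, add0r) mulr_sumr; apply: eq_bigr => q _.
rewrite /bump /= add1n mul0r add0r /=.
have q0 : q.+1%:R != 0 :> C by rewrite pnatr_eq0.
by move: (q.+1%:R : C) q0 => a q0; field.
Qed.

Lemma cpow1D_deriv z (X : R) : 0 <= X ->
  rder (fun X => cpow (1 + X) (- z)) X (- z * cpow (1 + X) (- (z + 1))).
Proof.
move=> X0; have X1 : 0 < 1 + X by lra.
have hd : is_derive X (1 : R) (fun X => ln (1 + X)) (1 + X)^-1.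
  have h1 : is_derive X (1 : R) (fun X => 1 + X) (0 + 1).
    by apply: is_deriveD.
  have := @is_derive1_comp _ (@ln R) (fun X => 1 + X) X _ _ (is_derive1_ln X1) h1.
  by rewrite add0r mulr1.
have hf : cderiv (fun w => cexp (- z * w)) (rc (ln (1 + X))) (cexp (- z * rc (ln (1 + X))) * (0 * rc (ln (1 + X)) + - z * 1)).
  apply: (@cderiv_comp _ (fun w => - z * w) (@cexp R)); last exact: cderiv_cexp.
  by apply: (@cderivM _ (fun=> - z) id); [exact: cderiv_cst|exact: cderiv_id].
have := rder_comp hd hf.
rewrite (_ : _ * _ * rc _ = - z * cpow (1 + X) (- (z + 1))) //.
have e1 : cpow (1 + X) (-1) = rc (1 + X)^-1.
  by rewrite cpowN rcV; have := cpow_nat 1 X1; rewrite expr1 => ->.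
by rewrite opprD cpowD e1 cpowE; ring.
Qed.

(** The derivative of the remainder is [- z] times the remainder of one order less at [z + 1]; hence
    an induction on [M] in which [Z] becomes [Z + 1]. *)
Lemma tay_bound M (Z : R) : 0 <= Z -> exists2 K : R, 0 <= K & forall X z, 0 <= X <= 1 -> nm z <= Z ->
  nm (cpow (1 + X) (- z) - tay M X z) <= K * X ^+ M.
Proof.
elim: M Z => [|M IH] Z Z0.
  exists (expR Z); first exact: expR_ge0.
  move=> X z /andP[X0 X1] hz; rewrite /tay big_ord0 subr0 expr0 mulr1 nm_cpow ler_expR ReN.
  have l0 : 0 <= ln (1 + X) by rewrite ln_ge0 // lerDl.
  have l1 : ln (1 + X) <= 1 by apply: le_trans (le_ln1Dx _) X1; lra.
  apply: le_trans (ler_norm _) _; rewrite normrM normrN (ger0_norm l0).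
  have := Re_le_nm z => hr; rewrite -[leRHS]mulr1; apply: ler_pM => //; lra.
have [K K0 hK] := IH (Z + 1) (ltac:(lra) : 0 <= Z + 1).
exists (Z * K); first by rewrite mulr_ge0.
move=> X z /andP[X0 X1] hz.
have -> : cpow (1 + X) (- z) - tay M.+1 X z =
  (cpow (1 + X) (- z) - tay M.+1 X z) - (cpow (1 + 0) (- z) - tay M.+1 0 z).
  have -> : tay M.+1 0 z = 1.
    rewrite /tay big_ord_recl expr0 mulr1 /= big1 ?addr0 // => q _.
    by rewrite /bump /= add1n exprS mul0r mulr0.
  by rewrite addr0 [cpow 1 _]cpowE ln1 rc0 mulr0 cexp0 subrr subr0.
have -> : Z * K * X ^+ M.+1 = Z * K * X ^+ M * (X - 0) by rewrite subr0 exprSr mulrA.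
apply: (@mean_value (fun X => cpow (1 + X) (- z) - tay M.+1 X z)) => // y /andP[y0 y1].
exists (- z * cpow (1 + y) (- (z + 1)) - - z * tay M y (z + 1)); last first.
  by apply: rderB; [exact: cpow1D_deriv|exact: tay_deriv].
rewrite -mulrBr nmM nmN -mulrA; apply: ler_pM; rewrite ?nm_ge0 //.
apply: le_trans (hK y (z + 1) _ _) _; first by lra.
  by apply: le_trans (nmD _ _) _; rewrite nm1; lra.
by rewrite ler_wpM2l // lerXn2r // nnegrE.
Qed.

(** Telescoping, one factor replaced at a time. *)
Lemma prod_diff_bound (I : Type) (s : seq I) (u v : I -> C) (K : R) : 1 <= K ->
  (forall i, nm (u i) <= K) -> (forall i, nm (v i) <= K) ->
  nm (\prod_(i <- s) u i - \prod_(i <- s) v i) <= K ^+ size s * \sum_(i <- s) nm (u i - v i).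
Proof.
move=> K1 hu hv.
have pv t : nm (\prod_(i <- t) v i) <= K ^+ size t.
  elim: t => [|i t IH]; first by rewrite big_nil nm1.
  by rewrite big_cons nmM exprS; apply: ler_pM; rewrite ?nm_ge0.
have K0 : 0 <= K by lra.
elim: s => [|i s IH]; first by rewrite !big_nil subrr nm0 mulr0.
rewrite !big_cons mulrDr.
have -> : u i * \prod_(j <- s) u j - v i * \prod_(j <- s) v j =
  (u i - v i) * \prod_(j <- s) v j + u i * (\prod_(j <- s) u j - \prod_(j <- s) v j) by ring.
apply: le_trans (nmD _ _) _; rewrite !nmM; apply: lerD.
  rewrite mulrC; apply: ler_pM; rewrite ?nm_ge0 //.
  by apply: le_trans (pv s) _; rewrite exprS ler_peMl // exprn_ge0.
by rewrite exprS -mulrA; apply: ler_pM; rewrite ?nm_ge0.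
Qed.

End ComplexPowers.

(** * Dirichlet series of linear forms *)

Section LayerCake.
Context {R : realType} {A I : finType} (b : A -> I -> R).

Definition meets (S : {set I}) (a : A) : bool := [exists i in S, b a i != 0].

Lemma meetsP (S : {set I}) a : reflect (exists2 i, i \in S & b a i != 0) (meets S a).
Proof. exact: exists_inP. Qed.

(* Layer-cake induction: subtract the least positive value of x from its support. *)
Lemma layer_cake (sg : A -> R) (x : I -> R) (m : A -> R) :
  (forall S, S != finset.set0 -> 2 * #|S|%:R <= \sum_(a | meets S a) sg a) ->
  (forall i, 0 <= x i) ->
  (forall a i, b a i != 0 -> x i <= m a) ->
  (forall a, exists2 i, b a i != 0 & x i = m a) ->
  2 * \sum_i x i <= \sum_a sg a * m a.
Proof.
move=> hsg; pose S (x : I -> R) := [set i | 0 < x i]%SET.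
have [k] := ubnP #|S x|; elim: k x m => // k IH x m; rewrite ltnS => Sk x0 mub mat.
have [S0|/set0Pn[i0 Si0]] := eqVneq (S x) finset.set0.
  have xz i : x i = 0.
    apply/eqP; rewrite eq_le x0 andbT leNgt; apply/negP => xi.
    have : i \in S x by rewrite inE.
    by rewrite S0 inE.
  rewrite !big1 ?mulr0 // => a _; have [i _ <-] := mat a; by rewrite xz mulr0.
pose i1 := [arg min_(i < i0 in S x) x i]%O.
have [i1S i1min] : i1 \in S x /\ forall j, j \in S x -> x i1 <= x j.
  by rewrite /i1; case: arg_minP => // i iS h; split.
set mu := x i1 in i1min.
have mu0 : 0 < mu by move: i1S; rewrite inE.
pose x' i := x i - (if i \in S x then mu else 0).
pose m' a := m a - (if meets (S x) a then mu else 0).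
have notS i : i \notin S x -> x i = 0.
  by rewrite inE -leNgt => h; apply/eqP; rewrite eq_le h x0.
have nmeet a i : ~~ meets (S x) a -> b a i != 0 -> i \notin S x.
  by move=> h bi; apply: contra h => iS; apply/meetsP; exists i.
have mpos a : meets (S x) a -> mu <= m a.
  by move=> /meetsP[i iS bi]; apply: le_trans (i1min i iS) (mub a i bi).
have SN : S x != finset.set0 by apply/set0Pn; exists i0.
have h1 : 2 * #|S x|%:R * mu <= (\sum_(a | meets (S x) a) sg a) * mu.
  by rewrite ler_pM2r // hsg.
suff h2 : 2 * \sum_i x i - 2 * #|S x|%:R * mu <= \sum_a sg a * m a - (\sum_(a | meets (S x) a) sg a) * mu.
  lra.
have xS i : i \in S x -> mu <= x i by exact: i1min.
have := IH x' m'; rewrite -/S.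
have -> : 2 * \sum_i x' i = 2 * \sum_i x i - 2 * #|S x|%:R * mu.
  rewrite /x' sumrB mulrBr -big_mkcond /= sumr_const -[mu *+ _]mulr_natl; ring.
have -> : \sum_a sg a * m' a = \sum_a sg a * m a - (\sum_(a | meets (S x) a) sg a) * mu.
  rewrite mulr_suml [in X in _ - X]big_mkcond -sumrB; apply: eq_bigr => a _.
  by rewrite /m'; case: ifP => _; ring.
apply.
- apply: leq_trans Sk; apply: proper_card; apply/properP; split.
    apply/fintype.subsetP => i; rewrite !inE /x'; case: ifP => [|_]; first by rewrite inE.
    by rewrite subr0.
  exists i1 => //; rewrite inE /x' i1S; have -> : x i1 = mu by []; by rewrite subrr ltxx.
- by move=> i; rewrite /x'; case: ifP => [/xS|_]; rewrite ?subr0 ?subr_ge0.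
- move=> a i bi; rewrite /x' /m'; case: ifPn => [iS|iS].
    have -> : meets (S x) a by apply/meetsP; exists i.
    by rewrite lerD2r mub.
  rewrite subr0 (notS i) //; case: ifP => [/mpos|_]; first by rewrite subr_ge0.
  by rewrite subr0 -(notS i) // mub.
- move=> a; have [i bi xi] := mat a; exists i => //.
  rewrite /x' /m' -xi; case: ifPn => [iS|iS].
    by have -> : meets (S x) a by apply/meetsP; exists i.
  case: ifP => // /mpos; rewrite -xi notS // => h; exfalso; lra.
Qed.

End LayerCake.

(** * Dirichlet series with weighted exponents *)

Section Forms.
Context {R : realType} {r N : nat} {A : finType}.
Local Notation C := (Cplx R).
Local Notation Cn := 'rV[C]_N.
Local Notation ix := {ffun 'I_r -> nat}.
Local Notation wt := {ffun A -> int}.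
Variables (b : A -> 'I_r -> R) (ell : A -> 'I_N -> C).
Hypothesis b_ge0 : forall a i, 0 <= b a i.
Hypothesis b_supp : forall a, exists i, b a i != 0.

Definition fL (a : A) (n : ix) : R := \sum_i b a i * (n i).+1%:R.

Lemma fL_gt0 a n : 0 < fL a n.
Proof.
have [i bi] := b_supp a; rewrite /fL (bigD1 i) //=.
rewrite ltr_pwDl //; first by rewrite mulr_gt0 // lt_def bi b_ge0.
by apply: sumr_ge0 => j _; rewrite mulr_ge0.
Qed.

Definition ez (k : wt) (s : Cn) (a : A) : C := linform (ell a) s + (k a)%:~R.

(* The weight k shifts the exponent of the form a, which is the linear function
   ell a of s.  Indices are natural numbers from 0 on, so the summation variable
   of the paper is m_i = (n i).+1. *)
Definition term (k : wt) (s : Cn) (n : ix) : C := \prod_a cpow (fL a n) (- ez k s a).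

Definition wS (S : {set 'I_r}) (k : wt) : int := \sum_(a | meets b S a) k a.

Definition lamS (S : {set 'I_r}) (s : Cn) : C := \sum_(a | meets b S a) linform (ell a) s.

Lemma sum_ez S k s : \sum_(a | meets b S a) ez k s a = lamS S s + (wS S k)%:~R.
Proof. by rewrite /ez big_split /= /wS rmorph_sum. Qed.

Lemma Re_int (k : int) : complex.Re (k%:~R : C) = k%:~R.
Proof. by rewrite -rc_int. Qed.

(** A form is comparable to the largest index m_i occurring in it: it is at least one of its
    coefficients times that index, and at most the sum of its coefficients times it. *)
Lemma fL_log : exists2 K : R, 0 <= K & forall a (n : ix) (m : R),
  (forall i, b a i != 0 -> ln (n i).+1%:R <= m) ->
  (exists2 i, b a i != 0 & ln (n i).+1%:R = m) -> `|ln (fL a n) - m| <= K.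
Proof.
pose K := \sum_a \sum_i `|ln (b a i)| + \sum_a `|ln (\sum_i b a i)|.
have p1 : 0 <= \sum_a \sum_i `|ln (b a i)| by apply: sumr_ge0 => a _; apply: sumr_ge0.
have p2 : 0 <= \sum_a `|ln (\sum_i b a i)| by apply: sumr_ge0.
exists K; first by rewrite addr_ge0.
move=> a n m hub [i bi hi]; rewrite ler_norml; apply/andP; split.
  have bp : 0 < b a i by rewrite lt_def bi b_ge0.
  have h : b a i * (n i).+1%:R <= fL a n.
    rewrite /fL (bigD1 i) //= lerDl; apply: sumr_ge0 => j _; by rewrite mulr_ge0.
  have := h; rewrite -ler_ln ?posrE ?mulr_gt0 ?fL_gt0 // lnM ?posrE // hi => {}h.
  have h2 : `|ln (b a i)| <= \sum_a \sum_i `|ln (b a i)|.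
    rewrite (bigD1 a) //= (bigD1 i) //= -addrA lerDl addr_ge0 // ?sumr_ge0 // => c _.
    exact: sumr_ge0.
  have := ler_norm (- ln (b a i)); rewrite normrN /K; lra.
have sp : 0 < \sum_i b a i.
  rewrite (bigD1 i) //= ltr_pwDl ?lt_def ?bi ?b_ge0 // sumr_ge0 //.
have h : fL a n <= (\sum_i b a i) * expR m.
  rewrite mulr_suml; apply: ler_sum => j _.
  have [->|bj] := eqVneq (b a j) 0; first by rewrite !mul0r.
  by rewrite ler_wpM2l // -[leLHS]lnK ?posrE // ler_expR hub.
have := h; rewrite -ler_ln ?posrE ?mulr_gt0 ?fL_gt0 ?expR_gt0 // lnM ?posrE ?expR_gt0 // expRK => {}h.
have h2 : `|ln (\sum_i b a i)| <= \sum_a `|ln (\sum_i b a i)|.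
  by rewrite (bigD1 a) //= lerDl sumr_ge0.
have := ler_norm (ln (\sum_i b a i)); rewrite /K; lra.
Qed.

Definition wbound (n : ix) : R := \prod_i (n i).+1%:R ^- 2.

Lemma term_bound (X : R) : exists2 K : R, 0 <= K & forall k s n,
  (forall a, nm (ez k s a) <= X) ->
  (forall S, S != finset.set0 -> 2 * #|S|%:R <= complex.Re (lamS S s) + (wS S k)%:~R) ->
  nm (term k s n) <= K * wbound n.
Proof.
have [K0 K00 hK] := fL_log.
exists (expR (\sum_(a : A) `|X| * K0)); first exact: expR_ge0.
move=> k s n hX hS.
pose x i := ln ((n i).+1%:R : R).
have x0 i : 0 <= x i by rewrite ln_ge0 // ler1n.
have mex a : exists m, (forall i, b a i != 0 -> x i <= m) /\ exists2 i, b a i != 0 & x i = m.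
  have [i0 bi0] := b_supp a.
  pose i1 := [arg max_(i > i0 | b a i != 0) x i]%O.
  exists (x i1); rewrite /i1; case: arg_maxP => // i bi h; split; last by exists i.
  exact: h.
have /choice[m hm] := mex.
pose sg a := complex.Re (ez k s a).
have lc : 2 * \sum_i x i <= \sum_a sg a * m a.
  apply: (@layer_cake _ _ _ b) => //; first last.
  - by move=> a; case: (hm a).
  - by move=> a; case: (hm a).
  move=> S SN; rewrite /sg -Re_sum sum_ez ReD Re_int; exact: hS.
have -> : wbound n = expR (- (2 * \sum_i x i)).
  rewrite /wbound mulr_sumr -sumrN expR_sum; apply: eq_bigr => i _.
  by rewrite expRN expRM_natl lnK ?posrE.
rewrite -expRD /term nm_prod.
under eq_bigr do rewrite nm_cpow ReN.
rewrite -expR_sum ler_expR.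
apply: (@le_trans _ _ (\sum_a (`|X| * K0 - sg a * m a))).
  apply: ler_sum => a _; have [h1 h2] := hm a; have := hK a n (m a) h1 h2.
  have hr : `|sg a| <= `|X|.
    by apply: le_trans (Re_le_nm _) _; apply: le_trans (hX a) (ler_norm _).
  move=> h3; have : `|sg a * (ln (fL a n) - m a)| <= `|X| * K0 by rewrite normrM; apply: ler_pM.
  by rewrite ler_norml /sg; lra.
rewrite sumrB; lra.
Qed.

Lemma wbound_sum s : uniq s -> \sum_(n <- s) wbound n <= 2 ^+ r.
Proof.
move=> us; apply: le_trans (sum_prod_bound (b := fun (_ : 'I_r) (m : nat) => (m.+1%:R ^- 2 : R)) (S := fun=> 2) _ _ us) _.
- by move=> i m; rewrite invr_ge0 exprn_ge0.
- by move=> i M; exact: inv_sq_sum_bound.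
- by rewrite prodr_const card_ord.
Qed.

Lemma abs_bounded_wbound (f : ix -> C) K : 0 <= K -> (forall n, nm (f n) <= K * wbound n) ->
  abs_bounded f (K * 2 ^+ r).
Proof.
move=> K0 hf; apply: (@abs_bounded_le _ _ _ (fun n => K * wbound n)) => // s us.
by rewrite -mulr_sumr ler_wpM2l // wbound_sum.
Qed.

(* xget picks the sum when there is one, and 0 otherwise. *)
Definition tsum (f : ix -> C) : C := xget 0 [set l | has_sum f l].

Lemma tsumP (f : ix -> C) K : 0 <= K -> (forall n, nm (f n) <= K * wbound n) -> has_sum f (tsum f).
Proof.
move=> K0 hf; have [l hl] := has_sum_exists (nat_box_exhaustion 'I_r) (abs_bounded_wbound K0 hf).
exact: (xgetPex 0 (ex_intro _ l hl)).
Qed.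

Lemma tsum_eq (f : ix -> C) l : has_sum f l -> tsum f = l.
Proof.
move=> hl; apply: (has_sum_uniq (nat_box_exhaustion 'I_r) _ hl).
exact: (xgetPex 0 (ex_intro _ l hl)).
Qed.

Lemma tsum_hol (F : Cn -> ix -> C) p rho K : 0 <= K ->
  (forall n, hol p rho (fun s => F s n)) ->
  (forall s n, vn (s - p) < rho -> nm (F s n) <= K * wbound n) ->
  hol p rho (fun s => tsum (F s)).
Proof.
move=> K0 hF hK.
apply: (@weierstrass _ _ p rho (fun M s => \sum_(n <- nat_box 'I_r M) F s n) _ (K * 2 ^+ r)).
- by move=> M s hs; apply: hdiff_sum => n _; exact: hF.
- move=> M s hs; apply: le_trans (nm_sum _ _ _) _.
  by apply: (abs_bounded_wbound K0 (fun n => hK s n hs)); exact: nat_box_uniq.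
- move=> s hs; apply: has_sum_clim (nat_box_exhaustion 'I_r) _.
  exact: tsumP K0 (fun n => hK s n hs).
Qed.

Lemma hdiff_ez k a s : hdiff (fun s => ez k s a) s.
Proof. by apply: hdiffD; [exact: hdiff_linform|exact: hdiff_cst]. Qed.

Lemma hdiff_cpow (x : R) (f : Cn -> C) s : hdiff f s -> hdiff (fun s => cpow x (f s)) s.
Proof.
move=> hf; apply: (@hdiff_comp _ _ (fun s => f s * rc (ln x)) (@cexp R)); last exact: cdiff_cexp.
by apply: hdiffM => //; exact: hdiff_cst.
Qed.

Lemma hdiffN (f : Cn -> C) s : hdiff f s -> hdiff (fun s => - f s) s.
Proof.
move=> /(hdiffZ (-1)); rewrite (_ : (fun z => -1 * f z) = fun z => - f z) //.
by apply/funext => z; rewrite mulN1r.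
Qed.

Lemma hdiff_term k n s : hdiff (fun s => term k s n) s.
Proof.
apply: hdiff_prod => a _ _; apply: hdiff_cpow; apply: hdiffN; exact: hdiff_ez.
Qed.

Lemma ez_bounded k (rho : R) : exists2 X, 0 <= X & forall s a, vn s <= rho -> nm (ez k s a) <= X.
Proof.
pose X := \sum_a ((\sum_j nm (ell a j)) * `|rho| + nm ((k a)%:~R : C)).
have p a : 0 <= (\sum_j nm (ell a j)) * `|rho| + nm ((k a)%:~R : C).
  by rewrite addr_ge0 ?nm_ge0 // mulr_ge0 // sum_nm_ge0.
exists X; first exact: sumr_ge0.
move=> s a hs; apply: le_trans (nmD _ _) _.
apply: (@le_trans _ _ ((\sum_j nm (ell a j)) * `|rho| + nm ((k a)%:~R : C))).
  rewrite lerD2r; apply: le_trans (nm_linform _ _) _.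
  by rewrite ler_wpM2l ?sum_nm_ge0 // (le_trans hs) // ler_norm.
by rewrite /X (bigD1 a) //= lerDl sumr_ge0.
Qed.

(** A natural number, because it serves to bound the levels of the carriers meeting a ball and to
    fix the threshold of the recursion. *)
Lemma lamS_bounded (rho : R) : exists B : nat, forall s S, vn s <= rho ->
  - B%:R <= complex.Re (lamS S s).
Proof.
have [X X0 hX] := ez_bounded [ffun=> 0] rho.
pose Y := #|A|%:R * X.
have Y0 : 0 <= Y by rewrite mulr_ge0.
exists (Num.bound Y) => s S hs.
have h : nm (lamS S s) <= Y.
  apply: le_trans (nm_sum _ _ _) _.
  apply: (@le_trans _ _ (\sum_(a | meets b S a) X)).
    by apply: ler_sum => a _; have := hX s a hs; rewrite /ez ffunE addr0.
  rewrite sumr_const -[X *+ _]mulr_natl /Y ler_wpM2r // ler_nat.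
  exact: max_card.
have := archi_boundP Y0; have := Re_le_nm (lamS S s); rewrite ler_norml; lra.
Qed.

Lemma termD k d s n : term (k + d) s n = term k s n * \prod_a rc (fL a n) ^ (- d a).
Proof.
rewrite /term -big_split; apply: eq_bigr => a _ /=.
by rewrite -cpow_int ?fL_gt0 // -cpowD /ez ffunE rmorphD rmorphN; congr cpow => /=; ring.
Qed.

Definition unit_wt (a : A) : wt := [ffun c => (c == a)%:R].

Lemma prod_unit a n (e : int) : \prod_c rc (fL c n) ^ (- (unit_wt a *~ e) c) = rc (fL a n) ^ (- e) :> C.
Proof.
rewrite (bigD1 a) //= big1 ?mulr1.
  by rewrite ffunMzE ffunE eqxx intz.
by move=> c /negPf ca; rewrite ffunMzE ffunE ca mul0rz oppr0.
Qed.

Lemma wSD S k d : wS S (k + d) = wS S k + wS S d.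
Proof. by rewrite /wS -big_split; apply: eq_bigr => a _; rewrite ffunE. Qed.

Lemma wS_unit S a : wS S (unit_wt a) = (meets b S a)%:R.
Proof.
rewrite /wS; case: (boolP (meets b S a)) => h.
  rewrite (bigD1 a) //= ffunE eqxx big1 ?addr0 // => c /andP[_ /negPf ca].
  by rewrite ffunE ca.
rewrite big1 // => c hc; rewrite ffunE; case: eqP => // ca; by rewrite ca (negPf h) in hc.
Qed.

End Forms.

(** * The identity obtained by shifting an index *)

Section Euler.
Context {R : realType} {r N : nat} {A : finType}.
Local Notation C := (Cplx R).
Local Notation Cn := 'rV[C]_N.
Local Notation ix := {ffun 'I_r -> nat}.
Local Notation wt := {ffun A -> int}.
Variables (b : A -> 'I_r -> R) (ell : A -> 'I_N -> C).
Hypothesis b_ge0 : forall a i, 0 <= b a i.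
Hypothesis b_supp : forall a, exists i, b a i != 0.
Variable sm : 'I_r -> A.
Hypothesis b_sm : forall i l, b (sm i) l = (l == i)%:R.
Variable pr : 'I_r -> 'I_r -> A.
Hypothesis b_pr : forall i j l, i != j -> b (pr i j) l = (l == i)%:R + (l == j)%:R.

Local Notation fL := (fL b).
Local Notation ez := (ez ell).
Local Notation term := (term b ell).
Local Notation wS := (wS b).
Local Notation lamS := (lamS b ell).
Local Notation u := (@unit_wt A).

Let fL_gt0 a n : 0 < fL a n. Proof. exact: fL_gt0. Qed.

Definition Dsum (k : wt) (s : Cn) : C := tsum (term k s).

(* A region where all series with weights at least -1 converge absolutely; the
   identities between them are proved there and extended by continuation. *)
Definition Omega (s : Cn) : Prop := forall S, S != finset.set0 ->
  2 * #|S|%:R + 1 <= complex.Re (lamS S s).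

Lemma meets_sm S i : meets b S (sm i) = (i \in S).
Proof.
apply/meetsP/idP => [[j jS]|iS]; first by rewrite b_sm; case: (eqVneq j i) => [<-|_] //; rewrite eqxx.
by exists i => //; rewrite b_sm eqxx oner_eq0.
Qed.

Lemma meets_pr S i j : i != j -> meets b S (pr i j) = (i \in S) || (j \in S).
Proof.
move=> ij; apply/meetsP/orP => [[l lS]|[h|h]].
- rewrite b_pr //; case: (eqVneq l i) => [<-|_]; first by left.
  by case: (eqVneq l j) => [<-|_]; [right|rewrite addr0 eqxx].
- by exists i => //; rewrite b_pr // eqxx (negPf ij) addr0 oner_eq0.
- by exists j => //; rewrite b_pr // eqxx (eq_sym j) (negPf ij) add0r oner_eq0.
Qed.

Lemma fL_sm i n : fL (sm i) n = (n i).+1%:R.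
Proof.
rewrite /(fL _ _) (bigD1 i) //= b_sm eqxx mul1r big1 ?addr0 // => j /negPf ij.
by rewrite b_sm ij mul0r.
Qed.

Lemma fL_pr i j n : i != j -> fL (pr i j) n = (n i).+1%:R + (n j).+1%:R.
Proof.
move=> ij; rewrite -!fL_sm /(fL _ _) -big_split; apply: eq_bigr => l _ /=.
by rewrite b_pr // !b_sm mulrDl.
Qed.

Lemma Dsum_has_sum k s :
  (forall S, S != finset.set0 -> 2 * #|S|%:R <= complex.Re (lamS S s) + (wS S k)%:~R) ->
  has_sum (term k s) (Dsum k s).
Proof.
move=> h; have [X X0 hX] := ez_bounded ell k (vn s).
have [K K0 hK] := term_bound ell b_ge0 b_supp X.
apply: (tsumP K0) => n; apply: hK => // a; exact: hX.
Qed.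

Lemma Dsum_Omega k s : Omega s -> (forall S, S != finset.set0 -> -1 <= wS S k) ->
  has_sum (term k s) (Dsum k s).
Proof.
move=> hs hk; apply: Dsum_has_sum => S SN; have := hs S SN.
have : (-1)%:~R <= (wS S k)%:~R :> R by rewrite ler_int; exact: hk.
rewrite mulrN1z => h1 h2; lra.
Qed.

Lemma term_sub_unit k a s n : term (k - u a) s n = rc (fL a n) * term k s n.
Proof.
rewrite termD // mulrC; congr (_ * _).
by have := @prod_unit R r A b a n (-1); rewrite opprK expr1z => <-; rewrite mulrN1z.
Qed.

Lemma term_add_unit k a s n (m : nat) : term (k + u a *+ m) s n = rc (fL a n) ^- m * term k s n.
Proof.
rewrite termD // mulrC; congr (_ * _).
by have := @prod_unit R r A b a n m; rewrite -exprnN => <-.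
Qed.

(** The summand is multiplied by (m_i + m_j) / (m_i + m_j), since lowering the exponent of [sm i] by
    1 multiplies it by m_i. *)
Lemma Dsum_split k s i j : i != j -> Omega s -> (forall S, S != finset.set0 -> 0 <= wS S k) ->
  Dsum k s = Dsum (k + u (pr i j) - u (sm i)) s + Dsum (k + u (pr i j) - u (sm j)) s.
Proof.
move=> ij hs hk.
have w1 l : (l == i) || (l == j) -> forall S, S != finset.set0 -> -1 <= wS S (k + u (pr i j) - u (sm l)).
  move=> lij S SN; rewrite wSD -[- u _]mulN1r.
  have -> : wS S (-1 * u (sm l)) = - (meets b S (sm l))%:R.
    by rewrite -wS_unit /(wS _ _) -sumrN; apply: eq_bigr => a _; rewrite mulN1r ffunE.
  rewrite wSD wS_unit; have := hk S SN.
  by case: (meets b S (pr i j)); case: (meets b S (sm l)); lia.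
have hl := Dsum_Omega hs (w1 i ltac:(by rewrite eqxx)).
have hr := Dsum_Omega hs (w1 j ltac:(by rewrite eqxx orbT)).
apply: tsum_eq; apply: eq_has_sum (has_sumD hl hr) => n.
rewrite !term_sub_unit -!mulrDl !fL_sm -rcD -fL_pr //.
have := term_add_unit k (pr i j) s n 1; rewrite mulr1n => ->.
by rewrite mulrA expr1 divff ?mul1r // -nm_gt0 nm_rc normr_gt0 gt_eqF.
Qed.

Definition sh (i : 'I_r) (n : ix) : ix := [ffun l => (n l + (l == i))%N].

(** The factor [n i] kills the terms outside the image of the shift, so there is no boundary
    term. *)
Lemma shift_has_sum i (f : ix -> C) l : has_sum (fun n : ix => (n i)%:R * f n) l ->
  has_sum (fun n : ix => (n i).+1%:R * f (sh i n)) l.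
Proof.
have inj : injective (sh i).
  by move=> a c /ffunP h; apply/ffunP => j; have := h j; rewrite !ffunE => /addIn.
move=> /(has_sum_reindex inj) h; apply: eq_has_sum (h _) => [n /=|n hn].
  by rewrite ffunE eqxx addn1.
case: (posnP (n i)) => [->|ni]; first by rewrite mul0r.
exfalso; apply: (hn [ffun j => (n j - (j == i))%N]); apply/ffunP => j; rewrite !ffunE.
by case: eqP => [->|_] /=; rewrite ?subn0 ?addn0 // subnK.
Qed.

Variables (M : nat) (k : wt).
Local Notation Q := {ffun A -> 'I_M.+2}.

Definition qw (q : Q) : wt := [ffun a => (q a : nat)%:Z].
Definition qdeg (q : Q) : nat := \sum_a q a.

(** The coefficient of the monomial [q] when every (L_a + b_ai)^(-e_a), with e_a = [ez k s a], is
    expanded in powers of b_ai / L_a; the powers of the L_a themselves are carried by the weight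
    [qw q]. *)
Definition cf (i : 'I_r) (q : Q) (s : Cn) : C :=
  \prod_a (binc (ez k s a) (q a) * rc (b a i) ^+ q a).

(* Error of the Taylor expansion, in the shift of the i-th index, of the summand;
   the factor (n i).+1 is absorbed by lowering the weight of the form sm i. *)
Definition rem (i : 'I_r) (s : Cn) (n : ix) : C :=
  (n i).+1%:R * term k s (sh i n) - \sum_(q : Q) cf i q s * term (k + qw q - u (sm i)) s n.

Lemma fL_sh i a n : fL a (sh i n) = fL a n + b a i.
Proof.
rewrite /(fL _ (sh i n)) /(fL _ n) (bigD1 i) //= [in RHS](bigD1 i) //= ffunE eqxx addn1.
rewrite (eq_bigr (fun j => b a j * (n j).+1%:R)); last first.
  by move=> j /negPf ij; rewrite ffunE ij addn0.
by rewrite -[(n i).+2%:R]natr1; ring.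
Qed.

Let X i a n := b a i / fL a n.

Let X01 i a n : 0 <= X i a n <= 1.
Proof.
rewrite /X divr_ge0 ?b_ge0 ?(ltW (fL_gt0 _ _)) //= ler_pdivrMr // mul1r /(fL _ _) (bigD1 i) //=.
apply: (@le_trans _ _ (b a i * (n i).+1%:R)).
  by rewrite ler_peMr // ler1n.
by rewrite lerDl; apply: sumr_ge0 => j _; rewrite mulr_ge0.
Qed.

Lemma term_sh i s n : term k s (sh i n) =
  term k s n * \prod_a cpow (1 + X i a n) (- ez k s a).
Proof.
rewrite /(term _ _ _) -big_split; apply: eq_bigr => a _ /=.
rewrite -cpowM //; last by have /andP[h _] := X01 i a n; lra.
by rewrite fL_sh /X mulrDr mulr1 mulrCA divff ?mulr1 // gt_eqF.
Qed.

Lemma sum_cf i s n : \sum_(q : Q) cf i q s * term (k + qw q - u (sm i)) s n =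
  (n i).+1%:R * term k s n * \prod_a tay M.+2 (X i a n) (ez k s a).
Proof.
rewrite bigA_distr_bigA mulr_sumr; apply: eq_bigr => q _.
rewrite term_sub_unit fL_sm rc_nat termD // /cf.
rewrite mulrC -!mulrA; congr (_ * (_ * _)); rewrite -big_split; apply: eq_bigr => a _ /=.
rewrite ffunE -exprnN /X rcM rcV exprMn exprVn; ring.
Qed.

Lemma remE i s n : rem i s n = (n i).+1%:R * term k s n *
  (\prod_a cpow (1 + X i a n) (- ez k s a) - \prod_a tay M.+2 (X i a n) (ez k s a)).
Proof. by rewrite /rem sum_cf term_sh; ring. Qed.

Lemma rem_bound i (Z : R) : 0 <= Z -> exists2 K : R, 0 <= K & forall s n,
  (forall a, nm (ez k s a) <= Z) ->
  nm (rem i s n) <= K * \sum_(a | b a i != 0) nm (term (k + u a *+ M.+2 - u (sm i)) s n).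
Proof.
move=> Z0; have [K K0 hK] := tay_bound M.+2 Z0.
have [K1 K10 hK1] := tay_bound 0 Z0.
pose T := K1 + K + 1.
have T1 : 1 <= T by rewrite /T; lra.
pose c := \sum_a (b a i) ^+ M.+2.
have c0 a : 0 <= (b a i) ^+ M.+2 by rewrite exprn_ge0.
exists (T ^+ #|A| * K * c); first by rewrite !mulr_ge0 ?exprn_ge0 ?sumr_ge0 //; lra.
move=> s n hZ; rewrite remE nmM.
pose U a := cpow (1 + X i a n) (- ez k s a); pose V a := tay M.+2 (X i a n) (ez k s a).
have hU a : nm (U a) <= K1.
  have := hK1 (X i a n) (ez k s a) (X01 i a n) (hZ a).
  by rewrite /tay big_ord0 subr0 expr0 mulr1.
have hUV a : nm (U a - V a) <= K * X i a n ^+ M.+2 by apply: hK.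
have hV a : nm (V a) <= K1 + K.
  have -> : V a = U a - (U a - V a) by ring.
  apply: le_trans (nm_sub _ _) _; apply: lerD => //; apply: le_trans (hUV a) _.
  by rewrite ler_piMr // exprn_ile1 //; case/andP: (X01 i a n).
have h1 : nm (\prod_a U a - \prod_a V a) <= T ^+ #|A| * \sum_a nm (U a - V a).
  rewrite cardE -!big_enum /=; apply: prod_diff_bound => // a.
    by apply: le_trans (hU a) _; rewrite /T; lra.
  by apply: le_trans (hV a) _; rewrite /T; lra.
apply: le_trans (ler_wpM2l (nm_ge0 _) h1) _.
have -> : nm ((n i).+1%:R * term k s n) * (T ^+ #|A| * \sum_a nm (U a - V a)) =
  T ^+ #|A| * \sum_a nm ((n i).+1%:R * term k s n) * nm (U a - V a).
  by rewrite mulrCA; congr (_ * _); rewrite mulr_sumr.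
rewrite -!mulrA ler_wpM2l ?exprn_ge0 //; first by lra.
rewrite [in leLHS](bigID (fun a => b a i != 0)) /= [X in _ + X]big1 ?addr0; last first.
  move=> a; rewrite negbK => /eqP ba; have : nm (U a - V a) <= 0.
    by apply: le_trans (hUV a) _; rewrite /X ba mul0r expr0n mulr0.
  by move=> /nm_le0_eq0 ->; rewrite nm0 mulr0.
rewrite mulrA mulr_sumr; apply: ler_sum => a ba.
rewrite term_sub_unit term_add_unit fL_sm rc_nat.
have -> : nm ((n i).+1%:R * (rc (fL a n) ^- M.+2 * term k s n)) =
  nm ((n i).+1%:R * term k s n) * fL a n ^- M.+2.
  by rewrite !nmM nmV nmX nm_rc gtr0_norm //; ring.
apply: (@le_trans _ _ (nm ((n i).+1%:R * term k s n) * (K * X i a n ^+ M.+2))).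
  by rewrite ler_wpM2l ?nm_ge0.
rewrite [leRHS]mulrCA ler_wpM2l ?nm_ge0 // -mulrA ler_wpM2l //.
rewrite /X expr_div_n ler_wpM2r ?invr_ge0 ?exprn_ge0 ?(ltW (fL_gt0 _ _)) //.
by rewrite /c (bigD1 a) //= lerDl sumr_ge0.
Qed.

Lemma wS_qw S (q : Q) : 0 <= wS S (qw q).
Proof. by apply: sumr_ge0 => a _; rewrite ffunE. Qed.

Lemma wSN S d : wS S (- d) = - wS S d.
Proof. by rewrite /(wS _ _) -sumrN; apply: eq_bigr => a _; rewrite ffunE. Qed.

Lemma qw0 : qw [ffun=> ord0] = 0.
Proof. by apply/ffunP => a; rewrite !ffunE. Qed.

Lemma cf0 i s : cf i [ffun=> ord0] s = 1.
Proof. by rewrite /cf big1 // => a _; rewrite ffunE /= expr0 mulr1. Qed.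

Hypothesis k_ge0 : forall S, S != finset.set0 -> 0 <= wS S k.

(** The sum of m_i - 1 times the summand equals the sum of m_i times the shifted summand. The Taylor
    term of degree 0 of the latter is the sum of m_i times the summand; it cancels on both sides and
    leaves [Dsum k]. *)
Lemma euler_one i s l : Omega s -> has_sum (rem i s) l ->
  0 = Dsum k s + \sum_(q : Q | q != [ffun=> ord0]) cf i q s * Dsum (k + qw q - u (sm i)) s + l.
Proof.
move=> hs hl.
have w1 q S : S != finset.set0 -> -1 <= wS S (k + qw q - u (sm i)).
  move=> SN; rewrite wSD wSN wSD wS_unit; have := k_ge0 SN; have := wS_qw S q.
  by case: (meets b S (sm i)); lia.
have hq q := Dsum_Omega hs (w1 q).
have hD : has_sum (term k s) (Dsum k s).
  by apply: Dsum_Omega => // S /k_ge0; lia.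
have h0 : has_sum (fun n : ix => (n i).+1%:R * term k s n) (Dsum (k + qw [ffun=> ord0] - u (sm i)) s).
  by apply: eq_has_sum (hq [ffun=> ord0]) => n; rewrite qw0 addr0 term_sub_unit fL_sm rc_nat.
have h1 : has_sum (fun n : ix => (n i)%:R * term k s n) (Dsum (k + qw [ffun=> ord0] - u (sm i)) s - Dsum k s).
  by apply: eq_has_sum (has_sumB h0 hD) => n; rewrite -natr1; ring.
have h2 := shift_has_sum h1.
have h3 : has_sum (fun n : ix => \sum_(q : Q) cf i q s * term (k + qw q - u (sm i)) s n)
    (\sum_(q : Q) cf i q s * Dsum (k + qw q - u (sm i)) s).
  by apply: has_sum_sum => q _; apply: has_sumZ.
have := has_sum_uniq (nat_box_exhaustion _) hl (has_sumB h2 h3).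
rewrite (bigD1 [ffun=> ord0]) //= cf0 => ->; ring.
Qed.

Definition delta_q (a : A) : Q := [ffun c => if c == a then inord 1 else ord0].

Lemma delta_qE a c : delta_q a c = (c == a)%N :> nat.
Proof. by rewrite ffunE; case: eqP => // _; rewrite inordK. Qed.

Lemma qw_delta a : qw (delta_q a) = u a.
Proof. by apply/ffunP => c; rewrite !ffunE -[nat_of_ord _]/(nat_of_ord _); case: eqP => // _; rewrite inordK. Qed.

Lemma cf_delta i a s : cf i (delta_q a) s = - ez k s a * rc (b a i).
Proof.
rewrite /cf (bigD1 a) //= !delta_qE eqxx big1 ?mulr1; last first.
  by move=> c /negPf ca; rewrite delta_qE ca expr0 mulr1.
by rewrite /= expr1 divr1 mulr1.
Qed.

Lemma sum_deg1 (G : Q -> C) : \sum_(q | qdeg q == 1%N) G q = \sum_a G (delta_q a).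
Proof.
have inj : injective delta_q.
  by move=> a c /ffunP /(_ a) /(congr1 val) /=; rewrite !delta_qE eqxx; case: eqP.
rewrite (eq_bigl (mem [set delta_q a | a : A]%SET)); last first.
  move=> q; apply/idP/imsetP => [/eqP h|[a _ ->]]; last first.
    rewrite /qdeg (bigD1 a) //= delta_qE eqxx big1 // => c /negPf ca; by rewrite delta_qE ca.
  have [a qa] : exists a, q a != 0%N :> nat.
    apply/existsP; rewrite -negb_forall; apply/negP => /forallP q0.
    by move: h; rewrite /qdeg big1 // => a _; apply/eqP; exact: q0.
  exists a => //; apply/ffunP => c; apply/val_inj; rewrite /= delta_qE.
  move: h; rewrite /qdeg (bigD1 a) //=.
  have [->|ca] := eqVneq c a; first by move: qa; case: (nat_of_ord (q a)) => // [[|m]]; lia.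
  rewrite (bigD1 c) //= => h; have h2 : (q a + q c <= 1)%N by rewrite -h addnA leq_addr.
  move: qa h2; case: (nat_of_ord (q a)) => // m _.
  by rewrite addSn ltnS leqn0 addn_eq0 => /andP[_ /eqP->].
by rewrite big_imset // => x y _ _ /inj.
Qed.

Lemma sum_b_term a s n : \sum_i rc (b a i) * term (k + u a - u (sm i)) s n = term k s n.
Proof.
under eq_bigr do rewrite term_sub_unit fL_sm mulrA -rcM.
rewrite -mulr_suml -rc_sum -/(fL a n).
have := term_add_unit k a s n 1; rewrite mulr1n => ->.
by rewrite mulrA expr1 divff ?mul1r // -nm_gt0 nm_rc normr_gt0 gt_eqF.
Qed.

Lemma sum_b_Dsum a s : Omega s ->
  \sum_i rc (b a i) * Dsum (k + u a - u (sm i)) s = Dsum k s.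
Proof.
move=> hs; apply/esym/tsum_eq.
apply: (@eq_has_sum _ _ (fun n : ix => \sum_i rc (b a i) * term (k + u a - u (sm i)) s n)).
  by move=> n; rewrite sum_b_term.
apply: has_sum_sum => i _; apply: has_sumZ; apply: Dsum_Omega => // S SN.
rewrite wSD wSN wSD !wS_unit; have := k_ge0 SN.
by case: (meets b S (sm i)); case: (meets b S a); lia.
Qed.

(** [euler_one] is summed over i in S. The linear terms have coefficients -e_a b_ai, with e_a =
    [ez k s a]. Completing their sum over i to all indices produces the factor L_a, hence -e_a D_k,
    and so the total exponent of the forms meeting S. The indices added outside S form the first sum
    on the right, and each i in S contributes 1 to |S|. *)
Lemma euler_identity (S : {set 'I_r}) s (l : 'I_r -> C) : Omega s ->
  (forall i, i \in S -> has_sum (rem i s) (l i)) ->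
  (lamS S s - #|S|%:R + (wS S k)%:~R) * Dsum k s =
  \sum_(a | meets b S a) \sum_(i | i \notin S) ez k s a * rc (b a i) * Dsum (k + u a - u (sm i)) s +
  \sum_(i in S) (\sum_(q : Q | (1 < qdeg q)%N) cf i q s * Dsum (k + qw q - u (sm i)) s + l i).
Proof.
move=> hs hl.
have e1 i : i \in S -> - Dsum k s =
   \sum_a - ez k s a * rc (b a i) * Dsum (k + u a - u (sm i)) s +
   (\sum_(q : Q | (1 < qdeg q)%N) cf i q s * Dsum (k + qw q - u (sm i)) s + l i).
  move=> iS; have := euler_one hs (hl i iS).
  rewrite (bigID (fun q => qdeg q == 1%N)) /=.
  rewrite (eq_bigl (fun q => qdeg q == 1%N)); last first.
    move=> q; have [->|//] := eqVneq q [ffun=> ord0].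
    by rewrite /qdeg big1 // => a _; rewrite ffunE.
  rewrite sum_deg1.
  rewrite [X in _ + (_ + X)](eq_bigl (fun q => (1 < qdeg q)%N)); last first.
    move=> q; have [->|q0] := eqVneq q [ffun=> ord0].
      by rewrite /qdeg big1 // => a _; rewrite ffunE.
    suff : qdeg q != 0%N by case: (qdeg q) => // [[|m]].
    apply: contra q0; rewrite /qdeg sum_nat_eq0 => /forallP h.
    by apply/eqP/ffunP => a; rewrite ffunE; apply/val_inj; apply/eqP; exact: h.
  under [X in _ + (X + _)]eq_bigr do rewrite cf_delta qw_delta.
  by move=> /esym/eqP; rewrite -!addrA addr_eq0 => /eqP h; rewrite [X in - X = _]h opprK.
have e2 : - #|S|%:R * Dsum k s = \sum_(i in S) \sum_a - ez k s a * rc (b a i) * Dsum (k + u a - u (sm i)) s +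
   \sum_(i in S) (\sum_(q : Q | (1 < qdeg q)%N) cf i q s * Dsum (k + qw q - u (sm i)) s + l i).
  rewrite -big_split /= -(eq_bigr _ (fun i iS => e1 i iS)) sumr_const -mulr_natl; ring.
rewrite exchange_big /= (bigID (meets b S)) /= [X in _ + X + _]big1 in e2; last first.
  move=> a /meetsP nm; rewrite big1 // => i iS.
  have -> : b a i = 0 by apply/eqP; apply/negPn/negP => h; apply: nm; exists i.
  by rewrite rc0 mulr0 mul0r.
rewrite addr0 in e2.
have e3 a : \sum_(i in S) - ez k s a * rc (b a i) * Dsum (k + u a - u (sm i)) s =
   - ez k s a * Dsum k s + \sum_(i | i \notin S) ez k s a * rc (b a i) * Dsum (k + u a - u (sm i)) s.
  rewrite -(sum_b_Dsum a hs) [in RHS](bigID (mem S)) /= mulrDr !mulr_sumr -addrA -big_split /=.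
  rewrite [X in _ = _ + X]big1 ?addr0; last by move=> i _; ring.
  by apply: eq_bigr => i _; ring.
rewrite (eq_bigr _ (fun a _ => e3 a)) big_split /= -mulr_suml sumrN sum_ez in e2.
have -> : (lamS S s - #|S|%:R + (wS S k)%:~R) * Dsum k s =
  (lamS S s + (wS S k)%:~R) * Dsum k s + - #|S|%:R * Dsum k s by ring.
by rewrite e2; ring.
Qed.

End Euler.

(** * The recursion producing the expansion on a ball *)

Section Recursion.
Context {R : realType} {r N : nat} {A : finType}.
Local Notation C := (Cplx R).
Local Notation Cn := 'rV[C]_N.
Local Notation ix := {ffun 'I_r -> nat}.
Local Notation wt := {ffun A -> int}.
Local Notation carr := ({set 'I_r} * nat)%type.
Variables (b : A -> 'I_r -> R) (ell : A -> 'I_N -> C).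
Hypothesis b_ge0 : forall a i, 0 <= b a i.
Hypothesis b_supp : forall a, exists i, b a i != 0.
Variable sm : 'I_r -> A.
Hypothesis b_sm : forall i l, b (sm i) l = (l == i)%:R.
Variable pr : 'I_r -> 'I_r -> A.
Hypothesis b_pr : forall i j l, i != j -> b (pr i j) l = (l == i)%:R + (l == j)%:R.

Local Notation wS := (wS b).
Local Notation lamS := (lamS b ell).
Local Notation u := (@unit_wt A).
Local Notation Dsum := (Dsum b ell).
Local Notation Omega := (Omega b ell).
Local Notation rem := (rem b ell sm).

Variables (rho : R) (B : nat).
Hypothesis hB : forall s S, vn s < rho -> S != finset.set0 ->
  2 * #|S|%:R - B%:R <= complex.Re (lamS S s).

(** [B] is the threshold of the recursion: once all weights have reached it, the series converges
    absolutely on the whole ball. *)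
Lemma conv_of_wS k s : vn s < rho -> (forall S, S != finset.set0 -> B%:Z <= wS S k) ->
  forall S, S != finset.set0 -> 2 * #|S|%:R <= complex.Re (lamS S s) + (wS S k)%:~R.
Proof.
move=> hs hk S SN; have := hB hs SN.
have : (B%:Z)%:~R <= (wS S k)%:~R :> R by rewrite ler_int; exact: hk.
rewrite -pmulrn => h1 h2; lra.
Qed.

Lemma term_good k : (forall S, S != finset.set0 -> B%:Z <= wS S k) ->
  exists2 K, 0 <= K & forall s n, vn s < rho -> nm (term b ell k s n) <= K * wbound n.
Proof.
move=> hk; have [X X0 hX] := ez_bounded ell k rho.
have [K K0 hK] := term_bound ell b_ge0 b_supp X.
exists K => // s n hs; apply: hK; first by move=> a; apply: hX; exact: ltW.
exact: conv_of_wS.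
Qed.

Lemma Dsum_hol k : (forall S, S != finset.set0 -> B%:Z <= wS S k) -> hol 0 rho (Dsum k).
Proof.
move=> /term_good[K K0 hK]; apply: (tsum_hol K0).
  by move=> n s _; exact: hdiff_term.
by move=> s n; rewrite subr0; exact: hK.
Qed.

Lemma hdiff_binc (f : Cn -> C) q s : hdiff f s -> hdiff (fun s => binc (f s) q) s.
Proof.
elim: q f => [|q IH] f hf /=; first exact: hdiff_cst.
apply: hdiffM; first by apply: hdiffM; [exact: hdiffN|exact: hdiff_cst].
by apply: (IH (fun s => f s + 1)); apply: hdiffD => //; exact: hdiff_cst.
Qed.

Lemma hdiff_cf M k i (q : {ffun A -> 'I_M.+2}) s : hdiff (fun s => cf b ell k i q s) s.
Proof.
apply: hdiff_prod => a _ _; apply: hdiffM; last exact: hdiff_cst.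
by apply: hdiff_binc; exact: hdiff_ez.
Qed.

Lemma hdiff_rem M k i n s : hdiff (fun s => rem M k i s n) s.
Proof.
apply: hdiffB; first by apply: hdiffM; [exact: hdiff_cst|exact: hdiff_term].
apply: hdiff_sum => q _; apply: hdiffM; [exact: hdiff_cf|exact: hdiff_term].
Qed.

Lemma rem_sum M k i :
  (forall a, b a i != 0 -> forall S, S != finset.set0 ->
     B%:Z <= wS S (k + u a *+ M.+2 - u (sm i))) ->
  exists2 f : Cn -> C, hol 0 rho f & forall s, vn s < rho -> has_sum (rem M k i s) (f s).
Proof.
move=> hk; have [Z Z0 hZ] := ez_bounded ell k rho.
have [K K0 hK] := rem_bound ell b_ge0 b_supp b_sm M k i Z0.
have ex a : exists Ka, 0 <= Ka /\ (b a i != 0 -> forall s n, vn s < rho ->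
    nm (term b ell (k + u a *+ M.+2 - u (sm i)) s n) <= Ka * wbound n).
  have [ba|ba] := eqVneq (b a i) 0; first by exists 0.
  by have [Ka Ka0 hKa] := term_good (hk a ba); exists Ka; split => // _.
have [Ka hKa] := choice ex.
have S0 : 0 <= \sum_(a | b a i != 0) Ka a.
  by apply: sumr_ge0 => a _; case: (hKa a).
have bnd s n : vn s < rho -> nm (rem M k i s n) <= (K * \sum_(a | b a i != 0) Ka a) * wbound n.
  move=> hs; apply: le_trans (hK s n _) _; first by move=> a; apply: hZ; exact: ltW.
  rewrite -mulrA ler_wpM2l // mulr_suml; apply: ler_sum => a ba.
  by have [_ h] := hKa a; exact: h.
exists (fun s => tsum (rem M k i s)).
  apply: (tsum_hol (mulr_ge0 K0 S0)).
    by move=> n s _; exact: hdiff_rem.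
  by move=> s n; rewrite subr0; exact: bnd.
by move=> s hs; apply: (tsumP (mulr_ge0 K0 S0)) => n; exact: bnd.
Qed.

Definition Lam (c : carr) (s : Cn) : C := lamS c.1 s - #|c.1|%:R + c.2%:R.

Lemma Lam_neq0 c s : Omega s -> c.1 != finset.set0 -> Lam c s != 0.
Proof.
move=> hs hc; apply/eqP => h; have := hs _ hc.
have : complex.Re (Lam c s) = 0 by rewrite h.
rewrite /Lam ReD ReB -(rc_nat #|c.1|) -(rc_nat c.2) /=.
have : 0 <= #|c.1|%:R :> R by []. have : 0 <= c.2%:R :> R by [].
lra.
Qed.

(** Unlike a flag, a chain may be empty: the empty one carries the holomorphic part. *)
Definition chain (F : seq carr) : bool :=
  all (fun c : carr => c.1 != finset.set0) F && sorted (fun c d : carr => c.1 \proper d.1) F.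

(* The level of a carrier is at least the weight of its support: once that weight
   has increased strictly, dividing by Lam (S, wS S k) meets a different level. *)
Definition flag_ok (k : wt) (F : seq carr) : bool :=
  chain F && all (fun c : carr => (wS c.1 k < B%:Z) && (wS c.1 k <= c.2%:Z)) F.

Definition invprod (F : seq carr) (s : Cn) : C := \prod_(c <- F) (Lam c s)^-1.

(** Finite sums of holomorphic functions divided by products of carrier forms, as an inductive
    closure, so that multiplication by a function and division by a form are checked term by term.
    [expd_ext] asks for equality on [Omega] only, where the identities between the series hold. *)
Inductive expd (k : wt) : (Cn -> C) -> Prop :=
| expd_term F K : flag_ok k F -> hol 0 rho K -> expd k (fun s => K s * invprod F s)
| expd_zero : expd k (fun=> 0)
| expd_add f g : expd k f -> expd k g -> expd k (fun s => f s + g s)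
| expd_ext f g : expd k f -> (forall s, vn s < rho -> Omega s -> f s = g s) -> expd k g.

Lemma expd_hol k f : hol 0 rho f -> expd k f.
Proof.
move=> hf; apply: (@expd_ext _ (fun s => f s * invprod [::] s)).
  by apply: expd_term.
by move=> s _ _; rewrite /invprod big_nil mulr1.
Qed.

Lemma expd_mul k f g : hol 0 rho g -> expd k f -> expd k (fun s => g s * f s).
Proof.
move=> hg; elim=> {f} [F K hF hK| |f1 f2 _ h1 _ h2|f1 f2 _ h1 e].
- apply: (@expd_ext _ (fun s => (g s * K s) * invprod F s)); last by move=> s _ _; rewrite mulrA.
  by apply: expd_term => // s hs; apply: hdiffM; [exact: hg|exact: hK].
- by apply: (expd_ext (expd_zero k)) => s _ _; rewrite mulr0.
- by apply: (expd_ext (expd_add h1 h2)) => s _ _; rewrite mulrDr.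
- by apply: (expd_ext h1) => s hs ho; rewrite e.
Qed.

Lemma expd_sum k (I : Type) (t : seq I) (P : pred I) (f : I -> Cn -> C) :
  (forall i, P i -> expd k (f i)) -> expd k (fun s => \sum_(i <- t | P i) f i s).
Proof.
move=> h; elim: t => [|i t IH].
  by apply: (expd_ext (expd_zero k)) => s _ _; rewrite big_nil.
have [Pi|nPi] := boolP (P i).
  by apply: (expd_ext (expd_add (h i Pi) IH)) => s _ _; rewrite big_cons Pi.
by apply: (expd_ext IH) => s _ _; rewrite big_cons (negPf nPi).
Qed.

Lemma flag_ok_mono k k' F : (forall S, S != finset.set0 -> wS S k <= wS S k') ->
  flag_ok k' F -> flag_ok k F.
Proof.
move=> h /andP[ch /allP ok]; rewrite /flag_ok ch /=; apply/allP => c cF.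
have cN : c.1 != finset.set0 by have /andP[/allP h0 _] := ch; exact: h0.
have /andP[h1 h2] := ok c cF.
by rewrite (le_lt_trans (h _ cN) h1) (le_trans (h _ cN) h2).
Qed.

Lemma expd_mono k k' f : (forall S, S != finset.set0 -> wS S k <= wS S k') ->
  expd k' f -> expd k f.
Proof.
move=> h; elim=> {f} [F K hF hK| |f1 f2 _ h1 _ h2|f1 f2 _ h1 e].
- by apply: expd_term => //; exact: flag_ok_mono hF.
- exact: expd_zero.
- exact: expd_add.
- exact: expd_ext h1 e.
Qed.

Lemma invprod_cons c F s : invprod (c :: F) s = (Lam c s)^-1 * invprod F s.
Proof. by rewrite /invprod big_cons. Qed.

(* Dividing by the smallest form of the chain: a partial fraction decomposition
   keeps at most one carrier per support. *)
Lemma expd_div k k' S0 (w0 : nat) f : S0 != finset.set0 -> wS S0 k = w0%:Z -> (w0 < B)%N ->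
  (forall S, S != finset.set0 -> wS S k <= wS S k') -> wS S0 k < wS S0 k' ->
  (forall S, S != finset.set0 -> wS S k < B%:Z -> S0 \subset S) ->
  expd k' f -> expd k (fun s => f s / Lam (S0, w0) s).
Proof.
move=> S0N w0E w0B kk' k0 Smin; elim=> {f} [F K hF hK| |f1 f2 _ h1 _ h2|f1 f2 _ h1 e].
- have hF' := flag_ok_mono kk' hF.
  have [[c [F' [FE cE]]]|nhead] := pselect (exists c F', F = c :: F' /\ c.1 = S0).
    move: hF' hF; rewrite FE => hF' hF.
    have wc : (w0 < c.2)%N.
      move: hF; rewrite /flag_ok /= => /andP[_ /andP[/andP[_ h] _]]; move: h; rewrite cE; move: k0; rewrite w0E; lia.
    have hF2 : flag_ok k ((S0, w0) :: F').
      move: hF'; rewrite {1}/flag_ok /chain /= => /andP[/andP[/andP[h1 h2] h3] /andP[h4 h5]].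
      rewrite /flag_ok /chain /= h2 h5 S0N w0E lexx !andbT /= ltz_nat w0B andbT.
      by case: F' {FE h2 h5 hF} h3 => //= d F'' ; rewrite cE.
    (* The difference of two forms with the same support is this nonzero constant, which gives the
       partial fractions. *)
    pose de : C := (c.2 - w0)%:R.
    have de0 : de != 0 by rewrite pnatr_eq0 subn_eq0 -ltnNge.
    have hKd (x : C) : hol 0 rho (fun s => x * K s) by move=> s hs; apply: hdiffZ; exact: hK.
    apply: (expd_ext (expd_add (expd_term hF2 (hKd de^-1)) (expd_term hF' (hKd (- de^-1))))).
    move=> s hs ho; rewrite !invprod_cons.
    have n1 : Lam (S0, w0) s != 0 by exact: Lam_neq0.
    have n2 : Lam c s != 0 by apply: Lam_neq0 => //; rewrite cE.
    have dE : de = Lam c s - Lam (S0, w0) s.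
      by rewrite /de /Lam cE /= natrB ?(ltnW wc) //; ring.
    rewrite dE in de0 *; by field; rewrite n1 n2.
  have hF2 : flag_ok k ((S0, w0) :: F).
    move: hF'; rewrite {1}/flag_ok /chain => /andP[/andP[h1 h2] h3].
    rewrite /flag_ok /chain /= h1 h3 S0N w0E lexx !andbT /= ltz_nat w0B andbT.
    case: F h1 h2 h3 nhead {hF} => //= c F' /andP[cN _] -> /andP[/andP[cB _] _] nh.
    rewrite andbT finset.properEneq Smin // andbT; apply/eqP => h.
    by apply: nh; exists c, F'.
  apply: (expd_ext (expd_term hF2 hK)) => s _ _; rewrite invprod_cons; ring.
- by apply: (expd_ext (expd_zero k)) => s _ _; rewrite mul0r.
- by apply: (expd_ext (expd_add h1 h2)) => s _ _; rewrite mulrDl.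
- by apply: (expd_ext h1) => s hs ho; rewrite e.
Qed.

(** The total deficit of the weights below [B]; it decreases when one small weight grows and no
    weight drops. *)
Definition potential (k : wt) : nat := \sum_(S : {set 'I_r} | S != finset.set0) absz (Num.max 0 (B%:Z - wS S k))%R.

Lemma potential_lt k k' S0 : S0 != finset.set0 -> wS S0 k < B%:Z ->
  (forall S, S != finset.set0 -> wS S k <= wS S k') -> wS S0 k < wS S0 k' ->
  (potential k' < potential k)%N.
Proof.
move=> S0N S0B kk' k0; rewrite /potential (bigD1 S0) //= [ltnRHS](bigD1 S0) //=.
rewrite -addSn; apply: leq_add; first by lia.
by apply: leq_sum => S /andP[SN _]; have := kk' S SN; lia.
Qed.

Lemma wS_sub k a c S : wS S (k + u a - u c) = wS S k + (meets b S a)%:R - (meets b S c)%:R.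
Proof. by rewrite wSD wSN wSD !wS_unit. Qed.

(** The induction is on [potential]: every series produced by a splitting or by the Euler identity
    has no weight lowered and some small weight raised. *)
Theorem Dsum_expd k : (forall S, S != finset.set0 -> 0 <= wS S k) -> expd k (Dsum k).
Proof.
have [m] := ubnP (potential k); elim: m k => // m IH k; rewrite ltnS => pk k_ge0.
pose bad S := (S != finset.set0) && (wS S k < B%:Z).
have [/existsP[Sx Sxbad]|/existsPn nobad] := boolP [exists S, bad S]; last first.
  apply: expd_hol; apply: Dsum_hol => S SN.
  by have := nobad S; rewrite /bad SN /= -leNgt.
have step k' S0 : bad S0 -> (forall S, S != finset.set0 -> wS S k <= wS S k') ->
    wS S0 k < wS S0 k' -> expd k' (Dsum k').
  move=> /andP[S0N S0B] kk' k0; apply: IH; last first.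
    by move=> S SN; apply: le_trans (k_ge0 S SN) (kk' S SN).
  exact: leq_trans (potential_lt S0N S0B kk' k0) pk.
have [[S [S' [Sb S'b nSS' nS'S]]]|nincomp] :=
    pselect (exists S S', [/\ bad S, bad S', ~~ (S \subset S') & ~~ (S' \subset S)]).
  have /fintype.subsetPn[i iS iS'] := nSS'; have /fintype.subsetPn[j jS' jS] := nS'S.
  have ij : i != j by apply: contraNneq jS => <-.
  (* The form m_i + m_j meets every set containing i or j, so nothing is lost; S' gains in the first
     series, as i is not in S', and S in the second. *)
  have ge1 l T : (l == i) || (l == j) -> wS T k <= wS T (k + u (pr i j) - u (sm l)).
    move=> lij; rewrite wS_sub (meets_pr b_pr) // (meets_sm b_sm).
    rewrite -addrA lerDl subr_ge0 ler_nat.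
    by case/orP: lij => /eqP ->; case: (i \in T); case: (j \in T).
  apply: (@expd_ext _ (fun s => Dsum (k + u (pr i j) - u (sm i)) s + Dsum (k + u (pr i j) - u (sm j)) s)).
    apply: expd_add.
      apply: (expd_mono (k' := k + u (pr i j) - u (sm i))); first by move=> T _; apply: ge1; rewrite eqxx.
      apply: (step _ S') => //; first by move=> T _; apply: ge1; rewrite eqxx.
      by rewrite wS_sub (meets_pr b_pr) // (meets_sm b_sm) jS' (negPf iS') /=; lia.
    apply: (expd_mono (k' := k + u (pr i j) - u (sm j))); first by move=> T _; apply: ge1; rewrite eqxx orbT.
    apply: (step _ S) => //; first by move=> T _; apply: ge1; rewrite eqxx orbT.
    by rewrite wS_sub (meets_pr b_pr) // (meets_sm b_sm) iS (negPf jS) /=; lia.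
  by move=> s hs ho; rewrite -(Dsum_split b_ge0 b_supp b_sm b_pr).
have comp S S' : bad S -> bad S' -> (S \subset S') || (S' \subset S).
  move=> h h'; apply/negP => /negP; rewrite negb_or => /andP[h1 h2].
  by apply: nincomp; exists S, S'.
pose S0 := [arg min_(S < Sx | bad S) #|S|]%N.
have [S0bad S0min] : bad S0 /\ forall S, bad S -> S0 \subset S.
  rewrite /S0; case: arg_minnP => // S Sb Smin; split => // T Tb.
  have /orP[//|TS] := comp S T Sb Tb.
  have /eqP -> : T == S by rewrite eqEcard TS Smin.
  by [].
have /andP[S0N S0B] := S0bad.
have [w0 w0E] : exists w0 : nat, wS S0 k = w0%:Z.
  by exists (absz (wS S0 k)); rewrite gez0_abs // k_ge0.
have w0B : (w0 < B)%N by rewrite -ltz_nat -w0E.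
have Smin S : S != finset.set0 -> wS S k < B%:Z -> S0 \subset S.
  by move=> SN Sb; apply: S0min; apply/andP.
have supp_meets a i (S : {set 'I_r}) : b a i != 0 -> i \in S -> meets b S a.
  by move=> bi iS; apply/meetsP; exists i.
have umul S a n : wS S (u a *+ n) = (meets b S a)%:R *+ n.
  by elim: n => [|n IHn]; rewrite ?mulr0n ?mulrS ?wSD ?IHn ?wS_unit // /(wS _ _) big1 // => c _; rewrite ffunE.
(* With parameter [B] the Taylor order is B + 2, so supports containing i gain B + 1. The others are
   not small, because small supports contain S0 and hence i, and they lose nothing. *)
have remex i : i \in S0 -> exists f : Cn -> C, hol 0 rho f /\
    forall s, vn s < rho -> has_sum (rem B k i s) (f s).
  move=> iS0; have [|f hf hs] := @rem_sum B k i; last by exists f.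
  move=> a ba S SN; rewrite wSD wSN wSD umul wS_unit (meets_sm b_sm).
  have := k_ge0 S SN; have [SB|SB] := ltP (wS S k) B%:Z.
    have iS : i \in S by have /fintype.subsetP := Smin S SN SB; apply.
    rewrite (supp_meets a i S ba iS) iS -mulr_natr; lia.
  case: (boolP (i \in S)) => iS.
    by rewrite (supp_meets a i S ba iS) -mulr_natr; lia.
  have : 0 <= ((meets b S a)%:R : int) *+ B.+2 by rewrite mulrn_wge0.
  by move: (_ *+ B.+2); lia.
have [remf hrem] : exists remf : 'I_r -> Cn -> C, forall i, i \in S0 ->
    hol 0 rho (remf i) /\ forall s, vn s < rho -> has_sum (rem B k i s) (remf i s).
  have /choice[g hg] : forall i, exists f : Cn -> C, i \in S0 -> hol 0 rho f /\
      forall s, vn s < rho -> has_sum (rem B k i s) (f s).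
    move=> i; have [iS|niS] := boolP (i \in S0); last by exists (fun=> 0).
    by have [f hf] := remex i iS; exists f.
  by exists g.
pose T1 s := \sum_(a | meets b S0 a) \sum_(i | i \notin S0)
   ez ell k s a * rc (b a i) * Dsum (k + u a - u (sm i)) s.
pose T2 s := \sum_(i in S0) (\sum_(q : {ffun A -> 'I_B.+2} | (1 < qdeg q)%N)
   cf b ell k i q s * Dsum (k + qw q - u (sm i)) s + remf i s).
have hEz a : hol 0 rho (fun s => ez ell k s a) by move=> s _; exact: hdiff_ez.
have dv k' f : (forall S, S != finset.set0 -> wS S k <= wS S k') -> wS S0 k < wS S0 k' ->
    expd k' f -> expd k (fun s => f s / Lam (S0, w0) s).
  by move=> kk' k0; exact: expd_div kk' k0 Smin.
have dv2 k' f : (forall S, S != finset.set0 -> wS S k <= wS S k') -> wS S0 k < wS S0 k' ->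
    hol 0 rho f -> expd k (fun s => f s * Dsum k' s / Lam (S0, w0) s).
  move=> kk' k0 hf; apply: (dv k' (fun s => f s * Dsum k' s)) => //.
  by apply: expd_mul => //; exact: step S0bad kk' k0.
have e1 : expd k (fun s => T1 s / Lam (S0, w0) s).
  apply: (@expd_ext _ (fun s => \sum_(a | meets b S0 a) \sum_(i | i \notin S0)
     (ez ell k s a * rc (b a i) * Dsum (k + u a - u (sm i)) s / Lam (S0, w0) s))); last first.
    by move=> s _ _; rewrite /T1 mulr_suml; apply: eq_bigr => a _; rewrite mulr_suml.
  apply: expd_sum => a aS0; apply: expd_sum => i iS0.
  (* Terms with coefficient 0 are set aside: only if m_i occurs in [a] does every set that loses
     [sm i] meet [a]. *)
  have [ba|ba] := eqVneq (b a i) 0.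
    by apply: (expd_ext (expd_zero k)) => s _ _; rewrite ba rc0 mulr0 !mul0r.
  apply: (dv2 _ (fun s => ez ell k s a * rc (b a i))).
  - move=> S SN; rewrite wS_sub (meets_sm b_sm).
    case: (boolP (i \in S)) => iS; last by case: (meets b S a); lia.
    by rewrite (supp_meets a i S ba iS); lia.
  - by rewrite wS_sub (meets_sm b_sm) aS0 (negPf iS0); lia.
  - by move=> s hs; apply: hdiffM; [exact: hEz|exact: hdiff_cst].
have e2 : expd k (fun s => T2 s / Lam (S0, w0) s).
  apply: (@expd_ext _ (fun s => \sum_(i in S0) ((\sum_(q : {ffun A -> 'I_B.+2} | (1 < qdeg q)%N)
     cf b ell k i q s * Dsum (k + qw q - u (sm i)) s / Lam (S0, w0) s) + remf i s / Lam (S0, w0) s))); last first.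
    by move=> s _ _; rewrite /T2 mulr_suml; apply: eq_bigr => i _; rewrite mulrDl mulr_suml.
  apply: expd_sum => i iS0; apply: expd_add; last first.
    (* The remainder is holomorphic, hence has an expansion for every weight; this one exceeds [k]
       on S0, as the division requires. *)
    apply: (dv (k + u (sm i))).
    - by move=> S SN; rewrite wSD wS_unit; case: (meets _ _ _); lia.
    - by rewrite wSD wS_unit (meets_sm b_sm) iS0; lia.
    - by apply: expd_hol; case: (hrem i iS0).
  apply: expd_sum => q q1.
  (* A monomial involving a form without m_i has coefficient 0. For the others a set containing i
     gains the full degree, at least 2, against the 1 lost. *)
  have [/forallP qs|/forallPn[a]] := boolP [forall a, (q a != 0%N :> nat) ==> (b a i != 0)]; last first.
    rewrite negb_imply negbK => /andP[qa /eqP ba].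
    apply: (expd_ext (expd_zero k)) => s _ _.
    have -> : cf b ell k i q s = 0.
      by rewrite /cf (bigD1 a) //= ba rc0 expr0n (negPf qa) mulr0 mul0r.
    by rewrite !mul0r.
  have qS (S : {set 'I_r}) : i \in S -> wS S (qw q) = (qdeg q)%:Z.
    move=> iS; rewrite /(wS _ _) /qdeg -natz natr_sum [RHS](bigID (meets b S)) /= [X in _ = _ + X]big1 ?addr0.
      by apply: eq_bigr => a _; rewrite ffunE natz.
    move=> a na; case: (eqVneq (nat_of_ord (q a)) 0%N) => [->//|qa].
    have := qs a; rewrite qa /= => ba; by rewrite (supp_meets a i S ba iS) in na.
  apply: (dv2 _ (fun s => cf b ell k i q s)).
  - move=> S SN; rewrite wSD wSN wSD wS_unit (meets_sm b_sm); have := wS_qw b S q.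
    by case: (boolP (i \in S)) => iS; [rewrite (qS S iS); lia|lia].
  - by rewrite wSD wSN wSD wS_unit (meets_sm b_sm) iS0 (qS _ iS0); lia.
  - by move=> s _; exact: hdiff_cf.
apply: (expd_ext (expd_add e1 e2)) => s hs ho.
have hl i : i \in S0 -> has_sum (rem B k i s) (remf i s).
  by move=> iS0; have [_ h] := hrem i iS0; exact: h.
have := euler_identity b_ge0 b_supp b_sm k_ge0 ho hl.
rewrite -/(T1 s) -/(T2 s) w0E => e.
have n1 : Lam (S0, w0) s != 0 by exact: Lam_neq0.
by rewrite -mulrDl -e /Lam /= -pmulrn mulrC mulKf.
Qed.

End Recursion.

(** * Continuation of the zeta function of a root system *)

Section RootForms.
Context {R : realType} {r : nat}.
Local Notation C := (Cplx R).
Variables (Phi : seq 'rV[R]_r) (beta : r.-tuple 'rV[R]_r).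
Hypothesis Phi_root : crystallographic_root_system Phi.
Hypothesis beta_simple : simple_system (map coroot Phi) beta.
Local Notation N := (size (pos_coroots Phi beta)).
Local Notation Cn := 'rV[C]_N.
Local Notation pos_coroot := (@pos_coroot R r Phi beta).
Local Notation Lambda := (@Lambda R r Phi beta).
Local Notation Rset := (@Rset R r Phi beta).
Local Notation zeta_term := (@zeta_term R r Phi beta).

Definition form : finType := ('I_N + 'I_r * 'I_r)%type.

(* The coefficient vectors of the linear forms L_alpha, and of the auxiliary
   forms m_i + m_j, which carry the exponent 0. *)
Definition fb (a : form) (i : 'I_r) : R :=
  match a with
  | inl j => coord beta i (pos_coroot j)
  | inr p => (i == p.1)%:R + (i == p.2)%:R
  end.

Definition fell (a : form) (i : 'I_N) : C :=
  match a with inl j => (i == j)%:R | inr _ => 0 end.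

Lemma pos_coroot_mem j : pos_coroot j \in pos_coroots Phi beta.
Proof. exact: mem_tnth. Qed.

Lemma coord_ge0 i j : 0 <= coord beta i (pos_coroot j).
Proof.
by have := pos_coroot_mem j; rewrite mem_filter => /andP[/forallP h _].
Qed.

Lemma fb_ge0 a i : 0 <= fb a i.
Proof. by case: a => [j|p] /=; [exact: coord_ge0|rewrite addr_ge0]. Qed.

Lemma dot_neq0 (a : 'rV[R]_r) : a != 0 -> dot a a != 0.
Proof.
move=> /eqP a0; apply/eqP => h; apply: a0; apply/rowP => i; rewrite mxE.
have h2 : forall i, true -> 0 <= a 0 i * a 0 i by move=> k _; rewrite -expr2 sqr_ge0.
have := psumr_eq0P h2 h (i := i) isT => /eqP; by rewrite mulf_eq0 orbb => /eqP.
Qed.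

Lemma pos_coroot_neq0 j : pos_coroot j != 0.
Proof.
have := pos_coroot_mem j; rewrite mem_filter => /andP[_ /mapP[a aPhi ->]].
have [[_ Phi0] _ _ _ _] := Phi_root.
have a0 : a != 0 by apply: contraNneq Phi0 => <-.
by rewrite /coroot scaler_eq0 negb_or a0 andbT mulf_neq0 // invr_eq0 dot_neq0.
Qed.

Lemma beta_basis : basis_of fullv beta. Proof. by case: beta_simple. Qed.

Lemma fb_supp a : exists i, fb a i != 0.
Proof.
case: a => [j|p] /=; last first.
  by exists p.1; rewrite eqxx -natrD pnatr_eq0.
apply/existsP; rewrite -negb_forall; apply/negP => /forallP h.
have := pos_coroot_neq0 j; rewrite [pos_coroot j](coord_basis beta_basis) ?memvf //.
by rewrite big1 ?eqxx // => i _; have /eqP -> := h i; rewrite scale0r.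
Qed.

Lemma beta_pos i : tnth beta i \in pos_coroots Phi beta.
Proof.
rewrite mem_filter; apply/andP; split; last by case: beta_simple => h _ _ _; exact: h.
apply/forallP => l; rewrite (tnth_nth 0) coord_free ?(basis_free beta_basis) //.
Qed.

Definition simple_index (i : 'I_r) : 'I_N :=
  Ordinal (introT idP (eq_ind_r is_true (beta_pos i) (index_mem (tnth beta i) (pos_coroots Phi beta)))).

Definition fsm (i : 'I_r) : form := inl (simple_index i).

Lemma pos_coroot_simple i : pos_coroot (simple_index i) = tnth beta i.
Proof. by rewrite /Defs.pos_coroot (tnth_nth 0) /= nth_index // beta_pos. Qed.

Lemma fb_sm i l : fb (fsm i) l = (l == i)%:R.
Proof.
by rewrite /= pos_coroot_simple (tnth_nth 0) coord_free ?(basis_free beta_basis) // eq_sym.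
Qed.

Definition fpr (i j : 'I_r) : form := inr (i, j).

Lemma fb_pr i j l : i != j -> fb (fpr i j) l = (l == i)%:R + (l == j)%:R.
Proof. by []. Qed.

Lemma linform_fell_inl j (s : Cn) : linform (fell (inl j)) s = s 0 j.
Proof.
rewrite /linform (bigD1 j) //= eqxx mul1r big1 ?addr0 // => i /negPf ->; by rewrite mul0r.
Qed.

Lemma linform_fell_inr p (s : Cn) : linform (fell (inr p)) s = 0.
Proof. exact: linform0. Qed.

Lemma meets_fb S j : meets fb S (inl j) = (j \in Rset S).
Proof.
rewrite inE; apply/meetsP/set0Pn => [[i iS bi]|[i h]].
  by exists i; rewrite !inE bi.
by move: h; rewrite !inE => /andP[bi iS]; exists i.
Qed.

Lemma lamS_sum S s : lamS fb fell S s = \sum_(j in Rset S) s 0 j.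
Proof.
rewrite /lamS big_sumType /= [X in _ + X]big1 ?addr0; last by move=> p _; exact: linform_fell_inr.
by apply: eq_big => [j|j _]; [rewrite meets_fb|rewrite linform_fell_inl].
Qed.

Lemma LambdaE c s : Lambda c s = Lam fb fell c s.
Proof. by rewrite /Lam lamS_sum. Qed.

Definition pos_ix (n : {ffun 'I_r -> nat}) : {ffun 'I_r -> nat} := [ffun j => (n j).+1].

Lemma pos_boxE M : pos_box r M = map pos_ix (nat_box 'I_r M).
Proof.
rewrite /pos_box /nat_box -map_comp; apply: eq_map => e /=.
by apply/ffunP => j; rewrite !ffunE.
Qed.

Lemma zeta_termE s n : zeta_term s (pos_ix n) = term fb fell 0 s n.
Proof.
rewrite /zeta_term /term big_sumType /= [X in _ * X]big1 ?mulr1; last first.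
  by move=> p _; rewrite /ez linform_fell_inr ffunE addr0 oppr0 cpow0.
apply: eq_bigr => j _; rewrite /ez linform_fell_inl.
have -> : (0 : {ffun form -> int}) (inl j) = 0 by rewrite ffunE.
have -> : fL fb (inl j) n = Defs.L j (pos_ix n).
  by apply: eq_bigr => i _; rewrite [pos_ix n i]ffunE.
by rewrite addr0.
Qed.

Lemma has_abs_sum_zeta s l : (exists B, abs_bounded (term fb fell 0 s) B) ->
  has_sum (term fb fell 0 s) l -> has_abs_sum (pos_box r) (zeta_term s) l.
Proof.
move=> hB hl.
have /(has_abs_sumP _ _ (nat_box_exhaustion _))[_ h] := conj hB hl.
have [[Bc hBc] hlim] := (has_abs_sumP (term fb fell 0 s) l (nat_box_exhaustion _)).2 (conj hB hl).
have sumE (V : nmodType) (f : {ffun 'I_r -> nat} -> V) M :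
  \sum_(m <- pos_box r M) f m = \sum_(n <- nat_box 'I_r M) f (pos_ix n).
  by rewrite pos_boxE big_map.
split.
  exists Bc => M; rewrite sumE; apply: le_trans (hBc M).
  by under eq_bigr do rewrite zeta_termE.
apply: cvg_trans hlim; apply: near_eq_cvg; near=> M.
by rewrite sumE; apply: eq_bigr => n _; rewrite zeta_termE.
Unshelve. all: by end_near. Qed.

Lemma Rset_neq0 (S : {set 'I_r}) : S != finset.set0 -> exists j, j \in Rset S.
Proof.
move=> /set0Pn[i iS]; exists (simple_index i).
by rewrite -meets_fb; have := meets_sm fb_sm S i; rewrite /fsm => ->.
Qed.

(** At least one coroot meets the nonempty set S; its exponent alone gives 2 |S| + 1, and the others
    have nonnegative real part. *)
Lemma Omega_of_Re (s : Cn) : (forall j, (r.*2.+1)%:R <= complex.Re (s 0 j)) -> Omega fb fell s.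
Proof.
move=> hs S SN; rewrite lamS_sum Re_sum.
have [j0 j0S] := Rset_neq0 SN.
rewrite (bigD1 j0) //=; apply: (@le_trans _ _ (r.*2.+1)%:R); last first.
  apply: le_trans (hs j0) _; rewrite lerDl; apply: sumr_ge0 => j _.
  by apply: le_trans (hs j).
rewrite -[r.*2.+1]addn1 natrD lerD2r -muln2 natrM mulrC ler_wpM2r // ler_nat.
by rewrite -[leqRHS]card_ord max_card.
Qed.

End RootForms.

(** * Neighbourhoods in C^N *)

Section NearVn.
Context {R : realType} {N : nat}.
Local Notation C := (Cplx R).
Local Notation Cn := 'rV[C]_N.

Lemma near_all (T : eqType) (l : seq T) (P : T -> Cn -> Prop) (p : Cn) :
  (forall c, c \in l -> \forall s \near p, P c s) ->
  \forall s \near p, forall c, c \in l -> P c s.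
Proof.
elim: l => [|c l IH] h; first by apply: filterE => s c.
have h1 := h c (mem_head _ _).
have h2 := IH (fun d hd => h d (mem_behead (hd : d \in behead (c :: l)))).
by apply: filterS2 h1 h2 => s a b d; rewrite in_cons => /orP[/eqP ->|/b].
Qed.

Lemma near_ball (p q : Cn) (rho : R) : vn (q - p) < rho -> \forall s \near q, vn (s - p) < rho.
Proof.
move=> h; apply/near_vnP; exists (rho - vn (q - p)); first by rewrite subr_gt0.
by move=> s hs; apply: le_lt_trans (vn_dist q _ _) _; rewrite -ltrBrDr.
Qed.

Lemma near_neq0 (f : Cn -> C) (p : Cn) : hdiff f p -> f p != 0 -> \forall s \near p, f s != 0.
Proof.
move=> /hdiff_cont hf fp; have f0 : 0 < nm (f p) by rewrite nm_gt0.
have [d d0 hd] := hf _ (divr_gt0 f0 (ltr0n R 2)).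
apply/near_vnP; exists d => // s hs; have := hd _ hs; rewrite (addrC p) subrK => h.
apply/eqP => fs; move: h; rewrite fs sub0r nmN; lra.
Qed.

Lemma hdiff_near (f g : Cn -> C) s : (\forall x \near s, f x = g x) -> hdiff f s -> hdiff g s.
Proof. by move=> /near_vnP[d d0 h]; exact: hdiff_ext d0 h. Qed.

Lemma open_ball0 (rho : R) : open [set s : Cn | vn s < rho].
Proof.
rewrite openE => s /= hs; have := @near_ball 0 s rho; rewrite subr0 => /(_ hs).
by apply: filterS => x; rewrite subr0.
Qed.

Lemma bounded_ball0 (rho : R) : bounded_set [set s : Cn | vn s < rho].
Proof.
exists (rc rho); split; first by rewrite realE -rc0 !rc_le le_total.
move=> x hx s /= hs; apply: ltW; apply: lt_trans hx; rewrite normv_vn rc_lt //.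
Qed.

End NearVn.

(** * Expansions on balls and their gluing *)

Section Continuation.
Context {R : realType} {r : nat}.
Local Notation C := (Cplx R).
Variables (Phi : seq 'rV[R]_r) (beta : r.-tuple 'rV[R]_r).
Hypothesis Phi_root : crystallographic_root_system Phi.
Hypothesis beta_simple : simple_system (map coroot Phi) beta.
Local Notation N := (size (pos_coroots Phi beta)).
Local Notation Cn := 'rV[C]_N.
Local Notation Lambda := (@Lambda R r Phi beta).
Local Notation Rset := (@Rset R r Phi beta).
Local Notation zeta_term := (@zeta_term R r Phi beta).
Local Notation zeta := (@zeta R r Phi beta).
Local Notation arrangement := (@arrangement R r Phi beta).
Local Notation carr := ({set 'I_r} * nat)%type.
Local Notation flagr := (seq carr).
Local Notation fb := (@fb R r Phi beta).
Local Notation fell := (@fell R r Phi beta).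
Implicit Types (c : carr) (s p : Cn) (F : flagr) (Fs : seq flagr).

Definition slope c (v : Cn) : C := \sum_(j in Rset c.1) v 0 j.

Lemma Lambda_line c s t v : Lambda c (s + t *: v) = Lambda c s + t * slope c v.
Proof.
rewrite /Defs.Lambda /slope mulr_sumr; under eq_bigr do rewrite !mxE.
by rewrite big_split /=; ring.
Qed.

Lemma hdiff_Lambda c s : hdiff (Lambda c) s.
Proof.
apply: hdiffD; last exact: hdiff_cst.
by apply: hdiffB; [apply: hdiff_sum => j _; exact: hdiff_coord|exact: hdiff_cst].
Qed.

Lemma slope1_neq0 c : c.1 != finset.set0 -> slope c (const_mx 1) != 0.
Proof.
move=> /(Rset_neq0 beta_simple)[j hj]; rewrite /slope.
under eq_bigr do rewrite mxE.
by rewrite sumr_const pnatr_eq0 -lt0n; apply/card_gt0P; exists j.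
Qed.

(** The hyperplanes are avoided one after the other by a small move along (1, ..., 1), a direction
    transverse to every carrier. In the induction [P] is strengthened to hold nearby as well, so
    that there is room for the next move. *)
Lemma not_arr_near (l : seq carr) p (P : Cn -> Prop) : (forall c, c \in l -> c.1 != finset.set0) ->
  (\forall s \near p, P s) -> exists2 s, P s & forall c, c \in l -> Lambda c s != 0.
Proof.
elim: l P p => [|c l IH] P p hl hP.
  by exists p; [exact: nbhs_singleton hP|].
have [s [Ps Pn] hs] : exists2 s, (P s /\ \forall x \near s, P x) & forall d, d \in l -> Lambda d s != 0.
  apply: (IH (fun s => P s /\ \forall x \near s, P x) p); first by move=> d dl; apply: hl; rewrite in_cons dl orbT.
  have [d d0 hd] := (near_vnP _ _).1 hP.
  apply: (near_vnP p _).2; exists d => [//|x hx]; split; first exact: hd.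
  apply: (near_vnP x P).2; exists (d - vn (x - p)); first by rewrite subr_gt0.
  by move=> y hy; apply: hd; apply: le_lt_trans (vn_dist x _ _) _; rewrite -ltrBrDr.
have h1 : \forall x \near s, forall d, d \in l -> Lambda d x != 0.
  by apply: near_all => d dl; apply: near_neq0; [exact: hdiff_Lambda|exact: hs].
have [d d0 hd] := (near_vnP s (fun x => P x /\ forall d, d \in l -> Lambda d x != 0)).1 (filterI Pn h1).
have [cs|cs] := eqVneq (Lambda c s) 0; last first.
  by exists s => // e; rewrite in_cons => /orP[/eqP ->//|]; exact: hs.
pose w : Cn := const_mx 1; have w0 := vn_ge0 w.
have w1 : 0 < vn w + 1 by lra.
pose t : R := d / (vn w + 1) / 2.
have t0 : 0 < t by rewrite divr_gt0 ?divr_gt0.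
have tw : vn (s + rc t *: w - s) < d.
  rewrite addrC addKr vnZ nm_rc gtr0_norm //.
  have e : d = 2 * (t * (vn w + 1)) by rewrite /t; field; lra.
  rewrite [ltRHS]e; nra.
have [Px hx] := hd _ tw; exists (s + rc t *: w) => // e; rewrite in_cons => /orP[/eqP ->|]; last exact: hx.
rewrite Lambda_line cs add0r mulf_neq0 //; first by rewrite -nm_gt0 nm_rc normr_gt0 gt_eqF.
by apply: slope1_neq0; apply: hl; rewrite mem_head.
Qed.

(** On a carrier the level is |S| minus the real part of the sum of the exponents, hence at most r +
    B on the ball. *)
Lemma carriers_bound (rho : R) : exists l : seq carr, [/\ uniq l,
  (forall c, c \in l -> c.1 != finset.set0) &
  forall c s, vn s <= rho -> c.1 != finset.set0 -> Lambda c s = 0 -> c \in l].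
Proof.
have [B hB] := @lamS_bounded R r N _ fb fell rho.
exists (undup [seq c <- flatten [seq [seq (T, e) | e <- iota 0 (B + r).+1] | T : {set 'I_r}] | c.1 != finset.set0]).
split.
- exact: undup_uniq.
- by move=> c; rewrite mem_undup mem_filter => /andP[].
- case=> T ell s hs SN L0; rewrite mem_undup mem_filter SN andTb.
  apply/flatten_mapP; exists T; first by rewrite mem_enum.
  apply/mapP; exists ell => //.
  rewrite mem_iota add0n /= ltnS -(ler_nat R) natrD.
  have := hB s T hs; have : complex.Re (Lambda (T, ell) s) = 0 by rewrite L0.
  rewrite LambdaE // /Lam ReD ReB -(rc_nat #|T|) -(rc_nat ell) /= => h1 h2.
  have : #|T|%:R <= r%:R :> R by rewrite ler_nat -[leqRHS]card_ord max_card.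
  lra.
Qed.

Lemma near_carriers p : exists l : seq carr, [/\ uniq l,
  (forall c, c \in l -> c.1 != finset.set0) &
  \forall s \near p, forall c, c.1 != finset.set0 -> Lambda c s = 0 -> c \in l /\ Lambda c p = 0].
Proof.
have [l [ul lN hl]] := carriers_bound (vn p + 1); exists l; split => //.
have h1 : \forall s \near p, forall c, c \in l -> Lambda c p != 0 -> Lambda c s != 0.
  apply: near_all => c cl; have [cp|cp] := eqVneq (Lambda c p) 0.
    by apply: filterE.
  by apply: filterS (near_neq0 (hdiff_Lambda c p) cp) => s.
have h2 : \forall s \near p, vn (s - p) < 1.
  by apply: near_ball; rewrite subrr vn0.
apply: filterS2 h1 h2 => s h1 h2 c cN cs.
have cl : c \in l.
  apply: (hl c s) => //; have := vnD (s - p) p; rewrite subrK; lra.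
by split=> //; apply/eqP; apply: contraT => /(h1 c cl); rewrite cs eqxx.
Qed.

Lemma notin_arr s c : ~ arrangement s -> c.1 != finset.set0 -> Lambda c s != 0.
Proof. by move=> h hc; apply/eqP => e; apply: h; exists c. Qed.

Lemma off_arr_near p (P : Cn -> Prop) : (\forall s \near p, P s) -> exists2 s, P s & ~ arrangement s.
Proof.
have [l [ul lN hl]] := near_carriers p => hP.
have [s [Ps hs] h] := not_arr_near lN (filterI hP hl).
exists s => // -[c cN cs]; have [cl _] := hs c cN cs.
by have := h c cl; rewrite cs eqxx.
Qed.

Lemma locally_finite : locally_finite_arrangement Phi beta.
Proof.
move=> p; have [l [ul lN hl]] := near_carriers p.
exists [set s | forall c, c.1 != finset.set0 -> Lambda c s = 0 -> c \in l /\ Lambda c p = 0] => //.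
apply: (sub_finite_set (B := [set` l])); last exact: finite_seq.
by move=> c [cN [s [cs hs]]]; have [] := hs c cN cs.
Qed.

Definition ev (Fs : seq flagr) (H : Cn -> C) (K : flagr -> Cn -> C) s : C :=
  H s + \sum_(F <- Fs) K F s * \prod_(c <- F) (Lambda c s)^-1.

(** The expansion multiplied by all forms of [l] and written without division, so that it is
    holomorphic across the hyperplanes. *)
Definition num (Fs : seq flagr) (H : Cn -> C) (K : flagr -> Cn -> C) (l : seq carr) s : C :=
  (\prod_(c <- l) Lambda c s) * H s +
  \sum_(F <- Fs) K F s * \prod_(c <- l | c \notin F) Lambda c s.

Definition cars (Fs : seq flagr) : seq carr := undup (flatten Fs).

Lemma cars_sub Fs F : F \in Fs -> {subset F <= cars Fs}.
Proof. by move=> FF c cF; rewrite mem_undup; apply/flattenP; exists F. Qed.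

Lemma cars_neq0 Fs : (forall F, F \in Fs -> is_flag F) -> forall c, c \in cars Fs -> c.1 != finset.set0.
Proof.
move=> h c; rewrite mem_undup => /flattenP[F /h/and3P[_ /allP hF _] /hF]; exact.
Qed.

Lemma flag_uniq (F : flagr) : is_flag F -> uniq F.
Proof.
move=> /and3P[_ _]; apply: sorted_uniq; last by move=> c; rewrite /= fintype.properxx.
by move=> a b c; exact: fintype.proper_trans.
Qed.

Lemma clear_prod (l F : seq carr) s : uniq l -> uniq F -> {subset F <= l} ->
  (forall c, c \in F -> Lambda c s != 0) ->
  (\prod_(c <- l) Lambda c s) * \prod_(c <- F) (Lambda c s)^-1 = \prod_(c <- l | c \notin F) Lambda c s.
Proof.
move=> ul uF Fl h; rewrite (bigID (fun c => c \in F)) /= mulrAC.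
have -> : \prod_(c <- l | c \in F) Lambda c s = \prod_(c <- F) Lambda c s.
  rewrite -big_filter; apply: perm_big; apply: uniq_perm; rewrite ?filter_uniq // => c.
  by rewrite mem_filter; case: (boolP (c \in F)) => // /Fl ->.
rewrite -big_split /= big_seq big1 ?mul1r // => c cF.
by rewrite divff // h.
Qed.

Lemma num_ev Fs H K l s : uniq l -> (forall F, F \in Fs -> is_flag F) ->
  (forall F, F \in Fs -> {subset F <= l}) -> (forall c, c \in l -> Lambda c s != 0) ->
  (\prod_(c <- l) Lambda c s) * ev Fs H K s = num Fs H K l s.
Proof.
move=> ul hF hl h; rewrite /ev /num mulrDr; congr (_ + _).
rewrite mulr_sumr; apply: eq_big_seq => F FF.
rewrite mulrCA clear_prod //; [exact: flag_uniq (hF F FF)|exact: hl|].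
by move=> c /(hl F FF); exact: h.
Qed.

Lemma hdiff_prodL (l : seq carr) (P : pred carr) s : hdiff (fun s => \prod_(c <- l | P c) Lambda c s) s.
Proof. by apply: hdiff_prod => c _ _; exact: hdiff_Lambda. Qed.

Lemma hdiff_num Fs H K l s : hdiff H s -> (forall F, F \in Fs -> hdiff (K F) s) ->
  hdiff (num Fs H K l) s.
Proof.
move=> hH hK; apply: hdiffD; first by apply: hdiffM => //; exact: hdiff_prodL.
rewrite (_ : (fun z => _) = fun z => \sum_(F <- Fs | F \in Fs) K F z * \prod_(c <- l | c \notin F) Lambda c z).
  by apply: hdiff_sum => F FF; apply: hdiffM; [exact: hK|exact: hdiff_prodL].
by apply/funext => z; exact: big_seq.
Qed.

Lemma prodL_neq0 (l : seq carr) s : (forall c, c \in l -> Lambda c s != 0) -> \prod_(c <- l) Lambda c s != 0.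
Proof. by move=> h; rewrite prodf_seq_neq0; apply/allP => c /h. Qed.

Lemma hdiff_ev Fs H K s : hdiff H s -> (forall F, F \in Fs -> hdiff (K F) s) ->
  (forall F, F \in Fs -> is_flag F) -> ~ arrangement s -> hdiff (ev Fs H K) s.
Proof.
move=> hH hK hF hs; apply: hdiffD => //.
rewrite (_ : (fun z => _) = fun z => \sum_(F <- Fs | F \in Fs) K F z * \prod_(c <- F) (Lambda c z)^-1); last first.
  by apply/funext => z; exact: big_seq.
apply: hdiff_sum => F FF; apply: hdiffM; first exact: hK.
apply: hdiff_prod => c cF _; apply: hdiffV; first exact: hdiff_Lambda.
by apply: (notin_arr hs); have /and3P[_ /allP h _] := hF F FF; exact: h.
Qed.

(** The coefficients vanish off the list, so that two expansions can be added over the union of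
    their lists, repeated flags being merged. *)
Lemma expd_exrep (rho : R) (B : nat) k f : expd fb fell rho B k f ->
  exists Fs H K, [/\ uniq Fs, (forall F, F \in Fs -> is_flag F), hol 0 rho H,
    (forall F, hol 0 rho (K F) /\ (F \notin Fs -> K F = fun=> 0)) &
    forall s, vn s < rho -> Omega fb fell s -> f s = ev Fs H K s].
Proof.
elim=> {f} [F K hF hK| |f1 f2 _ [Fs1 [H1 [K1 [u1 fl1 h1 k1 e1]]]] _ [Fs2 [H2 [K2 [u2 fl2 h2 k2 e2]]]]
   |f1 f2 _ [Fs [H [K [u1 fl h1 k1 e1]]]] e2].
- have [F0|FN] := eqVneq F [::].
    exists [::], K, (fun _ _ => 0); split => //.
      by move=> G; split=> // s _; exact: hdiff_cst.
    by move=> s _ _; rewrite F0 /invprod /ev !big_nil mulr1 addr0.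
  exists [:: F], (fun=> 0), (fun G => if G == F then K else fun=> 0); split => //.
  + move=> G; rewrite inE => /eqP ->; rewrite /is_flag FN /=.
    by move: hF; rewrite /flag_ok /chain => /andP[/andP[-> ->]].
  + by move=> s _; exact: hdiff_cst.
  + move=> G; split; last by rewrite inE => /negPf ->.
    by case: ifP => _ //; move=> s _; exact: hdiff_cst.
  + move=> s _ _; rewrite /ev big_seq1 eqxx add0r; congr (_ * _).
    by apply: eq_bigr => c _; rewrite LambdaE.
- exists [::], (fun=> 0), (fun _ _ => 0); split => //.
    by move=> s _; exact: hdiff_cst.
    by move=> G; split=> // s _; exact: hdiff_cst.
  by move=> s _ _; rewrite /ev big_nil addr0.
- exists (undup (Fs1 ++ Fs2)), (fun s => H1 s + H2 s), (fun F s => K1 F s + K2 F s); split.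
  + exact: undup_uniq.
  + by move=> F; rewrite mem_undup mem_cat => /orP[/fl1|/fl2].
  + by move=> s hs; apply: hdiffD; [exact: h1|exact: h2].
  + move=> F; have [k1F z1] := k1 F; have [k2F z2] := k2 F; split.
      by move=> s hs; apply: hdiffD; [exact: k1F|exact: k2F].
    by rewrite mem_undup mem_cat negb_or => /andP[/z1 -> /z2 ->]; apply/funext => s; rewrite addr0.
  + move=> s hs ho; rewrite e1 // e2 // /ev addrACA; congr (_ + _).
    under [in RHS]eq_bigr do rewrite mulrDl.
    rewrite big_split /=.
    have aux (Fs : seq flagr) (K : flagr -> Cn -> C) : uniq Fs -> {subset Fs <= undup (Fs1 ++ Fs2)} ->
       (forall F, F \notin Fs -> K F = fun=> 0) ->
       \sum_(F <- Fs) K F s * \prod_(c <- F) (Lambda c s)^-1 =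
       \sum_(F <- undup (Fs1 ++ Fs2)) K F s * \prod_(c <- F) (Lambda c s)^-1.
      move=> uF sF z; rewrite (sum_split_sub _ uF (undup_uniq _) sF).
      rewrite [X in _ + X]big_seq [X in _ + X]big1 ?addr0 // => F.
      by rewrite mem_filter => /andP[/z -> _]; rewrite mul0r.
    congr (_ + _); apply: aux => //.
    * by move=> F h; rewrite mem_undup mem_cat h.
    * by move=> F; have [] := k1 F.
    * by move=> F h; rewrite mem_undup mem_cat h orbT.
    * by move=> F; have [] := k2 F.
- exists Fs, H, K; split => // s hs ho; by rewrite -e2 // e1.
Qed.

Definition zsum : Cn -> C := Dsum fb fell 0.

Definition expansion_on (rho : R) Fs (H : Cn -> C) (K : flagr -> Cn -> C) : Prop :=
  [/\ uniq Fs, (forall F, F \in Fs -> is_flag F), hol 0 rho H, (forall F, hol 0 rho (K F)) &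
    forall s, vn s < rho -> Omega fb fell s -> zsum s = ev Fs H K s].

Lemma expansion_exists (rho : R) : exists Fs H K, expansion_on rho Fs H K.
Proof.
have [B hB] := @lamS_bounded R r N _ fb fell rho.
have hB2 s S : vn s < rho -> S != finset.set0 -> 2 * #|S|%:R - (B + r.*2)%:R <= complex.Re (lamS fb fell S s).
  move=> /ltW hs SN; have := hB s S hs; rewrite natrD -muln2 natrM.
  have : #|S|%:R <= r%:R :> R by rewrite ler_nat -[leqRHS]card_ord max_card.
  lra.
have k0 S : S != finset.set0 -> 0 <= wS fb S 0.
  by move=> _; rewrite /wS big1 // => a _; rewrite ffunE.
have := Dsum_expd (@fb_ge0 R r Phi beta) (fb_supp Phi_root beta_simple) (fb_sm beta_simple) (@fb_pr R r Phi beta) hB2 k0.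
move=> /expd_exrep[Fs [H [K [h1 h2 h3 h4 h5]]]]; exists Fs, H, K; split => // F.
by have [] := h4 F.
Qed.

(** Centre of a unit ball contained in [Omega], from which the identity theorem starts. *)
Definition deep : Cn := const_mx (r.*2.+3)%:R.

Lemma vn_deep : vn deep <= (r.*2.+3)%:R.
Proof. by apply: vn_le => // j; rewrite mxE -rc_nat nm_rc normr_nat. Qed.

Lemma deep_Omega s : vn (s - deep) < 1 -> Omega fb fell s.
Proof.
move=> hs; apply: (Omega_of_Re beta_simple) => j.
have : nm ((s - deep) 0 j) < 1 by apply: le_lt_trans hs; exact: vn_coord.
rewrite !mxE => h; have := le_lt_trans (Re_le_nm _) h.
have -> : complex.Re (s 0 j - (r.*2.+3)%:R) = complex.Re (s 0 j) - (r.*2.+3)%:R.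
  by rewrite ReB -(rc_nat r.*2.+3).
rewrite ltr_norml -[r.*2.+3]addn2 -[r.*2.+1]addn1 !natrD => /andP[h1 _]; lra.
Qed.

Lemma Omega_off_arr s : Omega fb fell s -> ~ arrangement s.
Proof. by move=> hs [c cN cs]; have := Lam_neq0 hs cN; rewrite -LambdaE // cs eqxx. Qed.

(** Off the arrangement both expansions can be multiplied by the forms of all carriers involved. The
    difference of the resulting numerators vanishes near [deep], where both expansions equal the
    series, hence on the smaller ball. *)
Lemma expansion_consistent rho1 rho2 Fs1 H1 K1 Fs2 H2 K2 :
  (r.*2.+3)%:R < rho1 -> (r.*2.+3)%:R < rho2 ->
  expansion_on rho1 Fs1 H1 K1 -> expansion_on rho2 Fs2 H2 K2 ->
  forall s, vn s < rho1 -> vn s < rho2 -> ~ arrangement s -> ev Fs1 H1 K1 s = ev Fs2 H2 K2 s.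
Proof.
move=> r1 r2 [u1 f1 h1 k1 e1] [u2 f2 h2 k2 e2] s s1 s2 hs.
pose l := undup (cars Fs1 ++ cars Fs2).
have lN c : c \in l -> c.1 != finset.set0.
  by rewrite mem_undup mem_cat => /orP[]; exact: cars_neq0.
have sub1 F : F \in Fs1 -> {subset F <= l}.
  by move=> FF c /(cars_sub FF) h; rewrite mem_undup mem_cat h.
have sub2 F : F \in Fs2 -> {subset F <= l}.
  by move=> FF c /(cars_sub FF) h; rewrite mem_undup mem_cat h orbT.
pose g z := num Fs1 H1 K1 l z - num Fs2 H2 K2 l z.
have hg : hol 0 (Num.min rho1 rho2) g.
  move=> z; rewrite subr0 lt_min => /andP[z1 z2]; apply: hdiffB; apply: hdiff_num => [|F _].
  - by apply: h1; rewrite subr0.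
  - by apply: k1; rewrite subr0.
  - by apply: h2; rewrite subr0.
  - by apply: k2; rewrite subr0.
have gs : g s = 0.
  apply: (identity_ball hg (q := deep) (delta := 1)) => //.
  - by rewrite subr0 lt_min; apply/andP; split; apply: le_lt_trans vn_deep _.
  - move=> x xd; rewrite subr0 lt_min => /andP[x1 x2]; have xO := deep_Omega xd.
    have nz c : c \in l -> Lambda c x != 0 by move=> /lN; apply: notin_arr; exact: Omega_off_arr.
    by rewrite /g -!num_ev ?undup_uniq // -e1 // -e2 // subrr.
  - by rewrite subr0 lt_min s1.
have nz c : c \in l -> Lambda c s != 0 by move=> /lN; apply: notin_arr.
move: gs; rewrite /g -!num_ev ?undup_uniq // -mulrBr => /eqP.
by rewrite mulf_eq0 (negPf (prodL_neq0 nz)) /= subr_eq0 => /eqP.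
Qed.

Lemma continuation : exists Z : Cn -> C, forall rho : R, exists Fs H K, exists2 rho', rho < rho' &
  expansion_on rho' Fs H K /\ forall s, vn s < rho' -> ~ arrangement s -> Z s = ev Fs H K s.
Proof.
(* At least 2 r + 4, so that every ball contains [deep]. *)
pose rho (n : nat) : R := (n + r.*2.+4)%:R.
have /choice[E hE] : forall n, exists E : (seq flagr * (Cn -> C) * (flagr -> Cn -> C))%type,
    expansion_on (rho n) E.1.1 E.1.2 E.2.
  by move=> n; have [Fs [H [K h]]] := expansion_exists (rho n); exists (Fs, H, K).
pose b s := Num.bound (vn s).
have bP s : vn s < rho (b s).
  apply: lt_le_trans (archi_boundP (vn_ge0 s)) _; by rewrite ler_nat leq_addr.
have rr n : (r.*2.+3)%:R < rho n by rewrite ltr_nat; lia.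
(* The value at [s] is read off the expansion on a ball chosen according to the norm of [s]. On the
   arrangement it carries no information, since the inverse of 0 is 0. *)
exists (fun s => ev (E (b s)).1.1 (E (b s)).1.2 (E (b s)).2 s) => x.
pose n := Num.bound `|x|; exists (E n).1.1, (E n).1.2, (E n).2, (rho n).
  apply: le_lt_trans (ler_norm x) _; apply: lt_le_trans (archi_boundP (normr_ge0 x)) _.
  by rewrite ler_nat leq_addr.
split=> // s sn hs.
exact: (expansion_consistent (rr (b s)) (rr n) (hE (b s)) (hE n)).
Qed.

End Continuation.

(** * Local expansions, meromorphy, polar set and the domain of convergence *)

Section Parts.
Context {R : realType} {r : nat}.
Local Notation C := (Cplx R).
Variables (Phi : seq 'rV[R]_r) (beta : r.-tuple 'rV[R]_r).
Hypothesis Phi_root : crystallographic_root_system Phi.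
Hypothesis beta_simple : simple_system (map coroot Phi) beta.
Local Notation N := (size (pos_coroots Phi beta)).
Local Notation Cn := 'rV[C]_N.
Local Notation Lambda := (@Lambda R r Phi beta).
Local Notation Rset := (@Rset R r Phi beta).
Local Notation zeta_term := (@zeta_term R r Phi beta).
Local Notation zeta := (@zeta R r Phi beta).
Local Notation arrangement := (@arrangement R r Phi beta).
Local Notation carr := ({set 'I_r} * nat)%type.
Local Notation flagr := (seq carr).
Local Notation fb := (@fb R r Phi beta).
Local Notation fell := (@fell R r Phi beta).
Implicit Types (c : carr) (s p : Cn) (F : flagr) (Fs : seq flagr).

Variable Z : Cn -> C.
Hypothesis hZ : forall rho : R, exists Fs H K, exists2 rho', rho < rho' &
  expansion_on rho' Fs H K /\ forall s, vn s < rho' -> ~ arrangement s -> Z s = ev Fs H K s.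

Lemma local_expansion p : exists U Fs H K,
  [/\ open U, U p, bounded_set U & flag_expansion Z U Fs H K].
Proof.
have [Fs [H [K [rho hrho [[u f h k _] e]]]]] := hZ (vn p).
exists [set s | vn s < rho], Fs, H, K; split => //.
- exact: open_ball0.
- exact: bounded_ball0.
- split=> //.
  + by move=> s hs; apply/hdiffP; apply: h; rewrite subr0.
  + by move=> F _ s hs; apply/hdiffP; apply: k; rewrite subr0.
Qed.

Lemma meromorphic_Z : meromorphic Z.
Proof.
move=> p; have [Fs [H [K [rho hrho [[u f h k _] e]]]]] := hZ (vn p + 1).
have [l [ul lN hl]] := near_carriers p.
(* The denominator contains every carrier near [p], not only those of the expansion: where it is
   nonzero the point has to be off the arrangement, since only there does the expansion describe
   [Z]. *)
pose l' := undup (l ++ cars Fs).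
have [d d0 hd] := (near_vnP p _).1 hl.
pose d1 := Num.min d 1; have d10 : 0 < d1 by rewrite lt_min d0 ltr01.
have inb s : vn (s - p) < d1 -> vn s < rho.
  rewrite lt_min => /andP[_ s1]; apply: lt_trans hrho.
  by have := vnD (s - p) p; rewrite subrK; lra.
have l'N c : c \in l' -> c.1 != finset.set0.
  by rewrite mem_undup mem_cat => /orP[/lN|/(cars_neq0 f)].
exists [set s | vn (s - p) < d1], (num Fs H K l'), (fun s => \prod_(c <- l') Lambda c s); split.
- split; last by rewrite /= subrr vn0.
  by rewrite openE => s /= hs; exact: near_ball.
- split=> s hs; apply/hdiffP; last by apply: hdiff_prodL.
  by apply: hdiff_num => [|F _]; [apply: h|apply: k]; rewrite subr0; exact: inb.
- move=> V oV [x Vx] VU.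
  have [s Vs hs] := off_arr_near beta_simple (open_nbhs_nbhs (conj oV Vx) : \forall s \near x, V s).
  exists s => //; apply: prodL_neq0 => c /l'N; exact: notin_arr.
- move=> s hs /eqP nz.
  have nz' c : c \in l' -> Lambda c s != 0.
    by move=> cl; apply/eqP => c0; apply: nz; rewrite (big_rem c) //= c0 mul0r.
  have noarr : ~ arrangement s.
    move=> -[c cN c0]; have [|cl _] := hd s _ c cN c0.
      by move: hs; rewrite /= lt_min => /andP[].
    have : c \in l' by rewrite mem_undup mem_cat cl.
    by move/nz'; rewrite c0 eqxx.
  rewrite e ?inb // -num_ev ?undup_uniq //; last first.
    by move=> F FF c /(cars_sub FF) cc; rewrite mem_undup mem_cat cc orbT.
  by rewrite mulrC mulKf //; exact: prodL_neq0.
Qed.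

Lemma near_off_arr p : ~ arrangement p -> \forall s \near p, ~ arrangement s.
Proof.
move=> hp; have [l [_ _ hl]] := near_carriers p.
apply: filterS hl => s hs [c cN c0]; apply: hp; exists c => //.
by have [] := hs c cN c0.
Qed.

Lemma hdiff_Z s : ~ arrangement s -> hdiff Z s.
Proof.
move=> hs; have [Fs [H [K [rho hrho [[u f h k _] e]]]]] := hZ (vn s).
have sb : vn (s - 0) < rho by rewrite subr0.
apply: (@hdiff_near _ _ (ev Fs H K)); last first.
  by apply: hdiff_ev => // [|F _]; [apply: h|apply: k].
have nb := near_ball sb.
by apply: filterS2 nb (near_off_arr hs) => x; rewrite subr0 => xb xa; rewrite e.
Qed.

Lemma polar_sub : polar_set Z `<=` arrangement.
Proof.
move=> p hp; apply: contrapT => /near_off_arr h; apply: hp.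
by apply: filterS h => s hs; apply/hdiffP; exact: hdiff_Z.
Qed.

Lemma abs_conv : exists sigma : R, forall s, (forall j, sigma < complex.Re (s 0 j)) ->
  has_abs_sum (pos_box r) (zeta_term s) (zeta s) /\ Z s = zeta s.
Proof.
exists (r.*2.+1)%:R => s hs.
have sO : Omega fb fell s by apply: (Omega_of_Re beta_simple) => j; exact: ltW.
have ge0 := @fb_ge0 R r Phi beta; have supp := fb_supp Phi_root beta_simple.
have w0 S : wS fb S 0 = 0 by rewrite /wS big1 // => a _; rewrite ffunE.
have h0 (S : {set 'I_r}) : S != finset.set0 -> 2 * #|S|%:R <= complex.Re (lamS fb fell S s) + (wS fb S 0)%:~R.
  by move=> SN; rewrite w0 addr0; have := sO S SN; lra.
have hs1 := Dsum_has_sum ge0 supp h0.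
have [X X0 hX] := ez_bounded fell 0 (vn s).
have [B B0 hB] := term_bound fell ge0 supp X.
have hs2 : has_abs_sum (pos_box r) (zeta_term s) (Dsum fb fell 0 s).
  apply: has_abs_sum_zeta => //; exists (B * 2 ^+ r).
  by apply: abs_bounded_wbound => // n; apply: hB => // a; exact: hX.
have zE : zeta s = Dsum fb fell 0 s.
  by case: hs2 => _ h; apply: cvg_lim h.
rewrite zE; split => //.
have [Fs [H [K [rho hrho [[u f h k e1] e]]]]] := hZ (vn s).
rewrite e //; last exact: Omega_off_arr.
by rewrite -e1.
Qed.

End Parts.

(** * Laurent coefficients along slices *)

Section Rotation.
Context {R : realType}.
Local Notation C := (Cplx R).

(* A rotation of infinite order, since (3 + 4i)^n = 3 + 4i modulo 5. *)
Definition rot : C := Complex (3 / 5) (4 / 5).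

Lemma nm_rot : nm rot = 1.
Proof.
rewrite nmE /=; have -> : (3 / 5) ^+ 2 + (4 / 5) ^+ 2 = 1 :> R by field.
exact: sqrtr1.
Qed.

Lemma rot_pow n : exists a b : int,
  rot ^+ n.+1 = Complex ((3 + 5 * a%:~R) / 5 ^+ n.+1) ((4 + 5 * b%:~R) / 5 ^+ n.+1).
Proof.
elim: n => [|n [a [b IH]]].
  by exists 0, 0; rewrite !expr1 !mulr0 !addr0.
exists (-2 + 3 * a - 4 * b), (4 + 4 * a + 3 * b).
have f5 : (5 : R) ^+ n != 0 by rewrite expf_neq0.
rewrite exprS IH; apply: complexP; rewrite ?ReM ?ImM /= !rmorphD ?rmorphN !rmorphM /= !exprS; field; exact: f5.
Qed.

Lemma rot_neq1 (n : int) : n != 0 -> rot ^ n != 1.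
Proof.
have pos (m : nat) : rot ^+ m.+1 != 1.
  apply/eqP; have [a [b ->]] := rot_pow m => /(congr1 (@complex.Im R)) /= h.
  have f5 : (5 : R) ^+ m.+1 != 0 by rewrite expf_neq0.
  have : 4 + 5 * b%:~R = 0 :> R.
    by move/eqP: h; rewrite mulf_eq0 invr_eq0 (negPf f5) orbF => /eqP.
  have -> : 4 + 5 * b%:~R = (4 + 5 * b)%:~R :> R by rewrite rmorphD rmorphM.
  by move=> /eqP; rewrite intr_eq0 => /eqP h'; lia.
case: n => [[|m]//|m] _; first exact: pos.
by rewrite NegzE -exprnN invr_eq1; exact: pos.
Qed.

(** A Cesaro mean of the powers of [rot ^ n]: it is 1 for n = 0 and, by the geometric sum, tends to
    0 with growing [q] otherwise. *)
Definition avg (q : nat) (n : int) : C := q.+1%:R^-1 * \sum_(j < q.+1) (rot ^ n) ^+ j.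

Lemma nm_rotz n : nm (rot ^ n) = 1.
Proof.
case: n => m; first by rewrite -exprnP nmX nm_rot expr1n.
by rewrite NegzE -exprnN nmV nmX nm_rot expr1n invr1.
Qed.

Lemma rot_neq0 : rot != 0. Proof. by rewrite -nm_gt0 nm_rot. Qed.

Lemma avg0 q : avg q 0 = 1.
Proof.
rewrite /avg expr0z; under eq_bigr do rewrite expr1n.
by rewrite sumr_const card_ord mulVf.
Qed.

Lemma nm_avg_le1 q n : nm (avg q n) <= 1.
Proof.
rewrite nmM nmV nm_nat mulrC ler_pdivrMr // mul1r.
apply: le_trans (nm_sum _ _ _) _; under eq_bigr do rewrite nmX nm_rotz expr1n.
by rewrite sumr_const card_ord.
Qed.

Lemma avg_small n (e : R) : n != 0 -> 0 < e ->
  exists q0, forall q, (q0 <= q)%N -> nm (avg q n) <= e.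
Proof.
move=> n0 e0; have d0 : 0 < nm (rot ^ n - 1) by rewrite nm_gt0 subr_eq0 rot_neq1.
exists (Num.bound (2 / (e * nm (rot ^ n - 1)))) => q hq.
have hq1 : 2 / (e * nm (rot ^ n - 1)) <= q.+1%:R.
  apply: le_trans (ltW (archi_boundP _)) _; first by rewrite divr_ge0 // mulr_ge0 // ltW.
  by rewrite ler_nat; apply: leq_trans hq _.
rewrite /avg -(@ler_pM2r _ (nm (rot ^ n - 1))) // -nmM -mulrA [_ * (rot ^ n - 1)]mulrC -subrX1.
rewrite nmM nmV nm_nat mulrC ler_pdivrMr //.
apply: (@le_trans _ _ 2).
  by apply: le_trans (nm_sub _ _) _; rewrite nmX nm_rotz expr1n nm1.
by move: hq1; rewrite ler_pdivrMr ?mulr_gt0 // mulrC.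
Qed.

Lemma near_finite (T : eqType) (s : seq T) (P : T -> nat -> Prop) :
  (forall i, i \in s -> exists q0, forall q, (q0 <= q)%N -> P i q) ->
  exists q0, forall q, (q0 <= q)%N -> forall i, i \in s -> P i q.
Proof.
elim: s => [|i s IH] h; first by exists 0%N.
have [q1 h1] := h i (mem_head _ _).
have [|q2 h2] := IH; first by move=> j js; apply: h; rewrite in_cons js orbT.
exists (maxn q1 q2) => q; rewrite geq_max => /andP[a b] j.
by rewrite in_cons => /orP[/eqP ->|]; [exact: h1|exact: h2].
Qed.

(* Averaging over the rotations isolates the terms of exponent m. *)
Lemma isolate (I : eqType) (w : I -> int) (a : I -> C) (bx : nat -> seq I) B : exhaustion bx -> abs_bounded a B ->
  (forall j, has_sum (fun i => a i * (rot ^ w i) ^+ j) 0) ->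
  forall m, has_sum (fun i => if w i == m then a i else 0) 0.
Proof.
move=> hb hB h m; pose f i : C := if w i == m then a i else 0.
have fle i : nm (f i) <= nm (a i) by rewrite /f; case: ifP => // _; rewrite nm0 nm_ge0.
have hf : abs_bounded f B by apply: abs_bounded_le fle hB.
have [l hl] := has_sum_exists hb hf.
suff l0 : l = 0 by rewrite -[X in has_sum _ X]l0.
apply/nm_le0_eq0/ge0_le_eps => e e0.
have e2 : 0 < e / 2 by rewrite divr_gt0.
(* Outside a finite box the terms are small in total; inside it a single [q] makes all averages with
   [w i] different from [m] small. *)
have [M0 hM] := abs_tail hb hB e2.
have B0 := abs_bounded_ge0 hB.
have B1 : 0 < 2 * (B + 1) by lra.
have [q hq] : exists q0, forall q, (q0 <= q)%N -> forall i, i \in bx M0 -> w i != m ->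
    nm (avg q (w i - m)) <= e / (2 * (B + 1)).
  apply: near_finite => i _; have [->|wm] := eqVneq (w i) m; first by exists 0%N.
  have [|q0 h0] := @avg_small (w i - m) (e / (2 * (B + 1))) _ (divr_gt0 e0 B1); first by rewrite subr_eq0.
  by exists q0 => q /h0.
have {}hq := hq q (leqnn q).
pose b i := a i * avg q (w i - m).
have hb0 : has_sum b 0.
  have -> : (0 : C) = q.+1%:R^-1 * \sum_(j < q.+1) (rot ^ (- m)) ^+ j * 0.
    by rewrite big1 ?mulr0 // => j _; rewrite mulr0.
  apply: eq_has_sum (has_sumZ _ (has_sum_sum _ (fun (j : 'I_q.+1) _ => has_sumZ _ (h j)))) => i.
  rewrite /b /avg mulrCA; congr (_ * _); rewrite mulr_sumr; apply: eq_bigr => j _.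
  by rewrite addrC expfzDr ?rot_neq0 // exprMn; ring.
have := has_sumB hl hb0; rewrite subr0 => /has_sum_nm; apply.
move=> s us; rewrite (bigID (fun i => i \in bx M0)) /=.
have c1 i : nm (f i - b i) <= nm (a i).
  rewrite /f /b; have [->|_] := eqVneq (w i) m; first by rewrite subrr avg0 mulr1 subrr nm0 nm_ge0.
  rewrite sub0r nmN nmM -[leRHS]mulr1 ler_wpM2l ?nm_ge0 ?nm_avg_le1 //.
have -> : e = e / 2 + e / 2 by lra.
apply: lerD; last first.
  apply: (@le_trans _ _ (\sum_(i <- [seq i <- s | i \notin bx M0]) nm (a i))).
    by rewrite big_filter; apply: ler_sum.
  apply: hM; first exact: filter_uniq.
  by move=> i; rewrite mem_filter => /andP[].
apply: (@le_trans _ _ (\sum_(i <- [seq i <- s | i \in bx M0]) nm (a i) * (e / (2 * (B + 1))))).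
  rewrite big_filter; apply: ler_sum => i iM.
  rewrite /f /b; have [->|wm] := eqVneq (w i) m.
    by rewrite subrr avg0 mulr1 subrr nm0 mulr_ge0 ?nm_ge0 // divr_ge0 // ltW.
  by rewrite sub0r nmN nmM ler_wpM2l ?nm_ge0 // hq.
rewrite -mulr_suml; have := hB _ (filter_uniq (fun i => i \in bx M0) us).
set S := \sum_(i <- _) _ => hS.
apply: (@le_trans _ _ ((B + 1) * (e / (2 * (B + 1))))).
  by apply: ler_wpM2r; [rewrite divr_ge0 // ltW|lra].
have -> : (B + 1) * (e / (2 * (B + 1))) = e / 2 by field; lra.
by [].
Qed.

End Rotation.

(** * Laurent expansions in one variable *)

Section Laurent.
Context {R : realType}.
Local Notation C := (Cplx R).

Lemma near_nmP (P : C -> Prop) :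
  (\forall t \near (0 : C)^', P t) <-> exists2 d : R, 0 < d & forall t, 0 < nm t < d -> P t.
Proof.
split.
  move=> /nbhs_ballP[e /= /cgt0P[d d0 ->] h]; exists d => // t /andP[t0 td]; apply: h.
    by rewrite -ball_normE /ball_ /= distrC subr0 normC_nm rc_lt.
  by rewrite -nm_gt0.
move=> [d d0 h]; apply/nbhs_ballP; exists (rc d); first by rewrite /= -rc0 rc_lt.
move=> t; rewrite -ball_normE /ball_ /= distrC subr0 normC_nm rc_lt => td t0; apply: h.
by rewrite td nm_gt0 t0.
Qed.

Definition laurent_sum (g : C -> C) (c : int -> C) (t : C) : Prop :=
  (exists B, abs_bounded (fun n : int => c n * t ^ n) B) /\ has_sum (fun n => c n * t ^ n) (g t).

Lemma laurent_at0P g c :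
  laurent_at0 g c <-> exists2 d : R, 0 < d & forall t, 0 < nm t < d -> laurent_sum g c t.
Proof.
rewrite /laurent_at0 near_nmP; split=> -[d d0 h]; exists d => // t td.
  exact: (has_abs_sumP _ _ int_interval_exhaustion).1 (h t td).
exact: (has_abs_sumP _ _ int_interval_exhaustion).2 (h t td).
Qed.

Lemma laurent_ext f g c : (\forall t \near (0 : C)^', f t = g t) -> laurent_at0 f c -> laurent_at0 g c.
Proof. by move=> h1 h2; apply: filterS2 h1 h2 => t ->. Qed.

Lemma laurentD (f g : C -> C) (c e : int -> C) : laurent_at0 f c -> laurent_at0 g e ->
  laurent_at0 (fun t => f t + g t) (fun n => c n + e n).
Proof.
move=> /laurent_at0P[d d0 h] /laurent_at0P[d' d'0 h']; apply/laurent_at0P.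
exists (Num.min d d'); first by rewrite lt_min d0.
move=> t; rewrite lt_min => /andP[t0 /andP[td td']].
have [|[B hB] hs] := h t; first by rewrite t0.
have [|[B' hB'] hs'] := h' t; first by rewrite t0.
split.
  exists (B + B'); apply: abs_bounded_le (fun n => le_refl _) _.
  by move=> s us; have := abs_boundedD hB hB' us; under eq_bigr do rewrite -mulrDl.
by apply: eq_has_sum (has_sumD hs hs') => n; rewrite mulrDl.
Qed.

Lemma laurent0 : laurent_at0 (fun _ : C => 0 : C) (fun=> 0).
Proof.
apply/laurent_at0P; exists 1 => // t _; split.
  by exists 0 => s _; rewrite big1 // => i _; rewrite mul0r nm0.
by apply: (@eq_has_sum _ _ (fun=> 0)) => [n|]; [rewrite mul0r|exact: has_sum0].
Qed.

Lemma laurent_bigsum (T : eqType) (s : seq T) (f : T -> C -> C) (c : T -> int -> C) :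
  (forall i, i \in s -> laurent_at0 (f i) (c i)) ->
  laurent_at0 (fun t => \sum_(i <- s) f i t) (fun n => \sum_(i <- s) c i n).
Proof.
elim: s => [|i s IH] h.
  have -> : (fun t => \sum_(i <- [::]) f i t) = fun=> 0 by apply/funext => t; rewrite big_nil.
  have -> : (fun n => \sum_(i <- [::]) c i n) = fun=> 0 by apply/funext => n; rewrite big_nil.
  exact: laurent0.
have -> : (fun t => \sum_(j <- i :: s) f j t) = fun t => f i t + \sum_(j <- s) f j t.
  by apply/funext => t; rewrite big_cons.
have -> : (fun n => \sum_(j <- i :: s) c j n) = fun n => c i n + \sum_(j <- s) c j n.
  by apply/funext => n; rewrite big_cons.
apply: laurentD; first exact: h (mem_head _ _).
by apply: IH => j js; apply: h; rewrite in_cons js orbT.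
Qed.

(** The difference of the two expansions sums to 0 at all points t rot^j of one circle, and
    [isolate] extracts each of its coefficients. *)
Lemma laurent_uniq (g : C -> C) (c c' : int -> C) : laurent_at0 g c -> laurent_at0 g c' -> c = c'.
Proof.
move=> /laurent_at0P[d d0 h] /laurent_at0P[d' d'0 h'].
pose e n := c n - c' n; pose D := Num.min d d'.
have D0 : 0 < D by rewrite lt_min d0.
have hD t : 0 < nm t < D -> (exists B, abs_bounded (fun n => e n * t ^ n) B) /\ has_sum (fun n => e n * t ^ n) 0.
  rewrite lt_min => /andP[t0 /andP[td td']].
  have [|[B hB] hs] := h t; first by rewrite t0.
  have [|[B' hB'] hs'] := h' t; first by rewrite t0.
  split; last by rewrite -(subrr (g t)); apply: eq_has_sum (has_sumB hs hs') => n; rewrite mulrBl.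
  exists (B + nm (-1) * B') => s us; have := abs_boundedD hB (abs_boundedZ (-1) hB') us.
  by under eq_bigr do rewrite mulN1r -mulrBl.
apply/funext => m; apply/eqP; rewrite -subr_eq0; apply/eqP.
pose t : C := rc (D / 2).
have tn : nm t = D / 2 by rewrite nm_rc gtr0_norm // divr_gt0.
have tD : 0 < nm t < D by rewrite tn; apply/andP; split; lra.
have t0 : t != 0 by rewrite -nm_gt0; case/andP: tD.
have [[B hB] _] := hD t tD.
have := isolate (w := id) int_interval_exhaustion hB _ m.
have hj (j : nat) : has_sum (fun n : int => e n * t ^ n * (rot ^ n) ^+ j) 0.
  have [|_ hs] := hD (t * rot ^+ j); first by rewrite nmM nmX nm_rot expr1n mulr1.
  apply: eq_has_sum hs => n; rewrite expfzMl mulrA; congr (_ * _).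
  by rewrite exprnP exprz_exp mulrC -exprz_exp.
move=> /(_ hj) h0.
have h1 : has_sum (fun n : int => if n == m then e n * t ^ n else 0) (e m * t ^ m).
  move=> eps eps0; exists [:: m] => s us sub.
  rewrite (bigD1_seq m) ?sub ?mem_head //= eqxx big1 ?addr0 ?subrr ?nm0 ?ltW // => n /negPf -> //.
have := has_sum_uniq int_interval_exhaustion h0 h1 => /esym/eqP.
by rewrite mulf_eq0 expfz_eq0 (negPf t0) andbF orbF => /eqP.
Qed.

Lemma cdiff_bounded (f : C -> C) : cdiff f 0 -> exists2 d : R, 0 < d & forall t, nm t < d -> nm (f t) <= nm (f 0) + 1.
Proof.
move=> /cdiff_ccont h; have [d d0 hd] := h 1 ltr01; exists d => // t td.
have := hd t td; rewrite ?add0r => h1; have := nm_rev (f t) (f 0); lra.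
Qed.

(** The Taylor series of [f] with its indices shifted by [p]. *)
Lemma laurent_exists (g f : C -> C) (p : nat) (d : R) : 0 < d ->
  (forall t, nm t < d -> cdiff f t) -> (forall t, 0 < nm t < d -> g t = f t / t ^+ p) ->
  exists c, laurent_at0 g c.
Proof.
move=> d0 hf hg; have f0 : cdiff f 0 by apply: hf; rewrite nm0.
have [d1 d10 hd1] := cdiff_bounded f0.
pose D := Num.min d d1; have D0 : 0 < D by rewrite lt_min d0.
have Dd : D <= d by rewrite ge_min lexx.
have Dd1 : D <= d1 by rewrite ge_min lexx orbT.
have rD : 0 < D / 2 < D by apply/andP; split; lra.
have [c [hc hs]] := cauchy_taylor rD (f := f) (B := nm (f 0) + 1)
  (fun z zD => hf z (lt_le_trans zD Dd)) (fun z zD => hd1 z (lt_le_trans zD Dd1)).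
have B0 : 0 <= 2 * (nm (f 0) + 1) by have := nm_ge0 (f 0); lra.
pose phi (k : nat) : int := k%:Z - p%:Z.
have phi_inj : injective phi by move=> a b; rewrite /phi; lia.
pose cc (n : int) : C := if 0 <= n + p%:Z then c (absz (n + p%:Z)) else 0.
exists cc.
apply/laurent_at0P; exists (D / 2); first by case/andP: rD.
move=> t /andP[t0 tD].
have tn0 : t != 0 by rewrite -nm_gt0.
pose F (n : int) : C := cc n * t ^ n.
have F0 n : (forall k, phi k <> n) -> F n = 0.
  move=> h; rewrite /F /cc; case: ifP => np; last by rewrite mul0r.
  by exfalso; apply: (h (absz (n + p%:Z))); rewrite /phi gez0_abs // addrK.
have Fphi k : F (phi k) = t ^- p * (c k * t ^+ k).
  by rewrite /F /cc /phi subrK lez_nat /= expfzDr // -exprnN -exprnP mulrA mulrC.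
have tb : (D / 2) != 0 by lra.
have r0 : 0 < D / 2 by case/andP: rD.
split.
  exists (nm (t ^- p) * (2 * (nm (f 0) + 1) * (1 - nm t / (D / 2))^-1)).
  have hb : abs_bounded (F \o phi) (nm (t ^- p) * (2 * (nm (f 0) + 1) * (1 - nm t / (D / 2))^-1)).
    apply: (@abs_bounded_le _ _ _ (fun k => nm (t ^- p * (c k * t ^+ k)))) => [k|s us]; first by rewrite /= Fphi.
    exact: (abs_boundedZ (t ^- p) (power_abs_bounded r0 tD B0 hc)).
  exact (abs_bounded_reindex phi_inj F0 hb).
apply/(@has_sum_reindex _ _ _ _ phi_inj F _ F0).
have -> : g t = t ^- p * f t.
  rewrite hg 1?mulrC // t0 /=; apply: lt_le_trans Dd.
  by apply: lt_trans tD _; case/andP: rD.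
apply: (@eq_has_sum _ _ (fun k => t ^- p * (c k * t ^+ k))) => [k|]; first by rewrite /= Fphi.
apply: has_sumZ.
apply: (has_sum_nat (A := 4 * (nm (f 0) + 1)) r0 tD B0 hc) => K.
exact: hs.
Qed.

End Laurent.

(** * Pullback to transverse slices *)

Section Slices.
Context {R : realType} {r : nat}.
Local Notation C := (Cplx R).
Variables (Phi : seq 'rV[R]_r) (beta : r.-tuple 'rV[R]_r).
Hypothesis beta_simple : simple_system (map coroot Phi) beta.
Local Notation N := (size (pos_coroots Phi beta)).
Local Notation Cn := 'rV[C]_N.
Local Notation Lambda := (@Lambda R r Phi beta).
Local Notation arrangement := (@arrangement R r Phi beta).
Local Notation carr := ({set 'I_r} * nat)%type.
Local Notation flagr := (seq carr).
Implicit Types (c : carr) (s p : Cn) (F : flagr) (Fs : seq flagr).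

Lemma transverse_slope s0 v c : transverse s0 v -> c.1 != finset.set0 -> Lambda c s0 = 0 ->
  slope c v != 0.
Proof.
move=> tv cN c0; have := tv c cN c0; apply: contraNneq => sl.
have -> : (fun t : C => Lambda c (slice s0 v t)) = cst 0.
  by apply/funext => t; rewrite /slice Lambda_line c0 sl mulr0 addr0.
by rewrite derive1_cst.
Qed.

Lemma near_slice (s0 v : Cn) (P : Cn -> Prop) : (\forall s \near s0, P s) ->
  exists2 d : R, 0 < d & forall t, nm t < d -> P (slice s0 v t).
Proof.
move=> /near_vnP[d d0 hd]; have v1 : 0 < vn v + 1 by have := vn_ge0 v; lra.
exists (d / (vn v + 1)); first by rewrite divr_gt0.
move=> t; rewrite ltr_pdivlMr // => ht; apply: hd; rewrite /slice addrC addKr vnZ.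
by apply: le_lt_trans ht; rewrite ler_wpM2l ?nm_ge0 // lerDl.
Qed.

(** Along the slice a form vanishing at [s0] is [t] times its slope, so the power of [t] in the
    denominator is the number of such forms in [F]; the other forms are invertible near [s0]. *)
Lemma laurent_term s0 v F (K : Cn -> C) : transverse s0 v ->
  (forall c, c \in F -> c.1 != finset.set0) -> (\forall s \near s0, hdiff K s) ->
  exists k, laurent_at0 ((fun s => K s * \prod_(c <- F) (Lambda c s)^-1) \o slice s0 v) k.
Proof.
move=> tv FN hK.
have h1 : \forall s \near s0, forall c, c \in F -> Lambda c s0 != 0 -> Lambda c s != 0.
  apply: near_all => c cl; have [cp|cp] := eqVneq (Lambda c s0) 0; first by apply: filterE.
  by apply: filterS (near_neq0 (hdiff_Lambda c s0) cp) => s.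
have [d d0 hd] := near_slice v (filterI hK h1).
pose G c s := if Lambda c s0 == 0 then (slope c v)^-1 else (Lambda c s)^-1.
apply: (laurent_exists (p := count (fun c => Lambda c s0 == 0) F) d0
  (f := fun t => K (s0 + t *: v) * \prod_(c <- F) G c (s0 + t *: v))).
  move=> t /hd[Kt Lt]; apply: (@hdiff_line _ _ (fun s => K s * \prod_(c <- F) G c s)).
  apply: hdiffM => //; apply: hdiff_prod => c cF _; rewrite /G; case: eqVneq => [_|h].
    exact: hdiff_cst.
  by apply: hdiffV; [exact: hdiff_Lambda|exact: Lt].
move=> t /andP[t0 td] /=; rewrite -mulrA; congr (_ * _).
rewrite nm_gt0 in t0.
elim: F FN {h1 hd} => [|c F IH] FN; first by rewrite !big_nil expr0 divr1.
rewrite !big_cons IH; last by move=> e eF; apply: FN; rewrite in_cons eF orbT.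
rewrite /= /slice /G exprD invfM mulrACA; congr (_ * _).
have cN := FN c (mem_head _ _).
rewrite Lambda_line; case: eqVneq => [c0|h]; last by rewrite /= expr0 divr1.
by rewrite c0 add0r expr1 invfM mulrC.
Qed.

Lemma slice_off_arr s0 v : transverse s0 v -> \forall t \near (0 : C)^', ~ arrangement (slice s0 v t).
Proof.
move=> tv; have [l [_ _ hl]] := near_carriers s0.
have [d d0 hd] := near_slice v hl; apply/near_nmP; exists d => // t /andP[t0 td] [c cN c1].
have [_ c0] := hd t td c cN c1.
move: c1; rewrite /hyperplane /= /slice Lambda_line c0 add0r => /eqP.
by rewrite mulf_eq0 (negPf (transverse_slope tv cN c0)) orbF -[_ == _]negbK -nm_gt0 t0.
Qed.

Lemma laurent_hdiff s0 v (H : Cn -> C) : transverse s0 v -> (\forall s \near s0, hdiff H s) ->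
  exists h, laurent_at0 (H \o slice s0 v) h.
Proof.
move=> tv hH; have [//|k hk] := laurent_term (F := [::]) tv _ hH.
exists k; apply: laurent_ext hk; apply: filterE => t /=; by rewrite big_nil mulr1.
Qed.

Lemma aggregate_exists (Z : Cn -> C) s0 v U Fs H K : transverse s0 v -> open U -> U s0 ->
  flag_expansion Z U Fs H K -> exists kappa, aggregate_laurent s0 v Fs H K kappa.
Proof.
move=> tv oU Us0 [[_ fl] hH hK _].
have nU : \forall s \near s0, U s by exact: open_nbhs_nbhs.
have [|h hh] := @laurent_hdiff s0 v H tv; first by apply: filterS nU => s Us; apply/hdiffP; exact: hH.
have /choice[k hk] : forall F, exists k, F \in Fs -> laurent_at0
    ((fun s => K F s * \prod_(c <- F) (Lambda c s)^-1) \o slice s0 v) k.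
  move=> F; have [FF|FF] := boolP (F \in Fs); last first.
    exists (fun=> 0) => FF'.
    exfalso.
    discriminate FF'.
  have [||k hk] := @laurent_term s0 v F (K F) tv; last by exists k.
    by move=> c; have /and3P[_ /allP h0 _] := fl F FF; exact: h0.
  by apply: filterS nU => s Us; apply/hdiffP; exact: hK.
by exists (fun n => h n + \sum_(F <- Fs) k F n), h, k.
Qed.

Lemma aggregate_laurent_at0 (Z : Cn -> C) s0 v U Fs H K kappa : transverse s0 v -> open U -> U s0 ->
  flag_expansion Z U Fs H K -> aggregate_laurent s0 v Fs H K kappa ->
  laurent_at0 (Z \o slice s0 v) kappa.
Proof.
move=> tv oU Us0 [_ _ _ eZ] [h [k [hh hk kE]]].
have -> : kappa = fun n => h n + \sum_(F <- Fs) k F n by apply/funext.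
apply: laurent_ext (laurentD hh (laurent_bigsum hk)).
have nU : \forall s \near s0, U s by exact: open_nbhs_nbhs.
have [d d0 hd] := near_slice v nU.
have nU' : \forall t \near (0 : C)^', U (slice s0 v t).
  by apply/near_nmP; exists d => // t /andP[_ /hd].
by apply: filterS2 nU' (slice_off_arr tv) => t Ut at_; rewrite /= eZ.
Qed.

(** By additivity every aggregate is a Laurent expansion of one function, the pullback of [Z],
    because a transverse slice is off the arrangement for small nonzero [t]. Uniqueness of Laurent
    coefficients then gives the independence. *)
Lemma slice_part (Z : Cn -> C) :
  (forall p, exists U Fs H K, [/\ open U, U p, bounded_set U & flag_expansion Z U Fs H K]) ->
  forall s0 v : Cn, transverse s0 v -> exists kappa : int -> C,
    (forall kappa', laurent_at0 (Z \o slice s0 v) kappa' <-> kappa' = kappa) /\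
    (forall U Fs H K, open U -> U s0 -> flag_expansion Z U Fs H K ->
       forall kappa', aggregate_laurent s0 v Fs H K kappa' <-> kappa' = kappa).
Proof.
move=> hZ s0 v tv; have [U [Fs [H [K [oU Us0 _ e]]]]] := hZ s0.
have [kappa hk] := aggregate_exists tv oU Us0 e.
have lk := aggregate_laurent_at0 tv oU Us0 e hk.
exists kappa; split=> [k'|U' Fs' H' K' oU' Us0' e' k'].
  by split=> [h|->//]; exact: laurent_uniq h lk.
split=> [/(aggregate_laurent_at0 tv oU' Us0' e') h|->]; first exact: laurent_uniq h lk.
have [k2 hk2] := aggregate_exists tv oU' Us0' e'.
by have := aggregate_laurent_at0 tv oU' Us0' e' hk2 => /(laurent_uniq lk) ->.
Qed.

End Slices.

(** * Residues at generic flag points *)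

Section Completion.
Context {R : realType} {r : nat}.
Local Notation C := (Cplx R).
Variables (Phi : seq 'rV[R]_r) (beta : r.-tuple 'rV[R]_r).
Hypothesis beta_simple : simple_system (map coroot Phi) beta.
Local Notation N := (size (pos_coroots Phi beta)).
Local Notation Cn := 'rV[C]_N.
Local Notation Lambda := (@Lambda R r Phi beta).
Local Notation Rset := (@Rset R r Phi beta).
Local Notation carr := ({set 'I_r} * nat)%type.
Local Notation flagr := (seq carr).
Local Notation c0 := ((finset.set0, 0%N) : carr).
Local Notation idx := (simple_index beta_simple).

Lemma idx_Rset (S : {set 'I_r}) i : (idx i \in Rset S) = (i \in S).
Proof. by rewrite -meets_fb; exact: (meets_sm (fb_sm beta_simple) S i). Qed.

Lemma idx_inj : injective idx.
Proof.
by move=> i j h; have := idx_Rset [set i]%SET i; rewrite h idx_Rset !inE eqxx => /eqP ->.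
Qed.

(** An index of each set of the flag that lies in none of the smaller ones; it makes the system of
    forms triangular. *)
Lemma flag_witness (F : flagr) : is_flag F -> forall m, (m < size F)%N ->
  exists i : 'I_r, i \in (nth c0 F m).1 /\ forall m', (m' < m)%N -> i \notin (nth c0 F m').1.
Proof.
move=> /and3P[_ /allP FN so] m mF.
have tr : transitive (fun c d : carr => c.1 \proper d.1).
  by move=> a b c; exact: fintype.proper_trans.
have lt i j : (i < j)%N -> (j < size F)%N -> (nth c0 F i).1 \proper (nth c0 F j).1.
  by move=> ij jF; apply: (sorted_ltn_nth tr _ so); rewrite ?inE ?(ltn_trans ij jF).
case: m mF => [|m] mF.
  by have /set0Pn[i hi] := FN _ (mem_nth c0 mF); exists i.
have /properP[_ [i i1 i2]] := lt m m.+1 (ltnSn m) mF.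
exists i; split=> // m'; rewrite ltnS leq_eqVlt => /orP[/eqP ->//|m'm].
have /proper_sub/fintype.subsetP h := lt m' m m'm (ltnW mF).
by apply: contra i2; exact: h.
Qed.

(** On the coordinates of the simple coroots indexed by the witnesses the forms of [F] are
    triangular with diagonal 1; the remaining coordinates complete them. *)
Lemma completes_exists (F : flagr) : is_flag F -> exists A (b : Cn), completes F A b.
Proof.
move=> fl; pose k := size F.
have /choice[wi hwi] : forall m : 'I_k, exists i : 'I_r, i \in (nth c0 F m).1 /\
    forall m', (m' < m)%N -> i \notin (nth c0 F m').1.
  by move=> m; exact: flag_witness.
pose sg (m : 'I_k) : 'I_N := idx (wi m).
have sg_inj : injective sg.
  move=> m m' /idx_inj e; apply/val_inj; case: (ltngtP m m') => // h.
    by have [h1 _] := hwi m; have [_ /(_ m h)] := hwi m'; rewrite -e h1.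
  by have [h1 _] := hwi m'; have [_ /(_ m' h)] := hwi m; rewrite e h1.
(* An ordering of the coordinates that starts with those of the witnesses; [pi] is the resulting
   permutation. *)
pose l := map sg (enum 'I_k) ++ [seq i <- enum 'I_N | i \notin map sg (enum 'I_k)].
have ul : uniq l.
  rewrite cat_uniq map_inj_uniq // enum_uniq filter_uniq ?enum_uniq // andbT.
  by apply/hasPn => i; rewrite mem_filter => /andP[].
have memb i : i \in l by rewrite mem_cat mem_filter mem_enum andbT; case: (i \in _).
have sl : size l = N.
  rewrite -[RHS]card_ord cardE; apply/perm_size; apply: uniq_perm => //; first exact: enum_uniq.
  by move=> i; rewrite memb mem_enum.
have kN : (k <= N)%N by rewrite -sl size_cat size_map size_enum_ord leq_addr.
pose pi (j : 'I_N) : 'I_N := nth j l j.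
have pi_low (m : 'I_k) : pi (widen_ord kN m) = sg m.
  rewrite /pi nth_cat size_map size_enum_ord /= ltn_ord (nth_map m) ?size_enum_ord //.
  by rewrite nth_ord_enum.
have pi_surj i : exists j, pi j = i.
  have h : (index i l < N)%N by rewrite -[ltnRHS]sl index_mem memb.
  by exists (Ordinal h); rewrite /pi /= nth_index // memb.
pose A : 'M[C]_N := \matrix_(i, j) (if (j < k)%N then (i \in Rset (nth c0 F j).1)%:R else (i == pi j)%:R).
pose b : Cn := \row_j (- #|(nth c0 F j).1|%:R + (nth c0 F j).2%:R).
exists A, b; split => //; last first.
  move=> s j jk; rewrite /affine_coords !mxE /Defs.Lambda addrA; congr (_ - _ + _).
  rewrite [RHS]big_mkcond; apply: eq_bigr => i _; rewrite mxE jk.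
  by case: (i \in _); rewrite ?mulr1 ?mulr0.
rewrite -row_free_unit; apply: inj_row_free => w wA.
have wj j : \sum_i w 0 i * A i j = 0 by have /rowP/(_ j) := wA; rewrite !mxE.
have high (j : 'I_N) : (k <= j)%N -> w 0 (pi j) = 0.
  move=> kj; have := wj j; rewrite (bigD1 (pi j)) //= mxE ltnNge kj /= eqxx mulr1 big1 ?addr0 // => i.
  by move=> /negPf ij; rewrite mxE ltnNge kj /= ij mulr0.
(* Column m involves only the witnesses up to m, since later ones avoid the m-th set; those before m
   are settled by induction. *)
have low m : forall mk : (m < k)%N, w 0 (sg (Ordinal mk)) = 0.
  have [M] := ubnP m; elim: M m => // M IH m; rewrite ltnS => mM mk.
  have := wj (widen_ord kN (Ordinal mk)); rewrite (bigD1 (sg (Ordinal mk))) //= mxE /= mk.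
  rewrite idx_Rset; have [-> _] := hwi (Ordinal mk); rewrite mulr1 big1 ?addr0 // => i im.
  rewrite mxE /= mk; have [j ij] := pi_surj i.
  have [jk|kj] := ltnP j k; last by rewrite -ij high // mul0r.
  have e : i = sg (Ordinal jk).
    by rewrite -ij -pi_low; congr pi; apply/val_inj.
  rewrite e; have [jm|mj|jm] := ltngtP j m.
  - by rewrite IH ?mul0r //; exact: leq_trans jm mM.
  - rewrite idx_Rset; have [_ /(_ m mj)] := hwi (Ordinal jk) => /negPf ->; by rewrite mulr0.
  - by move: im; rewrite e; case/eqP; congr sg; apply/val_inj.
apply/rowP => i; rewrite mxE; have [j <-] := pi_surj i.
have [jk|kj] := ltnP j k; last exact: high.
have -> : j = widen_ord kN (Ordinal jk) by apply/val_inj.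
by rewrite pi_low low.
Qed.

End Completion.

(** * Multiplying an expansion by the forms of a flag *)

Section Cleared.
Context {R : realType} {r : nat}.
Local Notation C := (Cplx R).
Variables (Phi : seq 'rV[R]_r) (beta : r.-tuple 'rV[R]_r).
Hypothesis beta_simple : simple_system (map coroot Phi) beta.
Local Notation N := (size (pos_coroots Phi beta)).
Local Notation Cn := 'rV[C]_N.
Local Notation Lambda := (@Lambda R r Phi beta).
Local Notation arrangement := (@arrangement R r Phi beta).
Local Notation carr := ({set 'I_r} * nat)%type.
Local Notation flagr := (seq carr).
Implicit Types (c : carr) (s p : Cn) (F : flagr) (Fs : seq flagr).

(** The factors common to [F] and [G] are cancelled, so that near a generic point the function is
    defined and holomorphic on the flag locus too. *)
Definition cleared Fs (H : Cn -> C) (K : flagr -> Cn -> C) F s : C :=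
  (\prod_(c <- F) Lambda c s) * H s + \sum_(G <- Fs) K G s *
    ((\prod_(c <- F | c \notin G) Lambda c s) * \prod_(c <- G | c \notin F) (Lambda c s)^-1).

Lemma cleared_ev Fs H K F s : is_flag F -> (forall G, G \in Fs -> is_flag G) -> ~ arrangement s ->
  cleared Fs H K F s = (\prod_(c <- F) Lambda c s) * ev Fs H K s.
Proof.
move=> fl fls hs; rewrite /cleared /ev mulrDr mulr_sumr; congr (_ + _).
apply: eq_big_seq => G GF; rewrite [RHS]mulrCA; congr (_ * _).
rewrite [in RHS](bigID (fun c => c \in G) xpredT (fun c => Lambda c s)) /=.
rewrite [in RHS](bigID (fun c => c \in F) xpredT (fun c => (Lambda c s)^-1)) /=.
set a := \prod_(c <- F | c \in G) _; set b := \prod_(c <- F | c \notin G) _.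
set d := \prod_(c <- G | c \in F) _; set e := \prod_(c <- G | c \notin F) _.
suff ad : a * d = 1 by rewrite mulrACA ad mul1r.
rewrite /a /d -[X in X * _]big_filter -[X in _ * X]big_filter.
have -> : \prod_(c <- [seq c <- G | c \in F]) (Lambda c s)^-1 = \prod_(c <- [seq c <- F | c \in G]) (Lambda c s)^-1.
  have uF := flag_uniq fl; have uG := flag_uniq (fls G GF).
  apply: perm_big; apply: uniq_perm; rewrite ?filter_uniq // => c.
  by rewrite !mem_filter andbC.
rewrite -big_split /= big_seq big1 // => c; rewrite mem_filter => /andP[_ cF].
by rewrite divff // (notin_arr hs) //; have /and3P[_ /allP h _] := fl; exact: h.
Qed.

(** On the locus a term survives only if no form of [F] is left uncancelled, that is, if [G]
    contains [F]. *)
Lemma cleared_coeff Fs H K F s : is_flag F -> flag_locus F s ->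
  cleared Fs H K F s = flag_coeff Fs K F s.
Proof.
move=> /and3P[F0 _ _] hs; rewrite /cleared /flag_coeff.
have -> : \prod_(c <- F) Lambda c s = 0.
  case: F F0 hs => // c F _ hs; rewrite big_cons.
  by have := hs c (mem_head _ _); rewrite /hyperplane /= => ->; rewrite mul0r.
rewrite mul0r add0r [RHS]big_mkcond /=; apply: eq_bigr => G _; case: ifPn => [/allP h|/allPn[c cF cG]].
  have -> : \prod_(c <- F | c \notin G) Lambda c s = 1.
    by rewrite big_seq_cond big1 // => c /andP[/h ->].
  by rewrite mul1r.
rewrite (big_rem c) //= cG; have := hs c cF; rewrite /hyperplane /= => ->.
by rewrite !mul0r mulr0.
Qed.

Lemma hdiff_cleared Fs H K F s0 : generic_flag_point F s0 -> (forall G, G \in Fs -> is_flag G) ->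
  (\forall s \near s0, hdiff H s) -> (forall G, G \in Fs -> \forall s \near s0, hdiff (K G) s) ->
  \forall s \near s0, hdiff (cleared Fs H K F) s.
Proof.
move=> [_ gen] fls hH hK.
have hK' := near_all hK.
have hL : \forall s \near s0, forall c, c \in flatten Fs -> c \notin F -> Lambda c s != 0.
  apply: near_all => c /flattenP[G GF cG]; have [cF|cF] := boolP (c \in F).
    by apply: filterE => s h; exfalso; discriminate h.
  have cN : c.1 != finset.set0 by have /and3P[_ /allP h _] := fls G GF; exact: h.
  have c0 : Lambda c s0 != 0 by apply: contra cF => /eqP h; exact: gen.
  by apply: filterS (near_neq0 (hdiff_Lambda c s0) c0) => s.
apply: filterS3 hH hK' hL => s Hs Ks Ls.
apply: hdiffD; first by apply: hdiffM => //; exact: hdiff_prodL.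
rewrite (_ : (fun z => _) = fun z => \sum_(G <- Fs | G \in Fs) K G z *
    ((\prod_(c <- F | c \notin G) Lambda c z) * \prod_(c <- G | c \notin F) (Lambda c z)^-1)); last first.
  by apply/funext => z; exact: big_seq.
apply: hdiff_sum => G GF; apply: hdiffM; first exact: Ks.
apply: hdiffM; first exact: hdiff_prodL.
apply: hdiff_prod => c cG cF; apply: hdiffV; first exact: hdiff_Lambda.
by apply: Ls => //; apply/flattenP; exists G.
Qed.

(** If the functions differed at a point they would, by continuity, differ at nearby points, some of
    which are off the arrangement. *)
Lemma eq_off_arr (f g : Cn -> C) s0 : (\forall s \near s0, hdiff f s) -> (\forall s \near s0, hdiff g s) ->
  (\forall s \near s0, ~ arrangement s -> f s = g s) -> \forall s \near s0, f s = g s.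
Proof.
move=> hf hg /near_vnP[d d0 e]; have [d' d'0 h] := (near_vnP s0 (fun s => hdiff f s /\ hdiff g s)).1 (filterI hf hg).
apply/near_vnP; exists (Num.min d d'); first by rewrite lt_min d0.
move=> s; rewrite lt_min => /andP[sd sd']; have [fs gs] := h s sd'.
apply/eqP; apply: contraT; rewrite -subr_eq0 => fg.
have n1 := near_neq0 (hdiffB fs gs) fg.
have [x [x1 x2] xa] := off_arr_near beta_simple (filterI n1 (near_ball sd)).
by move: x1; rewrite e // subrr eqxx.
Qed.

Lemma expansion_near (Z : Cn -> C) U Fs H K s0 : open U -> U s0 -> flag_expansion Z U Fs H K ->
  [/\ (forall G, G \in Fs -> is_flag G), (\forall s \near s0, hdiff H s),
    (forall G, G \in Fs -> \forall s \near s0, hdiff (K G) s) &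
    \forall s \near s0, ~ arrangement s -> Z s = ev Fs H K s].
Proof.
move=> oU Us0 [[_ fl] hH hK eZ].
have nU : \forall s \near s0, U s by exact: open_nbhs_nbhs.
split=> //.
- by apply: filterS nU => s Us; apply/hdiffP; exact: hH.
- by move=> G GF; apply: filterS nU => s Us; apply/hdiffP; exact: hK.
- by apply: filterS nU => s Us; exact: eZ.
Qed.

Lemma coeff_intrinsic (Z : Cn -> C) F s0 U1 Fs1 H1 K1 U2 Fs2 H2 K2 :
  is_flag F -> generic_flag_point F s0 ->
  open U1 -> U1 s0 -> flag_expansion Z U1 Fs1 H1 K1 ->
  open U2 -> U2 s0 -> flag_expansion Z U2 Fs2 H2 K2 ->
  \forall s \near s0, cleared Fs1 H1 K1 F s = cleared Fs2 H2 K2 F s.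
Proof.
move=> fl gen o1 u1 e1 o2 u2 e2.
have [f1 h1 k1 z1] := expansion_near o1 u1 e1; have [f2 h2 k2 z2] := expansion_near o2 u2 e2.
apply: eq_off_arr; [exact: hdiff_cleared|exact: hdiff_cleared|].
by apply: filterS2 z1 z2 => s a1 a2 hs; rewrite !cleared_ev // -a1 // -a2.
Qed.

Lemma generic_off_arr F s0 : generic_flag_point F s0 ->
  \forall s \near s0, (forall c, c \in F -> Lambda c s != 0) -> ~ arrangement s.
Proof.
move=> [_ gen]; have [l [_ _ hl]] := near_carriers s0.
apply: filterS hl => s hs nz [c cN c0]; have [_ c1] := hs c cN c0.
by have := nz c (gen c cN c1); rewrite (c0 : Lambda c s = 0) eqxx.
Qed.

End Cleared.

(** * Laurent series in several variables *)

Section SeveralLaurent.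
Context {R : realType}.
Local Notation C := (Cplx R).

(** [isolate], applied to one variable at a time. *)
Lemma isolate_multi k (a : {ffun 'I_k -> int} -> C) B : abs_bounded a B ->
  (forall n : 'I_k -> nat, has_sum (fun e : {ffun 'I_k -> int} => a e * \prod_j (rot ^ e j) ^+ n j) 0) ->
  forall e0, a e0 = 0.
Proof.
move=> hB h e0.
(* Once the variables in [s] are treated, only exponents agreeing with [e0] on [s] are left, and the
   rotations of the other variables are still free. *)
have part (s : seq 'I_k) : uniq s -> forall n : 'I_k -> nat, has_sum (fun e : {ffun 'I_k -> int} =>
    if all (fun j => e j == e0 j) s then a e * \prod_(j | j \notin s) (rot ^ e j) ^+ n j else 0) 0.
  elim: s => [_ n|j s IH /= /andP[js us] n]; first by apply: eq_has_sum (h n).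
  pose a' (e : {ffun 'I_k -> int}) : C :=
    if all (fun j => e j == e0 j) s then a e * \prod_(i | i \notin j :: s) (rot ^ e i) ^+ n i else 0.
  have hB' : abs_bounded a' B.
    apply: abs_bounded_le hB => e; rewrite /a'; case: ifP => _; last by rewrite nm0 nm_ge0.
    rewrite nmM nm_prod big1 ?mulr1 // => i _; by rewrite nmX nm_rotz expr1n.
  have h' m : has_sum (fun e : {ffun 'I_k -> int} => a' e * (rot ^ e j) ^+ m) 0.
    apply: eq_has_sum (IH us (fun i => if i == j then m else n i)) => e.
    rewrite /a'; case: ifP => _; last by rewrite mul0r.
    rewrite (bigD1 j) //= eqxx -mulrA; congr (_ * _); rewrite mulrC; congr (_ * _).
    apply: eq_big => i; first by rewrite in_cons negb_or andbC.
    by move=> /andP[_ /negPf ->].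
  apply: eq_has_sum (isolate (w := fun e : {ffun 'I_k -> int} => e j) (int_box_exhaustion k) hB' h' (e0 j)) => e.
  by rewrite /a' /=; case: (e j == e0 j).
have h0 := part (enum 'I_k) (enum_uniq _) (fun=> 0%N).
have h1 : has_sum (fun e : {ffun 'I_k -> int} => if e == e0 then a e else 0) (a e0).
  move=> eps eps0; exists [:: e0] => s us sub.
  rewrite (bigD1_seq e0) ?sub ?mem_head //= eqxx big1 ?addr0 ?subrr ?nm0 ?ltW // => e /negPf -> //.
apply: (has_sum_uniq (int_box_exhaustion k) h1).
apply: eq_has_sum h0 => e; case: eqP => [->|ne].
  by rewrite (introT allP) // big1 ?mulr1 // => j; rewrite mem_enum.
case: ifP => // /allP he; exfalso; apply: ne; apply/ffunP => j; apply/eqP/he.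
by rewrite mem_enum.
Qed.

Section Coordinates.
Context {n k : nat} (kn : (k <= n)%N).
Local Notation Cn := 'rV[C]_n.
Local Notation w := (widen_ord kn).

Definition kill (y : Cn) : Cn := \row_j (if (j < k)%N then 0 else y 0 j).

Definition ext (e : {ffun 'I_k -> nat}) : {ffun 'I_n -> nat} :=
  [ffun i : 'I_n => oapp e 0%N (insub (val i))].

Lemma ext_widen e j : ext e (w j) = e j.
Proof. by rewrite ffunE /= valK. Qed.

Lemma ext_high e (i : 'I_n) : (k <= i)%N -> ext e i = 0%N.
Proof. by move=> ki; rewrite ffunE insubF //= ltnNge ki. Qed.

Lemma ext_inj : injective ext.
Proof. by move=> e e' h; apply/ffunP => j; rewrite -!ext_widen h. Qed.

Lemma mon_ext (y : Cn) e : mon y (ext e) = \prod_j y 0 (w j) ^+ e j.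
Proof.
rewrite /mon (bigID (fun i : 'I_n => (i < k)%N)) /= [X in _ * X]big1 ?mulr1; last first.
  by move=> i; rewrite -leqNgt => ki; rewrite ext_high // expr0.
by rewrite big_ord_narrow; apply: eq_bigr => j _; rewrite ext_widen.
Qed.

Lemma kill_invariant (c : Cn -> C) : (forall y (j : 'I_n) t, (j < k)%N -> c (upd y j t) = c y) ->
  forall y, c (kill y) = c y.
Proof.
move=> hc y.
have part (s : seq 'I_n) : (forall j, j \in s -> (j < k)%N) ->
    c (\row_j (if j \in s then 0 else y 0 j)) = c y.
  elim: s => [|j s IH] h; first by congr c; apply/rowP => i; rewrite mxE.
  rewrite -IH; last by move=> i si; apply: h; rewrite in_cons si orbT.
  rewrite -[RHS](hc _ j 0) ?h ?mem_head //; congr c; apply/rowP => i.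
  by rewrite !mxE in_cons; case: eqP.
rewrite -[RHS](part [seq j : 'I_n <- enum 'I_n | (j < k)%N]).
  by congr c; apply/rowP => i; rewrite !mxE mem_filter mem_enum andbT.
by move=> j; rewrite mem_filter => /andP[].
Qed.

(** Power series in the first [k] coordinates at a point where these vanish. The coefficients depend
    only on the other coordinates, which is the form that [kill_coords] requires. *)
Lemma local_series (g : Cn -> C) (y0 : Cn) : (\forall y \near y0, hdiff g y) ->
  (forall j, y0 0 (w j) = 0) ->
  exists c : {ffun 'I_k -> nat} -> Cn -> C, (forall e y, c e (kill y) = c e y) /\
    \forall y \near y0, (forall e, hdiff (c e) y) /\
      (exists B, abs_bounded (fun e : {ffun 'I_k -> nat} => c e y * \prod_j y 0 (w j) ^+ e j) B) /\
      has_sum (fun e : {ffun 'I_k -> nat} => c e y * \prod_j y 0 (w j) ^+ e j) (g y).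
Proof.
move=> hg y00; have g0 : hdiff g y0 by exact: nbhs_singleton hg.
have [d1 d10 hd1] := (near_vnP _ _).1 hg.
have [d2 d20 hd2] := hdiff_cont g0 ltr01.
pose D := Num.min d1 d2; have D0 : 0 < D by rewrite lt_min d10.
have Dd1 : D <= d1 by rewrite ge_min lexx.
have Dd2 : D <= d2 by rewrite ge_min lexx orbT.
have rD : 0 < D / 2 < D by apply/andP; split; lra.
have [r0 _] := andP rD.
have hol1 : hol y0 D g by move=> y hy; apply: hd1; exact: lt_le_trans Dd1.
have bnd y : vn (y - y0) < D -> nm (g y) <= nm (g y0) + 1.
  move=> hy; have := hd2 _ (lt_le_trans hy Dd2); rewrite (addrC y0) subrK => h1.
  have := nm_rev (g y) (g y0); lra.
have y0z (j : 'I_n) : (j < k)%N -> y0 0 j = 0.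
  by move=> jk; rewrite -(y00 (Ordinal jk)); congr (y0 _ _); apply/val_inj.
have [c [c1 c2 c3 c4 c5]] := multi_series kn hol1 bnd y0z rD.
exists (fun e => c (ext e)); split=> [e y|].
  by apply: kill_invariant => z j t; exact: c3.
apply/near_vnP; exists (D / 2) => // y hy.
have hyD : vn (y - y0) < D by apply: lt_trans hy _; case/andP: rD.
have hyj (j : 'I_n) : (j < k)%N -> nm (y 0 j) < D / 2.
  move=> jk; apply: le_lt_trans hy; have := vn_coord (y - y0) j.
  by rewrite !mxE y0z // subr0.
have B0 : 0 <= 2 ^+ k * (nm (g y0) + 1).
  by rewrite mulr_ge0 ?exprn_ge0 //; have := nm_ge0 (g y0); lra.
have zero e : (forall e', ext e' <> e) -> c e y * mon y e = 0.
  move=> he; have [/existsP[j /andP[kj ej]]|/existsPn ne] := boolP [exists j : 'I_n, (k <= j)%N && (e j != 0%N)].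
    by rewrite (c4 e j) // mul0r.
  exfalso; apply: (he [ffun j => e (w j)]); apply/ffunP => i.
  have [ik|ki] := ltnP i k.
    have -> : i = w (Ordinal ik) by apply/val_inj.
    by rewrite ext_widen ffunE.
  by rewrite ext_high //; have := ne i; rewrite ki /= negbK => /eqP.
split; first by move=> e; exact: c1.
split.
  have [||B hB] := @multi_abs_bounded R n k (fun e => c e y) y _ (D / 2) r0 B0 _ _ hyj.
  - by move=> e; exact: c2.
  - by move=> e j kj ej; exact: c4 kj ej y.
  exists B; apply: (@abs_bounded_le _ _ _ (fun e => nm (c (ext e) y * mon y (ext e)))) => [e|s us].
    by rewrite mon_ext.
  exact: (abs_bounded_comp ext_inj hB us).
have := (has_sum_reindex ext_inj _ zero).1 (c5 y hyD hyj).
by apply: eq_has_sum => e /=; rewrite mon_ext.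
Qed.

End Coordinates.
End SeveralLaurent.

(** * Existence and uniqueness of the Laurent expansion along a flag *)

Section Residue.
Context {R : realType} {r : nat}.
Local Notation C := (Cplx R).
Variables (Phi : seq 'rV[R]_r) (beta : r.-tuple 'rV[R]_r).
Hypothesis beta_simple : simple_system (map coroot Phi) beta.
Local Notation N := (size (pos_coroots Phi beta)).
Local Notation Cn := 'rV[C]_N.
Local Notation Lambda := (@Lambda R r Phi beta).
Local Notation carr := ({set 'I_r} * nat)%type.
Local Notation flagr := (seq carr).
Variables (F : flagr) (A : 'M[C]_N) (b : Cn).
Hypothesis FAb : completes F A b.
Local Notation k := (size F).
Local Notation aff := (affine_coords A b).
Local Notation tF := (tnth (in_tuple F)).

Let A_unit : A \in unitmx. Proof. by case: FAb. Qed.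
Let kN : (k <= N)%N. Proof. by case: FAb. Qed.

Definition unaff (y : Cn) : Cn := (y - b) *m invmx A.

Lemma affK s : unaff (aff s) = s.
Proof. by rewrite /unaff /affine_coords addrK mulmxK. Qed.

Lemma unaffK y : aff (unaff y) = y.
Proof. by rewrite /unaff /affine_coords mulmxKV // subrK. Qed.

Lemma unaffB y z : unaff y - unaff z = (y - z) *m invmx A.
Proof. by rewrite /unaff -mulmxBl opprB addrA subrK. Qed.

Lemma Lambda_aff s j : Lambda (tF j) s = aff s 0 (widen_ord kN j).
Proof.
have [_ _ h] := FAb; rewrite h //= (tnth_nth (finset.set0, 0%N)).
by [].
Qed.

Lemma mem_tF c : c \in F -> exists j, c = tF j.
Proof. by move=> cF; have /tnthP[j ->] : c \in in_tuple F by []; exists j. Qed.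

Lemma prod_F (G : carr -> C) : \prod_(c <- F) G c = \prod_j G (tF j).
Proof. by rewrite -[in LHS](in_tupleE F) big_tnth. Qed.

Lemma aff_kill s : aff (kill_coords k A b s) = kill (k := k) (aff s).
Proof. exact: unaffK. Qed.

Lemma near_aff s0 (P : Cn -> Prop) : (\forall y \near aff s0, P y) -> \forall s \near s0, P (aff s).
Proof.
move=> /near_vnP[d d0 h]; have [K K0 hK] := vn_mulmx A.
have K1 : 0 < K + 1 by lra.
apply/near_vnP; exists (d / (K + 1)); first by rewrite divr_gt0.
move=> s; rewrite ltr_pdivlMr // => hs; apply: h.
have -> : aff s - aff s0 = (s - s0) *m A by rewrite /affine_coords mulmxBl opprD addrACA subrr addr0.
by have := hK (s - s0); have := vn_ge0 (s - s0); lra.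
Qed.

Lemma near_unaff s0 (P : Cn -> Prop) : (\forall s \near s0, P s) -> \forall y \near aff s0, P (unaff y).
Proof.
move=> /near_vnP[d d0 h]; have [K K0 hK] := vn_mulmx (invmx A).
have K1 : 0 < K + 1 by lra.
apply/near_vnP; exists (d / (K + 1)); first by rewrite divr_gt0.
move=> y; rewrite ltr_pdivlMr // => hy; apply: h.
have -> : unaff y - s0 = (y - aff s0) *m invmx A.
  by rewrite -unaffB affK.
by have := hK (y - aff s0); have := vn_ge0 (y - aff s0); lra.
Qed.

(** [g] is [Z] multiplied by the forms of the flag. Its power series in these forms, divided by
    their product, is a Laurent series with exponents at least -1; the coefficient with all
    exponents -1 is the constant term, which is [g] on the locus. *)
Lemma flag_laurent_exists (Z g : Cn -> C) s0 : flag_locus F s0 ->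
  (\forall s \near s0, hdiff g s) ->
  (\forall s \near s0, (forall c, c \in F -> Lambda c s != 0) ->
     g s = (\prod_(c <- F) Lambda c s) * Z s) ->
  exists a, flag_laurent Z s0 A b (F := F) a /\
    \forall s \near s0, flag_locus F s -> a [ffun=> -1] s = g s.
Proof.
move=> Fs0 hg gZ.
have y0 j : aff s0 0 (widen_ord kN j) = 0.
  by rewrite -Lambda_aff; apply: Fs0; exact: mem_tnth.
have hgu : \forall y \near aff s0, hdiff (g \o unaff) y.
  apply: filterS (near_unaff hg) => y hy.
  have e z : unaff z = z *m invmx A + (- (b *m invmx A)) by rewrite /unaff mulmxBl.
  rewrite (_ : g \o unaff = fun z => g (z *m invmx A + (- (b *m invmx A)))); last first.
    by apply/funext => z /=; rewrite e.
  by apply: hdiff_affine; rewrite -e.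
have [c [ck hc]] := local_series hgu y0.
pose a (e : {ffun 'I_k -> int}) (z : Cn) : C :=
  if [forall j, -1 <= e j] then c [ffun j => absz (e j + 1)] (aff z) else 0.
have a_kill e s : a e (kill_coords k A b s) = a e s.
  by rewrite /a aff_kill ck.
(* Division by the product of the forms lowers every exponent by 1. *)
pose phi (e : {ffun 'I_k -> nat}) : {ffun 'I_k -> int} := [ffun j => (e j)%:Z - 1].
have phi_inj : injective phi.
  move=> e e' /ffunP h; apply/ffunP => j; have := h j; rewrite !ffunE => /addIr.
  by move=> [].
have a_phi e s : a (phi e) s = c e (aff s).
  rewrite /a ifT; last by apply/forallP => j; rewrite ffunE; lia.
  by congr c; apply/ffunP => j; rewrite !ffunE subrK.
exists a; split.
  apply: filterS2 (near_aff hc) gZ => s [hdc [[B hB] hs]] gs; split.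
    move=> e; apply/hdiffP.
    rewrite (_ : (fun z => _) = a e); last by apply/funext => z; rewrite a_kill.
    have [he|he] := boolP [forall j, -1 <= e j]; last first.
      rewrite (_ : a e = fun=> 0); last by apply/funext => z; rewrite /a (negPf he).
      exact: hdiff_cst.
    rewrite (_ : a e = fun z => c [ffun j => absz (e j + 1)] (z *m A + b)).
      by apply: hdiff_affine; exact: hdc.
    by apply/funext => z; rewrite /a he.
  move=> nz.
  have nz' j : Lambda (tF j) s != 0 by apply: nz; exact: mem_tnth.
  pose T (e : {ffun 'I_k -> int}) : C := a e (kill_coords k A b s) * \prod_j Lambda (tF j) s ^ e j.
  pose q : C := (\prod_j Lambda (tF j) s)^-1.
  have Tphi e : T (phi e) = q * (c e (aff s) * \prod_j aff s 0 (widen_ord kN j) ^+ e j).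
    rewrite /T a_kill a_phi mulrCA; congr (_ * _).
    rewrite /q -prodfV -big_split /=; apply: eq_bigr => j _.
    by rewrite ffunE expfzDr // -Lambda_aff mulrC exprN1.
  have T0 e : (forall e', phi e' <> e) -> T e = 0.
    move=> he; rewrite /T a_kill /a; case: ifP => [/forallP e1|]; last by rewrite mul0r.
    exfalso; apply: (he [ffun j => absz (e j + 1)]); apply/ffunP => j; rewrite !ffunE.
    by rewrite gez0_abs ?addrK //; have := e1 j; lia.
  apply: (has_abs_sumP T (Z s) (int_box_exhaustion k)).2; split.
    exists (nm q * B); have hb : abs_bounded (T \o phi) (nm q * B).
      apply: (@abs_bounded_le _ _ _ (fun e => nm (q * (c e (aff s) * \prod_j aff s 0 (widen_ord kN j) ^+ e j)))) => [e|t ut].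
        by rewrite /= Tphi.
      exact: (abs_boundedZ q hB ut).
    exact (abs_bounded_reindex phi_inj T0 hb).
  apply: (has_sum_reindex phi_inj _ T0).2.
  have -> : Z s = q * (g \o unaff) (aff s).
    rewrite /= affK gs // prod_F mulKf //.
    by apply/prodf_neq0 => j _.
  by apply: eq_has_sum (has_sumZ q hs) => e; rewrite /= Tphi.
apply: filterS (near_aff hc) => s [hdc [_ hs]] Fs.
have -> : a [ffun=> -1] s = c [ffun=> 0%N] (aff s).
  rewrite -a_phi; congr (a _ s); apply/ffunP => j; by rewrite !ffunE sub0r.
have yz j : aff s 0 (widen_ord kN j) = 0.
  by rewrite -Lambda_aff; apply: Fs; exact: mem_tnth.
(* On the locus all the forms vanish, so only the constant term of the power series is left. *)
have h1 : has_sum (fun e : {ffun 'I_k -> nat} => c e (aff s) * \prod_j aff s 0 (widen_ord kN j) ^+ e j)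
    (c [ffun=> 0%N] (aff s)).
  have z e : e != [ffun=> 0%N] -> c e (aff s) * \prod_j aff s 0 (widen_ord kN j) ^+ e j = 0.
    move=> e0; have [/existsP[j ej]|/existsPn ne] := boolP [exists j, e j != 0%N].
      by rewrite (bigD1 j) //= yz expr0n (negPf ej) mul0r mulr0.
    by case/eqP: e0; apply/ffunP => j; rewrite ffunE; have := ne j; rewrite negbK => /eqP.
  move=> eps eps0; exists [:: [ffun=> 0%N]] => t ut sub.
  rewrite (bigD1_seq [ffun=> 0%N]) ?sub ?mem_head //= [X in _ + X - _]big1 ?addr0; last by move=> e; exact: z.
  rewrite big1 ?mulr1 ?subrr ?nm0 ?ltW // => j _; by rewrite ffunE expr0.
rewrite (has_sum_uniq (nat_box_exhaustion _) h1 hs) /= affK //.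
Qed.

(** For [s] on the locus both expansions are evaluated at the points with the same remaining
    coordinates as [s] and with forms equal to t rot^(n_j), for all n. The coefficients are then
    taken at [s] itself, and [isolate_multi] applies to their difference. *)
Lemma flag_laurent_uniq (Z : Cn -> C) s0 a a' :
  flag_laurent Z s0 A b (F := F) a -> flag_laurent Z s0 A b (F := F) a' ->
  \forall s \near s0, flag_locus F s -> forall e, a e s = a' e s.
Proof.
move=> h1 h2; have [d d0 hd] := (near_vnP s0 _).1 (filterI h1 h2).
have [K K0 hK] := vn_mulmx (invmx A).
have K1 : 0 < K + 1 by lra.
apply/near_vnP; exists (d / 2); first by rewrite divr_gt0.
move=> s hs Fs.
have yz j : aff s 0 (widen_ord kN j) = 0.
  by rewrite -Lambda_aff; apply: Fs; exact: mem_tnth.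
(* Small enough for the points below to stay within [d] of [s0]: giving the forms absolute value [t]
   moves [s] by at most [K * t]. *)
pose t : R := d / 2 / (K + 1) / 2.
have t0 : 0 < t by rewrite !divr_gt0.
have tC : rc t != 0 by rewrite -nm_gt0 nm_rc gtr0_norm.
pose Y (n : 'I_k -> nat) : Cn := \row_j oapp (fun i => rc t * rot ^+ n i) (aff s 0 j) (insub (val j)).
have Yw n j : Y n 0 (widen_ord kN j) = rc t * rot ^+ n j by rewrite mxE /= valK.
have Yh n (i : 'I_N) : (k <= i)%N -> Y n 0 i = aff s 0 i.
  by move=> ki; rewrite mxE insubF //= ltnNge ki.
have Yk n : kill_coords k A b (unaff (Y n)) = s.
  rewrite -[LHS]affK aff_kill unaffK -[RHS]affK; congr unaff.
  apply/rowP => i; rewrite mxE; case: ltnP => [ik|ki]; last exact: Yh.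
  by rewrite -(yz (Ordinal ik)); congr (aff s _ _); apply/val_inj.
have Yn n : vn (unaff (Y n) - s0) < d.
  have e : d = 2 * (2 * (t * (K + 1))) by rewrite /t; field; lra.
  apply: le_lt_trans (vn_dist s _ _) _.
  have -> : unaff (Y n) - s = (Y n - aff s) *m invmx A.
    by rewrite -unaffB affK.
  have : vn (Y n - aff s) <= t.
    apply: vn_le => [|i]; first exact: ltW.
    have -> : (Y n - aff s) 0 i = Y n 0 i - aff s 0 i.
      by rewrite [LHS]mxE; congr (_ + _); rewrite mxE.
    have [ik|ki] := ltnP i k; last by rewrite Yh // subrr nm0 ltW.
    have -> : i = widen_ord kN (Ordinal ik) by apply/val_inj.
    by rewrite Yw yz subr0 nmM nmX nm_rot expr1n mulr1 nm_rc gtr0_norm.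
  have := hK (Y n - aff s); have := vn_ge0 (Y n - aff s) => v0 v1 v2.
  have : K * vn (Y n - aff s) <= K * t by rewrite ler_wpM2l.
  by have := hs; move: (mulr_ge0 K0 (ltW t0)); lra.
have Lt n j : Lambda (tF j) (unaff (Y n)) = rc t * rot ^+ n j by rewrite Lambda_aff unaffK Yw.
have nz n c : c \in F -> Lambda c (unaff (Y n)) != 0.
  by move=> /mem_tF[j ->]; rewrite Lt mulf_neq0 // expf_neq0 // rot_neq0.
have tail (x : {ffun 'I_k -> int} -> Cn -> C) n :
   has_abs_sum (int_box k) (fun e => x e (kill_coords k A b (unaff (Y n))) *
     \prod_j Lambda (tF j) (unaff (Y n)) ^ e j) (Z (unaff (Y n))) ->
   (exists B, abs_bounded (fun e : {ffun 'I_k -> int} => x e s * (\prod_j rc t ^ e j) * \prod_j (rot ^ e j) ^+ n j) B) /\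
   has_sum (fun e : {ffun 'I_k -> int} => x e s * (\prod_j rc t ^ e j) * \prod_j (rot ^ e j) ^+ n j) (Z (unaff (Y n))).
  move=> h; apply: (has_abs_sumP _ _ (int_box_exhaustion k)).1.
  rewrite (_ : (fun e : {ffun 'I_k -> int} => _) = (fun e => x e (kill_coords k A b (unaff (Y n))) *
     \prod_j Lambda (tF j) (unaff (Y n)) ^ e j)) //.
  apply/funext => e; rewrite Yk -mulrA -big_split; congr (_ * _); apply: eq_bigr => j _ /=.
  rewrite Lt expfzMl; congr (_ * _); by rewrite !exprnP !exprz_exp mulrC.
have hx n := tail a n ((hd _ (Yn n)).1.2 (nz n)).
have hx' n := tail a' n ((hd _ (Yn n)).2.2 (nz n)).
have P1 (e : {ffun 'I_k -> int}) : \prod_j (rot ^ e j : C) ^+ 0 = 1 by rewrite big1 // => j _; rewrite expr0.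
have [[B hB] _] := hx (fun=> 0%N); have [[B' hB'] _] := hx' (fun=> 0%N).
pose D (e : {ffun 'I_k -> int}) : C := (a e s - a' e s) * \prod_j rc t ^ e j.
have hD : abs_bounded D (B + nm (-1) * B').
  apply: (@abs_bounded_le _ _ _ (fun e => nm (D e))) => // u uu.
  have := abs_boundedD hB (abs_boundedZ (-1) hB') uu.
  by under eq_bigr do rewrite /= P1 !mulr1 mulN1r -mulrBl.
have hn (n : 'I_k -> nat) : has_sum (fun e : {ffun 'I_k -> int} => D e * \prod_j (rot ^ e j) ^+ n j) 0.
  rewrite -(subrr (Z (unaff (Y n)))).
  by apply: eq_has_sum (has_sumB (hx n).2 (hx' n).2) => e; rewrite /D; ring.
move=> e; have /eqP := isolate_multi hD hn e; rewrite /D mulf_eq0 subr_eq0 => /orP[/eqP //|].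
by rewrite (negPf (_ : _ != 0)) //; apply/prodf_neq0 => j _; rewrite expfz_neq0.
Qed.

End Residue.

(** * The intrinsic residue *)

Section ResiduePart.
Context {R : realType} {r : nat}.
Local Notation C := (Cplx R).
Variables (Phi : seq 'rV[R]_r) (beta : r.-tuple 'rV[R]_r).
Hypothesis beta_simple : simple_system (map coroot Phi) beta.
Local Notation N := (size (pos_coroots Phi beta)).
Local Notation Cn := 'rV[C]_N.

(** The residue is the cleared function of one chosen expansion. Any other expansion has the same
    cleared function near [s0], and any Laurent expansion has the same coefficients on the locus. *)
Lemma residue_part (Z : Cn -> C) :
  (forall p, exists U Fs H K, [/\ open U, U p, bounded_set U & flag_expansion Z U Fs H K]) ->
  forall (F : flag) (s0 : Cn), is_flag F -> generic_flag_point F s0 ->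
    exists rho : Cn -> C, is_flag_residue Z F s0 rho /\
      (forall U Fs H K, open U -> U s0 -> flag_expansion Z U Fs H K ->
         \forall s \near s0, flag_locus F s -> flag_coeff Fs K F s = rho s).
Proof.
move=> hZ F s0 fl gen; have [U [Fs [H [K [oU Us0 _ e]]]]] := hZ s0.
have [fls hH hK eZ] := expansion_near oU Us0 e.
pose g := cleared Fs H K F.
have hg : \forall s \near s0, hdiff g s by exact: hdiff_cleared.
have gZ : \forall s \near s0, (forall c, c \in F -> Lambda c s != 0) ->
     g s = (\prod_(c <- F) Lambda c s) * Z s.
  apply: filterS2 (generic_off_arr gen) eZ => s h1 h2 nz; have ar := h1 nz.
  by rewrite /g cleared_ev // h2.
exists g; split; last first.
  move=> U' Fs' H' K' oU' Us0' e'.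
  apply: filterS (coeff_intrinsic beta_simple fl gen oU' Us0' e' oU Us0 e) => s h Fs0.
  by rewrite -(cleared_coeff _ H') // h.
split; first exact: completes_exists.
move=> A b FAb; have [Fs0 _] := gen.
have [a [ha ha1]] := flag_laurent_exists FAb Fs0 hg gZ.
split; first by exists a.
move=> a' ha'; apply: filterS2 (flag_laurent_uniq FAb ha' ha) ha1 => s h1 h2 Fs1.
by rewrite h1 // h2.
Qed.

End ResiduePart.

Unset Implicit Arguments.

Theorem theorem2p7 (R : realType) (r : nat) (Phi : seq 'rV[R]_r)
    (beta : r.-tuple 'rV[R]_r)
    (Phi_root : crystallographic_root_system Phi)
    (Phi_irr : irreducible_root_system Phi)
    (beta_simple : simple_system (map coroot Phi) beta) :
  exists Z : params Phi beta -> Cplx R,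
    [/\ (* meromorphic continuation *)
        meromorphic Z /\
        (exists sigma : R, forall s : params Phi beta,
           (forall j, sigma < complex.Re (s 0 j)) ->
           has_abs_sum (pos_box r) (zeta_term s) (zeta s) /\ Z s = zeta s),
        (* polar divisor *)
        locally_finite_arrangement Phi beta /\
        polar_set Z `<=` arrangement (Phi := Phi) (beta := beta),
        (* local expansions *)
        (forall p : params Phi beta, exists U Fs H K,
           [/\ open U, U p, bounded_set U & flag_expansion Z U Fs H K]),
        (* residues at generic flag intersections *)
        (forall (F : flag) (s0 : params Phi beta),
           is_flag F -> generic_flag_point F s0 ->
           exists rho : params Phi beta -> Cplx R,
             is_flag_residue Z F s0 rho /\
             (forall U Fs H K, open U -> U s0 -> flag_expansion Z U Fs H K ->
                \forall s \near s0, flag_locus F s ->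
                  flag_coeff Fs K F s = rho s)) &
        (* Laurent coefficients along transverse slices *)
        (forall s0 v : params Phi beta, transverse s0 v ->
           exists kappa : int -> Cplx R,
             (forall kappa', laurent_at0 (Z \o slice s0 v) kappa' <->
                             kappa' = kappa) /\
             (forall U Fs H K, open U -> U s0 -> flag_expansion Z U Fs H K ->
                forall kappa', aggregate_laurent s0 v Fs H K kappa' <->
                               kappa' = kappa))].
Proof.
have [Z hZ] := continuation Phi_root beta_simple.
have loc := local_expansion hZ.
exists Z; split.
- by split; [exact: meromorphic_Z hZ|exact: abs_conv hZ].
- by split; [exact: locally_finite|exact: polar_sub hZ].
- exact: loc.
- exact: residue_part.
- exact: slice_part.
Qed.
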